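(* Let $p\ge2$ and let $\mathcal H(\mu)=\mathcal H(a_1,a_2,-b_1,\dots,-b_p)$ be a stratum of meromorphic differentials on $\mathbb{CP}^1$ with two zeros. For any configuration of residues $\lambda\in\mathcal R_p\setminus\mathcal A_p$ and any relative homology class $[\gamma]\in H_1(\overline{\mathcal F}_\lambda\setminus P_{\omega_\lambda},Z_{\omega_\lambda})$ (integer coefficients), we have $$\int_{[\gamma]}\omega_\lambda=\sum_{j=1}^p w_j\lambda_j,$$ where $w_j\in\mathbb Z$ for all $1\le j\le p$.
   Context: $\mathcal H(\mu)$ is the moduli space of meromorphic one-forms on $\mathbb{CP}^1$ with labeled zeros $z_1,z_2$ of orders $a_1,a_2\ge1$ and labeled poles of orders $b_1,\dots,b_p\ge1$, up to biholomorphism ($a_1+a_2-\sum b_j=-2$). Residue at a pole means the period over a positively oriented loop around it ($2\pi i$ times the usual residue). $\mathcal R_p=\{\lambda\in\mathbb C^p:\sum\lambda_j=0\}$; $\mathcal A_p$ is the union of the hyperplanes $\{\sum_{i\in I}\lambda_i=0\}$ over nonempty proper $I\subset\{1,\dots,p\}$. $\mathcal F_\lambda$ is the locus of differentials in $\mathcal H(\mu)$ with residue $\lambda_j$ at the $j$-th pole for all $j$. On $\mathcal F_\lambda$, $\omega_\lambda=d(\int_\gamma\omega)$ for any path $\gamma$ from $z_1$ to $z_2$ avoiding the poles (this does not depend on $\gamma$). $\overline{\mathcal F}_\lambda$ is the closure of (the image of) $\mathcal F_\lambda$ in the multi-scale compactification (Bainbridge–Chen–Gendron–Grushevsky–Möller)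 of $\mathcal H(\mu)/\mathbb C^*$; it is a compact, possibly disconnected, Riemann surface to which $\omega_\lambda$ extends as a meromorphic one-form. $Z_{\omega_\lambda}$ and $P_{\omega_\lambda}$ are the sets of zeros and poles of $\omega_\lambda$ in $\overline{\mathcal F}_\lambda$. *)

(* Defs.v *)
From Stdlib Require List.
From mathcomp Require Import all_boot all_order all_algebra.
From mathcomp Require Import complex.
From mathcomp Require Import all_classical all_reals all_analysis.

Set Implicit Arguments.
Unset Strict Implicit.
Unset Printing Implicit Defensive.

Import Order.TTheory GRing.Theory Num.Theory.
Import numFieldNormedType.Exports.

Local Open Scope classical_set_scope.
Local Open Scope ring_scope.

(* Typed as a numFieldType so that R[i] receives the normed-module topology. *)
Definition Cx (R : realType) : numFieldType := R[i].

Definition cexp (R : realType) (z : Cx R) : Cx R :=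
  (expR (complex.Re z) * cos (complex.Im z) +i*
   (expR (complex.Re z) * sin (complex.Im z)))%C.

Definition cderiv (R : realType) (f : Cx R -> Cx R) (z d : Cx R) : Prop :=
  is_derive z (1 : Cx R) f d.

Definition holo_at (R : realType) (f : Cx R -> Cx R) (z : Cx R) : Prop :=
  \forall y \near z, exists d, cderiv f y d.

(* \int_g f(x) dx = v, for a continuous path g : [0,1] -> C along which f is
   holomorphic: F is a primitive of f(x) dx along g. *)
Definition path_integral (R : realType) (f : Cx R -> Cx R) (g : R -> Cx R)
    (v : Cx R) : Prop :=
  exists F : R -> Cx R,
    v = F 1 - F 0 /\
    forall u : R, `[0, 1]%classic u ->
      exists G : Cx R -> Cx R,
        (\forall y \near g u, cderiv G y (f y)) /\
        (\forall s \near u, `[0, 1]%classic s -> F s = G (g s)).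

Definition circle (R : realType) (q : Cx R) (r : R) (u : R) : Cx R :=
  q + ((r * cos (2 * pi * u)) +i* (r * sin (2 * pi * u)))%C.

(* Residue = period over a small positively oriented loop, i.e. 2 i pi times
   the coefficient of (x - q)^-1. *)
Definition residue (R : realType) (f : Cx R -> Cx R) (q v : Cx R) : Prop :=
  \forall r \near (0 : R)^'+, path_integral f (circle q r) v.

(* Since 0 ^ k = 0 for k < 0, a function of negative order is required to have
   the junk value 0 at its pole. *)
Definition has_order (R : realType) (f : Cx R -> Cx R) (z : Cx R) (k : int)
    : Prop :=
  exists g : Cx R -> Cx R,
    [/\ holo_at g z, g z != 0 & \forall s \near z, f s = (s - z) ^ k * g s].

Record mobius (R : realType) := Mobius {
  mob_a : Cx R; mob_b : Cx R; mob_c : Cx R; mob_d : Cx R;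
  mob_det : mob_a * mob_d - mob_b * mob_c != 0 }.

Definition mob_den (R : realType) (m : mobius R) (x : Cx R) : Cx R :=
  mob_c m * x + mob_d m.

Definition mob (R : realType) (m : mobius R) (x : Cx R) : Cx R :=
  (mob_a m * x + mob_b m) / mob_den m x.

Definition mob_deriv (R : realType) (m : mobius R) (x : Cx R) : Cx R :=
  (mob_a m * mob_d m - mob_b m * mob_c m) / mob_den m x ^+ 2.

Definition mob_sends (R : realType) (m : mobius R) (x y : Cx R) : Prop :=
  mob_den m x != 0 /\ mob m x = y.

(* inl ord0, inl ord_max are the zeros z_1, z_2; inr j is the j-th pole. *)
Definition leg (p : nat) : finType := ('I_2 + 'I_p)%type.

Definition leg_order (p : nat) (a : 'I_2 -> nat) (b : 'I_p -> nat)
    (s : leg p) : int :=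
  match s with inl i => (a i)%:Z | inr j => - (b j)%:Z end.

(* A meromorphic one-form on CP^1 with labeled zeros and poles is, up to
   biholomorphism, c * \prod_s (x - pos s) ^ (order of s) dx with all marked
   points in C; as the orders sum to -2, such a form is regular and nonzero at
   infinity. *)
Record p1_form (R : realType) (p : nat) := P1Form {
  f_pos : leg p -> Cx R;
  f_scale : Cx R;
  f_pos_inj : injective f_pos;
  f_scale_neq0 : f_scale != 0 }.

Definition form_fun (R : realType) (p : nat) (a : 'I_2 -> nat)
    (b : 'I_p -> nat) (W : p1_form R p) (x : Cx R) : Cx R :=
  f_scale W * \prod_(s : leg p) (x - f_pos W s) ^ leg_order a b s.

Definition residue_config (R : realType) (p : nat) (lam : 'I_p -> Cx R) : Prop :=
  \sum_(j < p) lam j = 0.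

Definition resonant (R : realType) (p : nat) (lam : 'I_p -> Cx R) : Prop :=
  exists I : {set 'I_p},
    [/\ I != finset.set0, I != [set: 'I_p]%SET & \sum_(j in I) lam j = 0].

Definition in_fiber (R : realType) (p : nat) (a : 'I_2 -> nat)
    (b : 'I_p -> nat) (lam : 'I_p -> Cx R) (W : p1_form R p) : Prop :=
  forall j : 'I_p, residue (form_fun a b W) (f_pos W (inr j)) (lam j).

(* Raw data on a graph given by its half-edges: [ms_flip] exchanges the two
   halves of an edge. Depth 0 is the top level. The component at v is CP^1 with
   a coordinate in which all special points (marked points and branches of
   nodes) are finite. [ms_kap h] is the number of prongs of the edge of h, and
   0 for horizontal edges. *)
Record ms_data (R : realType) (p : nat) := MsData {
  ms_V : finType;
  ms_H : finType;
  ms_flip : ms_H -> ms_H;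
  ms_depth : ms_V -> nat;
  ms_at : (leg p + ms_H)%type -> ms_V;
  ms_kap : ms_H -> nat;
  ms_pos : (leg p + ms_H)%type -> Cx R;
  ms_scale : ms_V -> Cx R;
  ms_sig : ms_H -> Cx R }.

Definition ms_spec (R : realType) (p : nat) (D : ms_data R p) : finType :=
  (leg p + ms_H D)%type.

Definition ms_vtx (R : realType) (p : nat) (D : ms_data R p) (h : ms_H D) : ms_V D :=
  ms_at (inr h : ms_spec D).

Definition ms_upper (R : realType) (p : nat) (D : ms_data R p) (h : ms_H D) : bool :=
  (ms_depth (ms_vtx h) < ms_depth (ms_vtx (ms_flip h)))%N.

Definition ms_order (R : realType) (p : nat) (a : 'I_2 -> nat)
    (b : 'I_p -> nat) (D : ms_data R p) (s : ms_spec D) : int :=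
  match s with
  | inl l => leg_order a b l
  | inr h => if ms_upper h then (ms_kap h)%:Z - 1 else - (ms_kap h)%:Z - 1
  end.

Definition ms_eta (R : realType) (p : nat) (a : 'I_2 -> nat)
    (b : 'I_p -> nat) (D : ms_data R p) (v : ms_V D) (x : Cx R) : Cx R :=
  ms_scale v *
  \prod_(s : ms_spec D | ms_at s == v) (x - ms_pos s) ^ ms_order a b s.

(* Leading Laurent coefficient of the differential at a branch of a node. *)
Definition ms_lead (R : realType) (p : nat) (a : 'I_2 -> nat)
    (b : 'I_p -> nat) (D : ms_data R p) (h : ms_H D) : Cx R :=
  ms_scale (ms_vtx h) *
  \prod_(s : ms_spec D | (ms_at s == ms_vtx h) && (s != inr h))
     (ms_pos (inr h : ms_spec D) - ms_pos s) ^ ms_order a b s.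

Definition ms_adj (R : realType) (p : nat) (D : ms_data R p) : rel (ms_V D) :=
  fun v w => [exists h : ms_H D, (ms_vtx h == v) && (ms_vtx (ms_flip h) == w)].

(* Adjacency in the subgraph of vertices strictly above depth L. *)
Definition ms_adj_above (R : realType) (p : nat) (D : ms_data R p) (L : nat)
    : rel (ms_V D) :=
  fun v w => [&& ms_adj v w, (ms_depth v < L)%N & (ms_depth w < L)%N].

(* Genus 0: the dual graph is a tree (connected, #V = #E + 1). *)
Definition ms_stable_tree (R : realType) (p : nat) (D : ms_data R p) : Prop :=
  [/\ forall h : ms_H D, ms_flip (ms_flip h) = h /\ ms_flip h != h,
      forall v w : ms_V D, connect (@ms_adj R p D) v w,
      (#|ms_H D| + 2 = 2 * #|ms_V D|)%N,
      forall v : ms_V D, (3 <= #|[pred s : ms_spec D | ms_at s == v]|)%N &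
      forall s s' : ms_spec D, ms_at s = ms_at s' -> ms_pos s = ms_pos s' -> s = s'].

(* The levels are 0, ..., N; kap is the enhancement of the level graph. *)
Definition ms_level_graph (R : realType) (p : nat) (D : ms_data R p) : Prop :=
  [/\ forall (v : ms_V D) (L : nat), (L <= ms_depth v)%N ->
        exists w : ms_V D, ms_depth w = L,
      forall h : ms_H D, ms_kap (ms_flip h) = ms_kap h &
      forall h : ms_H D, (ms_kap h == 0)%N =
        (ms_depth (ms_vtx h) == ms_depth (ms_vtx (ms_flip h)))].

(* Twisted differentials: prescribed orders, matching residues at horizontal
   nodes, and the global residue condition: for every L and every connected
   component Y of the part of the curve above depth L containing no marked
   pole, the residues at depth L of the nodes joining Y to depth L sum to 0. *)
Definition ms_twisted (R : realType) (p : nat) (a : 'I_2 -> nat)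
    (b : 'I_p -> nat) (D : ms_data R p) : Prop :=
  (forall v : ms_V D, ms_scale v != 0) /\
  (forall v : ms_V D,
     \sum_(s : ms_spec D | ms_at s == v) ms_order a b s = - 2%:Z) /\
  exists res : ms_H D -> Cx R,
    [/\ forall h : ms_H D,
          residue (ms_eta a b (ms_vtx h)) (ms_pos (inr h : ms_spec D)) (res h),
        forall h : ms_H D,
          ms_depth (ms_vtx h) = ms_depth (ms_vtx (ms_flip h)) ->
          res h + res (ms_flip h) = 0 &
        forall (L : nat) (v : ms_V D), (ms_depth v < L)%N ->
          (forall j : 'I_p,
             ~~ connect (@ms_adj_above R p D L) v
                  (ms_at (inl (inr j) : ms_spec D))) ->
          \sum_(h : ms_H D | connect (@ms_adj_above R p D L) v (ms_vtx h) &&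
                             (ms_depth (ms_vtx (ms_flip h)) == L))
             res (ms_flip h) = 0].

(* Prong-matchings at a vertical node with branches q+ (above) and q- (below):
   smoothing the node by (x - q+) (y - q-) = t turns A (x - q+)^(kap - 1) dx
   into - A t^kap (y - q-)^(- kap - 1) dy, hence the differentials
   A (x - q+)^(kap - 1) dx and B (y - q-)^(- kap - 1) dy can be glued for
   B = - A t^kap only. The kap solutions t, elements of T_{q+} (x) T_{q-} read
   in the coordinates x and y, correspond to the kap cyclic-order reversing
   bijections between the outgoing horizontal prongs at q+ and the incoming
   ones at q-; [ms_sig] is such a solution (and is unconstrained at horizontal
   nodes). *)
Definition ms_prong_matching (R : realType) (p : nat) (a : 'I_2 -> nat)
    (b : 'I_p -> nat) (D : ms_data R p) : Prop :=
  (forall h : ms_H D, ms_sig (ms_flip h) = ms_sig h) /\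
  (forall h : ms_H D, ms_upper h ->
     ms_lead a b (ms_flip h) = - (ms_lead a b h * ms_sig h ^+ ms_kap h)).

Definition multiscale (R : realType) (p : nat) (a : 'I_2 -> nat)
    (b : 'I_p -> nat) (D : ms_data R p) : Prop :=
  [/\ ms_stable_tree D, ms_level_graph D, ms_twisted a b D &
      ms_prong_matching a b D].

(* exp ((l_lower - l_upper) / kap): the factor by which the level rotation l
   acts on the prong-matching at the edge of an upper half-edge h. *)
Definition ms_turn (R : realType) (p : nat) (D : ms_data R p)
    (l : nat -> Cx R) (h : ms_H D) : Cx R :=
  cexp ((l (ms_depth (ms_vtx (ms_flip h))) - l (ms_depth (ms_vtx h))) /
        (ms_kap h)%:R).

(* Same point of the multi-scale compactification of H(mu)/C^*: isomorphism of
   the underlying pointed level graphs and curves, up to rescaling every level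
   (the top one included), with the induced action on prong-matchings. *)
Definition ms_equiv (R : realType) (p : nat) (a : 'I_2 -> nat)
    (b : 'I_p -> nat) (D D' : ms_data R p) : Prop :=
  exists (fV : ms_V D -> ms_V D') (fH : ms_H D -> ms_H D')
         (M : ms_V D -> mobius R) (l : nat -> Cx R),
    let fS (s : ms_spec D) : ms_spec D' :=
      match s with inl x => inl x | inr h => inr (fH h) end in
    [/\ bijective fV,
        bijective fH,
        forall v, ms_depth (fV v) = ms_depth v &
        forall h, fH (ms_flip h) = ms_flip (fH h) /\ ms_kap (fH h) = ms_kap h]
    /\
    [/\ forall s, ms_at (fS s) = fV (ms_at s),
        forall s, mob_sends (M (ms_at s)) (ms_pos s) (ms_pos (fS s)),
        forall v x, mob_den (M v) x != 0 ->
          ms_eta a b (fV v) (mob (M v) x) * mob_deriv (M v) x =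
          cexp (l (ms_depth v)) * ms_eta a b v x &
        forall h, ms_upper h ->
          ms_sig (fH h) =
          mob_deriv (M (ms_vtx h)) (ms_pos (inr h : ms_spec D)) *
          mob_deriv (M (ms_vtx (ms_flip h)))
                    (ms_pos (inr (ms_flip h) : ms_spec D)) *
          ms_turn l h * ms_sig h].

(* A form on a smooth CP^1: one vertex, no edge. *)
Definition ms_of_form (R : realType) (p : nat) (W : p1_form R p) : ms_data R p :=
  @MsData R p unit void (fun h => h) (fun _ => 0%N) (fun _ => tt)
    (fun _ => 0%N)
    (fun s => match s with inl x => f_pos W x | inr h => match h with end end)
    (fun _ => f_scale W) (fun _ => 1).

(* Convergence, in the multi-scale compactification of H(mu)/C^*, of the points
   of H(mu)/C^* represented by W n to the multi-scale differential D.
   M n v is a coordinate on the n-th sphere modelled on the component v, and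
   cexp (l n L) rescales the n-th form at depth L. In these coordinates marked
   points converge, the two sides of a node are related by
   (x - q) (y - q') = rho with rho -> 0, the rescaled forms converge, forms on
   deeper levels are infinitely smaller, and the gluing parameters, rescaled by
   the same logarithms l at all edges, converge to the prong-matching. *)
Definition ms_cvg (R : realType) (p : nat) (a : 'I_2 -> nat) (b : 'I_p -> nat)
    (W : nat -> p1_form R p) (D : ms_data R p) : Prop :=
  exists (M : nat -> ms_V D -> mobius R) (l : nat -> nat -> Cx R)
         (y : nat -> leg p -> Cx R) (q rho : nat -> ms_H D -> Cx R),
    [/\ forall s : leg p,
          y n s @[n --> \oo] --> ms_pos (inl s : ms_spec D) /\
          \forall n \near \oo,
            mob_sends (M n (ms_at (inl s : ms_spec D))) (y n s) (f_pos (W n) s),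
        forall h : ms_H D,
          [/\ q n h @[n --> \oo] --> ms_pos (inr h : ms_spec D),
              rho n h @[n --> \oo] --> (0 : Cx R),
              \forall n \near \oo, rho n (ms_flip h) = rho n h &
              \forall n \near \oo, forall x : Cx R,
                let x' := q n h + rho n h / (x - q n (ms_flip h)) in
                x != q n (ms_flip h) ->
                mob_den (M n (ms_vtx (ms_flip h))) x != 0 ->
                mob_den (M n (ms_vtx h)) x' != 0 ->
                mob (M n (ms_vtx (ms_flip h))) x = mob (M n (ms_vtx h)) x'],
        forall (v : ms_V D) (K : set (Cx R)) (e : Cx R),
          compact K ->
          (forall s : ms_spec D, ms_at s = v -> ~ K (ms_pos s)) -> 0 < e ->
          \forall n \near \oo, forall x, K x -> mob_den (M n v) x != 0 ->
            `| cexp (l n (ms_depth v)) * form_fun a b (W n) (mob (M n v) x) *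
                 mob_deriv (M n v) x - ms_eta a b v x | < e,
        forall v w : ms_V D, (ms_depth v < ms_depth w)%N ->
          (complex.Re (l n (ms_depth w) - l n (ms_depth v)) : R)
            @[n --> \oo] --> +oo &
        forall h : ms_H D, ms_upper h ->
          ms_turn (l n) h * rho n h @[n --> \oo] --> ms_sig h].

Definition in_closure (R : realType) (p : nat) (a : 'I_2 -> nat)
    (b : 'I_p -> nat) (lam : 'I_p -> Cx R) (D : ms_data R p) : Prop :=
  multiscale a b D /\
  exists W : nat -> p1_form R p,
    (forall n, in_fiber a b lam (W n)) /\ ms_cvg a b W D.

Record riemann_surface (R : realType) := RiemannSurface {
  rs_space :> topologicalType;
  rs_idx : Type;
  rs_dom : rs_idx -> set rs_space;
  rs_im : rs_idx -> set (Cx R);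
  rs_phi : rs_idx -> rs_space -> Cx R;
  rs_psi : rs_idx -> Cx R -> rs_space;
  rs_hausdorff : hausdorff_space rs_space;
  rs_dom_open : forall i, open (rs_dom i);
  rs_im_open : forall i, open (rs_im i);
  rs_cover : forall x, exists i, rs_dom i x;
  rs_phiP : forall i x, rs_dom i x ->
    [/\ rs_im i (rs_phi i x), rs_psi i (rs_phi i x) = x &
        {for x, continuous (rs_phi i)}];
  rs_psiP : forall i z, rs_im i z ->
    [/\ rs_dom i (rs_psi i z), rs_phi i (rs_psi i z) = z &
        {for z, continuous (rs_psi i)}];
  rs_transition : forall i j z, rs_im i z -> rs_dom j (rs_psi i z) ->
    holo_at (fun s => rs_phi j (rs_psi i s)) z }.

(* [om_coef i s ds] is the expression of the form in the i-th chart; the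
   identities below also hold at poles thanks to the junk value 0. *)
Record mero_form (R : realType) (X : riemann_surface R) := MeroForm {
  om_coef : rs_idx X -> Cx R -> Cx R;
  om_compat : forall (i j : rs_idx X) (z d : Cx R),
    rs_im i z -> rs_dom j (rs_psi i z) ->
    cderiv (fun s => rs_phi j (rs_psi i s)) z d ->
    om_coef i z = om_coef j (rs_phi j (rs_psi i z)) * d;
  om_mero : forall (i : rs_idx X) (z : Cx R), rs_im i z ->
    (exists k : int, has_order (om_coef i) z k) \/
    (\forall s \near z, om_coef i s = 0) }.

Definition is_zero (R : realType) (X : riemann_surface R) (om : mero_form X)
    (x : X) : Prop :=
  exists i : rs_idx X, rs_dom i x /\
    ((exists k : int, 0 < k /\ has_order (om_coef om i) (rs_phi i x) k) \/
     (\forall s \near rs_phi i x, om_coef om i s = 0)).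

Definition is_pole (R : realType) (X : riemann_surface R) (om : mero_form X)
    (x : X) : Prop :=
  exists i : rs_idx X, rs_dom i x /\
    exists k : int, k < 0 /\ has_order (om_coef om i) (rs_phi i x) k.

(* Singular 1-chains: finite integer combinations of paths [0,1] -> X (only
   the values on [0,1] matter). *)
Definition chain (R : realType) (X : riemann_surface R) := seq (int * (R -> X)).

(* Relative cycles representing classes in H_1(X \ P, Z; integers). *)
Definition rel_cycle (R : realType) (X : riemann_surface R) (P Z : set X)
    (c : chain X) : Prop :=
  (forall m g, List.In (m, g) c ->
     {within `[0, 1]%classic, continuous g} /\
     (forall u : R, `[0, 1]%classic u -> ~ P (g u))) /\
  (forall x : X, ~ Z x ->
     \sum_(mg <- c) mg.1 * ((mg.2 1 == x)%:R - (mg.2 0 == x)%:R) = 0).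

Definition surf_path_integral (R : realType) (X : riemann_surface R)
    (om : mero_form X) (g : R -> X) (v : Cx R) : Prop :=
  exists F : R -> Cx R,
    v = F 1 - F 0 /\
    forall u : R, `[0, 1]%classic u ->
      exists (i : rs_idx X) (G : Cx R -> Cx R),
        [/\ rs_dom i (g u),
            \forall z \near rs_phi i (g u), cderiv G z (om_coef om i z) &
            \forall s \near u, `[0, 1]%classic s -> F s = G (rs_phi i (g s))].

Definition chain_integral (R : realType) (X : riemann_surface R)
    (om : mero_form X) (c : chain X) : Cx R :=
  \sum_(mg <- c) (mg.1)%:~R * get (surf_path_integral om mg.2).

(* W s, for s in U, is a holomorphic family of differentials with residues lam
   representing the points of X with i-th coordinate s. *)
Definition fiber_family (R : realType) (p : nat) (a : 'I_2 -> nat)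
    (b : 'I_p -> nat) (lam : 'I_p -> Cx R) (X : riemann_surface R)
    (pt : X -> ms_data R p) (i : rs_idx X) (U : set (Cx R))
    (W : Cx R -> p1_form R p) : Prop :=
  [/\ open U, U `<=` rs_im i,
      forall s, U s -> in_fiber a b lam (W s) /\
        ms_equiv a b (pt (rs_psi i s)) (ms_of_form (W s)),
      forall s l, U s -> holo_at (fun s' => f_pos (W s') l) s &
      forall s, U s -> holo_at (fun s' => f_scale (W s')) s].

(* X, with the point pt x of the multi-scale compactification attached to x, is
   the compact Riemann surface closure of F_lambda. The topology is the one of
   the multi-scale compactification (determined by limits of sequences of the
   dense subset F_lambda), the complex structure that of F_lambda. *)
Record is_fiber_closure (R : realType) (p : nat) (a : 'I_2 -> nat)
    (b : 'I_p -> nat) (lam : 'I_p -> Cx R) (X : riemann_surface R)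
    (pt : X -> ms_data R p) : Prop := IsFiberClosure {
  fc_compact : compact [set: X];
  fc_closure : forall x, in_closure a b lam (pt x);
  fc_inj : forall x x', ms_equiv a b (pt x) (pt x') -> x = x';
  fc_surj : forall D, in_closure a b lam D -> exists x, ms_equiv a b (pt x) D;
  fc_topology : forall (u : nat -> X) (W : nat -> p1_form R p) (x : X),
    (forall n, in_fiber a b lam (W n) /\
       ms_equiv a b (pt (u n)) (ms_of_form (W n))) ->
    (u n @[n --> \oo] --> x <-> ms_cvg a b W (pt x));
  fc_complex : forall (x : X) (W0 : p1_form R p),
    in_fiber a b lam W0 -> ms_equiv a b (pt x) (ms_of_form W0) ->
    exists (i : rs_idx X) (U : set (Cx R)) (W : Cx R -> p1_form R p),
      [/\ rs_dom i x, U (rs_phi i x) & fiber_family a b lam pt i U W] }.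

(* om is the meromorphic extension of omega_lambda = d (\int_g omega), where g
   runs from z_1 to z_2 avoiding the poles: on a local holomorphic family W of
   elements of F_lambda with a continuous choice of paths g s, the derivative
   of t s = \int_(g s) W s is the coefficient of om. *)
Definition is_omega (R : realType) (p : nat) (a : 'I_2 -> nat)
    (b : 'I_p -> nat) (lam : 'I_p -> Cx R) (X : riemann_surface R)
    (pt : X -> ms_data R p) (om : mero_form X) : Prop :=
  forall (i : rs_idx X) (U : set (Cx R)) (W : Cx R -> p1_form R p)
         (g : Cx R -> R -> Cx R) (t : Cx R -> Cx R),
    fiber_family a b lam pt i U W ->
    {within U `*` `[0, 1]%classic,
       continuous (fun sr : Cx R * R => g sr.1 sr.2)} ->
    (forall s, U s ->
       [/\ g s 0 = f_pos (W s) (inl ord0),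
           g s 1 = f_pos (W s) (inl ord_max),
           forall (r : R) (j : 'I_p), `[0, 1]%classic r ->
             g s r <> f_pos (W s) (inr j) &
           path_integral (form_fun a b (W s)) (g s) (t s)]) ->
    forall s, U s -> cderiv t s (om_coef om i s).

(* Main.v *)
Require Import Defs.
From mathcomp Require Import all_boot all_order all_algebra.
From mathcomp Require Import complex ring lra zify.
From mathcomp Require Import all_classical all_reals all_analysis.
Set Implicit Arguments.
Unset Strict Implicit.
Unset Printing Implicit Defensive.
Import Order.TTheory GRing.Theory Num.Theory.
Import numFieldNormedType.Exports.
Local Open Scope classical_set_scope.
Local Open Scope ring_scope.

(* In the coordinate Y of CP^1 sending z_1 to 0 and z_2 to infinity, suitably
   scaled, a differential of the fibre reads Y^a_1 / prod_j (Y - zeta_j)^b_j dY.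
   Partial fractions express its residues and, once logarithms of the zeta_j are
   chosen, its integral tau from z_1 to z_2, which is thus well defined modulo
   Lambda = sum_j Z lambda_j. It suffices to show that near every point that is
   not a pole, omega has a primitive whose values are values of tau, where tau is
   set to 0 at the boundary points, and that the zeros of omega are boundary
   points: then the integral along a path is the difference of the values of tau
   at its end points modulo Lambda, and these cancel in a relative cycle.
   Along the fibre, zeta solves an autonomous holomorphic equation with respect
   to the time tau. At a zero of omega the time would be a ramified function of
   the point, and uniqueness of solutions would give two points with the same
   zeta. Near a boundary point where omega is bounded, zeta has to tend to
   infinity; nonresonance then forces all zeta_j into one cluster, on which tau
   has a single-valued branch tending to 0. This branch is an antiderivative of
   omega off the boundary, and an antiderivative with this behaviour makes the
   boundary discrete, hence removable. *)

(** * Complex calculus *)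

(** The topology of the closure is given only through limits of sequences of smooth differentials,
    and no coordinates near a degenerate point are provided. So no multi-scale differential with
    nodes is ever analysed: the only limits computed are smooth ones, and all that is known of a
    boundary point is that it has no normal form. A continuation argument turns this into an
    estimate: while the coefficient of omega is bounded, a bounded zeta survives on a disc of
    definite size, so near a boundary point zeta must be large. Finiteness of the boundary is not
    given either; it has to come out of the behaviour of the antiderivative. A normal form is unique
    up to multiplying zeta by an (a_2+1)-st root of unity, because the residues scale by the power
    -(a_2+1) of the factor and no lambda_j is 0. Under such a rotation tau changes by an element of
    Lambda. The branch on a cluster, whose logarithms are those of zeta_j divided by the mean of the
    zeta_j, does not change at all; this makes it a function on the closure. *)

Section Modulus.
Variable R : realType.
Implicit Types (z w : Cx R) (r : R).

Definition rc r : Cx R := (r%:C)%C.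
(** The norm of [Cx R] takes its values in [Cx R]; a real-valued modulus keeps all estimates in the
    ordered field [R], with [rc] as the bridge. *)
Definition nz z : R := ComplexField.Normc.normc z.

Lemma normE z : `|z| = rc (nz z). Proof. by []. Qed.
Lemma rcD : {morph rc : x y / x + y}. Proof. exact: (rmorphD (real_complex R)). Qed.
Lemma rcB : {morph rc : x y / x - y}. Proof. exact: (rmorphB (real_complex R)). Qed.
Lemma rcM : {morph rc : x y / x * y}. Proof. exact: (rmorphM (real_complex R)). Qed.
Lemma rcV : {morph rc : x / x^-1}. Proof. exact: (fmorphV (real_complex R)). Qed.
Lemma rc0 : rc 0 = 0. Proof. by []. Qed.
Lemma rc1 : rc 1 = 1. Proof. by []. Qed.
Lemma rcX n : {morph rc : x / x ^+ n}. Proof. exact: (rmorphXn (real_complex R)). Qed.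
Lemma rc_nat n : rc n%:R = n%:R. Proof. exact: (rmorph_nat (real_complex R)). Qed.
Lemma rc_int n : rc n%:~R = n%:~R. Proof. exact: (rmorph_int (real_complex R)). Qed.
Lemma rc_inj : injective rc. Proof. by move=> x y []. Qed.
Lemma rc_le r s : (rc r <= rc s) = (r <= s). Proof. exact: lecR. Qed.
Lemma rc_lt r s : (rc r < rc s) = (r < s). Proof. exact: ltcR. Qed.
Lemma rc_eq0 r : (rc r == 0) = (r == 0).
Proof. by rewrite -rc0 (inj_eq rc_inj). Qed.

Lemma nz_ge0 z : 0 <= nz z. Proof. by rewrite -rc_le -normE normr_ge0. Qed.
Lemma nzM z w : nz (z * w) = nz z * nz w.
Proof. by apply: rc_inj; rewrite rcM -!normE normrM. Qed.
Lemma nzD z w : nz (z + w) <= nz z + nz w.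
Proof. by rewrite -rc_le rcD -!normE ler_normD. Qed.
Lemma nzN z : nz (- z) = nz z.
Proof. by apply: rc_inj; rewrite -!normE normrN. Qed.
Lemma nzB z w : nz (z - w) <= nz z + nz w.
Proof. by rewrite -(nzN w) nzD. Qed.
Lemma nzC z w : nz (z - w) = nz (w - z).
Proof. by rewrite -nzN opprB. Qed.
Lemma nz0 : nz 0 = 0. Proof. by apply: rc_inj; rewrite -normE normr0. Qed.
Lemma nz1 : nz 1 = 1. Proof. by apply: rc_inj; rewrite -normE normr1. Qed.
Lemma nz_eq0 z : (nz z == 0) = (z == 0).
Proof. by rewrite -rc_eq0 -normE normr_eq0. Qed.
Lemma nz_gt0 z : (0 < nz z) = (z != 0).
Proof. by rewrite lt0r nz_eq0 nz_ge0 andbT. Qed.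
Lemma nzV z : nz z^-1 = (nz z)^-1.
Proof. by apply: rc_inj; rewrite rcV -!normE normfV. Qed.
Lemma nzX z n : nz (z ^+ n) = nz z ^+ n.
Proof. by apply: rc_inj; rewrite rcX -!normE normrX. Qed.
Lemma nz_rc r : nz (rc r) = `|r|.
Proof. by rewrite /nz /rc /= expr0n /= addr0 sqrtr_sqr. Qed.
Lemma nz_sum (I : Type) (s : seq I) (P : pred I) (F : I -> Cx R) :
  nz (\sum_(i <- s | P i) F i) <= \sum_(i <- s | P i) nz (F i).
Proof.
elim/big_rec2: _ => [|i x y _ le]; first by rewrite nz0.
by apply: le_trans (nzD _ _) _; rewrite lerD2l.
Qed.
Lemma nz_prod (I : Type) (s : seq I) (P : pred I) (F : I -> Cx R) :
  nz (\prod_(i <- s | P i) F i) = \prod_(i <- s | P i) nz (F i).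
Proof. by elim/big_rec2: _ => [|i x y _ <-]; rewrite ?nz1 ?nzM. Qed.
Lemma nzBge z w : nz z - nz w <= nz (z - w).
Proof. by have := nzD (z - w) w; rewrite subrK; lra. Qed.

Lemma cxE z : z = rc (complex.Re z) + 'i%C * rc (complex.Im z).
Proof. exact: complexE. Qed.
Lemma nzE z : nz z = Num.sqrt (complex.Re z ^+ 2 + complex.Im z ^+ 2).
Proof. by rewrite /nz; case: z. Qed.
Lemma nzRe z : `|complex.Re z| <= nz z.
Proof.
by rewrite nzE -sqrtr_sqr ler_wsqrtr // lerDl sqr_ge0.
Qed.
Lemma nzIm z : `|complex.Im z| <= nz z.
Proof.
by rewrite nzE -sqrtr_sqr ler_wsqrtr // lerDr sqr_ge0.
Qed.
Lemma nzReIm z : nz z <= `|complex.Re z| + `|complex.Im z|.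
Proof.
rewrite {1}[z]cxE; apply: le_trans (nzD _ _) _.
by rewrite nzM !nz_rc /nz /= expr0n expr1n add0r sqrtr1 mul1r.
Qed.

Lemma nearC z (P : Cx R -> Prop) :
  (\forall s \near z, P s) <->
  exists2 r : R, 0 < r & forall s, nz (s - z) < r -> P s.
Proof.
split.
  move=> /nbhs_ballP[e /= e0 H].
  (* The radius of a ball in [Cx R] is a positive complex number, hence real. *)
  have Ee : e = rc (complex.Re e) :> Cx R.
    by rewrite {1}[e]cxE (ger0_Im (ltW e0)) rc0 mulr0 addr0.
  rewrite Ee in e0 H; exists (complex.Re e); first by rewrite -rc_lt rc0.
  by move=> s sr; apply: H; rewrite /ball /= distrC normE rc_lt.
move=> [r r0 H]; apply/nbhs_ballP; exists (rc r); first by rewrite /= -rc0 rc_lt.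
by move=> s; rewrite /ball /= distrC normE rc_lt => /H.
Qed.

Lemma nearR (u : R) (P : R -> Prop) :
  (\forall s \near u, P s) <->
  exists2 r : R, 0 < r & forall s, `|s - u| < r -> P s.
Proof.
split.
  move=> /nbhs_ballP[e /= e0 H]; exists e => // s sr.
  by apply: H; rewrite /ball /= distrC.
move=> [r r0 H]; apply/nbhs_ballP; exists r => // s.
by rewrite /ball /= distrC => /H.
Qed.

Lemma cvgC (T : Type) (F : set_system T) {FF : Filter F} (f : T -> Cx R) z :
  f @ F --> z <-> forall e : R, 0 < e -> \forall t \near F, nz (f t - z) < e.
Proof.
split=> H.
  move=> e e0; apply: (H [set s | nz (s - z) < e]).
  by apply/nearC; exists e.
move=> A /nearC[r r0 Hr]; move: (H _ r0); apply: filterS => t; exact: Hr.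
Qed.

Lemma contC (f : Cx R -> Cx R) z :
  {for z, continuous f} <->
  forall e : R, 0 < e -> exists2 r : R, 0 < r &
    forall s, nz (s - z) < r -> nz (f s - f z) < e.
Proof.
split=> [/(@cvgC _ (nbhs z) _ f) H e /H /nearC //|H].
by apply/(@cvgC _ (nbhs z) _ f) => e /H ?; apply/nearC.
Qed.

(** Bounding the remainder instead of a difference quotient spares the exclusion of [s = z] in later
    estimates. *)
Lemma cderivP (f : Cx R -> Cx R) z d :
  cderiv f z d <->
  forall e : R, 0 < e -> exists2 r : R, 0 < r &
    forall s, nz (s - z) < r -> nz (f s - f z - d * (s - z)) <= e * nz (s - z).
Proof.
split.
  move=> [Hd <-].
  have := Hd; rewrite /derivable -/('D_1 f z) => /cvg_ex[l Hl].
  have El : 'D_1 f z = l by exact: cvg_lim Hl.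
  rewrite El => e e0.
  move/cvgC/(_ e e0) : Hl => /nbhs_ballP[e' /= e'0 H].
  have Ee : e' = rc (complex.Re e') :> Cx R.
    by rewrite {1}[e']cxE (ger0_Im (ltW e'0)) rc0 mulr0 addr0.
  rewrite Ee in e'0 H.
  exists (complex.Re e'); first by rewrite -rc_lt rc0.
  move=> s sr; have [->|sz] := eqVneq s z; first by rewrite !subrr mulr0 subrr nz0 mulr0.
  have sz' : s - z != 0 by rewrite subr_eq0.
  have := H (s - z); rewrite /ball /= sub0r normrN normE rc_lt => /(_ sr sz').
  rewrite /= [(s - z) *: _]mulr1 subrK /GRing.scale /= => /ltW h.
  have -> : f s - f z - l * (s - z) = (s - z) * ((s - z)^-1 * (f s - f z) - l).
    by rewrite [RHS]mulrBr mulVKf // (mulrC l).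
  by rewrite nzM mulrC ler_wpM2r // nz_ge0.
move=> H.
suff Hl : h^-1 *: ((f \o shift z) (h *: (1 : Cx R)) - f z) @[h --> 0^'] --> d.
  by apply: DeriveDef; [apply/cvg_ex; exists d | exact: cvg_lim Hl].
apply/cvgC => e e0; have e2 : 0 < e / 2 by lra.
  have [r r0 Hr] := H (e / 2) e2.
apply/nbhs_ballP; exists (rc r); first by rewrite /= -rc0 rc_lt.
move=> h; rewrite /ball /= sub0r normrN normE rc_lt => hr h0.
rewrite /= [h *: _]mulr1 /GRing.scale /=.
have := Hr (h + z); rewrite addrK => /(_ hr) h1.
have -> : h^-1 * (f (h + z) - f z) - d = h^-1 * (f (h + z) - f z - d * h).
  by rewrite [RHS]mulrBr (mulrC d) mulKf.
rewrite nzM nzV; apply: (@le_lt_trans _ _ (e / 2)); last lra.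
by rewrite ler_pdivrMl ?nz_gt0 // [X in _ <= X]mulrC.
Qed.
End Modulus.

(** * Continuous induction and mean value inequalities *)

Section MeanValue.
Variable R : realType.

(** Plays the part of compactness in arguments along a path: the supremum of the initial segments on
    which [P] holds is attained by the second hypothesis, and the third pushes it further unless it
    is 1. *)
Lemma real_induction (P : R -> Prop) :
  P 0 ->
  (forall u : R, 0 < u <= 1 -> (forall v : R, 0 <= v < u -> P v) -> P u) ->
  (forall u : R, 0 <= u < 1 -> P u ->
     exists2 r : R, 0 < r & forall v : R, u < v < u + r -> v <= 1 -> P v) ->
  forall u : R, 0 <= u <= 1 -> P u.
Proof.
move=> P0 Pl Pr.
pose A := [set u : R | 0 <= u <= 1 /\ forall v : R, 0 <= v <= u -> P v].
have A0 : A 0.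
  by split; [rewrite lexx ler01|move=> v /andP[v0 v1]; have -> : v = 0 by lra].
have As : has_sup A by split; [exists 0|exists 1 => x [/andP[_ ?] _]].
pose t := sup A.
have ubA : ubound A t by exact: sup_upper_bound.
have t0 : 0 <= t by exact: ubA.
have t1 : t <= 1 by apply: ge_sup; [exists 0|move=> x [/andP[_ ?] _]].
have below v : 0 <= v < t -> P v.
  move=> /andP[v0 vt]; have tv : 0 < t - v by lra.
  have [w [w01 Hw] vw] := sup_adherent tv As.
  by apply: Hw; rewrite -/t in vw; lra.
have Pt : P t.
  have [->//|tn0] := eqVneq t 0.
  by apply: Pl => //; rewrite lt0r tn0 t0.
have At : A t.
  split; first lra.
  move=> v /andP[v0]; rewrite le_eqVlt => /orP[/eqP->//|vt].
  by apply: below; rewrite v0.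
suff t_1 : t = 1.
  by move=> u u01; apply: At.2; rewrite t_1.
apply/eqP; rewrite eq_le t1 /= leNgt; apply/negP => lt1.
have [r r0 Hr] := Pr t ltac:(lra) Pt.
pose w := Num.min 1 (t + r / 2).
have wt : t < w by rewrite /w lt_min; apply/andP; split; lra.
have w1 : w <= 1 by rewrite /w ge_min lexx.
have wr : w < t + r by rewrite /w gt_min; apply/orP; right; lra.
suff : A w by move=> /ubA; lra.
split; first lra.
move=> v /andP[v0 vw]; have [vt|vt] := leP v t; first by apply: At.2; rewrite v0.
by apply: Hr; lra.
Qed.

(** A pointwise Lipschitz bound with slack [e] propagates by continuous induction in the form
    [(M + e) * u]; complex values admit no mean value equality. *)
Lemma mvi (F : R -> Cx R) (M : R) :
  (forall u : R, 0 <= u <= 1 -> forall e : R, 0 < e -> exists2 r : R, 0 < r &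
     forall s : R, 0 <= s <= 1 -> `|s - u| < r ->
       nz (F s - F u) <= (M + e) * `|s - u|) ->
  nz (F 1 - F 0) <= M.
Proof.
move=> H; apply/ler_addgt0Pr => e e0.
suff : forall u : R, 0 <= u <= 1 -> nz (F u - F 0) <= (M + e) * u.
  by move=> /(_ 1); rewrite mulr1; apply; rewrite ler01 lexx.
apply: real_induction.
- by rewrite subrr nz0 mulr0.
- move=> u /andP[u0 u1] IH.
  have [r r0 Hr] := H u ltac:(lra) e e0.
  pose s := Num.max 0 (u - r / 2).
  have s0 : 0 <= s by rewrite /s le_max lexx.
  have su : s < u by rewrite /s gt_max; apply/andP; split; lra.
  have sr : u - r < s by rewrite /s lt_max; apply/orP; right; lra.
  have := IH s ltac:(lra).
  have Es : `|s - u| = u - s by rewrite ltr0_norm ?opprB //; lra.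
  have := Hr s ltac:(lra); rewrite Es => /(_ ltac:(lra)).
  rewrite nzC; have := nzD (F u - F s) (F s - F 0); rewrite addrA subrK.
  by lra.
- move=> u /andP[u0 u1] IH.
  have [r r0 Hr] := H u ltac:(lra) e e0.
  exists r => // v /andP[uv vr] v1.
  have Es : `|v - u| = v - u by rewrite gtr0_norm //; lra.
  have := Hr v ltac:(lra); rewrite Es => /(_ ltac:(lra)).
  have := nzD (F v - F u) (F u - F 0); rewrite addrA subrK.
  by lra.
Qed.

(* The derivative is only needed off the left endpoint, where continuity is enough. *)
Lemma mvi_open (F : R -> Cx R) (M : R) :
  (forall u : R, 0 < u <= 1 -> forall e : R, 0 < e -> exists2 r : R, 0 < r &
     forall s : R, 0 <= s <= 1 -> `|s - u| < r ->
       nz (F s - F u) <= (M + e) * `|s - u|) ->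
  (forall e : R, 0 < e -> exists2 r : R, 0 < r &
     forall s : R, 0 < s < r -> nz (F s - F 0) <= e) ->
  nz (F 1 - F 0) <= M.
Proof.
move=> H H0.
have M0 : 0 <= M.
  rewrite leNgt; apply/negP => Mneg.
  (* If [M] were negative, the slack [- M / 2] at the right endpoint would bound a modulus by a
     negative number. *)
  have [r r0 Hr] := H 1 ltac:(lra) (- M / 2) ltac:(lra).
  pose s := Num.max (1/2) (1 - r / 2).
  have s0 : 1/2 <= s by rewrite /s le_max lexx.
  have su : s < 1 by rewrite /s gt_max; apply/andP; split; lra.
  have sr : 1 - r < s by rewrite /s lt_max; apply/orP; right; lra.
  have Es : `|s - 1| = 1 - s by rewrite ltr0_norm ?opprB //; lra.
  have := Hr s ltac:(lra); rewrite Es => /(_ ltac:(lra)).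
  by have := nz_ge0 (F s - F 1); nra.
apply/ler_addgt0Pr => e e0.
have [r r0 Hr] := H0 e e0.
pose d := Num.min (1/2) (r / 2).
have d0 : 0 < d by rewrite /d lt_min; apply/andP; split; lra.
have d1 : d <= 1/2 by rewrite /d ge_min lexx.
have dr : d < r by rewrite /d gt_min; apply/orP; right; lra.
have h0 := Hr d ltac:(lra).
(* The interval from [d] to 1 is rescaled to the unit interval; the piece before [d] costs at most
   [e] by continuity at 0. *)
pose G u := F (d + u * (1 - d)).
have : nz (G 1 - G 0) <= M.
  apply: mvi => u u01 e' e'0.
  have [r' r'0 Hr'] := H (d + u * (1 - d)) ltac:(nra) e' e'0.
  exists r' => // s s01 sr.
  have Es : `|d + s * (1 - d) - (d + u * (1 - d))| = (1 - d) * `|s - u|.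
    have -> : d + s * (1 - d) - (d + u * (1 - d)) = (1 - d) * (s - u) by ring.
    by rewrite normrM ger0_norm //; lra.
  have := Hr' (d + s * (1 - d)) ltac:(nra); rewrite Es.
  have n0 := normr_ge0 (s - u).
  have h1 : (1 - d) * `|s - u| < r' by nra.
  move=> /(_ h1) h2; apply: le_trans h2 _.
  by apply: ler_wpM2l; nra.
rewrite /G mul1r mul0r addr0 (addrC d) subrK.
by have := nzD (F 1 - F d) (F d - F 0); rewrite addrA subrK; lra.
Qed.

End MeanValue.

(** * Differentiation rules over the complex numbers *)

Section ComplexDerivative.
Variable R : realType.
Implicit Types (f g : Cx R -> Cx R) (z d : Cx R).

Lemma cderiv_ext f g z d :
  (\forall s \near z, f s = g s) -> cderiv f z d -> cderiv g z d.
Proof.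
move=> /nearC[r r0 E] /cderivP H; apply/cderivP => e /H[r' r'0 H'].
have Ez : f z = g z by apply: E; rewrite subrr nz0.
exists (Num.min r r'); first by rewrite lt_min r0.
by move=> s; rewrite lt_min => /andP[sr /H']; rewrite E // Ez.
Qed.

Lemma cderiv_unique f z d d' : cderiv f z d -> cderiv f z d' -> d = d'.
Proof. by move=> [_ <-] [_ <-]. Qed.

Lemma cderiv_cont f z d : cderiv f z d -> {for z, continuous f}.
Proof.
move=> /cderivP H; apply/contC => e e0.
have [r r0 Hr] := H 1 ltr01.
have n0 : 0 < 1 + nz d by have := nz_ge0 d; lra.
exists (Num.min r (e / (1 + nz d) / 2)).
  by rewrite lt_min r0 /=; rewrite !divr_gt0.
move=> s; rewrite lt_min => /andP[sr se]; have := Hr s sr.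
have := nzD (f s - f z - d * (s - z)) (d * (s - z)).
rewrite subrK nzM.
have : (1 + nz d) * nz (s - z) < e.
  rewrite -ltr_pdivlMl // mulrC; apply: lt_trans se _.
  by have := divr_gt0 e0 n0; lra.
by nra.
Qed.

Lemma cderiv_cst (c : Cx R) z : cderiv (fun=> c) z 0.
Proof. exact: is_derive_cst. Qed.
Lemma cderiv_id z : cderiv (fun s => s) z 1.
Proof. exact: is_derive_id. Qed.
Lemma cderivD f g z d d' :
  cderiv f z d -> cderiv g z d' -> cderiv (fun s => f s + g s) z (d + d').
Proof. exact: is_deriveD. Qed.
Lemma cderivN f z d : cderiv f z d -> cderiv (fun s => - f s) z (- d).
Proof. exact: is_deriveN. Qed.
Lemma cderivB f g z d d' :
  cderiv f z d -> cderiv g z d' -> cderiv (fun s => f s - g s) z (d - d').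
Proof. exact: is_deriveB. Qed.
Lemma cderivM f g z d d' :
  cderiv f z d -> cderiv g z d' ->
  cderiv (fun s => f s * g s) z (d * g z + f z * d').
Proof.
move=> Hf Hg; rewrite addrC [X in _ + X]mulrC; exact: is_deriveM.
Qed.
Lemma cderivZ (c : Cx R) f z d :
  cderiv f z d -> cderiv (fun s => c * f s) z (c * d).
Proof. by move=> H; have := cderivM (cderiv_cst c z) H; rewrite mul0r add0r. Qed.
Lemma cderivX f n z d :
  cderiv f z d -> cderiv (fun s => f s ^+ n) z (n%:R * f z ^+ n.-1 * d).
Proof.
move=> H; elim: n => [|n IH].
  by rewrite mul0r mul0r; apply: cderiv_ext (cderiv_cst 1 z); near=> s; rewrite expr0.
have := cderivM H IH; rewrite (_ : _ + _ = n.+1%:R * f z ^+ n.+1.-1 * d).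
  by apply: cderiv_ext; near=> s; rewrite exprS.
case: n IH => [|n] _ /=; first by rewrite expr0; ring.
by rewrite -[n.+2%:R]natr1 exprS; ring.
Unshelve. all: by end_near. Qed.
Lemma cderiv_sum (I : Type) (s : seq I) (P : pred I) (F : I -> Cx R -> Cx R) D z :
  (forall i, P i -> cderiv (F i) z (D i)) ->
  cderiv (fun x => \sum_(i <- s | P i) F i x) z (\sum_(i <- s | P i) D i).
Proof.
move=> H; elim: s => [|i s IH].
  rewrite big_nil; apply: cderiv_ext (cderiv_cst 0 z).
  by near=> x; rewrite big_nil.
rewrite big_cons; case: ifP => Pi.
  by apply: cderiv_ext (cderivD (H i Pi) IH); near=> x; rewrite big_cons Pi.
by apply: cderiv_ext IH; near=> x; rewrite big_cons Pi.
Unshelve. all: by end_near. Qed.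

Lemma cderiv_comp f g z d d' :
  cderiv f (g z) d -> cderiv g z d' -> cderiv (fun s => f (g s)) z (d * d').
Proof.
move=> /cderivP Hf Hg; have /contC Cg := cderiv_cont Hg.
move/cderivP in Hg; apply/cderivP => e e0.
have n0 := nz_ge0 d; have n0' := nz_ge0 d'.
pose e1 := e / 2 / (1 + nz d').
pose e2 := Num.min 1 (e / 2 / (1 + nz d)).
have e10 : 0 < e1 by rewrite !divr_gt0 //; lra.
have e20 : 0 < e2 by rewrite lt_min ltr01 !divr_gt0 //; lra.
have e21 : e2 <= 1 by rewrite ge_min lexx.
have he1 : e1 * (1 + nz d') = e / 2 by rewrite divfK //; lra.
have he2 : e2 * (1 + nz d) <= e / 2.
  by rewrite -ler_pdivlMr ?ge_min ?lexx ?orbT //; lra.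
have [r1 r10 H1] := Hf e1 e10.
have [r2 r20 H2] := Cg r1 r10.
have [r3 r30 H3] := Hg e2 e20.
exists (Num.min r2 r3); first by rewrite lt_min r20.
move=> s; rewrite lt_min => /andP[s2 s3].
have h1 := H1 _ (H2 s s2); have h3 := H3 s s3.
have := nzD (f (g s) - f (g z) - d * (g s - g z)) (d * (g s - g z - d' * (s - z))).
have -> : f (g s) - f (g z) - d * (g s - g z) + d * (g s - g z - d' * (s - z)) =
          f (g s) - f (g z) - d * d' * (s - z) by ring.
have := nzD (g s - g z - d' * (s - z)) (d' * (s - z)); rewrite subrK !nzM.
move: h1 h3; set A := nz (g s - g z); set B := nz (s - z).
set D := nz (_ - _ - d' * _); set E := nz (_ - _ - d * _).
move=> h1 h3 h4 h5; apply: le_trans h5 _.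
have B0 : 0 <= B by exact: nz_ge0.
have : E <= e1 * ((1 + nz d') * B).
  by apply: le_trans h1 _; rewrite ler_wpM2l //; [lra|nra].
have : nz d * D <= (e2 * (1 + nz d)) * B.
  have D0 : 0 <= D by exact: nz_ge0.
  by nra.
rewrite mulrA he1; nra.
Qed.

Lemma cderivV f z d :
  f z != 0 -> cderiv f z d -> cderiv (fun s => (f s)^-1) z (- d / f z ^+ 2).
Proof.
move=> fz Hf.
suff H : cderiv (fun w : Cx R => w^-1) (f z) (- (f z ^+ 2)^-1).
  by have := cderiv_comp H Hf; rewrite mulrC mulrN -mulNr.
move: (f z) fz => w w0 {f d Hf z}.
apply/cderivP => e e0; have W : 0 < nz w by rewrite nz_gt0.
exists (Num.min (nz w / 2) (e * nz w ^+ 3 / 2)).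
  by rewrite lt_min !divr_gt0 ?mulr_gt0 ?exprn_gt0.
move=> s; rewrite lt_min => /andP[s1 s2].
have S : nz w / 2 < nz s by have := nzBge w s; rewrite nzC; lra.
have s0 : s != 0 by rewrite -nz_gt0; lra.
have -> : s^-1 - w^-1 - - (w ^+ 2)^-1 * (s - w) = (s - w) * ((s - w) / (s * w ^+ 2)).
  by field; rewrite w0 s0.
rewrite nzM mulrC ler_wpM2r ?nz_ge0 // nzM nzV nzM nzX.
rewrite ler_pdivrMr ?mulr_gt0 ?exprn_gt0 //; last lra.
apply: le_trans (ltW s2) _.
have W2 : 0 < nz w ^+ 2 by rewrite exprn_gt0.
have -> : e * nz w ^+ 3 / 2 = e * nz w ^+ 2 * (nz w / 2) by field.
by rewrite -mulrA (mulrC (nz s)) ler_wpM2l // ?ler_wpM2l //; lra.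
Qed.

Lemma cderiv_div f g z d d' :
  g z != 0 -> cderiv f z d -> cderiv g z d' ->
  cderiv (fun s => f s / g s) z ((d * g z - f z * d') / g z ^+ 2).
Proof.
move=> gz Hf Hg; have := cderivM Hf (cderivV gz Hg).
by rewrite (_ : _ + _ = (d * g z - f z * d') / g z ^+ 2) //; field.
Qed.

End ComplexDerivative.

(** * Complex exponential and principal logarithm *)

Section Exponential.
Variable R : realType.
Implicit Types (z w d : Cx R).

Lemma is_derive_eps (f : R -> R) (x d : R) : is_derive x (1 : R) f d ->
  forall e : R, 0 < e -> exists2 r : R, 0 < r &
    forall s : R, `|s - x| < r -> `|f s - f x - d * (s - x)| <= e * `|s - x|.
Proof.
move=> [Hd <-] e e0.
have := Hd; rewrite /derivable -/('D_1 f x) => /cvg_ex[l Hl].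
have -> : 'D_1 f x = l by exact: cvg_lim Hl.
move/cvgrPdist_lt/(_ e e0) : Hl => /nbhs_ballP[r /= r0 H].
exists r => // s sr; have [->|sx] := eqVneq s x; first by rewrite !subrr mulr0 subrr normr0 mulr0.
have sx' : s - x != 0 by rewrite subr_eq0.
have := H (s - x); rewrite /ball /= sub0r normrN => /(_ sr sx').
rewrite [(s - x) *: _]mulr1 subrK distrC /GRing.scale /= => /ltW h.
have -> : f s - f x - l * (s - x) = (s - x) * ((s - x)^-1 * (f s - f x) - l).
  by rewrite [RHS]mulrBr mulVKf // (mulrC l).
by rewrite normrM mulrC ler_wpM2r.
Qed.

Lemma ReB z w : complex.Re (z - w) = complex.Re z - complex.Re w.
Proof. by case: z w => [a b] [c d]. Qed.
Lemma ImB z w : complex.Im (z - w) = complex.Im z - complex.Im w.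
Proof. by case: z w => [a b] [c d]. Qed.
Lemma nz_i : nz ('i%C : Cx R) = 1.
Proof. by rewrite nzE /= expr0n /= expr1n add0r sqrtr1. Qed.

Lemma cexp0 : cexp 0 = 1 :> Cx R.
Proof. by rewrite /cexp /= expR0 cos0 sin0 mulr0 mulr1. Qed.

Lemma cexpD z w : cexp (z + w) = cexp z * cexp w.
Proof.
case: z w => [a b] [c d]; rewrite /cexp /= expRD sinD cosD.
by apply/eqP; rewrite eq_complex /=; apply/andP; split; apply/eqP; ring.
Qed.

Lemma nz_cexp z : nz (cexp z) = expR (complex.Re z).
Proof.
rewrite nzE /= !exprMn -mulrDr cos2Dsin2 mulr1 sqrtr_sqr ger0_norm //.
Qed.

Lemma cexp_neq0 z : cexp z != 0.
Proof. by rewrite -nz_gt0 nz_cexp expR_gt0. Qed.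

Lemma cexpN z : cexp (- z) = (cexp z)^-1.
Proof.
by apply: (mulfI (cexp_neq0 z)); rewrite -cexpD subrr cexp0 mulfV ?cexp_neq0.
Qed.

Lemma cexpB z w : cexp (z - w) = cexp z / cexp w.
Proof. by rewrite cexpD cexpN. Qed.

Lemma cexp_nat n z : cexp (n%:R * z) = cexp z ^+ n.
Proof.
elim: n => [|n IH]; first by rewrite mul0r cexp0 expr0.
by rewrite -natr1 mulrDl mul1r cexpD IH exprSr.
Qed.

Lemma cderiv_cexp z : cderiv (@cexp R) z (cexp z).
Proof.
suff H0 : cderiv (@cexp R) 0 1.
  have H : cderiv (fun s => cexp z * cexp (s - z)) z (cexp z * (1 * (1 - 0))).
    apply: cderivZ; apply: cderiv_comp; first by rewrite subrr.
    by apply: cderivB; [exact: cderiv_id|exact: cderiv_cst].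
  rewrite subr0 !mulr1 in H; apply: cderiv_ext H.
  by near=> s; rewrite -cexpD addrC subrK.
apply/cderivP => e e0; pose e1 := Num.min 1 (e / 16).
have e10 : 0 < e1 by rewrite lt_min ltr01 /= divr_gt0.
have e11 : e1 <= 1 by rewrite ge_min lexx.
have e12 : e1 <= e / 16 by rewrite ge_min lexx orbT.
have [r1 r10 H1] := is_derive_eps (is_derive_expR 0) e10.
have [r2 r20 H2] := is_derive_eps (is_derive_cos 0) e10.
have [r3 r30 H3] := is_derive_eps (is_derive_sin 0) e10.
exists (Num.min (Num.min r1 r2) (Num.min r3 e1)).
  by rewrite lt_min lt_min r10 r20 lt_min r30 e10.
move=> s; rewrite subr0 !lt_min => /andP[/andP[s1 s2] /andP[s3 s4]].
rewrite cexp0 mul1r.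
have Ra := nzRe s; have Ia := nzIm s.
have h1 := H1 (complex.Re s); have h2 := H2 (complex.Im s); have h3 := H3 (complex.Im s).
rewrite !subr0 expR0 in h1; rewrite !subr0 cos0 sin0 oppr0 mul0r subr0 in h2.
rewrite !subr0 cos0 sin0 subr0 in h3.
move: h1 h2 h3 => /(_ (le_lt_trans Ra s1)) h1 /(_ (le_lt_trans Ia s2)) h2 /(_ (le_lt_trans Ia s3)) h3.
apply: le_trans (nzReIm _) _ => /=.
set x := complex.Re s in Ra h1 *; set y := complex.Im s in Ia h2 h3 *.
(* Both parts of [cexp s - 1 - s] are split into errors of the real exponential, cosine and sine;
   the four errors add up to at most [9 * e1 * N], whence the 16 in [e1]. *)
have -> : complex.Re (cexp s - 1 - s) = (expR x - 1 - 1 * x) + expR x * (cos y - 1).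
  by rewrite !ReB /= -/x -/y; ring.
have -> : complex.Im (cexp s - 1 - s) = expR x * (sin y - 1 * y) + (expR x - 1) * y.
  by rewrite !ImB /= -/x -/y; ring.
have t1 := ler_normD (expR x - 1 - 1 * x) (expR x * (cos y - 1)).
have t2 := ler_normD (expR x * (sin y - 1 * y)) ((expR x - 1) * y).
rewrite !normrM in t1 t2.
have t3 := ler_normD (expR x - 1 - 1 * x) x.
rewrite mul1r subrK in t3; rewrite !mul1r in t1 t2 h1 h3 *.
have t4 : `|expR x| <= `|expR x - 1| + 1.
  by have := ler_normD (expR x - 1) 1; rewrite subrK normr1.
move: h1 h2 h3 t1 t2 t3 t4 Ra Ia.
set N := nz s; set X := `|x|; set Y := `|y|.
set A := `|expR x - 1 - x|; set B := `|cos y - 1|; set D := `|sin y - y|.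
set E := `|expR x|; set F := `|expR x - 1|.
move=> h1 h2 h3 t1 t2 t3 t4 Ra Ia.
have [X0 Y0 A0] : [/\ 0 <= X, 0 <= Y & 0 <= A] by split; exact: normr_ge0.
have [B0 D0 E0] : [/\ 0 <= B, 0 <= D & 0 <= E] by split; exact: normr_ge0.
have F0 : 0 <= F by exact: normr_ge0.
have N0 : 0 <= N by exact: nz_ge0.
have s4' : N < e1 by rewrite /e1 lt_min.
have hX : X <= e1 by apply: le_trans Ra (ltW s4').
have hF : F <= 2 * e1 by nra.
have hE : E <= 3 by lra.
have eY : e1 * Y <= e1 * N by rewrite ler_wpM2l // ltW.
have k1 : E * B <= 3 * (e1 * N) by apply: ler_pM => //; exact: le_trans h2 _.
have k2 : E * D <= 3 * (e1 * N) by apply: ler_pM => //; exact: le_trans h3 _.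
have k3 : F * Y <= 2 * (e1 * N) by rewrite mulrA; apply: ler_pM.
have k4 : A <= e1 * N by apply: le_trans h1 _; rewrite ler_wpM2l // ltW.
have k5 : e1 * N <= e / 16 * N by rewrite ler_wpM2r.
have k6 := mulr_ge0 (ltW e0) N0.
apply: le_trans (lerD t1 t2) _; lra.
Unshelve. all: by end_near. Qed.

Lemma cexp_eq1 z : cexp z = 1 ->
  exists n : int, z = 'i%C * rc (pi *+ 2) * n%:~R.
Proof.
case: z => x y E.
have x0 : x = 0.
  have := nz_cexp (x +i* y)%C; rewrite E nz1 /= => /esym /eqP.
  by rewrite -expR0 => /eqP /expR_inj.
move: E; rewrite /cexp /= x0 expR0 !mul1r => /eqP; rewrite eq_complex /= => /andP[/eqP cy _].
have pi0 : 0 < pi *+ 2 :> R by rewrite mulrn_wgt0 // pi_gt0.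
have per (n : int) (a : R) : cos (a + (pi *+ 2) * n%:~R) = cos a.
  case: n => n.
    by rewrite -[_%:~R]/(n%:R) mulr_natr; exact: (periodicn (@cosD2pi R)).
  rewrite NegzE mulrNz mulrN; rewrite -[n.+1%:~R]/(n.+1%:R) mulr_natr -[in RHS](subrK (pi *+ 2 *+ n.+1) a).
  by rewrite (periodicn (@cosD2pi R)).
(* Brings the imaginary part between [- pi] and [pi], where cosine takes the value 1 only at 0. *)
pose n := Num.floor ((y + pi) / (pi *+ 2)).
pose t := y - (pi *+ 2) * n%:~R.
have ct : cos t = 1 by rewrite /t -mulrN -mulrNz per.
have pp := @pi_gt0 R.
have tb : - pi <= t <= pi.
  have := floor_itv ((y + pi) / (pi *+ 2)).
  rewrite -/n ler_pdivlMr // ltr_pdivrMr // intrD mulrDl /t !mulr2n => /andP[h1 h2].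
  rewrite mulrC; lra.
have t0 : `|t| = 0.
  apply: (@cos_inj R).
  - by rewrite in_itv /= normr_ge0 ler_norml.
  - by rewrite in_itv /= lexx pi_ge0.
  rewrite cos0; case: (ger0P t) => _ //; by rewrite cosN.
exists n; move/eqP: t0; rewrite normr_eq0 subr_eq0 => /eqP ->.
apply/eqP; rewrite -[n%:~R]/(n%:~R) -(rmorph_int (real_complex R)) eq_complex /=.
by apply/andP; split; apply/eqP; ring.
Qed.

Definition two_pi_i : Cx R := 'i%C * rc (pi *+ 2).

Lemma two_pi_i_neq0 : two_pi_i != 0.
Proof.
rewrite mulf_neq0 //; first by rewrite eq_complex /= oner_eq0 andbF.
by rewrite rc_eq0 mulrn_eq0 /= gt_eqF // pi_gt0.
Qed.

(** The plane cut along the nonpositive reals, in a form that is open by continuity and is exactly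
    the positivity of the denominator in [Log]. *)
Definition slit z : Prop := 0 < nz z + complex.Re z.

Lemma slit_Re z : 0 < complex.Re z -> slit z.
Proof. by rewrite /slit; have := nz_ge0 z; lra. Qed.

Lemma slit_Im z : complex.Im z != 0 -> slit z.
Proof.
move=> H; rewrite /slit; have h : `|complex.Re z| < nz z.
  rewrite nzE -sqrtr_sqr ltr_sqrt ?ltrDl ?exprn_even_gt0 //.
  by rewrite lt0r addr_ge0 ?sqr_ge0 // andbT paddr_eq0 ?sqr_ge0 // (sqrf_eq0 (complex.Im z)) (negbTE H) andbF.
by move: h; rewrite ltr_norml => /andP[h _]; lra.
Qed.

Lemma slitP z : slit z -> complex.Im z != 0 \/ 0 < complex.Re z.
Proof.
move=> H; have [I0|] := eqVneq (complex.Im z) 0; last by left.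
right; move: H; rewrite /slit nzE I0 expr0n /= addr0 sqrtr_sqr.
by case: ger0P => ? ?; lra.
Qed.

Lemma slit_neq0 z : slit z -> z != 0.
Proof.
by move=> H; apply/eqP => z0; move: H; rewrite /slit z0 nz0 /= addr0 ltxx.
Qed.

(** Star-shapedness about 1 makes one principal branch available along a straight segment, seen from
    any pole that the segment misses. *)
Lemma slit_star z (u : R) : slit z -> 0 <= u <= 1 -> slit (1 + rc u * (z - 1)).
Proof.
move=> /slitP H /andP[u0 u1].
have Ei : complex.Im (1 + rc u * (z - 1)) = u * complex.Im z.
  by case: (z) => a b /=; ring.
have Er : complex.Re (1 + rc u * (z - 1)) = 1 - u + u * complex.Re z.
  by case: (z) => a b /=; ring.
have [->|un0] := eqVneq u 0.
  by apply: slit_Re; rewrite mul0r addr0 /= ltr01.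
case: H => H; first by apply: slit_Im; rewrite Ei mulf_neq0.
apply: slit_Re; rewrite Er; have : 0 < u by rewrite lt0r un0.
by nra.
Qed.

Lemma contCR (f : Cx R -> R) z :
  {for z, continuous f} <->
  forall e : R, 0 < e -> exists2 r : R, 0 < r &
    forall s, nz (s - z) < r -> `|f s - f z| < e.
Proof.
split=> [/(@cvgrPdist_lt _ _ _ (nbhs z)) H e /H /nearC[r r0 Hr]|H].
  by exists r => // s /Hr; rewrite distrC.
apply/(@cvgrPdist_lt _ _ _ (nbhs z)) => e /H[r r0 Hr].
by apply/nearC; exists r => // s /Hr; rewrite distrC.
Qed.

Lemma cont_Re z : {for z, continuous (@complex.Re R : Cx R -> R)}.
Proof.
apply/contCR => e e0; exists e => // s h.
by apply: le_lt_trans h; apply: le_trans (nzRe _); case: (s) (z) => [a b] [c d].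
Qed.

Lemma cont_Im z : {for z, continuous (@complex.Im R : Cx R -> R)}.
Proof.
apply/contCR => e e0; exists e => // s h.
by apply: le_lt_trans h; apply: le_trans (nzIm _); case: (s) (z) => [a b] [c d].
Qed.

Lemma cont_nz z : {for z, continuous (@nz R : Cx R -> R)}.
Proof.
apply/contCR => e e0; exists e => // s h.
apply: le_lt_trans h; rewrite ler_norml; have := nzBge s z; have := nzBge z s.
by rewrite (nzC z); lra.
Qed.

Lemma cont_rc (f : Cx R -> R) z : {for z, continuous f} ->
  {for z, continuous (fun s => rc (f s))}.
Proof.
move=> /contCR H; apply/contC => e /H[r r0 Hr]; exists r => // s /Hr.
by rewrite -rcB nz_rc.
Qed.

Lemma slit_open z : slit z -> \forall s \near z, slit s.
Proof.
move=> H.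
have : {for z, continuous (fun s : Cx R => nz s + complex.Re s)}.
  by apply: continuousD; [exact: cont_nz|exact: cont_Re].
move/contCR/(_ _ H) => [r r0 Hr]; apply/nearC; exists r => // s /Hr; rewrite ltr_norml => /andP[+ _].
by rewrite /slit; lra.
Qed.

(** The argument is twice the arctangent of the half-angle slope, a single formula that is
    continuous on the whole cut plane. *)
Definition Log z : Cx R :=
  rc (ln (nz z)) + 'i%C * rc (atan (complex.Im z / (nz z + complex.Re z)) *+ 2).

Lemma Log1 : Log 1 = 0.
Proof. by rewrite /Log nz1 ln1 /= mul0r atan0 mul0rn rc0 mulr0 addr0. Qed.

Lemma LogK z : slit z -> cexp (Log z) = z.
Proof.
move=> H; have z0 := slit_neq0 H; have n0 : 0 < nz z by rewrite nz_gt0.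
have -> : Log z = (ln (nz z) +i* (atan (complex.Im z / (nz z + complex.Re z)) *+ 2))%C.
  rewrite /Log; apply/eqP; rewrite eq_complex /=; apply/andP; split; apply/eqP; ring.
rewrite /cexp /= lnK ?posrE //; set t := _ / _.
have c0 : cos (atan t) != 0.
  by rewrite cos_atan invr_eq0 sqrtr_eq0 -ltNge ltr_pwDl ?sqr_ge0.
have s_c : sin (atan t) = t * cos (atan t).
  by rewrite -{2}(atanK t) /tan divfK.
have c2 : cos (atan t) ^+ 2 = (1 + t ^+ 2)^-1.
  rewrite cos_atan exprVn sqr_sqrtr // addr_ge0 ?sqr_ge0 //.
rewrite cos_mulr2n sin_mulr2n s_c.
have -> : cos (atan t) * (t * cos (atan t)) = t * (1 + t ^+ 2)^-1.
  by rewrite -c2; ring.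
rewrite c2.
have N2 : nz z ^+ 2 = complex.Re z ^+ 2 + complex.Im z ^+ 2.
  by rewrite nzE sqr_sqrtr // addr_ge0 ?sqr_ge0.
have S0 : nz z + complex.Re z != 0 by rewrite gt_eqF.
have T : 1 + t ^+ 2 = 2 * nz z / (nz z + complex.Re z).
  have -> : t ^+ 2 = (nz z ^+ 2 - complex.Re z ^+ 2) / (nz z + complex.Re z) ^+ 2.
    by rewrite N2 /t; field.
  by field.
have n0' : nz z != 0 by rewrite gt_eqF.
have -> : (1 + t ^+ 2)^-1 = (nz z + complex.Re z) / (2 * nz z).
  by rewrite T invf_div.
apply/eqP; rewrite eq_complex /=; apply/andP; split; apply/eqP.
  by rewrite mulr2n; field.
by rewrite /t mulr2n; field; rewrite n0' S0.
Qed.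

Lemma cont_Log z : slit z -> {for z, continuous Log}.
Proof.
move=> H; have n0 : 0 < nz z by rewrite nz_gt0 slit_neq0.
have c1 : {for z, continuous (fun s => rc (ln (nz s)))}.
  by apply: cont_rc; apply: (continuous_comp (@cont_nz z)); exact: continuous_ln.
apply: continuousD; first exact: c1.
apply: continuousM; first exact: cst_continuous.
apply: cont_rc; apply/contCR => e e0.
suff /contCR/(_ (e / 2) ltac:(lra))[r r0 Hr] :
    {for z, continuous (fun s : Cx R => atan (complex.Im s / (nz s + complex.Re s)))}.
  exists r => // s /Hr; set A := atan _; set B := atan _.
  have -> : A *+ 2 - B *+ 2 = (A - B) * 2 by ring.
  by rewrite normrM (ger0_norm (ler0n _ 2)); lra.
apply: (@continuous_comp _ _ _ (fun s : Cx R => complex.Im s / (nz s + complex.Re s)) (@atan R)); last exact: continuous_atan.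
apply: continuousM; first exact: cont_Im.
apply: continuousV; first by rewrite gt_eqF.
by apply: continuousD; [exact: cont_nz|exact: cont_Re].
Qed.

(** Applies to any continuous logarithm, whichever branch. The expansion of the exponential at [L z]
    first bounds the increment of [L] by that of [f], and is then solved for it. *)
Lemma cderiv_log (L f : Cx R -> Cx R) z d :
  (\forall s \near z, cexp (L s) = f s) -> {for z, continuous L} ->
  cderiv f z d -> cderiv L z (d / f z).
Proof.
move=> /nearC[r r0 E] /contC CL /cderivP Hf.
have Ez : cexp (L z) = f z by apply: E; rewrite subrr nz0.
have /cderivP He := cderiv_cexp (L z).
set w := cexp (L z) in He; have w0 : w != 0 by exact: cexp_neq0.
have W0 : 0 < nz w by rewrite nz_gt0.
apply/cderivP => e e0; rewrite -Ez -/w.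
have D0 := nz_ge0 d.
pose e1 := Num.min (nz w / 2) (e * nz w ^+ 2 / (4 * (1 + nz d))).
have e10 : 0 < e1.
  by rewrite lt_min !divr_gt0 // ?mulr_gt0 ?exprn_gt0 //; lra.
have e11 : e1 <= nz w / 2 by rewrite ge_min lexx.
have e12 : e1 * (4 * (1 + nz d)) <= e * nz w ^+ 2.
  by rewrite -ler_pdivlMr ?ge_min ?lexx ?orbT //; lra.
pose e2 := Num.min 1 (e * nz w / 2).
have e20 : 0 < e2 by rewrite lt_min ltr01 /= !divr_gt0 // mulr_gt0.
have e21 : e2 <= 1 by rewrite ge_min lexx.
have e22 : e2 <= e * nz w / 2 by rewrite ge_min lexx orbT.
have [r1 r10 H1] := He e1 e10.
have [r2 r20 H2] := CL r1 r10.
have [r3 r30 H3] := Hf e2 e20.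
exists (Num.min r (Num.min r2 r3)); first by rewrite !lt_min r0 r20.
move=> s; rewrite !lt_min => /and3P[s1 s2 s3].
have h1 := H1 _ (H2 s s2); have h3 := H3 s s3.
rewrite E // {1}/w Ez in h1.
set B := nz (s - z) in h3 *; have B0 : 0 <= B by exact: nz_ge0.
set a := L s - L z in h1 *.
have A0 := nz_ge0 a.
have k1 : nz (w * a) <= nz (f s - f z) + e1 * nz a.
  have := nzB (f s - f z) (f s - f z - w * a); rewrite opprB addrCA subrr addr0.
  by move=> h; apply: le_trans h _; rewrite lerD2l.
have k2 : nz (f s - f z) <= (1 + nz d) * B.
  have := nzD (f s - f z - d * (s - z)) (d * (s - z)); rewrite subrK nzM -/B.
  by move=> h; nra.
rewrite nzM in k1.
have k3 : nz w * nz a <= 2 * ((1 + nz d) * B) by nra.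
have -> : a - d / w * (s - z) = w^-1 * ((f s - f z - d * (s - z)) - (f s - f z - w * a)).
  by field.
rewrite nzM nzV ler_pdivrMl //.
have k4 := nzB (f s - f z - d * (s - z)) (f s - f z - w * a).
apply: le_trans k4 _.
have k5 : e1 * nz a <= e * nz w / 2 * B.
  rewrite -(ler_pM2l W0).
  have : e1 * (nz w * nz a) <= e1 * (2 * ((1 + nz d) * B)) by rewrite ler_wpM2l // ltW.
  have : e1 * (4 * (1 + nz d)) * B <= e * nz w ^+ 2 * B by rewrite ler_wpM2r.
  by rewrite expr2; lra.
have k6 : e2 * B <= e * nz w / 2 * B by rewrite ler_wpM2r.
by lra.
Qed.

Lemma cderiv_Log z : slit z -> cderiv Log z z^-1.
Proof.
move=> H; rewrite -[z^-1]mul1r.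
apply: (@cderiv_log Log (fun s => s)).
- by move: (slit_open H); apply: filterS => s; exact: LogK.
- exact: cont_Log.
- exact: cderiv_id.
Qed.

Lemma cexp_surj z : z != 0 -> exists w, cexp w = z.
Proof.
move=> z0; have [H|H] := pselect (slit z); first by exists (Log z); exact: LogK.
(* On the cut, the logarithm of [- z] is shifted by i pi. *)
exists ('i%C * rc pi + Log (- z)); rewrite cexpD LogK; last first.
  have [I0|I0] := eqVneq (complex.Im z) 0; last first.
    by case: H; exact: slit_Im.
  apply: slit_Re; rewrite (_ : complex.Re (- z) = - complex.Re z); last by case: (z).
  have : complex.Re z <= 0 by rewrite leNgt; apply/negP => ?; apply: H; exact: slit_Re.
  have : complex.Re z != 0.
    by apply: contraNneq z0 => E; rewrite [z]cxE E I0 rc0 mulr0 addr0.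
  by move=> *; rewrite oppr_gt0 lt_neqAle; apply/andP.
rewrite (_ : cexp _ = -1) ?mulN1r ?opprK //.
rewrite (_ : _ * _ = (0 +i* pi)%C); last first.
  by apply/eqP; rewrite eq_complex /=; apply/andP; split; apply/eqP; ring.
by rewrite /cexp /= expR0 cospi sinpi; apply/eqP; rewrite eq_complex /= !mul1r oppr0 !eqxx.
Qed.

(** Near 0 the difference of the two sides is a multiple of 2 pi i of modulus less than 2 pi. *)
Lemma Log_cexp_small : exists2 r : R, 0 < r & forall w, nz w < r -> Log (cexp w) = w.
Proof.
have s1 : slit 1 by apply: slit_Re; rewrite /= ltr01.
pose rho : R := pi; have rho0 : 0 < rho by exact: pi_gt0.
have /contC CL := cont_Log s1.
have [r1 r10 H1] := CL rho rho0.
have /contC CE := cderiv_cont (cderiv_cexp 0).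
have /nearC[r3 r30 H3] := slit_open s1.
have [r2 r20 H2] := CE (Num.min r1 r3) ltac:(by rewrite lt_min r10).
exists (Num.min r2 rho); first by rewrite lt_min r20.
move=> w; rewrite lt_min => /andP[w1 w2].
have := H2 w; rewrite subr0 cexp0 lt_min => /(_ w1) /andP[/H1 h1 /H3 h3].
rewrite Log1 subr0 in h1.
have : cexp (Log (cexp w) - w) = 1.
  by rewrite cexpB LogK // mulfV // cexp_neq0.
move=> /cexp_eq1[n En].
have := nzB (Log (cexp w)) w; rewrite En => h.
have hn : nz ('i%C * rc (pi *+ 2) * n%:~R) = rho *+ 2 * `|n%:~R|.
  rewrite -rc_int !nzM !nz_rc nz_i mul1r; congr (_ * _).
  by rewrite ger0_norm // mulrn_wge0 // pi_ge0.
have : n = 0.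
  apply/eqP; rewrite -(intr_eq0 R) -normr_eq0.
  apply/negPn/negP => n0.
  have : 1 <= `|n%:~R| :> R.
    rewrite -intr_norm ler1z.
    by move: n0; rewrite normr_eq0 intr_eq0; lia.
  move=> n1; have : rho *+ 2 * `|n%:~R| < rho *+ 2 by rewrite -hn mulr2n; lra.
  by rewrite mulr2n; nra.
by move=> n0; move/eqP: En; rewrite n0 mulr0 subr_eq0 => /eqP.
Qed.
End Exponential.

(** * Partial fractions *)

Section PartialFractions.
Variables (F : fieldType) (p n a1 : nat).
Implicit Types (z : 'I_p -> F) (c : 'I_p -> nat -> F) (s : seq 'I_p).

Definition pf_eval z c (y : F) : F :=
  \sum_j \sum_(k < n) c j k * (y - z j) ^- k.+1.

(** Coefficients after division by [y - z i]. Orders at [z i] go up by one, and the new simple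
    coefficient there is the value at [z i] of the terms at the other poles; at another pole each
    term is expanded by [pf_split]. *)
Definition pf_div z (i : 'I_p) c (j : 'I_p) (k : nat) : F :=
  if j == i then
    (if k is k'.+1 then c i k'
     else \sum_(j' | j' != i) \sum_(l < n) c j' l * (z i - z j') ^- l.+1)
  else - \sum_(l < n | (k <= l)%N) c j l * (z i - z j) ^- (l - k).+1.

(* Coefficients of y ^ minn a1 (size s).-1 / \prod_(i <- s) (y - z i): the a1
   numerators are absorbed first, as y / (y - z i) = 1 + z i / (y - z i). *)
Fixpoint pf_coef z s {struct s} : 'I_p -> nat -> F :=
  match s with
  | [::] => fun _ _ => 0
  | i :: s' =>
    if s' is [::] then fun j k => ((j == i) && (k == 0%N))%:R
    else let c := pf_coef z s' in
      fun j k => (if (size s' <= a1)%N then c j k + z i * pf_div z i c j k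
                  else pf_div z i c j k)
  end.

Lemma pf_coef_cons z i i' s j k :
  pf_coef z (i :: i' :: s) j k =
  if (size (i' :: s) <= a1)%N
  then pf_coef z (i' :: s) j k + z i * pf_div z i (pf_coef z (i' :: s)) j k
  else pf_div z i (pf_coef z (i' :: s)) j k.
Proof. by []. Qed.

(** Used with [u = y - z j] and [v = y - z i], so that [u - v] is the constant [z i - z j] and the
    right-hand side is a partial fraction decomposition in [y]. *)
Lemma pf_split (u v : F) l : u != 0 -> v != 0 -> u != v ->
  u ^- l.+1 * v^-1 =
  (u - v) ^- l.+1 * v^-1 - \sum_(k < l.+1) u ^- k.+1 * (u - v) ^- (l - k).+1.
Proof.
move=> u0 v0 uv; have uv0 : u - v != 0 by rewrite subr_eq0.
elim: l => [|l IH].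
  by rewrite big_ord_recl big_ord0 !expr1; field; rewrite u0 v0 uv0.
rewrite exprS invfM -mulrA IH mulrBr mulr_sumr [in RHS]big_ord_recl /= subn0.
under [X in _ - (_ + X)]eq_bigr => k _ do rewrite /bump /= add1n subSS exprS invfM -mulrA.
rewrite opprD addrA; congr (_ - _).
by rewrite !exprS; field; rewrite u0 v0 uv0 expf_neq0.
Qed.

(** The orders at [z i] go up by one, so the top coefficient must be free for the sum to stay within
    [n] terms. *)
Lemma pf_divE z i c y : injective z -> (forall j, y != z j) ->
  (forall j k, (n <= k.+1)%N -> c j k = 0) ->
  pf_eval z (pf_div z i c) y = pf_eval z c y / (y - z i).
Proof.
move=> zI yz cn; have yz0 j : y - z j != 0 by rewrite subr_eq0.
rewrite /pf_eval mulr_suml (bigD1 i) //= [in RHS](bigD1 i) //=.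
under eq_bigr => k _ do rewrite /pf_div eqxx.
under [X in _ + X]eq_bigr => j ji do
  under eq_bigr => k _ do rewrite /pf_div (negbTE ji).
have HR j : j != i -> (\sum_(k < n) c j k * (y - z j) ^- k.+1) / (y - z i) =
    (\sum_(l < n) c j l * (z i - z j) ^- l.+1) * (y - z i)^-1 +
    \sum_(k < n) (- \sum_(l < n | (k <= l)%N) c j l * (z i - z j) ^- (l - k).+1) *
       (y - z j) ^- k.+1.
  move=> ji; rewrite !mulr_suml.
  under [X in _ = _ + X]eq_bigr => k _ do rewrite mulNr mulr_suml big_mkcond /=.
  rewrite sumrN exchange_big /= -sumrB; apply: eq_bigr => l _.
  have E : y - z j - (y - z i) = z i - z j by ring.
  have dji : y - z j != y - z i.
    by rewrite (inj_eq (addrI y)) (inj_eq oppr_inj) (inj_eq zI).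
  rewrite -mulrA pf_split // E mulrBr mulrA; congr (_ - _).
  rewrite mulr_sumr (big_ord_widen n (fun k => c j l * ((y - z j) ^- k.+1 * (z i - z j) ^- (l - k).+1))) //.
  rewrite big_mkcond /=; apply: eq_bigr => k _; rewrite ltnS.
  by case: ifP => // _; rewrite mulrA mulrAC.
rewrite (eq_bigr _ HR) big_split /= addrA; congr (_ + _).
case: n cn => [|m] cn.
  by rewrite !big_ord0 mul0r big1 ?addr0 // => j _; rewrite big_ord0 mul0r.
rewrite big_ord_recl /= expr1 [LHS]addrC; congr (_ + _); last by rewrite mulr_suml.
rewrite [in RHS]big_ord_recr /= (cn i m) // mul0r addr0 mulr_suml.
apply: eq_bigr => k _; rewrite /bump /= add1n -mulrA; congr (_ * _).
by rewrite exprSr invfM.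
Qed.

(** Residue theorem for a fraction that vanishes at infinity and is divided by one more linear
    factor; here it is a cancellation built into [pf_div]. *)
Lemma pf_div_sum0 z i c : \sum_j pf_div z i c j 0 = 0.
Proof.
rewrite (bigD1 i) //= {1}/pf_div eqxx; apply/eqP; rewrite addr_eq0 -sumrN.
apply/eqP; apply: eq_bigr => j ji; rewrite /pf_div (negbTE ji) opprK.
by apply: eq_bigr => l _; rewrite subn0.
Qed.

Lemma pf_coef_mult z s j k : (count_mem j s <= k)%N -> (size s <= n)%N ->
  pf_coef z s j k = 0.
Proof.
move=> H Hs; elim: s j k H Hs => [//|i s IH] j k.
case: s IH => [|i' s] IH.
  by move=> /= + _; rewrite eq_sym; case: eqP => //= _; case: k.
rewrite pf_coef_cons [count_mem _ _]/= => H Hs.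
have Hs' : (size (i' :: s) <= n)%N by exact: leq_trans Hs.
have c0 : pf_coef z (i' :: s) j k = 0.
  by apply: IH => //; apply: leq_trans H; rewrite leq_addl.
suff d0 : pf_div z i (pf_coef z (i' :: s)) j k = 0.
  by rewrite c0 d0 mulr0 addr0 if_same.
rewrite /pf_div; case: eqP => [ji|ji].
  subst j; rewrite eqxx /= in H; case: k H {c0} => // k H.
  exact: IH.
rewrite big1 ?oppr0 // => l kl; rewrite IH ?mul0r //.
apply: leq_trans kl; apply: leq_trans H; exact: leq_addl.
Qed.

Lemma pf_coefE z s y : injective z -> (forall j, y != z j) ->
  s != [::] -> (size s <= n)%N ->
  pf_eval z (pf_coef z s) y =
  y ^+ minn a1 (size s).-1 / \prod_(i <- s) (y - z i).
Proof.
move=> zI yz; have yz0 j : y - z j != 0 by rewrite subr_eq0.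
elim: s => [//|i s IH] _ Hs; case: s IH Hs => [|i' s] IH Hs.
  rewrite /= minn0 expr0 big_seq1 /pf_eval (bigD1 i) //= eqxx /=.
  rewrite [X in _ + X]big1 ?addr0 => [|j /negbTE ->].
    case: n Hs => // m _; rewrite big_ord_recl /= expr1 big1 ?addr0 ?mul1r //.
    by move=> k _; rewrite mul0r.
  by rewrite big1 // => k _; rewrite mul0r.
have Hs' : (size (i' :: s) <= n)%N by exact: leq_trans Hs.
have {}IH := IH isT Hs'.
have cn j k : (n <= k.+1)%N -> pf_coef z (i' :: s) j k = 0.
  move=> nk; apply: pf_coef_mult => //; apply: leq_trans (count_size _ _) _.
  by rewrite -ltnS (leq_trans Hs).
have Hd := pf_divE i zI yz cn.
rewrite big_cons.
have -> : pf_eval z (pf_coef z [:: i, i' & s]) y =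
  if (size (i' :: s) <= a1)%N then pf_eval z (fun j k => pf_coef z (i' :: s) j k +
       z i * pf_div z i (pf_coef z (i' :: s)) j k) y
  else pf_eval z (pf_div z i (pf_coef z (i' :: s))) y.
  rewrite /pf_eval; case: ifP => Ha; apply: eq_bigr => j _; apply: eq_bigr => k _;
    by rewrite pf_coef_cons Ha.
case: ifP => Ha.
  have -> : pf_eval z (fun j k => pf_coef z (i' :: s) j k +
       z i * pf_div z i (pf_coef z (i' :: s)) j k) y =
     pf_eval z (pf_coef z (i' :: s)) y +
     z i * pf_eval z (pf_div z i (pf_coef z (i' :: s))) y.
    rewrite /pf_eval mulr_sumr -big_split; apply: eq_bigr => j _ /=.
    rewrite mulr_sumr -big_split; apply: eq_bigr => k _ /=; ring.
  have P0 : \prod_(i <- i' :: s) (y - z i) != 0.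
    by rewrite prodf_seq_neq0; apply/allP => j _; rewrite yz0.
  have -> : minn a1 (size [:: i, i' & s]).-1 = (size s).+1 by exact: (minn_idPr Ha).
  have E1 : minn a1 (size (i' :: s)).-1 = size s by exact: (minn_idPr (ltnW Ha)).
  rewrite Hd IH E1 exprS; move: P0; set P := bigop _ _ _ => P0.
  by field; rewrite P0 yz0.
rewrite Hd IH /= invfM mulrA [in RHS]mulrAC.
move/negbT: Ha; rewrite -ltnNge => Ha.
by rewrite (minn_idPl (ltnW Ha)) (minn_idPl _).
Qed.

(** The fraction is homogeneous in [y] and [z] jointly. The identity is carried along the recursion
    instead of comparing functions, so coinciding poles do no harm. *)
Lemma pf_coef_homog z s (m : F) j k : m != 0 -> (size s <= n)%N -> (0 < size s)%N ->
  pf_coef (fun j => m * z j) s j k * m ^+ size s =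
  m ^+ (k + minn a1 (size s).-1).+1 * pf_coef z s j k.
Proof.
move=> m0; elim: s j k => [//|i s IH] j k Hs _.
case: s IH Hs => [|i' s] IH Hs.
  rewrite /= minn0 addn0; case: eqVneq => [_|_] /=; last by rewrite mul0r mulr0.
  by case: k => [|k] /=; rewrite ?mul0r ?mulr0 // mulrC.
have Hs' : (size (i' :: s) <= n)%N by exact: leq_trans Hs.
have {}IH j' k' := IH j' k' Hs' isT.
rewrite !pf_coef_cons.
set c := pf_coef z _ in IH *; set c' := pf_coef _ (i' :: s) in IH *.
set S := size (i' :: s) in IH *; set M := minn a1 S.-1 in IH *.
have D : pf_div (fun j => m * z j) i c' j k * m ^+ S.+1 =
         m ^+ (k + M).+1 * pf_div z i c j k.
  have inner j' l r : c' j' l * (m * z i - m * z j') ^- r.+1 * m ^+ S.+1 * m ^+ r =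
           m ^+ (l + M).+1 * (c j' l * (z i - z j') ^- r.+1).
    rewrite -mulrBr exprMn invfM (exprS _ S).
    have -> : c' j' l * ((m ^+ r.+1)^-1 * (z i - z j') ^- r.+1) * (m * m ^+ S) * m ^+ r =
              (c' j' l * m ^+ S) * (z i - z j') ^- r.+1 * ((m ^+ r.+1)^-1 * (m * m ^+ r)) by ring.
    by rewrite IH -exprS mulVf ?expf_neq0 // mulr1 mulrA.
  rewrite /pf_div; case: eqP => [_|ji].
    case: k => [|k]; last by rewrite exprSr mulrA IH addSn [in RHS]exprS; ring.
    rewrite mulr_suml mulr_sumr; apply: eq_bigr => j' _.
    rewrite mulr_suml mulr_sumr; apply: eq_bigr => l _.
    apply: (mulIf (expf_neq0 l m0)); rewrite inner add0n [m ^+ (l + M).+1]exprS [m ^+ M.+1]exprS exprD; ring.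
  rewrite mulNr mulrN mulr_suml mulr_sumr; congr (- _); apply: eq_bigr => l kl.
  apply: (mulIf (expf_neq0 (l - k) m0)); rewrite inner.
  rewrite -{1}(subnK kl) -addnA -addnS exprD; ring.
have Ssz : size (i :: i' :: s) = S.+1 by []; rewrite Ssz /=.
case: ifP => Ha.
  have -> : minn a1 S = M.+1.
    by rewrite /M (minn_idPr Ha) (minn_idPr (leq_trans (leq_pred _) Ha)).
  have IH' : c' j k * m ^+ S.+1 = m * (m ^+ (k + M).+1 * c j k).
    by rewrite exprS mulrCA IH.
  rewrite mulrDl IH' -[m * z i * _ * _]mulrA D addnS [m ^+ (k + M).+2]exprS; ring.
rewrite D; congr (m ^+ (k + _).+1 * _); rewrite /M.
move/negbT: Ha; rewrite -ltnNge => Ha.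
by rewrite (minn_idPl (ltnW Ha)) (minn_idPl _).
Qed.

(** * Dependence of the coefficients on the poles *)

Section Dependence.
Variables (T : Type) (t0 : T) (Q : (T -> F) -> Prop).
Hypotheses (Qc : forall x, Q (fun=> x))
  (QD : forall f g, Q f -> Q g -> Q (fun t => f t + g t))
  (QM : forall f g, Q f -> Q g -> Q (fun t => f t * g t))
  (QV : forall f, Q f -> f t0 != 0 -> Q (fun t => (f t)^-1)).

Lemma param_sum (I : Type) (r : seq I) (P : pred I) (f : I -> T -> F) :
  (forall i, P i -> Q (f i)) -> Q (fun t => \sum_(i <- r | P i) f i t).
Proof.
move=> H; elim: r => [|i r IH].
  have -> : (fun t => \sum_(i <- [::] | P i) f i t) = fun=> 0.
    by apply: funext => t; rewrite big_nil.
  exact: Qc.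
have -> : (fun t => \sum_(i <- i :: r | P i) f i t) =
    fun t => (if P i then f i t else 0) + \sum_(i <- r | P i) f i t.
  by apply: funext => t; rewrite big_cons; case: ifP => // _; rewrite add0r.
by apply: QD => //; have := H i; case: (P i) => [h|_]; [exact: h|exact: Qc].
Qed.

Lemma param_exp f k : Q f -> Q (fun t => f t ^+ k).
Proof.
move=> Hf; elim: k => [|k IH]; first exact: Qc.
by under eq_fun do rewrite exprS; exact: QM.
Qed.

(** [Q] stands for any regularity at [t0] that field operations preserve; it is instantiated with
    differentiability at a point and with convergence of a sequence. *)
Lemma param_pf_coef (z : 'I_p -> T -> F) s j k :
  injective (fun j => z j t0) -> (forall j, Q (z j)) ->
  Q (fun t => pf_coef (fun j => z j t) s j k).
Proof.
move=> zI Hz; elim: s j k => [|i s IH] j k; first exact: Qc.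
case: s IH => [|i' s] IH; first exact: Qc.
under eq_fun do rewrite pf_coef_cons.
have HN f : Q f -> Q (fun t => - f t).
  by move=> Hf; under eq_fun do rewrite -mulN1r; apply: QM => //; exact: Qc.
have D r j' : j' != i -> Q (fun t => (z i t - z j' t) ^- r).
  move=> ji; apply: QV; last by rewrite expf_neq0 // subr_eq0 eq_sym (inj_eq zI).
  by apply: param_exp; apply: QD => //; exact: HN.
have E : Q (fun t => pf_div (fun j => z j t) i (pf_coef (fun j => z j t) (i' :: s)) j k).
  rewrite /pf_div; case: eqP => [_|/eqP ji].
    case: k => [|k]; last exact: IH.
    by do 2![apply: param_sum => ? ?]; apply: QM; [exact: IH|exact: D].
  by apply: HN; apply: param_sum => l _; apply: QM; [exact: IH|exact: D].
by case: (size (i' :: s) <= a1)%N => //; apply: QD; [exact: IH|exact: QM].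
Qed.
End Dependence.

End PartialFractions.

(** * Path integrals *)

Section PathIntegrals.
Variable R : realType.
Implicit Types (z w a b : Cx R) (f G : Cx R -> Cx R) (g : R -> Cx R).

Definition seg a b (u : R) : Cx R := a + rc u * (b - a).

Lemma seg0 a b : seg a b 0 = a. Proof. by rewrite /seg rc0 mul0r addr0. Qed.
Lemma seg1 a b : seg a b 1 = b. Proof. by rewrite /seg rc1 mul1r addrC subrK. Qed.
Lemma seg_sub a b (u s : R) : seg a b s - seg a b u = rc (s - u) * (b - a).
Proof. by rewrite /seg rcB; ring. Qed.
Lemma nz_seg a b (u s : R) : nz (seg a b s - seg a b u) = `|s - u| * nz (b - a).
Proof. by rewrite seg_sub nzM nz_rc. Qed.

Definition path_cont g := forall u : R, 0 <= u <= 1 -> forall e : R, 0 < e ->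
  exists2 r : R, 0 < r & forall s : R, 0 <= s <= 1 -> `|s - u| < r -> nz (g s - g u) < e.

Lemma lip_path_cont g (L : R) :
  (forall u s : R, 0 <= u <= 1 -> 0 <= s <= 1 -> nz (g s - g u) <= L * `|s - u|) ->
  path_cont g.
Proof.
move=> H u u01 e e0; have m0 : 0 < Num.max 1 L by rewrite lt_max ltr01.
exists (e / Num.max 1 L); first by rewrite divr_gt0.
move=> s s01; rewrite ltr_pdivlMr // => h; apply: le_lt_trans (H u s u01 s01) _.
by apply: le_lt_trans h; rewrite mulrC ler_wpM2l // le_max lexx orbT.
Qed.

Lemma seg_bound f (D : R -> Cx R) (M : R) a b :
  (forall u : R, 0 <= u <= 1 -> cderiv f (seg a b u) (D u)) ->
  (forall u : R, 0 <= u <= 1 -> nz (D u) <= M) ->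
  nz (f b - f a) <= M * nz (b - a).
Proof.
move=> Hf HD.
have -> : f b - f a = f (seg a b 1) - f (seg a b 0) by rewrite seg0 seg1.
apply: (@mvi _ (fun u => f (seg a b u))) => u u01 e e0.
have n0 := nz_ge0 (b - a).
have e1 : 0 < e / (1 + nz (b - a)) by rewrite divr_gt0 //; lra.
have /cderivP/(_ _ e1)[r r0 Hr] := Hf u u01.
exists (r / (1 + nz (b - a))); first by rewrite divr_gt0 //; lra.
move=> s s01 su; have := Hr (seg a b s); rewrite nz_seg => /(_ _) h.
have h1 : `|s - u| * nz (b - a) < r.
  move: su; rewrite ltr_pdivlMr; last by lra.
  by have := normr_ge0 (s - u); nra.
have := nzD (f (seg a b s) - f (seg a b u) - D u * (seg a b s - seg a b u))
            (D u * (seg a b s - seg a b u)).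
rewrite subrK nzM nz_seg => h2.
have h3 := h h1; have h4 := HD u u01.
apply: le_trans h2 _; rewrite mulrDl [leRHS]addrC; apply: lerD; last first.
  by rewrite mulrAC -mulrA ler_wpM2r // mulr_ge0.
apply: le_trans h3 _.
rewrite mulrA mulrAC ler_wpM2r // mulrAC ler_pdivrMr; last by lra.
by rewrite ler_wpM2l ?ltW //; lra.
Qed.

Lemma seg_ball z (r : R) a b (u : R) :
  nz (a - z) < r -> nz (b - z) < r -> 0 <= u <= 1 -> nz (seg a b u - z) < r.
Proof.
move=> ha hb /andP[u0 u1].
have -> : seg a b u - z = rc (1 - u) * (a - z) + rc u * (b - z).
  by rewrite /seg rcB rc1; ring.
apply: le_lt_trans (nzD _ _) _; rewrite !nzM !nz_rc !ger0_norm; try lra.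
pose m := Num.max (nz (a - z)) (nz (b - z)).
have mr : m < r by rewrite gt_max ha.
have h1 : 0 <= (1 - u) * (m - nz (a - z)) by rewrite mulr_ge0 ?subr_ge0 // le_max lexx.
have h2 : 0 <= u * (m - nz (b - z)) by rewrite mulr_ge0 ?subr_ge0 // le_max lexx orbT.
by lra.
Qed.

Lemma deriv0_const G z (r : R) :
  (forall y, nz (y - z) < r -> cderiv G y 0) ->
  forall y, nz (y - z) < r -> G y = G z.
Proof.
move=> H y yr; apply/eqP; rewrite -subr_eq0 -nz_eq0 eq_le nz_ge0 andbT.
have -> : 0 = 0 * nz (y - z) by rewrite mul0r.
have zr : nz (z - z) < r by rewrite subrr nz0; exact: le_lt_trans (nz_ge0 _) yr.
apply: (@seg_bound _ (fun=> 0)) => u u01; last by rewrite nz0.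
by apply: H; exact: seg_ball.
Qed.

Lemma near_comp f z (P : Cx R -> Prop) : {for z, continuous f} ->
  (\forall y \near f z, P y) -> \forall y \near z, P (f y).
Proof. by move=> C N; exact: (C _ N). Qed.

Lemma cont_near_eq (f g : Cx R -> Cx R) (w : Cx R) :
  {for w, continuous f} -> {for w, continuous g} ->
  (exists2 r : R, 0 < r & forall s, s != w -> nz (s - w) < r -> f s = g s) -> f w = g w.
Proof.
move=> /contC Cf /contC Cg [r r0 E]; apply/eqP; rewrite -subr_eq0 -nz_eq0 eq_le nz_ge0 andbT.
apply/ler_addgt0Pr => e e0; rewrite add0r.
have [r1 r10 H1] := Cf (e / 2) ltac:(lra); have [r2 r20 H2] := Cg (e / 2) ltac:(lra).
pose t := Num.min r (Num.min r1 r2) / 2.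
have t0 : 0 < t by rewrite divr_gt0 // !lt_min r0 r10.
have [tr tr1 tr2] : [/\ t < r, t < r1 & t < r2].
  have h : t < Num.min r (Num.min r1 r2) by rewrite /t in t0 *; lra.
  by move: h; rewrite !lt_min => /and3P[].
have E1 : w + rc t - w = rc t by ring.
have := H1 (w + rc t); have := H2 (w + rc t); have := E (w + rc t).
rewrite E1 nz_rc gtr0_norm // -subr_eq0 E1 rc_eq0 gt_eqF // => /(_ isT tr) -> /(_ tr2) h2 /(_ tr1) h1.
have := nzD (f w - g (w + rc t)) (g (w + rc t) - g w).
by rewrite addrA subrK; rewrite nzC in h1; lra.
Qed.

Lemma same_deriv_const f G1 G2 z :
  (\forall y \near z, cderiv G1 y (f y)) -> (\forall y \near z, cderiv G2 y (f y)) ->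
  \forall y \near z, G1 y - G2 y = G1 z - G2 z.
Proof.
move=> /nearC[r1 r10 H1] /nearC[r2 r20 H2]; apply/nearC.
exists (Num.min r1 r2); first by rewrite lt_min r10.
apply: (@deriv0_const (fun y => G1 y - G2 y)) => y; rewrite lt_min => /andP[y1 y2].
by rewrite -(subrr (f y)); apply: cderivB; [exact: H1|exact: H2].
Qed.

Lemma mem01 (u : R) : `[0, 1]%classic u = (0 <= u <= 1) :> Prop.
Proof. by rewrite /= in_itv. Qed.

(** The difference of two primitives along [g] is locally constant, so the mean value inequality
    applies with bound 0. *)
Lemma path_integral_unique f g v v' :
  path_cont g -> path_integral f g v -> path_integral f g v' -> v = v'.
Proof.
move=> Hg [F [-> HF]] [F' [-> HF']].
suff : nz ((F 1 - F' 1) - (F 0 - F' 0)) <= 0.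
  rewrite le_eqVlt ltNge nz_ge0 orbF nz_eq0 subr_eq0 => /eqP h.
  have -> : F 1 = F' 1 + (F 0 - F' 0) by rewrite -h; ring.
  by ring.
apply: (@mvi _ (fun u => F u - F' u)) => u u01 e e0.
have u01' : `[0, 1]%classic u by rewrite mem01.
have [G [HG /nearR[r1 r10 E1]]] := HF u u01'.
have [G' [HG' /nearR[r2 r20 E2]]] := HF' u u01'.
have /nearC[r3 r30 E3] := same_deriv_const HG HG'.
have [r4 r40 E4] := Hg u u01 r3 r30.
exists (Num.min r1 (Num.min r2 r4)); first by rewrite !lt_min r10 r20.
move=> s s01; rewrite !lt_min => /and3P[s1 s2 s4].
have s01' : `[0, 1]%classic s by rewrite mem01.
have zu (r : R) : 0 < r -> `|u - u| < r by rewrite subrr normr0.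
rewrite E1 // E2 // (E1 u) ?zu // (E2 u) ?zu // E3; last exact: E4.
by rewrite subrr nz0 mulr_ge0 //; lra.
Qed.

Lemma path_integral_prim f g G :
  (forall u : R, 0 <= u <= 1 -> \forall y \near g u, cderiv G y (f y)) ->
  path_integral f g (G (g 1) - G (g 0)).
Proof.
move=> H; exists (fun u => G (g u)); split=> // u; rewrite mem01 => u01.
by exists G; split; [exact: H|near=> s].
Unshelve. all: by end_near. Qed.

Lemma path_integralD f1 f2 g v1 v2 :
  path_integral f1 g v1 -> path_integral f2 g v2 ->
  path_integral (fun y => f1 y + f2 y) g (v1 + v2).
Proof.
move=> [F1 [-> H1]] [F2 [-> H2]]; exists (fun u => F1 u + F2 u); split; first by ring.
move=> u u01; have [G1 [D1 E1]] := H1 u u01; have [G2 [D2 E2]] := H2 u u01.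
exists (fun y => G1 y + G2 y); split.
  by apply: filterS2 D1 D2 => y; exact: cderivD.
by apply: filterS2 E1 E2 => s h1 h2 s01; rewrite h1 ?h2.
Qed.

Lemma path_integralZ c f g v :
  path_integral f g v -> path_integral (fun y => c * f y) g (c * v).
Proof.
move=> [F [-> H]]; exists (fun u => c * F u); split; first by rewrite mulrBr.
move=> u u01; have [G [D E]] := H u u01; exists (fun y => c * G y); split.
  by apply: filterS D => y; exact: cderivZ.
by apply: filterS E => s h s01; rewrite h.
Qed.

Lemma path_integral_sum (I : Type) (s : seq I) (f : I -> Cx R -> Cx R) g v :
  (forall i, path_integral (f i) g (v i)) ->
  path_integral (fun y => \sum_(i <- s) f i y) g (\sum_(i <- s) v i).
Proof.
move=> H; elim: s => [|i s IH].
  have -> : (fun y => \sum_(i <- [::]) f i y) = fun=> 0.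
    by apply/funext => y; rewrite big_nil.
  rewrite big_nil; have := @path_integral_prim (fun=> 0) g (fun=> 0); rewrite subrr.
  by apply=> u _; near=> y; exact: cderiv_cst.
have -> : (fun y => \sum_(j <- i :: s) f j y) = fun y => f i y + \sum_(j <- s) f j y.
  by apply/funext => y; rewrite big_cons.
by rewrite big_cons; exact: path_integralD.
Unshelve. all: by end_near. Qed.

Lemma path_integral_ext f1 f2 g v :
  (forall u : R, 0 <= u <= 1 -> \forall y \near g u, f1 y = f2 y) ->
  path_integral f1 g v -> path_integral f2 g v.
Proof.
move=> H [F [-> HF]]; exists F; split=> // u u01; have [G [D E]] := HF u u01.
exists G; split=> //; have := H u; rewrite -mem01 => /(_ u01) h.
by apply: filterS2 D h => y + <-.
Qed.

Lemma path_integral_bound f g v (L M : R) :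
  (forall u s : R, 0 <= u <= 1 -> 0 <= s <= 1 -> nz (g s - g u) <= L * `|s - u|) ->
  (forall u : R, 0 <= u <= 1 -> nz (f (g u)) <= M) ->
  path_integral f g v -> nz v <= L * M.
Proof.
move=> HL HM [F [-> HF]].
have L0 : 0 <= L.
  have := HL 0 1; rewrite !lexx !ler01 subr0 normr1 mulr1 => /(_ isT isT).
  exact: le_trans (nz_ge0 _).
apply: mvi => u u01 e e0.
have u01' : `[0, 1]%classic u by rewrite mem01.
have [G [/nearC[r1 r10 D] /nearR[r2 r20 E]]] := HF u u01'.
have e1 : 0 < e / (1 + L) by rewrite divr_gt0 //; lra.
have := D (g u); rewrite subrr nz0 => /(_ r10)/cderivP/(_ _ e1)[r3 r30 H3].
have [r4 r40 H4] := lip_path_cont HL u01 r30.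
exists (Num.min r2 r4); first by rewrite lt_min r20.
move=> s s01; rewrite lt_min => /andP[s2 s4].
have s01' : `[0, 1]%classic s by rewrite mem01.
rewrite E // (E u) ?subrr ?normr0 //.
have h := H3 _ (H4 s s01 s4); have hl := HL u s u01 s01; have hm := HM u u01.
have := nzD (G (g s) - G (g u) - f (g u) * (g s - g u)) (f (g u) * (g s - g u)).
rewrite subrK nzM => h2; apply: le_trans h2 _.
have A0 := nz_ge0 (g s - g u); have N0 := normr_ge0 (s - u).
have M0 : 0 <= M by exact: le_trans (nz_ge0 _) hm.
have k1 : nz (f (g u)) * nz (g s - g u) <= M * (L * `|s - u|).
  by apply: ler_pM => //; exact: nz_ge0.
have k2 : e / (1 + L) * nz (g s - g u) <= e * `|s - u|.
  apply: (@le_trans _ _ (e / (1 + L) * (L * `|s - u|))); first by rewrite ler_wpM2l // ltW.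
  rewrite mulrA ler_wpM2r // mulrAC ler_pdivrMr; last by lra.
  by rewrite ler_wpM2l ?ltW //; lra.
by rewrite mulrDl; lra.
Qed.

Lemma cderiv_logslit (c q : Cx R) y : slit ((y - q) / c) -> c != 0 ->
  cderiv (fun y => Log ((y - q) / c)) y (y - q)^-1.
Proof.
move=> S c0; have := slit_neq0 S; rewrite mulf_eq0 negb_or => /andP[yq _].
have -> : (y - q)^-1 = ((y - q) / c)^-1 * ((1 - 0) * c^-1 + (y - q) * 0).
  by field; rewrite c0 yq.
apply: (@cderiv_comp _ (@Log R) (fun y => (y - q) / c)); first exact: cderiv_Log.
apply: cderivM; last exact: cderiv_cst.
by apply: cderivB; [exact: cderiv_id|exact: cderiv_cst].
Qed.

Lemma near_slit (c q : Cx R) y : slit ((y - q) / c) -> c != 0 ->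
  \forall s \near y, slit ((s - q) / c).
Proof.
move=> S c0.
have C : {for y, continuous (fun s : Cx R => (s - q) / c)}.
  apply: cderiv_cont; apply: cderivM; last exact: cderiv_cst.
  by apply: cderivB; [exact: cderiv_id|exact: cderiv_cst].
exact: (C _ (slit_open S)).
Qed.

Lemma circleE (q : Cx R) (r u : R) :
  circle q r u = q + rc r * cexp ('i%C * rc (2 * pi * u)).
Proof.
congr (_ + _); have -> : 'i%C * rc (2 * pi * u) = (0 +i* (2 * pi * u))%C.
  by apply/eqP; rewrite eq_complex /=; apply/andP; split; apply/eqP; ring.
by rewrite /cexp /= expR0; apply/eqP; rewrite eq_complex /=; apply/andP; split; apply/eqP; ring.
Qed.

Lemma nz_cexp_i (t : R) : nz (cexp ('i%C * rc t)) = 1.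
Proof. by rewrite nz_cexp (_ : complex.Re _ = 0) ?expR0 //=; ring. Qed.

Lemma nz_circle (q : Cx R) (r u : R) : 0 <= r -> nz (circle q r u - q) = r.
Proof. by move=> r0; rewrite circleE addrAC subrr add0r nzM nz_cexp_i mulr1 nz_rc ger0_norm. Qed.

Lemma circle01 (q : Cx R) (r : R) : circle q r 1 = circle q r 0.
Proof. by rewrite /circle mulr1 mulr0 mulr_natl cos2pi sin2pi cos0 sin0. Qed.

Lemma lip_circle (q : Cx R) (r u s : R) : 0 <= r ->
  nz (circle q r s - circle q r u) <= (r * (2 * pi)) * `|s - u|.
Proof.
move=> r0; rewrite !circleE.
have -> : q + rc r * cexp ('i%C * rc (2 * pi * s)) - (q + rc r * cexp ('i%C * rc (2 * pi * u))) =
  rc r * (cexp ('i%C * rc (2 * pi * s)) - cexp ('i%C * rc (2 * pi * u))) by ring.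
rewrite nzM nz_rc ger0_norm // -[X in _ <= X]mulrA ler_wpM2l //.
have := @seg_bound (@cexp R) (fun t => cexp (seg ('i%C * rc (2 * pi * u)) ('i%C * rc (2 * pi * s)) t)) 1
  ('i%C * rc (2 * pi * u)) ('i%C * rc (2 * pi * s)).
have -> : nz ('i%C * rc (2 * pi * s) - 'i%C * rc (2 * pi * u)) = 2 * pi * `|s - u|.
  rewrite -mulrBr -rcB -mulrBr nzM nz_i mul1r nz_rc normrM ger0_norm //.
  by rewrite mulr_ge0 // pi_ge0.
rewrite mul1r; apply=> t _; first exact: cderiv_cexp.
have -> : seg ('i%C * rc (2 * pi * u)) ('i%C * rc (2 * pi * s)) t =
   'i%C * rc (2 * pi * u + t * (2 * pi * s - 2 * pi * u)).
  by rewrite /seg !rcD !rcM !rcB; rewrite !rcM; ring.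
by rewrite nz_cexp_i.
Qed.

Lemma circle_path_cont (q : Cx R) (r : R) : 0 <= r -> path_cont (circle q r).
Proof. by move=> r0; apply: lip_path_cont => u s _ _; exact: lip_circle. Qed.

(** Divided by the direction [m - q], the path seen from [q] stays in the cut plane, so one branch
    of the logarithm is a primitive all along. *)
Lemma path_integral_log g (m q : Cx R) :
  m != q -> (forall u : R, 0 <= u <= 1 -> slit ((g u - q) / (m - q))) ->
  path_integral (fun y => (y - q)^-1) g
    (Log ((g 1 - q) / (m - q)) - Log ((g 0 - q) / (m - q))).
Proof.
move=> mq H; have mq0 : m - q != 0 by rewrite subr_eq0.
apply: (@path_integral_prim _ g (fun y => Log ((y - q) / (m - q)))) => u /H S.
by apply: filterS (near_slit S mq0) => y Sy; exact: cderiv_logslit.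
Qed.

Lemma path_integral_circle_out (q z : Cx R) (r : R) : 0 < r -> r < nz (z - q) ->
  path_integral (fun y => (y - z)^-1) (circle q r) 0.
Proof.
move=> r0 rz; have qz : q != z by apply: contraTneq rz => ->; rewrite subrr nz0 -leNgt ltW.
have := @path_integral_log (circle q r) q z qz; rewrite circle01 subrr; apply=> u _.
have qz0 : q - z != 0 by rewrite subr_eq0.
apply: slit_Re; have -> : (circle q r u - z) / (q - z) = 1 + (circle q r u - q) / (q - z).
  by field.
have : nz ((circle q r u - q) / (q - z)) < 1.
  by rewrite nzM nz_circle ?(ltW r0) // nzV ltr_pdivrMr ?nz_gt0 // mul1r nzC.
have := nzRe ((circle q r u - q) / (q - z)); case: (_ / _) => x y /=.
by rewrite ler_norml => /andP[h1 _] h2; lra.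
Qed.

Lemma path_integral_circle_in (q z : Cx R) (r : R) : nz (z - q) < r ->
  path_integral (fun y => (y - z)^-1) (circle q r) (two_pi_i R).
Proof.
move=> zr; have r0 : 0 < r by exact: le_lt_trans (nz_ge0 _) zr.
have rr0 : rc r != 0 by rewrite rc_eq0 gt_eqF.
have cq u : circle q r u - q = rc r * cexp ('i%C * rc (2 * pi * u)).
  by rewrite circleE addrAC subrr add0r.
have cq0 u : circle q r u - q != 0 by rewrite cq mulf_neq0 // cexp_neq0.
(* [(y - z)^-1] and [(y - q)^-1] differ by the derivative of [H], which is single-valued on the
   circle because [z] is closer to [q] than the circle is. *)
pose H y := Log (1 - (z - q) / (y - q)).
have Hs y : nz (z - q) < nz (y - q) -> slit (1 - (z - q) / (y - q)).
  move=> h; apply: slit_Re.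
  have y0 : 0 < nz (y - q) by exact: le_lt_trans (nz_ge0 _) h.
  have : nz ((z - q) / (y - q)) < 1 by rewrite nzM nzV ltr_pdivrMr // mul1r.
  have := nzRe ((z - q) / (y - q)); case: (_ / _) => a b /=.
  by rewrite ler_norml => /andP[_ h1] h2; lra.
(* The logarithm of [y - q] continued along the circle is linear in the parameter; locally it is
   matched with a principal branch recentred at the current point. *)
exists (fun u => two_pi_i R * rc u + H (circle q r u)); split.
  by rewrite circle01 rc1 rc0; ring.
move=> u; rewrite mem01 => u01.
have /nearC[r1 r10 S1] : \forall y \near circle q r u, slit ((y - q) / (circle q r u - q)).
  by apply: near_slit => //; rewrite divff //; apply: slit_Re; rewrite /= ltr01.
exists (fun y => two_pi_i R * rc u + Log ((y - q) / (circle q r u - q)) + H y); split.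
  have r2 : 0 < r - nz (z - q) by rewrite subr_gt0.
  apply/nearC; exists (Num.min r1 (r - nz (z - q))); first by rewrite lt_min r10.
  move=> y; rewrite lt_min => /andP[y1 y2].
  have yz : nz (z - q) < nz (y - q).
    have := nz_circle q u (ltW r0); have := nzB (y - q) (y - circle q r u).
    have -> : y - q - (y - circle q r u) = circle q r u - q by ring.
    by lra.
  have yq0 : y - q != 0 by rewrite -nz_gt0; exact: le_lt_trans (nz_ge0 _) yz.
  have yz0 : y - z != 0.
    apply: contraTneq yz => /eqP; rewrite subr_eq0 => /eqP ->; by rewrite ltxx.
  have -> : (y - z)^-1 = 0 + (y - q)^-1 +
      (1 - (z - q) / (y - q))^-1 * (0 - (0 * (y - q)^-1 + (z - q) * (- (1 - 0) / (y - q) ^+ 2))).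
    have h : 1 - (z - q) / (y - q) = (y - z) / (y - q) by field.
    by rewrite h; field; rewrite yz0 yq0.
  apply: cderivD; first (apply: cderivD; first exact: cderiv_cst).
    by apply: cderiv_logslit => //; exact: S1.
  apply: (@cderiv_comp _ (@Log R) (fun y => 1 - (z - q) / (y - q))).
    by apply: cderiv_Log; exact: Hs.
  apply: cderivB; first exact: cderiv_cst.
  apply: cderivM; first exact: cderiv_cst.
  by apply: cderivV => //; apply: cderivB; [exact: cderiv_id|exact: cderiv_cst].
have [r3 r30 L3] := Log_cexp_small R.
have pp := @pi_gt0 R.
apply/nearR; exists (r3 / (2 * pi)); first by rewrite divr_gt0 // mulr_gt0.
move=> s su _; congr (_ + _); rewrite !cq.
have -> : rc r * cexp ('i%C * rc (2 * pi * s)) / (rc r * cexp ('i%C * rc (2 * pi * u))) =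
          cexp (two_pi_i R * rc (s - u)).
  rewrite -mulf_div divff // mul1r -cexpB; congr cexp.
  by rewrite /two_pi_i -mulr_natl rcB !rcM; ring.
rewrite L3; last first.
  rewrite /two_pi_i !nzM nz_i mul1r !nz_rc.
  have -> : `|pi *+ 2| = pi *+ 2 :> R by rewrite ger0_norm // mulrn_wge0 // ltW.
  rewrite mulrC.
  by move: su; rewrite ltr_pdivlMr ?mulr_gt0 // mulr_natl.
by rewrite rcB; ring.
Qed.

End PathIntegrals.

(** * Normal forms of differentials *)

Section NormalForm.
Variables (R : realType) (p : nat) (a : 'I_2 -> nat) (b : 'I_p -> nat).
Implicit Types (z : 'I_p -> Cx R) (x y : Cx R).

Local Notation a1 := (a ord0).
Local Notation a2 := (a ord_max).

Definition pole_list : seq 'I_p := flatten [seq nseq (b j) j | j <- enum 'I_p].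
Definition deg := (a1 + a2).+2.

Hypothesis hab : (\sum_(i < 2) a i + 2 = \sum_(j < p) b j)%N.

Lemma degE : deg = (\sum_(j < p) b j)%N.
Proof.
rewrite -hab big_ord_recl big_ord1 addn2 /deg; congr (_ + a _).+2.
by apply: val_inj.
Qed.

Lemma size_pole_list : size pole_list = deg.
Proof.
rewrite size_flatten /shape -map_comp sumnE big_map big_enum /= degE.
by apply: eq_bigr => j _; rewrite size_nseq.
Qed.

Lemma prod_pole_list (F : 'I_p -> Cx R) :
  \prod_(i <- pole_list) F i = \prod_j F j ^+ b j.
Proof.
rewrite big_flatten /= big_map big_enum /=; apply: eq_bigr => j _.
by rewrite big_nseq -Monoid.iteropE /= Monoid.iteropE; elim: (b j) => [//|n IH]; rewrite iterS exprS IH.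
Qed.

Lemma count_pole_list j : count_mem j pole_list = b j.
Proof.
rewrite count_flatten -map_comp sumnE big_map big_enum /= (bigD1 j) //=.
rewrite count_nseq /= eqxx mul1n big1 ?addn0 // => i ij.
by rewrite count_nseq /= (negbTE ij) mul0n.
Qed.

(* The coefficient of (Y - z j) ^- k.+1 in Y ^+ a1 / \prod_j (Y - z j) ^+ b j. *)
Definition cf z (j : 'I_p) (k : nat) : Cx R := pf_coef deg a1 z pole_list j k.

Lemma cf_eval z y : injective z -> (forall j, y != z j) ->
  \sum_j \sum_(k < deg) cf z j k * (y - z j) ^- k.+1 =
  y ^+ a1 / \prod_j (y - z j) ^+ b j.
Proof.
move=> zI yz; rewrite -[LHS]/(pf_eval deg z (cf z) y) pf_coefE //.
- rewrite size_pole_list prod_pole_list (minn_idPl _) // /deg /=.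
  by rewrite -addnS leq_addr.
- by rewrite -size_eq0 size_pole_list.
- by rewrite size_pole_list.
Qed.

Lemma cf_mult z j k : (b j <= k)%N -> cf z j k = 0.
Proof.
by move=> H; apply: pf_coef_mult; rewrite ?count_pole_list ?size_pole_list.
Qed.

(** The fraction has order [a2 + 2] at infinity, so it has no residue there. In the recursion, the
    [a1] numerators are used up before the last division. *)
Lemma cf_sum0 z : \sum_j cf z j 0 = 0.
Proof.
rewrite /cf; have := size_pole_list; case: pole_list => [//|i [//|i' s]] Hs.
have Hs' : size (i' :: s) = deg.-1 by rewrite -Hs.
have F : (size (i' :: s) <= a1)%N = false.
  by apply/negbTE; rewrite -ltnNge Hs' /deg /= ltnS leq_addr.
by under eq_bigr => j _ do rewrite pf_coef_cons F; exact: pf_div_sum0.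
Qed.

(** Rescaling the poles by [m] divides the residues by [m ^+ a2.+1]; rotations by roots of unity of
    order [a2.+1] preserve them. *)
Lemma cf_homog z (m : Cx R) j k : m != 0 ->
  cf (fun j => m * z j) j k * m ^+ a2.+1 = m ^+ k * cf z j k.
Proof.
move=> m0; have Hs : (size pole_list <= deg)%N by rewrite size_pole_list.
have Hs0 : (0 < size pole_list)%N by rewrite size_pole_list.
have := pf_coef_homog a1 z j k m0 Hs Hs0; rewrite size_pole_list.
rewrite (minn_idPl _); last by rewrite /deg /= -addnS leq_addr.
have -> : m ^+ deg = m ^+ a2.+1 * m ^+ a1.+1.
  by rewrite -exprD /deg addSn addnS addnC.
have -> : m ^+ (k + a1).+1 = m ^+ k * m ^+ a1.+1 by rewrite -exprD addnS.
rewrite /cf; move: (pf_coef _ _ _ _ _ _) (pf_coef _ _ _ _ _ _) => X Y H.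
by apply: (mulIf (expf_neq0 a1.+1 m0)); rewrite -mulrA H mulrAC.
Qed.

(* The integral of the differential from z_1 to z_2 once logarithms L j of the
   z j are chosen, in the coordinate where z_1 = 0 and z_2 is infinite. *)
Definition tau z (L : 'I_p -> Cx R) : Cx R :=
  \sum_j \sum_(k < deg.-1) cf z j k.+1 / k.+1%:R * (- z j) ^- k.+1
  - \sum_j cf z j 0 * L j.

Section MobiusCoordinate.
(* Y = (al x + be) / (ga x + de) *)
Variables (z : 'I_p -> Cx R) (al be ga de : Cx R).
Hypothesis zI : injective z.

Definition mnum x := al * x + be.
Definition mden x := ga * x + de.
Definition mN j x := mnum x - z j * mden x.
Definition mdet := al * de - be * ga.
(** Pullback of the normal form with denominators cleared, so that it makes sense where [Y] is
    infinite; the exponent of [mden] is [deg - a1 - 2 = a2]. *)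
Definition mform x := mdet * mnum x ^+ a1 * mden x ^+ a2 / \prod_j mN j x ^+ b j.
(** Primitive of the terms of order at least 2, normalised to vanish where [Y] is infinite. *)
Definition mprim x := - \sum_j \sum_(k < deg.-1) cf z j k.+1 / k.+1%:R * (mden x / mN j x) ^+ k.+1.
Definition mdprim x := \sum_j \sum_(k < deg.-1) cf z j k.+1 * (mden x / mN j x) ^+ k * (mdet / mN j x ^+ 2).

Lemma cderiv_mnum x : cderiv mnum x al.
Proof.
by have := cderivD (cderivZ al (cderiv_id x)) (cderiv_cst be x); rewrite mulr1 addr0.
Qed.

Lemma cderiv_mden x : cderiv mden x ga.
Proof.
by have := cderivD (cderivZ ga (cderiv_id x)) (cderiv_cst de x); rewrite mulr1 addr0.
Qed.

Lemma cderiv_mN j x : cderiv (mN j) x (al - z j * ga).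
Proof. exact: cderivB (cderiv_mnum x) (cderivZ (z j) (cderiv_mden x)). Qed.

Lemma cderiv_mprim x : (forall j, mN j x != 0) -> cderiv mprim x (mdprim x).
Proof.
move=> N0; rewrite -[mdprim x]opprK; apply: cderivN.
rewrite /mdprim -sumrN; apply: (@cderiv_sum _ _ _ _ (fun j x => _)) => j _.
rewrite -sumrN; apply: (@cderiv_sum _ _ _ _ (fun (k : 'I_deg.-1) x => cf z j k.+1 / k.+1%:R * (mden x / mN j x) ^+ k.+1)) => k _.
have D := @cderivX _ (fun x => mden x / mN j x) k.+1 _ _
  (cderiv_div (N0 j) (cderiv_mden x) (cderiv_mN j x)).
have := cderivZ (cf z j k.+1 / k.+1%:R) D.
have k0 : k.+1%:R != 0 :> Cx R by rewrite -rc_nat rc_eq0 pnatr_eq0.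
have -> : ga * mN j x - mden x * (al - z j * ga) = - mdet.
  by rewrite /mN /mnum /mden /mdet; ring.
rewrite /= (_ : cf z j k.+1 / k.+1%:R * _ =
   - (cf z j k.+1 * (mden x / mN j x) ^+ k * (mdet / mN j x ^+ 2))) //.
rewrite /=; move: (_ ^+ k) k0 (N0 j); move: (k.+1%:R : Cx R) (mN j x) => K N A K0 N0'.
by field; rewrite K0 N0'.
Qed.

Lemma mform_pf0 x : (forall j, mN j x != 0) -> mden x != 0 ->
  mform x = mdprim x + \sum_j cf z j 0 * ((al - z j * ga) / mN j x).
Proof.
move=> N0 M0; pose y := mnum x / mden x.
have Ny j : mN j x = mden x * (y - z j) by rewrite /mN /y; field.
have yz j : y != z j.
  by have := N0 j; rewrite Ny mulf_eq0 negb_or subr_eq0 => /andP[].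
have yz0 j : y - z j != 0 by rewrite subr_eq0.
have -> : mform x = y ^+ a1 / \prod_j (y - z j) ^+ b j * (mdet / mden x ^+ 2).
  rewrite /mform; under eq_bigr => j _ do rewrite Ny exprMn.
  rewrite big_split /= prodrXr -degE /y expr_div_n.
  have P0 : \prod_j (y - z j) ^+ b j != 0.
    by apply/prodf_neq0 => j _; rewrite expf_neq0.
  have -> : mden x ^+ deg = mden x ^+ a1 * mden x ^+ a2 * mden x ^+ 2.
    by rewrite -!exprD /deg addn2.
  move: P0; rewrite /y; set P := bigop _ _ _ => P0.
  by field; rewrite P0 !expf_neq0 // M0.
rewrite -cf_eval // /deg mulr_suml /mdprim /= -big_split.
(* Each simple term is the logarithmic derivative of [mN j / mden]; since the residues sum to 0, the
   contribution of [mden] drops out. *)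
have S0 : \sum_j cf z j 0 * (ga / mden x) = 0 by rewrite -mulr_suml cf_sum0 mul0r.
rewrite -[RHS]subr0 -[X in _ = _ - X]S0 -sumrB; apply: eq_bigr => j _ /=.
rewrite big_ord_recl mulrDl mulr_suml [LHS]addrC -[RHS]addrA; congr (_ + _).
  apply: eq_bigr => k _; rewrite lift0 Ny.
  have -> : mden x / (mden x * (y - z j)) = (y - z j)^-1 by field; rewrite M0 yz0.
  rewrite exprVn !exprS; set A := (y - z j) ^+ k.
  have A0 : A != 0 by rewrite expf_neq0.
  by field; rewrite A0 M0 yz0.
rewrite /= expr1 Ny -mulrA -mulrBr; congr (_ * _).
have -> : mdet = (al - z j * ga) * mden x - ga * (mden x * (y - z j)).
  by rewrite -Ny /mN /mnum /mden /mdet; ring.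
by field; rewrite M0 yz0.
Qed.

Lemma near_mN x : (forall j, mN j x != 0) -> \forall y \near x, forall j, mN j y != 0.
Proof.
move=> N0; apply: (@filter_forall _ _ (fun j y => mN j y != 0) (nbhs x) _) => j.
have /contC/(_ (nz (mN j x)))[|r r0 H] := cderiv_cont (cderiv_mN j x).
  by rewrite nz_gt0.
apply/nearC; exists r => // y /H h; apply: contraTneq h => ->.
by rewrite sub0r nzN ltxx.
Qed.

(** Continuity of both sides covers the point where [Y] is infinite; paths ending at [z_2] need
    it. *)
Lemma mform_pf x : mdet != 0 -> (forall j, mN j x != 0) ->
  mform x = mdprim x + \sum_j cf z j 0 * ((al - z j * ga) / mN j x).
Proof.
move=> D0 N0; have [M0|M0] := eqVneq (mden x) 0; last exact: mform_pf0.
have cN j : cderiv (mN j) x (al - z j * ga) by exact: cderiv_mN.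
have P0 : \prod_j mN j x ^+ b j != 0 by apply/prodf_neq0 => j _; rewrite expf_neq0.
have cprod (r : seq 'I_p) : exists d, cderiv (fun x => \prod_(j <- r) mN j x ^+ b j) x d.
  elim: r => [|j r [d Hd]].
    by exists 0; apply: cderiv_ext (cderiv_cst 1 x); near=> s; rewrite big_nil.
  eexists; apply: cderiv_ext (cderivM (cderivX (b j) (cN j)) Hd).
  by near=> s; rewrite big_cons.
have [dP HP] := cprod (index_enum 'I_p).
apply: (@cont_near_eq _ mform (fun x => mdprim x + \sum_j cf z j 0 * ((al - z j * ga) / mN j x)) x).
- have := cderivM (cderivM (cderivM (cderiv_cst mdet x) (cderivX a1 (cderiv_mnum x)))
    (cderivX a2 (cderiv_mden x))) (cderivV P0 HP).
  exact: cderiv_cont.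
- have Dq j k : exists d, cderiv (fun x => cf z j k.+1 * (mden x / mN j x) ^+ k * (mdet / mN j x ^+ 2)) x d.
    eexists; apply: cderivM.
      apply: cderivZ; apply: (@cderivX _ (fun x => mden x / mN j x)).
      exact: cderiv_div (N0 j) (cderiv_mden x) (cN j).
    apply: cderivZ; apply: (@cderivV _ (fun x => mN j x ^+ 2)); last exact: cderivX.
    by rewrite expf_neq0.
  have {Dq} /choice[D HD] : forall jk : 'I_p * nat, exists d,
     cderiv (fun x => cf z jk.1 jk.2.+1 * (mden x / mN jk.1 x) ^+ jk.2 * (mdet / mN jk.1 x ^+ 2)) x d.
    by move=> [j k]; exact: Dq.
  apply: (@cderiv_cont _ _ _ (\sum_j \sum_(k < deg.-1) D (j, val k) +
     \sum_j cf z j 0 * (0 / mN j x + (al - z j * ga) * (- (al - z j * ga) / mN j x ^+ 2)))).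
  apply: cderivD.
    apply: (@cderiv_sum _ _ _ _ (fun j x => _)) => j _.
    by apply: (@cderiv_sum _ _ _ _ (fun (k : 'I_deg.-1) x => _)) => k _; exact: (HD (j, val k)).
  apply: (@cderiv_sum _ _ _ _ (fun j x => _)) => j _.
  apply: cderivZ; apply: cderivM; first exact: cderiv_cst.
  by apply: cderivV.
- have /nearC[r r0 Hr] := near_mN N0; exists r => // s sx /Hr Ns.
  apply: mform_pf0 => //.
  have ga0 : ga != 0.
    apply: contraNneq D0 => g0; move: M0; rewrite /mden /mdet g0 mul0r add0r => ->.
    by rewrite !mulr0 subrr.
  have -> : mden s = mden x + ga * (s - x) by rewrite /mden; ring.
  by rewrite M0 add0r mulf_neq0 // subr_eq0.
Unshelve. all: by end_near. Qed.

End MobiusCoordinate.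
End NormalForm.

(** * Residues and periods of a differential in normal form *)

Section FormPeriods.
Variables (R : realType) (p : nat) (a : 'I_2 -> nat) (b : 'I_p -> nat).
Implicit Types (z : 'I_p -> Cx R) (x y m q w k : Cx R) (W : p1_form R p) (g : R -> Cx R).

Local Notation a1 := (a ord0).
Local Notation a2 := (a ord_max).
Local Notation z1 W := (f_pos W (inl ord0)).
Local Notation z2 W := (f_pos W (inl ord_max)).
Local Notation pj W j := (f_pos W (inr j)).

Hypothesis hab : (\sum_(i < 2) a i + 2 = \sum_(j < p) b j)%N.

Lemma cderiv_Log_comp (N : Cx R -> Cx R) x c w :
  cderiv N x c -> w != 0 -> slit (N x / w) -> cderiv (fun y => Log (N y / w)) x (c / N x).
Proof.
move=> HN w0 S; have Nw := slit_neq0 S.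
have N0 : N x != 0 by apply: contraNneq Nw => ->; rewrite mul0r.
have -> : c / N x = (N x / w)^-1 * (c * w^-1 + N x * 0) by field; rewrite w0 N0.
apply: (@cderiv_comp _ (@Log R) (fun y => N y / w)); first exact: cderiv_Log.
by apply: cderivM => //; exact: cderiv_cst.
Qed.

Lemma path_mform z (al be ga de : Cx R) g (l : 'I_p -> Cx R) :
  injective z -> mdet al be ga de != 0 ->
  (forall u : R, 0 <= u <= 1 -> forall j, mN z al be ga de j (g u) != 0) ->
  (forall j, path_integral (fun y => (al - z j * ga) / mN z al be ga de j y) g (l j)) ->
  path_integral (mform a b z al be ga de) g
    (mprim a b z al be ga de (g 1) - mprim a b z al be ga de (g 0) + \sum_j cf a b z j 0 * l j).
Proof.
move=> zI D0 N0 Hl.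
apply: (@path_integral_ext _ (fun y => mdprim a b z al be ga de y +
    \sum_j cf a b z j 0 * ((al - z j * ga) / mN z al be ga de j y))).
  move=> u u01; move: (near_mN (N0 u u01)); apply: filterS => y Ny.
  by rewrite -mform_pf.
apply: path_integralD.
  apply: path_integral_prim => u u01; move: (near_mN (N0 u u01)); apply: filterS => y Ny.
  exact: cderiv_mprim.
by apply: (@path_integral_sum _ _ _ (fun j y => cf a b z j 0 * _)) => j; exact: path_integralZ.
Qed.

Lemma ordP (P : 'I_2 -> Prop) : P ord0 -> P ord_max -> forall i, P i.
Proof.
move=> H0 H1 [[|[|//]] i]; first by rewrite (_ : Ordinal _ = ord0) //; exact: val_inj.
by rewrite (_ : Ordinal _ = ord_max) //; exact: val_inj.
Qed.

Lemma form_funE W x : form_fun a b W x =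
  f_scale W * (x - z1 W) ^+ a1 * (x - z2 W) ^+ a2 / \prod_j (x - pj W j) ^+ b j.
Proof.
rewrite /form_fun big_sumType /= big_ord_recl big_ord1 /= -!mulrA; congr (_ * (_ * _)).
rewrite (_ : lift ord0 ord0 = ord_max); last exact: val_inj.
rewrite -exprnP; congr (_ * _).
by rewrite -prodfV; apply: eq_bigr => j _; rewrite exprnN.
Qed.

(* In the coordinate Y = k (x - z_1) / (x - z_2) the form W becomes
   Y ^+ a1 / \prod_j (Y - z j) ^+ b j dY. *)
Definition normal W k z : Prop :=
  [/\ k != 0, forall j, z j = k * (pj W j - z1 W) / (pj W j - z2 W) &
      f_scale W * k ^+ a2.+1 * (z1 W - z2 W) ^+ (a1 + a2).+1 =
      \prod_j (pj W j - z2 W) ^+ b j].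

Lemma pos_neq W s t : s != t -> f_pos W s - f_pos W t != 0.
Proof. by rewrite subr_eq0 (inj_eq (@f_pos_inj _ _ W)). Qed.

Lemma normal_inj W k z : normal W k z -> injective z.
Proof.
case=> k0 Hz _ i j; rewrite !Hz => /eqP.
have [i2 j2 h12] : [/\ pj W i - z2 W != 0, pj W j - z2 W != 0 & z1 W - z2 W != 0].
  by split; apply: pos_neq.
rewrite eqr_div // -subr_eq0.
have -> : k * (pj W i - z1 W) * (pj W j - z2 W) - k * (pj W j - z1 W) * (pj W i - z2 W) =
   k * (z1 W - z2 W) * (pj W i - pj W j) by ring.
rewrite !mulf_eq0 (negbTE k0) (negbTE h12) /= subr_eq0 => /eqP /f_pos_inj.
by case.
Qed.

Lemma normal_neq0 W k z j : normal W k z -> z j != 0.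
Proof.
case=> k0 -> _; rewrite !mulf_neq0 // ?invr_eq0; exact: pos_neq.
Qed.

Lemma normal_kz W k z j : normal W k z -> k - z j = k * (z1 W - z2 W) / (pj W j - z2 W).
Proof. by case=> k0 -> _; field; apply: pos_neq. Qed.

Lemma normal_kz0 W k z j : normal W k z -> k - z j != 0.
Proof.
move=> H; rewrite (normal_kz _ H); case: H => k0 _ _.
rewrite !mulf_neq0 // ?invr_eq0; exact: pos_neq.
Qed.

Lemma normal_mN W k z j x : normal W k z ->
  mN z k (- k * z1 W) 1 (- z2 W) j x = (k - z j) * (x - pj W j).
Proof.
case=> k0 Hz _; rewrite /mN /mnum /mden Hz; field; exact: pos_neq.
Qed.

Lemma normal_mform W k z x : normal W k z ->
  mform a b z k (- k * z1 W) 1 (- z2 W) x = form_fun a b W x.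
Proof.
move=> H; rewrite form_funE /mform; have h12 : z1 W - z2 W != 0 by apply: pos_neq.
pose h := z1 W - z2 W; pose Pq := \prod_j (pj W j - z2 W) ^+ b j.
have E : \prod_j mN z k (- k * z1 W) 1 (- z2 W) j x ^+ b j =
   (k * h) ^+ deg a / Pq * \prod_j (x - pj W j) ^+ b j.
  under eq_bigr => j _ do rewrite (normal_mN _ _ H) (normal_kz _ H) exprMn expr_div_n.
  by rewrite !big_split /= prodfV prodrXr -(degE hab).
rewrite E invfM; move: (\prod_j (x - _) ^+ _)^-1 => I.
case: (H) => k0 Hz Hs; rewrite -/Pq -/h in Hs; rewrite -/h in h12.
have Pq0 : Pq != 0 by apply/prodf_neq0 => j _; rewrite expf_neq0 //; apply: pos_neq.
have -> : mdet k (- k * z1 W) 1 (- z2 W) = k * h by rewrite /mdet /h; ring.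
have -> : mnum k (- k * z1 W) x = k * (x - z1 W) by rewrite /mnum; ring.
have -> : mden 1 (- z2 W) x = x - z2 W by rewrite /mden mul1r.
have -> : (k * h) ^+ deg a = k * h * k ^+ a1 * (k ^+ a2.+1 * h ^+ (a1 + a2).+1).
  by rewrite /deg !exprS !exprMn !exprD; ring.
rewrite -Hs in Pq0 *; move: Pq0; rewrite exprMn.
move: (k ^+ a1) (k ^+ a2.+1) (h ^+ (a1 + a2).+1) (expf_neq0 a1 k0) => A B C A0.
rewrite !mulf_eq0 !negb_or => /andP[/andP[s0 B0] C0].
by field; rewrite k0 h12 s0 A0 B0 C0.
Qed.

(** [A] is the primitive of the part without logarithms: 0 at [z_2], where [Y] is infinite, and
    explicit at [z_1], where [Y = 0]. Between given end points only the logarithmic integrals [l j]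
    depend on the path. *)
Lemma path_integral_normal W k z g (l : 'I_p -> Cx R) : normal W k z ->
  (forall u : R, 0 <= u <= 1 -> forall j, g u != pj W j) ->
  (forall j, path_integral (fun y => (y - pj W j)^-1) g (l j)) ->
  exists A : Cx R -> Cx R,
    [/\ A (z2 W) = 0,
        A (z1 W) = - \sum_j \sum_(i < (deg a).-1) cf a b z j i.+1 / i.+1%:R * (- z j) ^- i.+1 &
        path_integral (form_fun a b W) g (A (g 1) - A (g 0) + \sum_j cf a b z j 0 * l j)].
Proof.
move=> H Hg Hl; have zI := normal_inj H.
exists (mprim a b z k (- k * z1 W) 1 (- z2 W)).
have [h12 h2] : z1 W - z2 W != 0 /\ forall j, z2 W - pj W j != 0.
  by split=> [|j]; apply: pos_neq.
have h1 j : z1 W - pj W j != 0 by apply: pos_neq.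
case: (H) => k0 Hz _; split.
- rewrite /mprim big1 ?oppr0 // => j _; rewrite big1 // => i _.
  by rewrite (_ : mden _ _ _ = 0) ?mul0r ?exprS ?mul0r ?mulr0 // /mden mul1r subrr.
- rewrite /mprim; congr (- _); apply: eq_bigr => j _; apply: eq_bigr => i _.
  congr (_ * _); rewrite -exprVn; congr (_ ^+ _).
  rewrite (normal_mN _ _ H) (normal_kz _ H) Hz /mden.
  by field; rewrite !(h1, h12, k0) (@pos_neq W (inr j) (inl ord0) isT) (@pos_neq W (inr j) (inl ord_max) isT).
have F : form_fun a b W = mform a b z k (- k * z1 W) 1 (- z2 W).
  by apply/funext => x; rewrite normal_mform.
rewrite F; apply: path_mform => //.
- by rewrite /mdet (_ : _ - _ = k * (z1 W - z2 W)) ?mulf_neq0 //; ring.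
- move=> u u01 j; rewrite (normal_mN _ _ H) mulf_neq0 ?(normal_kz0 _ H) //.
  by rewrite subr_eq0 Hg.
- move=> j; apply: path_integral_ext (Hl j) => u u01; near=> y.
  by rewrite (normal_mN _ _ H) mulr1 invfM mulrA divff ?mul1r // (normal_kz0 _ H).
Unshelve. all: by end_near. Qed.

Lemma residue_cf W k z j : normal W k z ->
  residue (form_fun a b W) (pj W j) (two_pi_i R * cf a b z j 0).
Proof.
move=> H.
have /nearC[r0 r00 Hr0] : \forall y \near pj W j, forall i, i != j -> y - pj W i != 0.
  apply: (@filter_forall _ _ (fun i y => i != j -> y - pj W i != 0) (nbhs (pj W j)) _) => i.
  have [->|ij] := eqVneq i j; first by near=> y.
  have n0 : 0 < nz (pj W j - pj W i).
    rewrite nz_gt0; apply: (@pos_neq W (inr j) (inr i)); apply: contra_neq ij; by case.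
  apply/nearC; exists (nz (pj W j - pj W i)) => // y h _.
  apply: contraTneq h => /eqP; rewrite subr_eq0 => /eqP ->; by rewrite nzC ltxx.
have far i : i != j -> r0 <= nz (pj W i - pj W j).
  move=> ij; rewrite leNgt; apply/negP => /Hr0 /(_ i ij); by rewrite subrr eqxx.
near=> r; have rp : 0 < r by near: r; exact: nbhs_right_gt.
have rr0 : r < r0 by near: r; apply: nbhs_right_lt.
pose l i : Cx R := if i == j then two_pi_i R else 0.
have [|i|A [_ _]] := @path_integral_normal W k z (circle (pj W j) r) l H.
- move=> u u01 i; apply/eqP => E.
  have := nz_circle (pj W j) u (ltW rp); rewrite E.
  have [->|ij] := eqVneq i j; first by rewrite subrr nz0 => r_0; rewrite -r_0 ltxx in rp.
  by have := far i ij; lra.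
- rewrite /l; case: eqP => [->|/eqP ij].
    by apply: path_integral_circle_in; rewrite subrr nz0.
  by apply: path_integral_circle_out => //; have := far i ij; lra.
rewrite circle01 subrr add0r (bigD1 j) //= /l eqxx big1 ?addr0; first by rewrite mulrC.
by move=> i /negbTE ->; rewrite mulr0.
Unshelve. all: by end_near. Qed.

Lemma residue_unique (f : Cx R -> Cx R) q v v' : residue f q v -> residue f q v' -> v = v'.
Proof.
move=> H H'.
have [r [[h h'] r0]] : exists r : R, (path_integral f (circle q r) v /\
    path_integral f (circle q r) v') /\ 0 < r.
  apply: (@filter_ex _ ((0 : R)^'+) _ (fun r => (path_integral f (circle q r) v /\
    path_integral f (circle q r) v') /\ 0 < r)).
  near=> r; split; last by near: r; exact: nbhs_right_gt.
  by split; near: r.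
exact: path_integral_unique (circle_path_cont q (ltW r0)) h h'.
Unshelve. all: by end_near. Qed.

(** Membership in the fibre becomes a condition on [z] alone, through coefficients that are rational
    in [z]. *)
Lemma in_fiber_cf W k z lam : normal W k z ->
  in_fiber a b lam W <-> forall j, two_pi_i R * cf a b z j 0 = lam j.
Proof.
move=> H; split=> [Hf j|E j]; last by rewrite -E; exact: residue_cf H.
exact: residue_unique (residue_cf j H) (Hf j).
Qed.

(** Geometrically, [q] is not on the segment from [m] to [w]; phrased with [slit] so as to provide a
    logarithm of [y - q] along that segment. *)
Definition good_base (w q m : Cx R) : Prop := m - q != 0 /\ slit ((w - q) / (m - q)).

Lemma good_base_open (w q m : Cx R) : good_base w q m -> \forall y \near m, good_base w q y.
Proof.
move=> [mq S]; have D : cderiv (fun m => m - q) m (1 - 0).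
  by apply: cderivB; [exact: cderiv_id|exact: cderiv_cst].
have C := cderiv_cont (cderivM (cderiv_cst (w - q) m) (@cderivV _ (fun m => m - q) m _ mq D)).
have N : \forall y \near m, y - q != 0.
  apply/nearC; exists (nz (m - q)); first by rewrite nz_gt0.
  move=> y h; apply: contraTneq h => /eqP; rewrite subr_eq0 => /eqP ->; by rewrite nzC ltxx.
by move: N (C _ (slit_open S)); apply: filterS2.
Qed.

Lemma exists_good_base (l : seq (Cx R * Cx R)) :
  (forall wq, wq \in l -> wq.1 != wq.2) ->
  exists m (r : R), 0 < r /\ forall wq, wq \in l -> forall y, nz (y - m) < r -> good_base wq.1 wq.2 y.
Proof.
elim: l => [|[w q] l IH] Hl; first by exists 0, 1; split.
have [|m [r [r0 Hm]]] := IH; first by move=> wq h; apply: Hl; rewrite inE h orbT.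
have wq : w - q != 0 by rewrite subr_eq0 (Hl (w, q)) // mem_head.
have [m' mm' G] : exists2 m', nz (m' - m) < r & good_base w q m'.
  have [G|nG] := pselect (good_base w q m); first by exists m; rewrite // subrr nz0.
  pose t := (m - q) / (w - q).
  have tE : m = q + t * (w - q) by rewrite /t; field.
  have It : complex.Im t = 0.
    apply/eqP/negPn/negP => I0; apply: nG.
    have t0 : t != 0 by apply: contraNneq I0 => ->.
    have mq0 : m - q != 0 by apply: contraNneq t0 => E; rewrite /t E mul0r.
    split=> //; apply: slit_Im; have -> : (w - q) / (m - q) = t^-1 by rewrite /t invf_div.
    move: I0 t0; case: (t) => x y /= y0 _.
    by rewrite oppr_eq0 mulf_neq0 // invr_eq0 paddr_eq0 ?sqr_ge0 // !sqrf_eq0 negb_and y0 orbT.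
  pose e := r / 2 / nz (w - q).
  have n0 : 0 < nz (w - q) by rewrite nz_gt0.
  have e0 : 0 < e by rewrite !divr_gt0.
  (* A base point can fail only on the line through [w] and [q]. A small step off this line repairs
     it and stays in the ball that is good for the other pairs. *)
  pose t' := t + 'i%C * rc e.
  exists (q + t' * (w - q)).
    rewrite [in X in _ - X]tE /t' (_ : _ - _ = 'i%C * rc e * (w - q)); last by ring.
    rewrite !nzM nz_i mul1r nz_rc gtr0_norm // /e divfK ?gt_eqF //; lra.
  have It' : complex.Im t' != 0.
    rewrite /t'; move: It; case: (t) => x y /= ->.
    by rewrite mul0r mul1r !add0r gt_eqF.
  have t'0 : t' != 0 by apply: contraNneq It' => ->.
  have E : q + t' * (w - q) - q = t' * (w - q) by ring.
  split; first by rewrite E mulf_neq0.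
  rewrite E (_ : _ / _ = t'^-1); last by field; rewrite wq t'0.
  apply: slit_Im; move: It' t'0; case: (t') => x y /= y0 _.
  by rewrite oppr_eq0 mulf_neq0 // invr_eq0 paddr_eq0 ?sqr_ge0 // !sqrf_eq0 negb_and y0 orbT.
have /nearC[r1 r10 H1] := good_base_open G.
exists m', (Num.min r1 (r - nz (m' - m))); split; first by rewrite lt_min r10 subr_gt0.
move=> wq'; rewrite inE => /orP[/eqP->|Hin] y; rewrite lt_min => /andP[h1 h2]; first exact: H1.
apply: Hm => //; have := nzD (y - m') (m' - m); rewrite addrA subrK; lra.
Qed.

(** A broken path through a common base point [m]: for every pole at once, the branch of the
    logarithm recentred at [m] serves both halves. *)
Definition brk (u0 m u1 : Cx R) (u : R) : Cx R :=
  if u <= 1/2 then seg u0 m (2 * u) else seg m u1 (2 * u - 1).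

Lemma brk0 u0 m u1 : brk u0 m u1 0 = u0.
Proof. by rewrite /brk ifT; [rewrite mulr0 seg0|lra]. Qed.
Lemma brk1 u0 m u1 : brk u0 m u1 1 = u1.
Proof.
rewrite /brk ifF; last by apply/negbTE; rewrite -ltNge; lra.
have -> : 2 * 1 - 1 = 1 :> R by ring.
exact: seg1.
Qed.

Lemma brk_slit u0 m u1 q (u : R) : 0 <= u <= 1 -> good_base u0 q m -> good_base u1 q m ->
  slit ((brk u0 m u1 u - q) / (m - q)).
Proof.
move=> u01 [mq S0] [_ S1]; rewrite /brk.
have E w (t : R) : (m + rc t * (w - m) - q) / (m - q) = 1 + rc t * ((w - q) / (m - q) - 1).
  by field.
case: ifPn => h.
  have -> : seg u0 m (2 * u) = m + rc (1 - 2 * u) * (u0 - m).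
    by rewrite /seg rcB rc1; ring.
  by rewrite E; apply: slit_star => //; lra.
by rewrite /seg E; apply: slit_star => //; rewrite -ltNge in h; lra.
Qed.

(** The logarithms on the right are those of [z j / k], not of [z j]; the common shift is harmless
    by [tau_shift]. *)
Lemma path_integral_brk W k z m : normal W k z ->
  (forall j, good_base (z1 W) (pj W j) m) -> (forall j, good_base (z2 W) (pj W j) m) ->
  path_integral (form_fun a b W) (brk (z1 W) m (z2 W))
    (tau a b z (fun j => Log ((z1 W - pj W j) / (m - pj W j)) - Log ((z2 W - pj W j) / (m - pj W j)))).
Proof.
move=> H G1 G2; pose l j := Log ((z2 W - pj W j) / (m - pj W j)) - Log ((z1 W - pj W j) / (m - pj W j)).
have [|j|A [A2 A1]] := @path_integral_normal W k z (brk (z1 W) m (z2 W)) l H.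
- move=> u u01 j; have := slit_neq0 (brk_slit u01 (G1 j) (G2 j)).
  by apply: contra_neq => ->; rewrite subrr mul0r.
- have mp : m != pj W j by have [] := G1 j; rewrite subr_eq0.
  have := @path_integral_log _ (brk (z1 W) m (z2 W)) m (pj W j) mp.
  by rewrite brk0 brk1; apply=> u u01; exact: brk_slit.
rewrite brk0 brk1 A2 A1 sub0r opprK.
rewrite (_ : tau a b z _ = \sum_j \sum_(i < (deg a).-1) cf a b z j i.+1 / i.+1%:R * (- z j) ^- i.+1 + \sum_j cf a b z j 0 * l j) //.
rewrite /tau; congr (_ + _); rewrite -sumrN; apply: eq_bigr => j _.
by rewrite /l; ring.
Qed.

(* The branch of tau when all z j are close to w: the integral from z_1 to z_2
   along a path that stays away from the cluster of poles. *)
Definition tau_cluster z w : Cx R := tau a b z (fun j => Log (z j / w)).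

(** The path is the ray opposite to the cluster, [Y = w (1 + x) / x] for [x] from 0 to -1. There
    [mN j x = w (1 + x (1 - z j / w))] has modulus at least [nz w / 2]. It runs from [z_2] to [z_1],
    whence the sign inside the proof. *)
Lemma tau_cluster_bound z w : injective z -> w != 0 ->
  (forall j, nz (z j / w - 1) <= 1/2) ->
  nz (tau_cluster z w) <= 2 ^+ deg a / nz w ^+ a2.+1.
Proof.
move=> zI w0 Hz; have n0 : 0 < nz w by rewrite nz_gt0.
have NE j x : mN z w w 1 0 j x = w * (1 + x * (1 - z j / w)).
  by rewrite /mN /mnum /mden; field.
have low (u : R) j : 0 <= u <= 1 -> 1/2 <= nz (1 + seg 0 (-1) u * (1 - z j / w)).
  move=> /andP[u0 u1]; rewrite /seg add0r subr0 mulrN1 mulNr.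
  have := nzBge 1 (rc u * (1 - z j / w)).
  rewrite nz1 nzM nz_rc ger0_norm // => h.
  have := Hz j; rewrite (nzC (z j / w)); have := nz_ge0 (1 - z j / w); nra.
have N0 (u : R) : 0 <= u <= 1 -> forall j, mN z w w 1 0 j (seg 0 (-1) u) != 0.
  move=> u01 j; rewrite NE mulf_neq0 // -nz_gt0; have := low u j u01; lra.
have D0 : mdet w w 1 0 != 0 by rewrite /mdet mulr0 mulr1 sub0r oppr_eq0.
have Hl j : path_integral (fun y => (w - z j * 1) / mN z w w 1 0 j y) (seg 0 (-1))
   (Log (z j / w)).
  have := @path_integral_prim _ (fun y => (w - z j * 1) / mN z w w 1 0 j y) (seg 0 (-1))
     (fun y => Log (mN z w w 1 0 j y / w)).
  rewrite seg0 seg1 !NE (_ : w * (1 + -1 * (1 - z j / w)) / w = z j / w); last by field.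
  rewrite (_ : w * (1 + 0 * (1 - z j / w)) / w = 1); last by field.
  rewrite Log1 subr0; apply=> u u01.
  have S : slit (mN z w w 1 0 j (seg 0 (-1) u) / w).
    rewrite NE mulrC mulKf //; apply: slit_Re.
    move: u01 => /andP[u0 u1]; rewrite /seg add0r subr0 mulrN1 mulNr.
    have h1 := nzRe (z j / w - 1); have h2 := Hz j; move: h1 h2.
    have -> : complex.Re (1 - rc u * (1 - z j / w)) = 1 + u * complex.Re (z j / w - 1).
      by case: (z j / w) => x y /=; ring.
    rewrite ler_norml => /andP[h1 _] h2; nra.
  have C := cderiv_cont (cderivM (cderiv_mN z w w 1 0 j (seg 0 (-1) u)) (cderiv_cst w^-1 (seg 0 (-1) u))).
  have N : \forall y \near seg 0 (-1) u, slit (mN z w w 1 0 j y / w) by exact: (C _ (slit_open S)).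
  move: N; apply: filterS => y Sy.
  exact: (cderiv_Log_comp (cderiv_mN z w w 1 0 j y) w0 Sy).
have := path_mform zI D0 N0 Hl; rewrite seg0 seg1.
rewrite (_ : mprim _ _ _ _ _ _ _ 0 = 0); last first.
  rewrite /mprim big1 ?oppr0 // => j _; rewrite big1 // => i _.
  by rewrite /mden mulr0 addr0 mul0r exprS mul0r mulr0.
rewrite (_ : _ + _ = - tau_cluster z w); last first.
  rewrite subr0 /mprim /tau_cluster /tau opprB [RHS]addrC; congr (- _ + _).
  apply: eq_bigr => j _; apply: eq_bigr => i _; congr (_ * _).
  rewrite -exprVn NE /mden; congr (_ ^+ _).
  have -> : w * (1 + -1 * (1 - z j / w)) = z j by field.
  by rewrite mul1r addr0 invrN mulN1r.
rewrite -[X in _ -> nz X <= _]opprK nzN -[X in _ -> _ <= X]mul1r.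
apply: path_integral_bound.
- by move=> u s _ _; rewrite nz_seg subr0 nzN nz1 mulr1 mul1r.
move=> u u01; rewrite /mform !nzM nzV nz_prod.
under eq_bigr => j _ do rewrite NE nzX nzM exprMn.
rewrite big_split /= prodrXr -(degE hab).
have hm : nz (mdet w w 1 0) = nz w by rewrite /mdet mulr0 mulr1 sub0r nzN.
have hu : nz (seg 0 (-1) u) <= 1.
  by rewrite /seg add0r subr0 mulrN1 nzN nz_rc ger0_norm; lra.
have hu1 : nz (1 + seg 0 (-1) u) <= 1.
  have -> : 1 + seg 0 (-1) u = rc (1 - u) by rewrite /seg rcB rc1; ring.
  by rewrite nz_rc ger0_norm; lra.
rewrite hm !nzX (_ : mnum w w _ = w * (1 + seg 0 (-1) u)); last by rewrite /mnum; ring.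
rewrite (_ : mden _ _ _ = seg 0 (-1) u); last by rewrite /mden mul1r addr0.
rewrite nzM exprMn.
have k1 : nz (1 + seg 0 (-1) u) ^+ a1 <= 1 by rewrite exprn_ile1 ?nz_ge0.
have k2 : nz (seg 0 (-1) u) ^+ a2 <= 1 by rewrite exprn_ile1 ?nz_ge0.
have k3 : (1/2) ^+ deg a <= \prod_(j < p) nz (1 + seg 0 (-1) u * (1 - z j / w)) ^+ b j.
  rewrite (degE hab) -prodrXr; apply: ler_prod => j _; apply/andP; split.
    by rewrite exprn_ge0 //; lra.
  apply: lerXn2r; [by rewrite nnegrE; lra|by rewrite nnegrE nz_ge0|exact: low].
set Pr := bigop _ _ _ in k3 *.
have h0 : 0 < (1/2 : R) ^+ deg a by rewrite exprn_gt0 //; lra.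
have Pr0 : 0 < Pr by exact: lt_le_trans k3.
have h2 : 2 ^+ deg a = ((1/2 : R) ^+ deg a)^-1 by rewrite -exprVn; congr (_ ^+ _); field.
have Pri : Pr^-1 <= 2 ^+ deg a by rewrite h2 lef_pV2 ?posrE.
rewrite (_ : nz w ^+ deg a = nz w * nz w ^+ a1 * nz w ^+ a2.+1); last first.
  by rewrite /deg exprS -addnS exprD; ring.
move: k1 k2; set A := nz (1 + _) ^+ a1; set B := nz (seg _ _ _) ^+ a2 => k1 k2.
have A0 : 0 <= A by rewrite exprn_ge0 ?nz_ge0.
have B0 : 0 <= B by rewrite exprn_ge0 ?nz_ge0.
have w1 : nz w ^+ a1 != 0 by rewrite expf_neq0 // gt_eqF.
have w2 : nz w ^+ a2.+1 != 0 by rewrite expf_neq0 // gt_eqF.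
have -> : nz w * (nz w ^+ a1 * A) * B / (nz w * nz w ^+ a1 * nz w ^+ a2.+1 * Pr) =
   (A * B * Pr^-1) / nz w ^+ a2.+1.
  by field; rewrite w1 w2 !gt_eqF.
rewrite ler_wpM2r ?invr_ge0 ?exprn_ge0 ?nz_ge0 //.
apply: le_trans Pri; rewrite -[leRHS]mul1r ler_wpM2r ?invr_ge0 ?(ltW Pr0) //.
by rewrite -[leRHS]mul1r ler_pM.
Qed.

End FormPeriods.

(** * Clustering of the poles and compactness *)

Section Clusters.
Variables (R : realType) (p : nat) (a : 'I_2 -> nat) (b : 'I_p -> nat).
Implicit Types (z : 'I_p -> Cx R) (lam : 'I_p -> Cx R).

Local Notation a1 := (a ord0).
Local Notation a2 := (a ord_max).

Hypothesis hab : (\sum_(i < 2) a i + 2 = \sum_(j < p) b j)%N.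

Lemma finite_pos_lb (T : finType) (P : pred T) (F : T -> R) :
  (forall t, P t -> 0 < F t) -> exists2 e : R, 0 < e & forall t, P t -> e <= F t.
Proof.
move=> H.
have : \forall e \near (0 : R)^'+, forall t, P t -> e <= F t.
  apply: (@filter_forall _ _ (fun t e => P t -> e <= F t) ((0 : R)^'+) _) => t.
  case Pt : (P t); last by near=> e.
  near=> e => _; near: e; apply: nbhs_right_le; exact: H.
move=> N; have [e [He e0]] : exists e : R, (forall t, P t -> e <= F t) /\ 0 < e.
  apply: (@filter_ex _ ((0 : R)^'+) _ (fun e => (forall t, P t -> e <= F t) /\ 0 < e)).
  by near=> e; split; near: e => //; exact: nbhs_right_gt.
by exists e.
Unshelve. all: by end_near. Qed.

(** The sum of the residues inside the circle is an integral over it, where the numerator is at most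
    [2 ^+ a1] and every factor of the denominator at least [e] in modulus. *)
Lemma cf_circle_bound z (q : Cx R) (r e : R) : injective z ->
  0 < e -> 0 < r <= 1 -> nz q <= 1 ->
  (forall j, nz (z j - q) <= r - e \/ r + e <= nz (z j - q)) ->
  nz (\sum_(j | nz (z j - q) < r) two_pi_i R * cf a b z j 0) <=
  2 * pi * (2 ^+ a1 / e ^+ deg a).
Proof.
move=> zI e0 /andP[r0 r1] q1 Hz.
pose l j : Cx R := if nz (z j - q) < r then two_pi_i R else 0.
have NE j y : mN z 1 0 0 1 j y = y - z j by rewrite /mN /mnum /mden; ring.
have dist (u : R) j : e <= nz (circle q r u - z j).
  have hc := nz_circle q u (ltW r0).
  have h1 := nzBge (circle q r u - q) (z j - q); have h2 := nzBge (z j - q) (circle q r u - q).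
  have E1 : circle q r u - q - (z j - q) = circle q r u - z j by ring.
  have E2 : z j - q - (circle q r u - q) = - (circle q r u - z j) by ring.
  rewrite E1 hc in h1; rewrite E2 nzN hc in h2.
  by case: (Hz j); lra.
have D1 : mdet (1 : Cx R) 0 0 1 != 0 by rewrite /mdet mulr1 mulr0 subr0 oner_eq0.
have N0 (u : R) : 0 <= u <= 1 -> forall j, mN z 1 0 0 1 j (circle q r u) != 0.
  by move=> _ j; rewrite NE -nz_gt0; have := dist u j; lra.
have Hl j : path_integral (fun y => (1 - z j * 0) / mN z 1 0 0 1 j y) (circle q r) (l j).
  have := @path_integral_ext _ (fun y => (y - z j)^-1) (fun y => (1 - z j * 0) / mN z 1 0 0 1 j y) (circle q r) (l j).
  apply.
    by move=> u _; near=> y; rewrite NE mulr0 subr0 mul1r.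
  rewrite /l; case: ifPn => h; first exact: path_integral_circle_in.
  by apply: path_integral_circle_out => //; case: (Hz j); rewrite -leNgt in h; lra.
have := path_mform hab zI D1 N0 Hl; rewrite circle01 subrr add0r.
rewrite (_ : \sum_j _ = \sum_(j | nz (z j - q) < r) two_pi_i R * cf a b z j 0); last first.
  rewrite [RHS]big_mkcond; apply: eq_bigr => j _; rewrite /l; case: ifP => _; last by rewrite mulr0.
  by rewrite mulrC.
move=> PI; have := path_integral_bound (fun u s _ _ => lip_circle q u s (ltW r0)) _ PI.
have pp := @pi_gt0 R.
move=> /(_ (2 ^+ a1 / e ^+ deg a)) H; apply: le_trans (H _) _.
  move=> u u01; rewrite /mform !nzM nzV nz_prod.
  have -> : mdet (1 : Cx R) 0 0 1 = 1 by rewrite /mdet; ring.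
  have -> : mnum (1 : Cx R) 0 (circle q r u) = circle q r u by rewrite /mnum; ring.
  have -> : mden (0 : Cx R) 1 (circle q r u) = 1 by rewrite /mden; ring.
  rewrite !nzX nz1 expr1n mul1r mulr1.
  have c2 : nz (circle q r u) <= 2.
    have := nzD (circle q r u - q) q; rewrite subrK nz_circle ?(ltW r0) //; lra.
  apply: ler_pM; rewrite ?exprn_ge0 ?nz_ge0 ?invr_ge0 //.
  - by apply: prodr_ge0 => j _; exact: nz_ge0.
  - by apply: lerXn2r; rewrite ?nnegrE ?nz_ge0.
  have k3 : e ^+ deg a <= \prod_(j < p) nz (mN z 1 0 0 1 j (circle q r u) ^+ b j).
    rewrite (degE hab) -prodrXr; apply: ler_prod => j _; rewrite exprn_ge0 ?(ltW e0) //= nzX.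
    by apply: lerXn2r; rewrite ?nnegrE ?nz_ge0 ?(ltW e0) // NE.
  by rewrite lef_pV2 ?posrE ?exprn_gt0 // (lt_le_trans _ k3) // exprn_gt0.
rewrite ler_wpM2r //; first by rewrite divr_ge0 ?exprn_ge0 // ltW.
by rewrite -[leRHS]mul1r ler_wpM2r // mulr_ge0 // ltW.
Unshelve. all: by end_near. Qed.

(* Nonresonance forces all poles into one cluster when they go to infinity:
   otherwise some circle separates them, and the sum of the rescaled residues
   inside the circle is bounded. *)
Lemma far_poles_cluster lam : (2 <= p)%N -> ~ resonant lam ->
  exists M : R, forall z i0, injective z -> (forall j, two_pi_i R * cf a b z j 0 = lam j) ->
    (forall j, nz (z j) <= nz (z i0)) -> M <= nz (z i0) ->
    forall j, nz (z j / z i0 - 1) <= 1 / 6.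
Proof.
move=> p2 nres.
have [eps eps0 Heps] : exists2 e : R, 0 < e & forall I : {set 'I_p},
    (I != finset.set0) && (I != [set: 'I_p]%SET) -> e <= nz (\sum_(j in I) lam j).
  apply: finite_pos_lb => I /andP[I0 IT]; rewrite nz_gt0.
  by apply/eqP => E; apply: nres; exists I.
(* There will be [p] disjoint annuli about 1 of width [2 * dl], the first starting at radius [dl],
   the last ending at [(2 * p + 1) * dl = 1 / 6]. *)
pose dl : R := (12 * p%:R + 6)^-1.
have p0 : 0 <= p%:R :> R by [].
have dl0 : 0 < dl by rewrite invr_gt0; lra.
have dlE : dl * (12 * p%:R + 6) = 1 by rewrite mulVf // gt_eqF //; lra.
pose K := 2 * pi * (2 ^+ a1 / dl ^+ deg a) / eps.
exists (Num.max 1 K + 1) => z i0 zI Hres Hmax HM j; rewrite leNgt; apply/negP => Hj.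
have X1 : 1 < nz (z i0).
  have m1 : 1 <= Num.max 1 K by rewrite le_max lexx.
  by lra.
have XK : K < nz (z i0).
  have mK : K <= Num.max 1 K by rewrite le_max lexx orbT.
  by lra.
have z0 : z i0 != 0 by rewrite -nz_gt0; lra.
pose y i := z i / z i0.
have yI : injective y by move=> i i' /(mulIf (invr_neq0 z0)) /zI.
have zy : z = (fun i => z i0 * y i) by apply/funext => i; rewrite /y mulrC divfK.
(* In the coordinate where the farthest pole is 1, the residues carry the large factor
   [z i0 ^+ a2.+1]. *)
have cy i : two_pi_i R * cf a b y i 0 = z i0 ^+ a2.+1 * lam i.
  have := cf_homog hab y i 0 z0; rewrite -zy expr0 mul1r => <-.
  by rewrite -Hres mulrA mulrC.
(* Pigeonhole: if all [p] annuli were occupied, every pole would lie in one of them, but the pole at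
   1 lies in none. *)
have [k Hk] : exists k : 'I_p, forall i, ~ ((2 * k%:R + 1) * dl <= nz (y i - 1) < (2 * k%:R + 3) * dl).
  apply: contrapT => /forallNP H.
  have {H} /choice[f Hf] : forall k : 'I_p, exists i,
    (2 * k%:R + 1) * dl <= nz (y i - 1) < (2 * k%:R + 3) * dl.
    by move=> k; have /existsNP[i /contrapT Hi] := H k; exists i.
  have fI : injective f.
    move=> k k' E; have := Hf k; have := Hf k'; rewrite E => /andP[h1 h2] /andP[h3 h4].
    have : (2 * k'%:R + 1) * dl < (2 * k%:R + 3) * dl by lra.
    have : (2 * k%:R + 1) * dl < (2 * k'%:R + 3) * dl by lra.
    rewrite !ltr_pM2r // => h5 h6.
    have : (k%:R < k'.+1%:R :> R) && (k'%:R < k.+1%:R :> R) by rewrite -!natr1; lra.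
    by rewrite !ltr_nat !ltnS -eqn_leq => /eqP /val_inj.
  have [g _ gK] := injF_bij fI; have := Hf (g i0); rewrite gK /y divff // subrr nz0.
  move=> /andP[h _]; have : 0 <= (g i0)%:R :> R by [].
  by nra.
pose r := (2 * k%:R + 2) * dl.
have k0 : 0 <= k%:R :> R by [].
have kp : k%:R + 1 <= p%:R :> R by rewrite natr1 ler_nat.
have r0 : 0 < r by rewrite mulr_gt0 //; lra.
have r1 : r <= 1/6.
  have -> : 1/6 = (2 * p%:R + 1) * dl by lra.
  by rewrite ler_pM2r //; lra.
have sep i : nz (y i - 1) <= r - dl \/ r + dl <= nz (y i - 1).
  have -> : r - dl = (2 * k%:R + 1) * dl by rewrite /r; ring.
  have -> : r + dl = (2 * k%:R + 3) * dl by rewrite /r; ring.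
  have [h1|/ltW] := leP ((2 * k%:R + 1) * dl) (nz (y i - 1)); last by left.
  by have [h2|] := ltP (nz (y i - 1)) ((2 * k%:R + 3) * dl); [case: (Hk i); rewrite h1 h2|right].
have r01 : 0 < r <= 1 by rewrite r0 /=; lra.
have q1 : nz (1 : Cx R) <= 1 by rewrite nz1.
have := cf_circle_bound yI dl0 r01 q1 sep.
pose I := [set i | nz (y i - 1) < r]%SET.
rewrite (eq_bigl (fun i => i \in I)); last by move=> i; rewrite inE.
under eq_bigr => i _ do rewrite cy.
rewrite -mulr_sumr nzM nzX.
have I0 : I != finset.set0.
  by apply/set0Pn; exists i0; rewrite inE /y divff // subrr nz0.
have IT : I != [set: 'I_p]%SET.
  apply/eqP => E; have : j \in I by rewrite E inE.
  by rewrite inE; move: Hj; rewrite -/(y j); lra.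
have := Heps I; rewrite I0 IT => /(_ isT) h1 h2.
have X2 : nz (z i0) <= nz (z i0) ^+ a2.+1 by rewrite ler_eXnr // ltW.
have h3 : nz (z i0) * eps <= nz (z i0) ^+ a2.+1 * nz (\sum_(j in I) lam j).
  by apply: ler_pM => //; [exact: nz_ge0|exact: ltW].
have : K * eps < nz (z i0) * eps by rewrite ltr_pM2r.
rewrite /K divfK ?gt_eqF //; lra.
Qed.

Lemma cf_cderiv (z : 'I_p -> Cx R -> Cx R) (s0 : Cx R) j k :
  injective (fun j => z j s0) -> (forall j, exists d, cderiv (z j) s0 d) ->
  exists d, cderiv (fun s => cf a b (fun j => z j s) j k) s0 d.
Proof.
move=> zI Hz.
apply: (@param_pf_coef _ _ _ _ (Cx R) s0 (fun f => exists d, cderiv f s0 d)) => //.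
- by move=> x; exists 0; exact: cderiv_cst.
- by move=> f g [d Hd] [d' Hd']; eexists; exact: cderivD Hd Hd'.
- by move=> f g [d Hd] [d' Hd']; eexists; exact: cderivM Hd Hd'.
- by move=> f [d Hd] f0; eexists; exact: cderivV f0 Hd.
Qed.

Lemma cf_cvg (z : nat -> 'I_p -> Cx R) z' j k : injective z' ->
  (forall j, z n j @[n --> \oo] --> z' j) ->
  cf a b (z n) j k @[n --> \oo] --> cf a b z' j k.
Proof.
move=> zI Hz.
(* The limit is stored as the value at [None], which serves as the base point of [param_pf_coef]. *)
pose Z j (t : option nat) := if t is Some n then z n j else z' j.
pose Q (f : option nat -> Cx R) := (fun n => f (Some n)) @ \oo --> f None.
have Qc x : Q (fun=> x) by exact: cvg_cst.
have QD f g : Q f -> Q g -> Q (fun t => f t + g t) by exact: cvgD.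
have QM f g : Q f -> Q g -> Q (fun t => f t * g t) by exact: cvgM.
have QV f : Q f -> f None != 0 -> Q (fun t => (f t)^-1) by move=> Hf f0; exact: cvgV.
have QZ i : Q (Z i) by exact: Hz.
exact: (param_pf_coef (deg a) a1 Qc QD QM QV (pole_list b) j k zI QZ).
Qed.

(** Real and imaginary parts form one row vector in a product of segments. The condition [n <= f n]
    suffices for indices to tend to infinity. *)
Lemma bounded_subsequence (Z : nat -> 'I_p -> Cx R) (B : R) :
  (forall n j, nz (Z n j) <= B) ->
  exists (f : nat -> nat) (z' : 'I_p -> Cx R),
    (forall n, (n <= f n)%N) /\ forall j, Z (f n) j @[n --> \oo] --> z' j.
Proof.
move=> HB.
pose A (i : 'I_(p + p)) : set R := `[- B, B]%classic.
have cA i : compact (A i) by exact: segment_compact.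
pose V n : 'rV[R]_(p + p) :=
  row_mx (\row_j complex.Re (Z n j)) (\row_j complex.Im (Z n j)).
have VA n : [set v : 'rV[R]_(p + p) | forall i, A i (v ord0 i)] (V n).
  move=> i; rewrite /A /V mxE /= in_itv /= -ler_norml.
  case: (fintype.split i) => j; rewrite mxE.
    exact: le_trans (nzRe _) (HB n j).
  exact: le_trans (nzIm _) (HB n j).
have FV : (V @ \oo) [set v : 'rV[R]_(p + p) | forall i, A i (v ord0 i)].
  by exists 0%N => // n _; exact: VA.
have [v [_ Cv]] := rV_compact cA _ FV.
have {}Cv (n : nat) : exists m, (n <= m)%N /\ forall j,
    `|complex.Re (Z m j) - v ord0 (lshift p j)| < n.+1%:R^-1 /\
    `|complex.Im (Z m j) - v ord0 (rshift p j)| < n.+1%:R^-1.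
  have n0 : 0 < n.+1%:R^-1 :> R by rewrite invr_gt0.
  have [|w [[m nm <-] Hw]] := Cv [set V m | m in [set m | (n <= m)%N]] (ball v n.+1%:R^-1) _ (nbhsx_ballx v _ n0).
    by exists n => // m nm; exists m.
  exists m; split=> // j; case: Hw => _ Hw.
  have h1 := Hw ord0 (lshift p j); have h2 := Hw ord0 (rshift p j).
  move: h1 h2; rewrite /V row_mxEl row_mxEr !mxE /ball /= => h1 h2.
  by rewrite distrC (distrC (complex.Im _)).
have /choice[f Hf] := Cv.
exists f, (fun j => (v ord0 (lshift p j) +i* v ord0 (rshift p j))%C); split; first by move=> n; case: (Hf n).
move=> j; apply/(@cvgC _ _ \oo) => e e0.
have e2 : 0 < e / 2 by lra.
near=> n; have [_ /(_ j)[h1 h2]] := Hf n.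
apply: le_lt_trans (nzReIm _) _; rewrite ReB ImB /=.
have : n.+1%:R^-1 < e / 2 by near: n; exact: near_infty_natSinv_lt (PosNum e2).
move=> h3; have -> : e = e / 2 + e / 2 by field.
by apply: ltrD; [exact: lt_trans h1 h3|exact: lt_trans h2 h3].
Unshelve. all: by end_near. Qed.

End Clusters.

(** * The differential equation of an isoresidual family *)

Section IsoresidualVariation.
Variables (F : numFieldType) (p a1 : nat) (b : 'I_p -> nat).
Variables (z dz : 'I_p -> F) (c dc : 'I_p -> nat -> F).
Hypotheses (z0 : forall j, z j != 0) (hb : forall j, (1 <= b j)%N).

Lemma poly_eq_off (r q : {poly F}) :
  (forall y, (forall j, y != z j) -> r.[y] = q.[y]) -> r = q.
Proof.
move=> H; pose m := \prod_j ('X - (z j)%:P).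
have m0 : m != 0 by apply/prodf_neq0 => j _; rewrite polyXsubC_eq0.
apply/eqP; rewrite -subr_eq0 -(inj_eq (mulfI m0)) mulr0; apply/negPn/negP => rn0.
pose s : seq F := [seq i%:R | i <- iota 0 (size (m * (r - q)))].
have su : uniq s by rewrite map_inj_uniq ?iota_uniq // => i k /eqP; rewrite eqr_nat => /eqP.
have sr : all (root (m * (r - q))) s.
  apply/allP => y _; rewrite rootE hornerM /m horner_prod.
  have [/existsP[j /eqP yj]|/existsPn Hy] := boolP [exists j, y == z j].
    by rewrite (bigD1 j) //= hornerXsubC yj subrr !mul0r.
  by rewrite !hornerE H ?subrr ?mulr0.
by have := max_poly_roots rn0 sr su; rewrite size_map size_iota ltnn.
Qed.

Lemma coefM_top (r q : {poly F}) m n : (size r <= m.+1)%N -> (size q <= n.+1)%N ->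
  (r * q)`_(m + n) = r`_m * q`_n.
Proof.
move=> Hr Hq; rewrite coefM.
have Hm : (m < (m + n).+1)%N by rewrite ltnS leq_addr.
rewrite (bigD1 (Ordinal Hm)) //= addKn big1 ?addr0 // => i im.
have [h|h] := leqP i m.
  rewrite [q`_ _]nth_default ?mulr0 //; apply: leq_trans Hq _.
  have : (i < m)%N by rewrite ltn_neqAle h andbT; apply: contraNneq im => e; apply/eqP/val_inj.
  by lia.
by rewrite nth_default ?mul0r //; exact: leq_trans Hr _.
Qed.

(** Numerator of the derivative of [r / q] over [q ^+ 2]. *)
Definition wr (r q : {poly F}) := r^`() * q - r * q^`().

Lemma wr_sum (I : Type) (s : seq I) (G : I -> {poly F}) q :
  wr (\sum_(i <- s) G i) q = \sum_(i <- s) wr (G i) q.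
Proof.
elim/big_rec2: _ => [|i x y _ <-]; first by rewrite /wr deriv0 !mul0r subrr.
by rewrite /wr derivD !mulrDl opprD addrACA.
Qed.

Lemma wrZ (k : F) r q : wr (k *: r) q = k *: wr r q.
Proof. by rewrite /wr derivZ scalerBr !scalerAl. Qed.

(** The derivative of [r / P] is ['X^a1 * S / P ^+ 2]. Top coefficients show that [r] has degree at
    most [a1], low ones that [r / P] is constant up to order [a1] at 0; together they leave only
    multiples of the truncation of [P]. *)
Lemma wronskian_truncated (P r S : {poly F}) :
  (0 < size P)%N -> (size r < size P)%N -> (size S < size P)%N -> P`_0 != 0 ->
  wr r P = 'X^a1 * S ->
  r = (r`_0 / P`_0) *: take_poly a1.+1 P.
Proof.
move=> P0 rP SP Pn0 E.
(* The Euler operator multiplies the coefficient of degree [k] by [k], so coefficients can be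
   compared without a shift of index. *)
have coXd (q : {poly F}) k : ('X * q^`())`_k = q`_k * k%:R.
  by case: k => [|k]; rewrite coefXM ?mulr0 // coef_deriv mulr_natr.
have szXd (q : {poly F}) m : (size q <= m.+1)%N -> (size ('X * q^`())%R <= m.+1)%N.
  move=> h; apply/leq_sizeP => k mk; rewrite coXd nth_default ?mul0r //.
  exact: leq_trans h mk.
have EX q : 'X * wr q P = ('X * q^`()) * P - q * ('X * P^`()) by rewrite /wr; ring.
have XS : (polyX F) * ((polyX F) ^+ a1 * S) = S * (polyX F) ^+ a1.+1 by rewrite mulrA -exprS mulrC.
have Pd : (size P <= (size P).-1.+1)%N by rewrite prednK.
have top m : (a1 < m)%N -> (size r <= m.+1)%N -> r`_m = 0.
  move=> am Hm; have := congr1 (fun q : {poly F} => ('X * q)`_(m + (size P).-1)) E.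
  rewrite EX coefB (@coefM_top ('X * r^`())) ?szXd // (@coefM_top r) ?szXd // !coXd.
  rewrite XS coefMXn ifF; last by apply/negbTE; rewrite -leqNgt; lia.
  rewrite [S`_ _]nth_default; last by move: SP am P0; move: (size S) (size P) => s q *; lia.
  rewrite mulrA [X in _ - X]mulrAC -mulrBl -mulrBr => /eqP.
  rewrite !mulf_eq0 -/(lead_coef P) lead_coef_eq0 -size_poly_eq0 (gtn_eqF P0) orbF.
  have [->|rm] /= := eqVneq r`_m 0 => //.
  rewrite subr_eq0 eqr_nat => /eqP mP.
  have : r`_m = 0 by rewrite nth_default // mP -ltnS prednK.
  by move/eqP; rewrite (negbTE rm).
have hi k : (a1 < k)%N -> r`_k = 0.
  have [n] := ubnP (size r - k)%N; elim: n k => // n IH k Hn ak.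
  apply: top => //; apply/leq_sizeP => i ki.
  have [h|h] := leqP (size r) i; first by rewrite nth_default.
  by apply: IH; lia.
set e := _ / _; pose r0 := r - e *: P.
have E0 : wr r0 P = 'X^a1 * S.
  by rewrite -E /wr /r0 derivB derivZ -!mul_polyC; ring.
have lo k : (k <= a1)%N -> r0`_k = 0.
  have [n] := ubnP k; elim: n k => // n IH k kn ka.
  case: k kn ka => [|k] kn ka; first by rewrite /r0 coefB coefZ /e divfK // subrr.
  have lt (i : 'I_k.+1) : (i < n)%N /\ (i <= a1)%N.
    by have := ltn_ord i; split; [apply: leq_trans (ltn_ord i) _ | apply: leq_trans (ltnW (ltn_ord i)) _].
  have := congr1 (fun q : {poly F} => ('X * q)`_k.+1) E0.
  rewrite EX coefB XS coefMXn ltnS ka !coefM.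
  rewrite big_ord_recr /= big1 => [|i _]; last by case: (lt i) => ? ?; rewrite coXd IH ?mul0r ?mul0r.
  rewrite big_ord_recr /= big1 => [|i _]; last by case: (lt i) => ? ?; rewrite IH ?mul0r.
  rewrite !add0r subnn !coXd mulr0 mulr0 subr0 => /eqP.
  by rewrite !mulf_eq0 (negbTE Pn0) orbF pnatr_eq0 orbF => /eqP.
apply/polyP => k; rewrite coefZ coef_take_poly ltnS.
have [ka|ka] := leqP k a1; last by rewrite mulr0 hi.
by apply/eqP; rewrite -subr_eq0 -coefZ -coefB lo.
Qed.

Definition polP : {poly F} := \prod_j ('X - (z j)%:P) ^+ b j.
Definition polA j : {poly F} := \prod_(i | i != j) ('X - (z i)%:P) ^+ b i.
(** For [m <= b j] this is [polP] divided by [m] factors at [z j]: sums of pole terms become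
    polynomials over the common denominator [polP]. *)
Definition polB j m : {poly F} := polA j * ('X - (z j)%:P) ^+ (b j - m).

Lemma polPE j : polP = polA j * ('X - (z j)%:P) ^+ b j.
Proof. by rewrite /polP (bigD1 j) //= mulrC. Qed.

Lemma polP_horner y : polP.[y] = \prod_j (y - z j) ^+ b j.
Proof. by rewrite horner_prod; apply: eq_bigr => j _; rewrite !hornerE. Qed.

Lemma size_polP : size polP = (\sum_j b j).+1.
Proof.
rewrite size_prod; last by move=> j _; rewrite expf_neq0 // polyXsubC_eq0.
under eq_bigr => j _ do rewrite size_exp_XsubC -addn1.
by rewrite big_split /= sum1_card -addSn addnK.
Qed.

Lemma polP_neq0 : polP != 0.
Proof. by rewrite -size_poly_eq0 size_polP. Qed.

Lemma size_polB j m : (0 < m)%N -> (size (polB j m) < size polP)%N.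
Proof.
move=> m0; have An0 : polA j != 0.
  by apply/prodf_neq0 => i _; rewrite expf_neq0 // polyXsubC_eq0.
have un0 k : ('X - (z j)%:P) ^+ k != 0 :> {poly F} by rewrite expf_neq0 // polyXsubC_eq0.
rewrite (polPE j) /polB !size_mul // !size_exp_XsubC.
by have := hb j; rewrite -size_poly_gt0 in An0; lia.
Qed.

Lemma polB_horner j m y : (m <= b j)%N -> y != z j ->
  (polB j m).[y] = polP.[y] * (y - z j) ^- m.
Proof.
move=> mb yz; have y0 : y - z j != 0 by rewrite subr_eq0.
rewrite (polPE j) !hornerE -mulrA; congr (_ * _).
rewrite -{2}(subnK mb) exprD mulfK ?expf_neq0 //.
Qed.

Lemma polB_root i j m : j != i -> (polB i m).[z j] = 0.
Proof.
move=> ji; rewrite /polB hornerM /polA (bigD1 j) //= hornerM horner_exp hornerXsubC subrr.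
by rewrite expr0n gtn_eqF ?hb // !mul0r.
Qed.

Lemma polB_lower j m : (m < b j)%N -> (polB j m).[z j] = 0.
Proof.
move=> mb; rewrite /polB hornerM horner_exp hornerXsubC subrr expr0n subn_eq0.
by rewrite leqNgt mb mulr0.
Qed.

Lemma polB_full j : (polB j (b j)).[z j] = (polA j).[z j].
Proof. by rewrite /polB subnn expr0 mulr1. Qed.

Lemma polB_wr j m y : (m <= b j)%N -> y != z j ->
  (wr (polB j m) polP).[y] = - m%:R * polP.[y] ^+ 2 * (y - z j) ^- m.+1.
Proof.
move=> mb yz; have y0 : y - z j != 0 by rewrite subr_eq0.
pose u := y - z j; rewrite -/u in y0 *.
have dX k : ((('X - (z j)%:P) ^+ k)^`()).[y] = u ^+ k.-1 * k%:R.
  by rewrite deriv_exp derivXsubC hornerMn mul1r -mulr_natr horner_exp hornerXsubC.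
have uX k : (('X - (z j)%:P) ^+ k).[y] = u ^+ k by rewrite horner_exp hornerXsubC.
rewrite /wr (polPE j) /polB !derivM hornerD hornerN !hornerM !hornerD !hornerM !dX !uX.
have [n ->] : exists n, b j = (n + m)%N by exists (b j - m)%N; rewrite subnK.
rewrite addnK.
set A := (polA j).[y]; set A' := _.[y].
have Hn k : u ^+ k.-1 * k%:R * u = u ^+ k * k%:R.
  by case: k => [|k]; rewrite ?mulr0 ?mul0r //= mulrAC -exprSr.
apply: (mulIf y0); rewrite mulrBl.
have -> : (A' * u ^+ n + A * (u ^+ n.-1 * n%:R)) * (A * u ^+ (n + m)) * u =
  (A' * u ^+ n * u + A * (u ^+ n.-1 * n%:R * u)) * (A * u ^+ (n + m)) by ring.
have -> : A * u ^+ n * (A' * u ^+ (n + m) + A * (u ^+ (n + m).-1 * (n + m)%:R)) * u =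
  A * u ^+ n * (A' * u ^+ (n + m) * u + A * (u ^+ (n + m).-1 * (n + m)%:R * u)) by ring.
rewrite !Hn natrD -[1 *- m]/(- m%:R) [u ^+ m.+1]exprS exprD; field.
by rewrite expf_neq0.
Qed.

(** [dcE] is [cE] differentiated in a parameter along which the poles move with velocity [dz] and
    the coefficients with velocity [dc]; [dc0] keeps the residues constant and [dcb] keeps the pole
    orders. *)
Hypotheses (cE : forall y, (forall j, y != z j) ->
    \sum_j \sum_(k < b j) c j k * (y - z j) ^- k.+1 = y ^+ a1 / \prod_j (y - z j) ^+ b j)
  (dcE : forall y, (forall j, y != z j) ->
    \sum_j \sum_(k < b j) (dc j k * (y - z j) ^- k.+1 + k.+1%:R * c j k * dz j * (y - z j) ^- k.+2) =
    y ^+ a1 / \prod_j (y - z j) ^+ b j * \sum_j (b j)%:R * dz j / (y - z j))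
  (dc0 : forall j, dc j 0 = 0) (dcb : forall j, dc j (b j) = 0).

(** The primitive [r / polP] in [isoresidual_dz] vanishes at infinity and is [- dtau] at 0, so this
    is the derivative of the integral from 0 to infinity; compare [tau_cderiv]. *)
Definition dtau : F := \sum_j \sum_(k < b j) (dc j k.+1 / k.+1%:R + c j k * dz j) * (- z j) ^- k.+1.

(* With residues constant, the derivative of the form is exact; its primitive
   r / P vanishes to high order at infinity and is constant to high order at 0,
   which forces r to be a multiple of the truncation of P. *)
Lemma isoresidual_dz j : dz j = - dtau * (z j * (drop_poly a1.+1 polP).[z j]).
Proof.
pose r : {poly F} := \sum_j \sum_(k < b j) (- (dc j k.+1 / k.+1%:R) - c j k * dz j) *: polB j k.+1.
pose S : {poly F} := \sum_j ((b j)%:R * dz j) *: polB j 1.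
have sz (G : 'I_p -> {poly F}) : (forall j, (size (G j) < size polP)%N) ->
    (size (\sum_j G j)%R < size polP)%N.
  move=> H; apply: leq_ltn_trans (size_sum _ _ _) _.
  elim/big_rec: _ => [|i m _ IH]; first by rewrite size_poly_gt0 polP_neq0.
  by rewrite gtn_max H.
have szr : (size r < size polP)%N.
  apply: sz => i; apply: leq_ltn_trans (size_sum _ _ _) _.
  elim/big_rec: _ => [|k m _ IH]; first by rewrite size_poly_gt0 polP_neq0.
  by rewrite gtn_max IH andbT; apply: leq_ltn_trans (size_scale_leq _ _) _; exact: size_polB.
have szS : (size S < size polP)%N.
  by apply: sz => i; apply: leq_ltn_trans (size_scale_leq _ _) _; exact: size_polB.
have P00 : polP`_0 != 0.
  rewrite -horner_coef0 polP_horner; apply/prodf_neq0 => i _.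
  by rewrite sub0r expf_neq0 // oppr_eq0.
have E : wr r polP = 'X^a1 * S.
  apply: poly_eq_off => y yz.
  have y0 i : y - z i != 0 by rewrite subr_eq0.
  have Py0 : polP.[y] != 0 by rewrite polP_horner; apply/prodf_neq0 => i _; rewrite expf_neq0.
  rewrite hornerM hornerXn /S horner_sum.
  have -> : \sum_i (((b i)%:R * dz i) *: polB i 1).[y] =
      polP.[y] * \sum_i (b i)%:R * dz i / (y - z i).
    by rewrite mulr_sumr; apply: eq_bigr => i _; rewrite hornerZ polB_horner // expr1; ring.
  have -> : y ^+ a1 * (polP.[y] * \sum_i (b i)%:R * dz i / (y - z i)) =
     polP.[y] ^+ 2 * (y ^+ a1 / polP.[y] * \sum_i (b i)%:R * dz i / (y - z i)) by field.
  rewrite {2}polP_horner -dcE //.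
  rewrite /r wr_sum horner_sum mulr_sumr; apply: eq_bigr => i _.
  rewrite wr_sum horner_sum mulr_sumr.
  (* The index of [dc] moves up by one, as [dc] vanishes at both ends of the range; each term then
     is a derivative of a term of [r / polP], up to the factor [polP.[y] ^+ 2]. *)
  have -> : \sum_(k < b i) polP.[y] ^+ 2 *
      (dc i k * (y - z i) ^- k.+1 + k.+1%:R * c i k * dz i * (y - z i) ^- k.+2) =
    \sum_(k < b i) polP.[y] ^+ 2 *
      (dc i k.+1 * (y - z i) ^- k.+2 + k.+1%:R * c i k * dz i * (y - z i) ^- k.+2).
    under eq_bigr => k _ do rewrite mulrDr; rewrite big_split /=.
    under [RHS]eq_bigr => k _ do rewrite mulrDr; rewrite [RHS]big_split /=; congr (_ + _).
    rewrite -!mulr_sumr; congr (_ * _).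
    have := hb i; case Eb : (b i) => [//|m] _.
    rewrite big_ord_recl [RHS]big_ord_recr /= dc0 mul0r add0r -Eb dcb mul0r addr0.
    by apply: eq_bigr => k _; rewrite /bump /= add1n.
  apply: eq_bigr => k _.
  have k0 : k.+1%:R != 0 :> F by rewrite pnatr_eq0.
  rewrite wrZ hornerZ polB_wr //; move: k0 (expf_neq0 k.+2 (y0 i)).
  move: (k.+1%:R : F) ((y - z i) ^+ k.+2) => K U K0 U0.
  by field; rewrite K0 U0.
have := wronskian_truncated _ szr szS P00 E; rewrite size_poly_gt0 polP_neq0 => /(_ isT) rE.
(* At [z j] only the term of highest pole order there survives. *)
have rzj : r.[z j] = - (c j (b j).-1 * dz j) * (polA j).[z j].
  rewrite /r horner_sum (bigD1 j) //= [X in _ + X]big1 ?addr0; last first.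
    move=> i ij; rewrite horner_sum big1 // => k _.
    by rewrite hornerZ polB_root ?mulr0 // eq_sym.
  have := hb j; case Eb : (b j) => [//|m] _.
  rewrite big_ord_recr /= hornerD horner_sum big1 ?add0r; last first.
    by move=> k _; rewrite hornerZ polB_lower ?mulr0 // Eb ltnS.
  by rewrite hornerZ -Eb polB_full dcb mul0r oppr0 sub0r.
have czj : c j (b j).-1 * (polA j).[z j] = z j ^+ a1.
  have X1 : 'X^a1 = \sum_j \sum_(k < b j) c j k *: polB j k.+1 :> {poly F}.
    apply: poly_eq_off => y yz.
    have Py0 : polP.[y] != 0.
      by rewrite polP_horner; apply/prodf_neq0 => i _; rewrite expf_neq0 // subr_eq0.
    rewrite hornerXn horner_sum; apply: (mulIf (invr_neq0 Py0)).
    rewrite {1}polP_horner -cE // mulr_suml; apply: eq_bigr => i _.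
    rewrite horner_sum mulr_suml; apply: eq_bigr => k _.
    by rewrite hornerZ polB_horner //; field; rewrite Py0 expf_neq0 // subr_eq0.
  rewrite -hornerXn X1 horner_sum (bigD1 j) //= [X in _ + X]big1 ?addr0; last first.
    move=> i ij; rewrite horner_sum big1 // => k _.
    by rewrite hornerZ polB_root ?mulr0 // eq_sym.
  have := hb j; case Eb : (b j) => [//|m] _.
  rewrite big_ord_recr /= hornerD horner_sum big1 ?add0r; last first.
    by move=> k _; rewrite hornerZ polB_lower ?mulr0 // Eb ltnS.
  by rewrite hornerZ -Eb polB_full.
have r0 : r`_0 = - dtau * polP`_0.
  rewrite -!horner_coef0 /r horner_sum /dtau -sumrN mulr_suml; apply: eq_bigr => i _.
  rewrite horner_sum -sumrN mulr_suml; apply: eq_bigr => k _.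
  by rewrite hornerZ polB_horner ?sub0r 1?eq_sym //; ring.
(* [polP] vanishes at [z j], so its low part can be traded for its high part, whose factor
   [z j ^+ a1.+1] absorbs the [z j ^+ a1] of the other side. *)
have Pz : (take_poly a1.+1 polP).[z j] = - (z j ^+ a1.+1 * (drop_poly a1.+1 polP).[z j]).
  have : polP.[z j] = 0.
    by rewrite polP_horner (bigD1 j) //= subrr expr0n gtn_eqF ?hb // mul0r.
  rewrite -{1}(poly_take_drop a1.+1 polP) hornerD hornerM hornerXn => /eqP.
  by rewrite addr_eq0 => /eqP ->; rewrite mulrC.
have := congr1 (fun q : {poly F} => q.[z j]) rE; rewrite rzj hornerZ Pz r0 mulfK //.
have -> : - (c j (b j).-1 * dz j) * (polA j).[z j] = - (z j ^+ a1 * dz j) by rewrite -czj; ring.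
move=> H; apply: (mulfI (expf_neq0 a1 (z0 j))); apply: oppr_inj; rewrite H exprS; ring.
Qed.

End IsoresidualVariation.

(** * Lipschitz bounds for polynomial maps *)

Section LipschitzOnBounded.
Variables (R : realType) (I : Type).
Implicit Types (f g : (I -> Cx R) -> Cx R) (v : I -> Cx R).

(** Boundedness is demanded together with the Lipschitz property, on balls of the sup norm, to make
    the class stable under products. *)
Definition lip_bdd f : Prop :=
  forall B : R, exists2 K : R, 0 <= K & forall v v', (forall i, nz (v i) <= B) ->
    (forall i, nz (v' i) <= B) -> nz (f v) <= K /\
    forall d : R, 0 <= d -> (forall i, nz (v i - v' i) <= d) -> nz (f v - f v') <= K * d.

Lemma lip_bdd_cst c : lip_bdd (fun=> c).
Proof.
move=> B; exists (nz c) => [|v v' _ _]; first exact: nz_ge0.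
by split=> // d d0 Hd; rewrite subrr nz0 mulr_ge0 ?nz_ge0.
Qed.

Lemma lip_bdd_coord i : lip_bdd (fun v => v i).
Proof.
move=> B; exists (`|B| + 1) => [|v v' H _]; first by rewrite addr_ge0.
split=> [|d d0 Hd]; first by apply: le_trans (H i) _; rewrite (le_trans (ler_norm B)) // lerDl.
by apply: le_trans (Hd i) _; rewrite ler_peMl // lerDr.
Qed.

Lemma lip_bddD f g : lip_bdd f -> lip_bdd g -> lip_bdd (fun v => f v + g v).
Proof.
move=> Hf Hg B; have [K K0 HK] := Hf B; have [M M0 HM] := Hg B.
exists (K + M) => [|v v' Bv Bv']; first exact: addr_ge0.
have [f1 f2] := HK v v' Bv Bv'; have [g1 g2] := HM v v' Bv Bv'.
split=> [|d d0 Hd]; first by apply: le_trans (nzD _ _) _; lra.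
rewrite opprD addrACA; apply: le_trans (nzD _ _) _; rewrite mulrDl.
by apply: lerD; [exact: f2|exact: g2].
Qed.

Lemma lip_bddM f g : lip_bdd f -> lip_bdd g -> lip_bdd (fun v => f v * g v).
Proof.
move=> Hf Hg B; have [K K0 HK] := Hf B; have [M M0 HM] := Hg B.
exists (K * M + K * M) => [|v v' Bv Bv']; first by rewrite addr_ge0 ?mulr_ge0.
have [f1 f2] := HK v v' Bv Bv'; have [g1 g2] := HM v v' Bv Bv'.
have [f3 _] := HK v' v Bv' Bv.
have n1 := nz_ge0 (f v); have n2 := nz_ge0 (g v); have n3 := nz_ge0 (f v').
split=> [|d d0 Hd]; first by rewrite nzM; nra.
have -> : f v * g v - f v' * g v' = (f v - f v') * g v + f v' * (g v - g v') by ring.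
apply: le_trans (nzD _ _) _; rewrite !nzM.
have {}f2 := f2 d d0 Hd; have {}g2 := g2 d d0 Hd.
have n4 := nz_ge0 (f v - f v'); have n5 := nz_ge0 (g v - g v').
have h1 : nz (f v - f v') * nz (g v) <= (K * d) * M by apply: ler_pM.
have h2 : nz (f v') * nz (g v - g v') <= K * (M * d) by apply: ler_pM.
by lra.
Qed.

Lemma lip_bdd_sum (T : Type) (s : seq T) (P : pred T) (f : T -> (I -> Cx R) -> Cx R) :
  (forall t, lip_bdd (f t)) -> lip_bdd (fun v => \sum_(t <- s | P t) f t v).
Proof.
move=> H; elim: s => [|t s IH].
  by under eq_fun => v do rewrite big_nil; exact: lip_bdd_cst.
under eq_fun => v do rewrite big_cons.
by case: (P t) => //; exact: lip_bddD.
Qed.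

Lemma lip_bddX f n : lip_bdd f -> lip_bdd (fun v => f v ^+ n).
Proof.
move=> H; elim: n => [|n IH]; first exact: lip_bdd_cst.
by under eq_fun => v do rewrite exprS; exact: lip_bddM.
Qed.

Definition lip_poly (q : (I -> Cx R) -> {poly Cx R}) : Prop :=
  forall k, lip_bdd (fun v => (q v)`_k).

Lemma lip_poly_cst c : lip_poly (fun=> c).
Proof. by move=> k; exact: lip_bdd_cst. Qed.

Lemma lip_polyM q r : lip_poly q -> lip_poly r -> lip_poly (fun v => q v * r v).
Proof.
move=> Hq Hr k; under eq_fun => v do rewrite coefM.
by apply: (@lip_bdd_sum _ _ _ (fun (i : 'I_k.+1) v => (q v)`_i * (r v)`_(k - i))) => i; exact: lip_bddM.
Qed.

Lemma lip_polyX q n : lip_poly q -> lip_poly (fun v => q v ^+ n).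
Proof.
move=> H; elim: n => [|n IH]; first exact: lip_poly_cst.
by under eq_fun => v do rewrite exprS; exact: lip_polyM.
Qed.

Lemma lip_poly_prod (T : Type) (s : seq T) (q : T -> (I -> Cx R) -> {poly Cx R}) :
  (forall t, lip_poly (q t)) -> lip_poly (fun v => \prod_(t <- s) q t v).
Proof.
move=> H; elim: s => [|t s IH].
  by under eq_fun => v do rewrite big_nil; exact: lip_poly_cst.
by under eq_fun => v do rewrite big_cons; exact: lip_polyM.
Qed.

Lemma lip_poly_XsubC i : lip_poly (fun v => 'X - (v i)%:P).
Proof.
move=> k; under eq_fun => v do rewrite coefB coefC -mulN1r.
apply: lip_bddD; first exact: lip_bdd_cst.
apply: lip_bddM; first exact: lip_bdd_cst.
by case: (k == 0)%N; [exact: lip_bdd_coord|exact: lip_bdd_cst].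
Qed.

End LipschitzOnBounded.

Lemma cderiv_invX (R : realType) (f : Cx R -> Cx R) n (z d : Cx R) :
  f z != 0 -> cderiv f z d -> cderiv (fun s => f s ^- n) z (- n%:R * d * f z ^- n.+1).
Proof.
move=> f0 df; have := @cderivV _ (fun s => f s ^+ n) _ _ (expf_neq0 n f0) (cderivX n df).
congr (cderiv _ _ _); case: n => [|n]; first by rewrite !mul0r oppr0 !mul0r.
by rewrite /= !exprS; field; rewrite expf_neq0 // f0.
Qed.

(** * The autonomous equation of an isoresidual family *)

Section IsoresidualField.
Variables (R : realType) (p : nat) (a : 'I_2 -> nat) (b : 'I_p -> nat).
Implicit Types (z : 'I_p -> Cx R).

Local Notation a1 := (a ord0).
Local Notation a2 := (a ord_max).

(** Velocity of the poles in the time [tau]: [isoresidual_dz] reads [dz j = dtau * ifield z j]. It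
    is polynomial in [z], so nothing blows up even where poles collide. *)
Definition ifield z j : Cx R := - (z j * (drop_poly a1.+1 (polP b z)).[z j]).

(** The first bound will keep poles away from 0, the second will keep them apart, the third gives
    uniqueness of solutions. All are instances of one Lipschitz bound, once the point of evaluation
    is made a variable of its own. *)
Lemma ifield_lip (B : R) : exists2 K : R, 0 < K &
  forall z, (forall j, nz (z j) <= B) ->
    [/\ forall j, nz (ifield z j) <= K * nz (z j),
        forall i j, nz (ifield z i - ifield z j) <= K * nz (z i - z j) &
        forall z' j (d : R), (forall j, nz (z' j) <= B) -> (forall i, nz (z i - z' i) <= d) ->
          nz (ifield z j - ifield z' j) <= K * d].
Proof.
pose F (v : option 'I_p -> Cx R) : Cx R :=
  - (v None * (drop_poly a1.+1 (polP b (v \o Some))).[v None]).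
have LF : lip_bdd F.
  rewrite /F; under eq_fun => v do rewrite -mulN1r.
  apply: lip_bddM; first exact: lip_bdd_cst.
  apply: lip_bddM; first exact: lip_bdd_coord.
  have S (v : option 'I_p -> Cx R) : (size (drop_poly a1.+1 (polP b (v \o Some))) <= (\sum_j b j).+1)%N.
    by rewrite size_drop_poly (leq_trans (leq_subr _ _)) // size_polP.
  under eq_fun => v do rewrite (horner_coef_wide _ (S v)).
  apply: (@lip_bdd_sum _ _ _ _ _ (fun (i : 'I__) v => (drop_poly a1.+1 (polP b (v \o Some)))`_i * v None ^+ i)) => i.
  apply: lip_bddM; last by apply: lip_bddX; exact: lip_bdd_coord.
  under eq_fun => v do rewrite coef_drop_poly.
  apply: (@lip_poly_prod _ _ _ _ (fun j v => ('X - (v (Some j))%:P) ^+ b j)) => j.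
  by apply: lip_polyX; exact: lip_poly_XsubC.
have [K K0 HK] := LF `|B|.
pose ex z (y : Cx R) (o : option 'I_p) := if o is Some j then z j else y.
have Fex z j : F (ex z (z j)) = ifield z j by [].
have F0 z : F (ex z 0) = 0 by rewrite /F mul0r oppr0.
exists (K + 1) => [|z Bz]; first by rewrite ltr_wpDl.
have Bz' j : nz (z j) <= `|B| by exact: le_trans (Bz j) (ler_norm _).
have Bex y : nz y <= `|B| -> forall o, nz (ex z y o) <= `|B| by move=> By [j|] /=.
have dex y y' d : 0 <= d -> nz (y - y') <= d -> forall o, nz (ex z y o - ex z y' o) <= d.
  by move=> d0 H [j|] //=; rewrite subrr nz0.
have KK (d : R) : 0 <= d -> K * d <= (K + 1) * d by move=> d0; rewrite ler_wpM2r // lerDl.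
split=> [j|i j|z' j d Bz2 Hd].
- have [_ H] := HK _ _ (Bex _ (Bz' j)) (Bex 0 (eq_ind_r (fun x => x <= _) (normr_ge0 _) (nz0 R))).
  apply: le_trans (KK _ (nz_ge0 _)); rewrite -Fex -[F _]subr0 -(F0 z).
  by apply: H; rewrite ?nz_ge0 //; apply: dex; rewrite ?nz_ge0 // subr0.
- have [_ H] := HK _ _ (Bex _ (Bz' i)) (Bex _ (Bz' j)).
  apply: le_trans (KK _ (nz_ge0 _)); rewrite -!Fex.
  by apply: H; rewrite ?nz_ge0 //; apply: dex; rewrite ?nz_ge0.
have d0 : 0 <= d by exact: le_trans (nz_ge0 _) (Hd j).
apply: le_trans (KK _ d0); rewrite -!Fex.
have [|_ H] := HK (ex z (z j)) (ex z' (z' j)) (Bex _ (Bz' j)).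
  by case=> [i|] /=; exact: le_trans (Bz2 _) (ler_norm _).
by apply: H => // -[i|] /=.
Qed.

Hypothesis hb : forall j, (1 <= b j)%N.
Hypothesis hab : (\sum_(i < 2) a i + 2 = \sum_(j < p) b j)%N.

Definition zfiber (lam : 'I_p -> Cx R) z : Prop :=
  [/\ injective z, forall j, z j != 0 & forall j, two_pi_i R * cf a b z j 0 = lam j].

(** The residues sum to 0, so a common shift is invisible; thus logarithms of [z j] serve as well as
    those of [- z j], which integration from 0 would produce. *)
Lemma tau_shift z L l : tau a b z (fun j => L j + l) = tau a b z L.
Proof.
rewrite /tau; congr (_ - _); under eq_bigr => j _ do rewrite mulrDr.
by rewrite big_split /= -mulr_suml cf_sum0 // mul0r addr0.
Qed.

Lemma b_lt_deg j : (b j <= deg a)%N.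
Proof. by rewrite (degE hab) (bigD1 j) //= leq_addr. Qed.

Lemma sum_deg_cut (G : 'I_p -> nat -> Cx R) : (forall j k, (b j <= k)%N -> G j k = 0) ->
  \sum_j \sum_(k < deg a) G j k = \sum_j \sum_(k < b j) G j k.
Proof.
move=> H; apply: eq_bigr => j _.
rewrite (big_ord_widen _ (G j) (b_lt_deg j)) [LHS](bigID (fun k : 'I_(deg a) => (k < b j)%N)) /=.
by rewrite [X in _ + X]big1 ?addr0 // => k; rewrite -leqNgt => /H.
Qed.

Lemma tau_cderiv (Z L : 'I_p -> Cx R -> Cx R) s (dz : 'I_p -> Cx R) (dc : 'I_p -> nat -> Cx R) :
  injective (fun j => Z j s) -> (forall j, Z j s != 0) ->
  (forall j, cderiv (Z j) s (dz j)) -> (forall j, cderiv (L j) s (dz j / Z j s)) ->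
  (forall j k, cderiv (fun s' => cf a b (fun j => Z j s') j k) s (dc j k)) ->
  (forall j, dc j 0 = 0) -> (forall j k, (b j <= k)%N -> dc j k = 0) ->
  cderiv (fun s' => tau a b (fun j => Z j s') (fun j => L j s')) s
    (dtau b (fun j => Z j s) dz (cf a b (fun j => Z j s)) dc).
Proof.
move=> zI z0 dZ dL dC dc0 dcb; pose c := cf a b (fun j => Z j s).
have dV j k : cderiv (fun s' => (- Z j s') ^- k.+1) s (k.+1%:R * dz j * (- Z j s) ^- k.+2).
  have n0 : - Z j s != 0 by rewrite oppr_eq0.
  by have := @cderiv_invX _ (fun s => - Z j s) k.+1 _ _ n0 (cderivN (dZ j)); rewrite mulrNN.
have D1 : cderiv (fun s' => \sum_j \sum_(k < (deg a).-1)
     cf a b (fun j => Z j s') j k.+1 / k.+1%:R * (- Z j s') ^- k.+1) s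
   (\sum_j \sum_(k < (deg a).-1) (dc j k.+1 / k.+1%:R * (- Z j s) ^- k.+1 +
        c j k.+1 / k.+1%:R * (k.+1%:R * dz j * (- Z j s) ^- k.+2))).
  apply: (@cderiv_sum _ _ _ _ (fun j s' => \sum_(k < (deg a).-1) _)) => j _.
  apply: (@cderiv_sum _ _ _ _ (fun (k : 'I__) s' => cf a b (fun j => Z j s') j k.+1 / k.+1%:R * (- Z j s') ^- k.+1)) => k _.
  apply: cderivM (dV j k); have := cderivM (dC j k.+1) (cderiv_cst (k.+1%:R)^-1 s).
  by rewrite mulr0 addr0.
have D2 : cderiv (fun s' => \sum_j cf a b (fun j => Z j s') j 0 * L j s') s
    (\sum_j (dc j 0 * L j s + c j 0 * (dz j / Z j s))).
  apply: (@cderiv_sum _ _ _ _ (fun j s' => cf a b (fun j => Z j s') j 0 * L j s')) => j _.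
  exact: cderivM (dC j 0) (dL j).
have := cderivB D1 D2; congr (cderiv _ _ _).
rewrite /dtau -/c -(@sum_deg_cut (fun j k => (dc j k.+1 / k.+1%:R + c j k * dz j) * (- Z j s) ^- k.+1)); last first.
  by move=> j k jk; rewrite /c cf_mult // dcb ?(leqW jk) // !mul0r addr0 mul0r.
rewrite -sumrB; apply: eq_bigr => j _; rewrite dc0 mul0r add0r.
have E : deg a = (deg a).-1.+1 by [].
have -> : \sum_(k < deg a) (dc j k.+1 / k.+1%:R + c j k * dz j) * (- Z j s) ^- k.+1 =
   \sum_(k < deg a) dc j k.+1 / k.+1%:R * (- Z j s) ^- k.+1 +
   \sum_(k < deg a) c j k * dz j * (- Z j s) ^- k.+1.
  by rewrite -big_split /=; apply: eq_bigr => k _; rewrite mulrDl.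
rewrite big_split /= -addrA; congr (_ + _).
  by rewrite [RHS]big_ord_recr /= dcb ?mul0r ?addr0 ?b_lt_deg.
rewrite [RHS]big_ord_recl /= addrC expr1 invrN mulrN -mulrA; congr (_ + _).
apply: eq_bigr => k _; rewrite /bump /= add1n.
by rewrite !mulrA divfK ?pnatr_eq0.
Qed.

(** The continuous logarithms are differentiable by [cderiv_log], which identifies [h] with [dtau].
    Differentiating both sides of [cf_eval] along the family at a fixed [y] supplies the hypothesis
    [dcE] of [isoresidual_dz]. *)
Lemma tau_ode lam (Z L : 'I_p -> Cx R -> Cx R) s h :
  (\forall s' \near s, zfiber lam (fun j => Z j s')) ->
  (forall j, exists d, cderiv (Z j) s d) ->
  (\forall s' \near s, forall j, cexp (L j s') = Z j s') ->
  (forall j, {for s, continuous (L j)}) ->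
  cderiv (fun s' => tau a b (fun j => Z j s') (fun j => L j s')) s h ->
  forall j, cderiv (Z j) s (h * ifield (fun j => Z j s) j).
Proof.
move=> Hf Hd HL cL Ht.
have [zI z0 _] := nbhs_singleton Hf.
have /choice[dz dZ] := Hd.
have /choice[dc' dC'] : forall jk : 'I_p * nat, exists d,
    cderiv (fun s' => cf a b (fun j => Z j s') jk.1 jk.2) s d.
  by move=> [j k] /=; exact: cf_cderiv.
pose dc j k := dc' (j, k).
have dC j k : cderiv (fun s' => cf a b (fun j => Z j s') j k) s (dc j k) by exact: dC' (j, k).
have dc0 j : dc j 0 = 0.
  apply: cderiv_unique (dC j 0) _; apply: cderiv_ext (cderiv_cst (lam j / two_pi_i R) s).
  apply: filterS Hf => s' [_ _ /(_ j) <-].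
  by rewrite mulrAC divff ?mul1r // two_pi_i_neq0.
have dcb j k : (b j <= k)%N -> dc j k = 0.
  move=> jk; apply: cderiv_unique (dC j k) _; apply: cderiv_ext (cderiv_cst 0 s).
  by apply/nearC; exists 1 => // s' _; rewrite cf_mult.
have dL j : cderiv (L j) s (dz j / Z j s).
  apply: cderiv_log => //; apply: filterS HL => s' H; exact: H.
have Dt := tau_cderiv zI z0 dZ dL dC dc0 dcb.
have hE := cderiv_unique Ht Dt.
move=> j; suff -> : h * ifield (fun j => Z j s) j = dz j by [].
rewrite /ifield mulrN -mulNr hE; apply/esym.
apply: (@isoresidual_dz _ _ a1) => //.
- move=> y yz; rewrite -(sum_deg_cut (G := fun j k => cf a b (fun j => Z j s) j k * (y - Z j s) ^- k.+1)).
    exact: cf_eval.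
  by move=> i k ik; rewrite cf_mult // mul0r.
- move=> y yz.
  rewrite -(sum_deg_cut (G := fun j k => dc j k * (y - Z j s) ^- k.+1 + k.+1%:R * cf a b (fun j => Z j s) j k * dz j * (y - Z j s) ^- k.+2)); last first.
    by move=> i k ik; rewrite dcb // cf_mult // mulr0 !mul0r addr0.
  have y0 i : y - Z i s != 0 by rewrite subr_eq0.
  have dy i : cderiv (fun s' => y - Z i s') s (- dz i).
    by have := cderivB (cderiv_cst y s) (dZ i); rewrite sub0r.
  have D1 : cderiv (fun s' => \sum_i \sum_(k < deg a) cf a b (fun j => Z j s') i k * (y - Z i s') ^- k.+1) s
     (\sum_i \sum_(k < deg a) (dc i k * (y - Z i s) ^- k.+1 + k.+1%:R * cf a b (fun j => Z j s) i k * dz i * (y - Z i s) ^- k.+2)).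
    apply: (@cderiv_sum _ _ _ _ (fun i s' => \sum_(k < deg a) _)) => i _.
    apply: (@cderiv_sum _ _ _ _ (fun (k : 'I__) s' => cf a b (fun j => Z j s') i k * (y - Z i s') ^- k.+1)) => k _.
    have := cderivM (dC i k) (@cderiv_invX _ (fun s' => y - Z i s') k.+1 _ _ (y0 i) (dy i)).
    by rewrite mulrNN !mulrA [_ * k.+1%:R]mulrC.
  have HE : \forall s' \near s, y ^+ a1 * \prod_j (y - Z j s') ^- b j =
      \sum_i \sum_(k < deg a) cf a b (fun j => Z j s') i k * (y - Z i s') ^- k.+1.
    have Hy : \forall s' \near s, forall i, y != Z i s'.
      apply: (@filter_forall _ _ (fun i s' => y != Z i s') (nbhs s) _) => i.
      have := cderiv_cont (dy i) => /contC/(_ _ (eq_ind_r (fun x => is_true x) (y0 i) (nz_gt0 _)))[r r0 H].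
      apply/nearC; exists r => // s' /H; apply: contraTneq => ->.
      by rewrite subrr sub0r nzN ltxx.
    apply: filterS2 Hf Hy => s' [zI' _ _] Hy; rewrite cf_eval //.
    by rewrite prodfV.
  have D2 : cderiv (fun s' => y ^+ a1 * \prod_j (y - Z j s') ^- b j) s
      (y ^+ a1 / \prod_j (y - Z j s) ^+ b j * \sum_j (b j)%:R * dz j / (y - Z j s)).
    have P (r : seq 'I_p) : cderiv (fun s' => \prod_(j <- r) (y - Z j s') ^- b j) s
        ((\prod_(j <- r) (y - Z j s) ^- b j) * \sum_(j <- r) (b j)%:R * dz j / (y - Z j s)).
      elim: r => [|i r IH].
        under eq_fun => s' do rewrite big_nil; rewrite !big_nil mulr0; exact: cderiv_cst.
      under eq_fun => s' do rewrite big_cons; rewrite !big_cons.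
      have := cderivM (@cderiv_invX _ (fun s' => y - Z i s') (b i) _ _ (y0 i) (dy i)) IH.
      congr (cderiv _ _ _); rewrite mulrDr mulrA; congr (_ + _).
      by rewrite mulrNN exprS; field; rewrite expf_neq0 // y0.
    have := cderivZ (y ^+ a1) (P (index_enum 'I_p)); congr (cderiv _ _ _).
    by rewrite mulrA prodfV.
  exact: cderiv_unique D1 (cderiv_ext HE D2).
- by move=> i; exact: dcb.
Qed.

(** The mean replaces the farthest pole as centre of the cluster because it is holomorphic in [z]
    and involves no choice. Closeness 1/6 to the farthest pole becomes [(1/6 + 1/6) / (5/6) = 2/5]
    relative to the mean. *)
Lemma cluster_mean lam : (2 <= p)%N -> ~ resonant lam ->
  exists M : R, forall z i0, zfiber lam z -> M <= nz (z i0) ->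
    let w := (\sum_j z j) / p%:R in
    [/\ w != 0, forall j, nz (z j / w - 1) <= 1 / 2 & nz (z i0) <= 2 * nz w].
Proof.
move=> p2 nres; have [M HM] := far_poles_cluster hab p2 nres.
exists M => z i1 [zI z0 Hres] Hi1 w.
have [i0 _ Hmax] := @arg_maxP _ _ _ i1 predT (fun j => nz (z j)) isT.
have {}Hmax j : nz (z j) <= nz (z i0) by exact: Hmax.
have Hc := HM z i0 zI Hres Hmax (le_trans Hi1 (Hmax i1)).
have p0 : p%:R != 0 :> Cx R by rewrite pnatr_eq0; lia.
have pr : 0 < p%:R :> R by rewrite ltr0n; lia.
pose m := w / z i0.
have m1 : nz (m - 1) <= 1 / 6.
  have -> : m - 1 = p%:R^-1 * \sum_j (z j / z i0 - 1).
    rewrite sumrB sumr_const card_ord -mulr_suml /m /w; field.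
    by rewrite p0 z0.
  rewrite nzM nzV -[p%:R](rc_nat R) nz_rc normr_nat.
  rewrite mulrC ler_pdivrMr //; apply: le_trans (nz_sum _ _ _) _.
  apply: le_trans (ler_sum _ (fun j _ => Hc j)) _.
  by rewrite sumr_const card_ord mulr_natr.
have nm : 5 / 6 <= nz m.
  by have := nzBge 1 m; rewrite nz1 nzC; lra.
have m0 : m != 0 by rewrite -nz_gt0; lra.
have w0 : w != 0 by apply: contraNneq m0; rewrite /m => ->; rewrite mul0r.
have wE : nz w = nz m * nz (z i0) by rewrite -nzM divfK.
split=> // [j|]; last first.
  by have := Hmax i1; have := nz_ge0 (z i0); rewrite wE; nra.
have -> : z j / w - 1 = ((z j / z i0 - 1) - (m - 1)) / m.
  by rewrite /m; field; rewrite w0 z0.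
rewrite nzM nzV ler_pdivrMr ?nz_gt0 //.
by have := nzB (z j / z i0 - 1) (m - 1); have := Hc j; lra.
Qed.

End IsoresidualField.

(** * Points of the compactification *)

Section FilterLimits.
Variables (R : realType) (T : Type) (F : set_system T).
Context {FF : Filter F}.
Implicit Types (f : T -> Cx R).

Lemma cvg_mulC f g (c d : Cx R) : f t @[t --> F] --> c -> g t @[t --> F] --> d ->
  f t * g t @[t --> F] --> c * d.
Proof. exact: cvgM. Qed.

Lemma cvg_constC (c : Cx R) : (fun _ : T => c) @ F --> c.
Proof. exact: cvg_cst. Qed.

Lemma cvg_addC f g (c d : Cx R) : f t @[t --> F] --> c -> g t @[t --> F] --> d ->
  f t + g t @[t --> F] --> c + d.
Proof. exact: cvgD. Qed.

Lemma cvg_subC f g (c d : Cx R) : f t @[t --> F] --> c -> g t @[t --> F] --> d ->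
  f t - g t @[t --> F] --> c - d.
Proof. exact: cvgB. Qed.

Lemma cvg_expr f (c : Cx R) n : f t @[t --> F] --> c -> f t ^+ n @[t --> F] --> c ^+ n.
Proof.
move=> H; elim: n => [|n IH]; first exact: cvg_cst.
rewrite exprS (_ : (fun t => _) = fun t => f t * f t ^+ n); first exact: cvg_mulC.
by apply/funext => t; rewrite exprS.
Qed.

Lemma cvg_prod (I : Type) (s : seq I) (f : I -> T -> Cx R) (c : I -> Cx R) :
  (forall i, f i t @[t --> F] --> c i) ->
  \prod_(i <- s) f i t @[t --> F] --> \prod_(i <- s) c i.
Proof.
move=> H; elim: s => [|i s IH].
  rewrite big_nil (_ : (fun t => _) = fun=> 1); first exact: cvg_cst.
  by apply/funext => t; rewrite big_nil.
rewrite big_cons (_ : (fun t => _) = fun t => f i t * \prod_(i <- s) f i t).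
  by apply: cvg_mulC; [exact: H|exact: IH].
by apply/funext => t; rewrite big_cons.
Qed.

Lemma cvg_mform (p : nat) (a : 'I_2 -> nat) (b : 'I_p -> nat)
    (z : T -> 'I_p -> Cx R) (x : T -> Cx R) (z' : 'I_p -> Cx R) (x' al be ga de : Cx R) :
  (forall j, z t j @[t --> F] --> z' j) -> x t @[t --> F] --> x' ->
  (forall j, mN z' al be ga de j x' != 0) ->
  mform a b (z t) al be ga de (x t) @[t --> F] --> mform a b z' al be ga de x'.
Proof.
move=> Hz Hx N0.
have aff (c d : Cx R) : (fun t => c * x t + d) @ F --> c * x' + d.
  apply: (@cvg_addC (fun t => c * x t) (fun=> d)); last exact: cvg_constC.
  by apply: (@cvg_mulC (fun=> c) x) Hx; exact: cvg_constC.
have HN j : mN (z t) al be ga de j (x t) @[t --> F] --> mN z' al be ga de j x'.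
  exact: (cvg_subC (aff al be) (cvg_mulC (Hz j) (aff ga de))).
have HP : (\prod_j mN (z t) al be ga de j (x t) ^+ b j)^-1 @[t --> F] -->
   (\prod_j mN z' al be ga de j x' ^+ b j)^-1.
  apply: (@cvgV _ _ _ _ (fun t => \prod_j mN (z t) al be ga de j (x t) ^+ b j)); first by apply/prodf_neq0 => j _; rewrite expf_neq0.
  apply: (@cvg_prod _ _ (fun j t => mN (z t) al be ga de j (x t) ^+ b j)) => j.
  exact: (@cvg_expr (fun t => mN (z t) al be ga de j (x t)) _ (b j) (HN j)).
rewrite /mform; apply: (@cvg_mulC (fun t => mdet al be ga de * mnum al be (x t) ^+ a ord0 * mden ga de (x t) ^+ a ord_max)) HP.
apply: (@cvg_mulC (fun t => mdet al be ga de * mnum al be (x t) ^+ a ord0)).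
  apply: (@cvg_mulC (fun=> mdet al be ga de)); first exact: cvg_constC.
  exact: (@cvg_expr (fun t => al * x t + be) _ (a ord0) (aff al be)).
exact: (@cvg_expr (fun t => ga * x t + de) _ (a ord_max) (aff ga de)).
Qed.

End FilterLimits.

(** * Smooth points and convergence to them *)

Section SmoothModels.
Variables (R : realType) (p : nat) (a : 'I_2 -> nat) (b : 'I_p -> nat).
Implicit Types (z : 'I_p -> Cx R) (x k : Cx R) (W : p1_form R p) (D : ms_data R p).

Local Notation a1 := (a ord0).
Local Notation a2 := (a ord_max).
Local Notation z1 W := (f_pos W (inl ord0)).
Local Notation z2 W := (f_pos W (inl ord_max)).
Local Notation pj W j := (f_pos W (inr j)).

Hypothesis hab : (\sum_(i < 2) a i + 2 = \sum_(j < p) b j)%N.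

Lemma normal_rescale (P : leg p -> Cx R) k : injective P -> k != 0 ->
  exists2 W, f_pos W = P &
    normal a b W k (fun j => k * (P (inr j) - P (inl ord0)) / (P (inr j) - P (inl ord_max))).
Proof.
move=> PI k0.
have n0 s t : s != t -> P s - P t != 0 by rewrite subr_eq0 (inj_eq PI).
pose c := (\prod_j (P (inr j) - P (inl ord_max)) ^+ b j) /
  (k ^+ a2.+1 * (P (inl ord0) - P (inl ord_max)) ^+ (a1 + a2).+1).
have d0 : k ^+ a2.+1 * (P (inl ord0) - P (inl ord_max)) ^+ (a1 + a2).+1 != 0.
  by rewrite mulf_neq0 ?expf_neq0 ?n0.
have c0 : c != 0.
  rewrite mulf_neq0 ?invr_eq0 //; apply/prodf_neq0 => j _; rewrite expf_neq0 //; exact: n0.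
exists (P1Form PI c0) => //; split=> //=.
by rewrite -mulrA divfK.
Qed.

(** [k] is a root of order [a2.+1], extracted through the exponential; its choice is the only
    freedom in a normal form. *)
Lemma normal_exists W : exists k z, normal a b W k z.
Proof.
pose c := (\prod_j (pj W j - z2 W) ^+ b j) / (f_scale W * (z1 W - z2 W) ^+ (a1 + a2).+1).
have c0 : c != 0.
  rewrite mulf_neq0 ?invr_eq0 ?mulf_neq0 ?f_scale_neq0 ?expf_neq0 ?pos_neq //.
  by apply/prodf_neq0 => j _; rewrite expf_neq0 //; exact: pos_neq.
have [w Hw] := cexp_surj c0.
exists (cexp (w / a2.+1%:R)), (fun j => cexp (w / a2.+1%:R) * (pj W j - z1 W) / (pj W j - z2 W)).
split=> //; first exact: cexp_neq0.
rewrite -cexp_nat mulrC [_%:R * _]mulrC divfK ?pnatr_eq0 // Hw /c.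
have e0 : (z1 W - z2 W) ^+ (a1 + a2).+1 != 0 by rewrite expf_neq0 // pos_neq.
move: (\prod_j _) (_ ^+ (a1 + a2).+1) e0 (f_scale W) (f_scale_neq0 W) => P e e0 s s0.
by field; rewrite e0 s0.
Qed.

Lemma normal_realize z : injective z -> (forall j, z j != 0) ->
  exists W k, normal a b W k z.
Proof.
move=> zI z0.
(* [Y = m] goes to the point at infinity of the coordinate [x = Y / (Y - m)], in which [z_1] is 0,
   [z_2] is 1 and all poles are finite. *)
have [m m0 mz] : exists2 m : Cx R, m != 0 & forall j, z j - m != 0.
  pose M := \sum_j nz (z j) + 1.
  have M0 : 0 <= \sum_j nz (z j) by apply: sumr_ge0 => j _; exact: nz_ge0.
  have Mj j : nz (z j) < M.
    rewrite /M (bigD1 j) //= -addrA ltrDl ltr_wpDl //.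
    by apply: sumr_ge0 => i _; exact: nz_ge0.
  exists (rc M) => [|j]; first by rewrite rc_eq0 gt_eqF // ltr_wpDl.
  rewrite subr_eq0; apply/eqP => E; have := Mj j; rewrite E nz_rc.
  by rewrite ger0_norm ?ltxx // addr_ge0.
pose P (s : leg p) : Cx R := match s with
  | inl i => if i == ord0 then 0 else 1 | inr j => z j / (z j - m) end.
have P1 j : P (inr j) - 1 = m / (z j - m) by rewrite /P; field; exact: mz.
have PI : injective P.
  have o1 : forall i : 'I_2, i != ord0 -> i = ord_max.
    by apply: ordP => // _.
  have N0 j : P (inr j) != 0 by rewrite /P mulf_neq0 ?invr_eq0.
  have N1 j : P (inr j) != 1.
    by rewrite -subr_eq0 P1 mulf_neq0 ?invr_eq0.
  have I0 (i : 'I_2) j : P (inl i) != P (inr j).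
    by rewrite eq_sym; have := N0 j; have := N1 j; rewrite {2 4}/P; case: (i == ord0).
  move=> [i|i] [j|j].
  - rewrite /P; case: eqP => [->|/eqP/o1 ->]; case: eqP => [->|/eqP/o1 ->] // /eqP.
      by rewrite eq_sym oner_eq0.
    by rewrite oner_eq0.
  - by move=> /eqP; rewrite (negbTE (I0 _ _)).
  - by move=> /eqP; rewrite eq_sym (negbTE (I0 _ _)).
  move=> E; congr inr; apply: zI; move/eqP: E; rewrite /P eqr_div // => /eqP E.
  apply: (mulIf m0); have -> : z i * m = z i * z j - z i * (z j - m) by ring.
  by rewrite E; ring.
have [W HW HN] := normal_rescale PI m0; exists W, m.
suff -> : z = (fun j => m * (P (inr j) - P (inl ord0)) / (P (inr j) - P (inl ord_max))) by [].
apply/funext => j; rewrite {2}/P eqxx subr0 [P (inl ord_max)]/P /= P1 /P.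
by field; rewrite m0 mz.
Qed.

(* D is a sphere without nodes whose normal form is z, up to rescaling. *)
Definition smooth_model D k z : Prop :=
  [/\ forall v w : ms_V D, v = w, ms_H D -> False &
      exists W (c : Cx R), [/\ normal a b W k z, c != 0,
        forall s, f_pos W s = ms_pos (inl s : ms_spec D) &
        forall (v : ms_V D) x, ms_eta a b v x = c * form_fun a b W x]].

Lemma smooth_modelI D k : multiscale a b D ->
  (forall v w : ms_V D, v = w) -> (ms_H D -> False) -> k != 0 ->
  let P s := ms_pos (inl s : ms_spec D) in
  smooth_model D k (fun j => k * (P (inr j) - P (inl ord0)) / (P (inr j) - P (inl ord_max))).
Proof.
move=> [[_ _ _ _ posI] _ [sc0 _] _] V1 H0 k0 P.
have PI : injective P by move=> s t /(posI _ _ (V1 _ _)) [].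
have [W WP WN] := normal_rescale PI k0.
split=> //; pose v0 := ms_at (inl (inl ord0) : ms_spec D).
exists W, (ms_scale v0 / f_scale W); split=> //.
- by rewrite mulf_neq0 ?invr_eq0 ?f_scale_neq0.
- by rewrite WP.
move=> v x; rewrite /ms_eta /form_fun mulrA divfK ?f_scale_neq0 // (V1 v v0) big_sumType /=.
rewrite [X in _ * (_ * X)]big1 ?mulr1; last by move=> h; case: (H0 h).
congr (_ * _); rewrite WP; apply: eq_bigl => s.
by rewrite (V1 (ms_at _) v0) eqxx.
Qed.

Lemma mobB (m : mobius R) x y : mob_den m x != 0 -> mob_den m y != 0 ->
  mob m x - mob m y = (mob_a m * mob_d m - mob_b m * mob_c m) * (x - y) / (mob_den m x * mob_den m y).
Proof. by rewrite /mob; rewrite /mob_den => x0 y0; field; rewrite x0 y0. Qed.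

(** The bijections on vertices and half-edges leave [D] one vertex and no node. A Moebius map
    changes the quotients defining [z] by its denominators at [z_1] and [z_2] only, and these are
    absorbed into [k']. *)
Lemma equiv_smooth_model D W k z : multiscale a b D ->
  ms_equiv a b D (ms_of_form W) -> normal a b W k z -> exists k', smooth_model D k' z.
Proof.
move=> HD [fV [fH [M [l [[bV _ _ _] [_ Hpos _ _]]]]]] [k0 Hz _].
have V1 (v w : ms_V D) : v = w by apply: (bij_inj bV); case: (fV v); case: (fV w).
have H0 : ms_H D -> False by move=> h; case: (fH h).
pose P s := ms_pos (inl s : ms_spec D).
pose m := M (ms_at (inl (inl ord0) : ms_spec D)).
have Hm s : mob_den m (P s) != 0 /\ mob m (P s) = f_pos W s.
  have := Hpos (inl s); rewrite (V1 (ms_at _) (ms_at (inl (inl ord0) : ms_spec D))).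
  by [].
have PI : injective P.
  by move=> s t st; apply: (@f_pos_inj _ _ W); rewrite -!(proj2 (Hm _)) st.
exists (k * mob_den m (P (inl ord_max)) / mob_den m (P (inl ord0))).
have k'0 : k * mob_den m (P (inl ord_max)) / mob_den m (P (inl ord0)) != 0.
  by rewrite !mulf_neq0 ?invr_eq0 ?(proj1 (Hm _)).
have := smooth_modelI HD V1 H0 k'0.
suff -> : z = (fun j => k * mob_den m (P (inl ord_max)) / mob_den m (P (inl ord0)) *
   (P (inr j) - P (inl ord0)) / (P (inr j) - P (inl ord_max))) by [].
apply/funext => j; rewrite Hz -!(proj2 (Hm _)) !mobB ?(proj1 (Hm _)) //.
have n0 s t : s != t -> P s - P t != 0 by rewrite subr_eq0 (inj_eq PI).
have D0 := mob_det m.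
move: (proj1 (Hm (inr j))) (proj1 (Hm (inl ord0))) (proj1 (Hm (inl ord_max))) => d1 d2 d3.
have n2 := n0 (inr j) (inl ord_max) isT.
move: (mob_det m); move: (_ * _ - _ : Cx R) => dd dd0.
by field; rewrite n2 d1 d2 d3 dd0.
Qed.

(* The Moebius map identifying the coordinates Y of the two normal forms. *)
Lemma transport_mobius W k z W' k' z' : normal a b W k z -> normal a b W' k' z' ->
  exists m : mobius R,
    [/\ mob_sends m (z1 W) (z1 W'), mob_sends m (z2 W) (z2 W'),
      forall j, z' j != k -> mob_sends m ((z' j * z2 W - k * z1 W) / (z' j - k)) (pj W' j) &
      forall x, mob_den m x != 0 -> form_fun a b W' (mob m x) * mob_deriv m x =
        mform a b z' k (- k * z1 W) 1 (- z2 W) x].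
Proof.
move=> HW HW'; have [k0 _ _] := HW; have [k'0 Hz' _] := HW'.
have n : z1 W - z2 W != 0 by exact: pos_neq.
have n' : z1 W' - z2 W' != 0 by exact: pos_neq.
(* These coefficients come from solving [k' (x' - z_1') / (x' - z_2') = k (x - z_1) / (x - z_2)] for
   [x']. *)
have E : (k' * z1 W' - k * z2 W') * (- k' * z2 W + k * z1 W) -
  (- k' * z1 W' * z2 W + k * z2 W' * z1 W) * (k' - k) = k * k' * (z1 W' - z2 W') * (z1 W - z2 W).
  by ring.
have D0 : (k' * z1 W' - k * z2 W') * (- k' * z2 W + k * z1 W) -
  (- k' * z1 W' * z2 W + k * z2 W' * z1 W) * (k' - k) != 0 by rewrite E !mulf_neq0.
pose m := Mobius D0; exists m.
have den x : mob_den m x = k' * (x - z2 W) - k * (x - z1 W) by rewrite /mob_den /=; ring.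
have m1 x : mob_den m x != 0 ->
    mob m x - z1 W' = k * (z1 W' - z2 W') * (x - z1 W) / mob_den m x.
  by move=> d0; rewrite /mob; move: d0; rewrite den /= => d0; field.
have m2 x : mob_den m x != 0 ->
    mob m x - z2 W' = k' * (z1 W' - z2 W') * (x - z2 W) / mob_den m x.
  by move=> d0; rewrite /mob; move: d0; rewrite den /= => d0; field.
have nN : z2 W - z1 W != 0 by rewrite -opprB oppr_eq0.
split.
- have d0 : mob_den m (z1 W) != 0 by rewrite den subrr mulr0 subr0 mulf_neq0.
  by split=> //; apply/eqP; rewrite -subr_eq0 m1 // subrr mulr0 mul0r.
- have d0 : mob_den m (z2 W) != 0.
    by rewrite den subrr mulr0 sub0r oppr_eq0 mulf_neq0.
  by split=> //; apply/eqP; rewrite -subr_eq0 m2 // subrr mulr0 mul0r.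
- move=> j zk; have c0 : z' j - k != 0 by rewrite subr_eq0.
  have kz := normal_kz0 j HW'; set X := _ / _.
  have X2 : X - z2 W = k * (z2 W - z1 W) / (z' j - k) by rewrite /X; field.
  have X1 : X - z1 W = z' j * (z2 W - z1 W) / (z' j - k) by rewrite /X; field.
  have dX : mob_den m X = k * (z2 W - z1 W) * (k' - z' j) / (z' j - k).
    by rewrite den X1 X2; field.
  have d0 : mob_den m X != 0 by rewrite dX !mulf_neq0 ?invr_eq0.
  split=> //; apply/eqP; rewrite -(inj_eq (addIr (- z2 W'))) m2 // dX X2 -subr_eq0.
  have pz : pj W' j - z2 W' != 0 by exact: pos_neq.
  have kzE : k' - z' j = k' * (z1 W' - z2 W') / (pj W' j - z2 W') by exact: normal_kz HW'.
  rewrite kzE; apply/eqP; field.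
  by rewrite pz c0 k0 k'0 n' nN.
move=> x d0; rewrite -(normal_mform hab _ HW').
pose e := k' * (z1 W' - z2 W') / mob_den m x.
have e0 : e != 0 by rewrite !mulf_neq0 ?invr_eq0.
have A1 : mnum k' (- k' * z1 W') (mob m x) = e * mnum k (- k * z1 W) x.
  have -> : mnum k' (- k' * z1 W') (mob m x) = k' * (mob m x - z1 W') by rewrite /mnum; ring.
  by rewrite m1 // /e /mnum; field.
have A2 : mden 1 (- z2 W') (mob m x) = e * mden 1 (- z2 W) x.
  have -> : mden 1 (- z2 W') (mob m x) = mob m x - z2 W' by rewrite /mden; ring.
  by rewrite m2 // /e /mden; field.
have A3 : \prod_j mN z' k' (- k' * z1 W') 1 (- z2 W') j (mob m x) ^+ b j =
    e ^+ deg a * \prod_j mN z' k (- k * z1 W) 1 (- z2 W) j x ^+ b j.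
  rewrite (degE hab) -prodrXr -big_split /=; apply: eq_bigr => j _.
  by rewrite -exprMn /mN A1 A2; congr (_ ^+ _); ring.
have eD : k' * (z1 W' - z2 W') = e * mob_den m x by rewrite /e divfK.
clearbody e.
rewrite /mform A1 A2 A3 !exprMn invfM /mob_deriv /= E /deg !exprS exprD expr0.
have -> : mdet k' (- k' * z1 W') 1 (- z2 W') = e * mob_den m x by rewrite -eD /mdet; ring.
have -> : k * k' * (z1 W' - z2 W') * (z1 W - z2 W) = k * e * (z1 W - z2 W) * mob_den m x.
  by rewrite -[k * k' * _]mulrA eD; ring.
have -> : mdet k (- k * z1 W) 1 (- z2 W) = k * (z1 W - z2 W) by rewrite /mdet; ring.
move: (\prod_j _)^-1 (mob_den m x) d0 (e ^+ a1) (e ^+ a2) (expf_neq0 a1 e0) (expf_neq0 a2 e0).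
move=> I d d0 A B A0 B0; move: (mnum _ _ _ ^+ a1) (mden _ _ _ ^+ a2) => N M.
by field; rewrite d0 e0 A0 B0.
Qed.

(** With one level and no node, convergence is that of marked points and of forms on compact sets.
    The chosen coordinate on the n-th sphere has the [z_1], [z_2] and [Y] of the limit, so only the
    poles move. *)
Lemma smooth_model_cvg D k z (Wn : nat -> p1_form R p) (kn : nat -> Cx R) (zn : nat -> 'I_p -> Cx R) :
  smooth_model D k z -> (forall n, normal a b (Wn n) (kn n) (zn n)) ->
  (forall j, zn n j @[n --> \oo] --> z j) -> ms_cvg a b Wn D.
Proof.
move=> [V1 H0 [W [c [HW c0 WP HE]]]] HWn Hz.
have /choice[m Hm] : forall n, exists m : mobius R,
    [/\ mob_sends m (z1 W) (z1 (Wn n)), mob_sends m (z2 W) (z2 (Wn n)),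
      forall j, zn n j != k -> mob_sends m ((zn n j * z2 W - k * z1 W) / (zn n j - k)) (pj (Wn n) j) &
      forall x, mob_den m x != 0 -> form_fun a b (Wn n) (mob m x) * mob_deriv m x =
        mform a b (zn n) k (- k * z1 W) 1 (- z2 W) x].
  by move=> n; exact: (transport_mobius HW (HWn n)).
have [l Hl] := cexp_surj c0.
have zk j : z j - k != 0 by rewrite -opprB oppr_eq0; exact: normal_kz0 HW.
exists (fun n _ => m n), (fun _ _ => l),
  (fun n s => match s with inl i => f_pos W (inl i)
    | inr j => (zn n j * z2 W - k * z1 W) / (zn n j - k) end),
  (fun _ _ => 0), (fun _ _ => 0); split.
- case=> [i|j]; rewrite -WP.
    split; first exact: cvg_constC.
    by apply: nearW => n; have [h1 h2 _ _] := Hm n; move: i; exact: ordP.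
  split.
    have -> : pj W j = (z j * z2 W - k * z1 W) / (z j - k).
      have := normal_mN j (pj W j) HW; rewrite subrr mulr0 /mN /mnum /mden mul1r => /eqP.
      rewrite subr_eq0 => /eqP h; apply: (mulIf (zk j)); rewrite divfK //.
      have -> : pj W j * (z j - k) = z j * (pj W j - z2 W) + z j * z2 W - k * pj W j by ring.
      by rewrite -h; ring.
    apply: cvg_mulC; last first.
      by apply: cvgV => //; apply: cvg_subC; [exact: Hz|exact: cvg_constC].
    apply: cvg_subC; last exact: cvg_constC.
    by apply: cvg_mulC; [exact: Hz|exact: cvg_constC].
  have : \forall n \near \oo, nz (zn n j - z j) < nz (z j - k).
    by have /cvgC/(_ (nz (z j - k))) := Hz j; apply; rewrite nz_gt0.
  apply: filterS => n Hn; have [_ _ h _] := Hm n; apply: h.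
  by apply: contraTneq Hn => ->; rewrite nzC ltxx.
- by move=> h; case: (H0 h).
- move=> v K e Kc HK e0.
  have e1 : 0 < complex.Re e by move: e0; rewrite ltcE => /andP[].
  have ee : e = rc (complex.Re e).
    by move: e0; rewrite ltcE => /andP[/eqP /= E _]; case: e E {e1} => x y /= ->.
  have Kx x : K x -> forall j, mN z k (- k * z1 W) 1 (- z2 W) j x != 0.
    move=> xK j; rewrite (normal_mN _ _ HW) mulf_neq0 ?(normal_kz0 j HW) // subr_eq0.
    apply/eqP => E; apply: (HK (inl (inr j))); first exact: V1.
    by rewrite -WP -E.
  (* Convergence jointly in the form and the point becomes uniform on [K] by the near-covering
     property of compact sets. *)
  have NC := (compact_near_coveringP K).1 Kc.
  have := NC nat \oo (fun n x => nz (c * mform a b (zn n) k (- k * z1 W) 1 (- z2 W) x - ms_eta a b v x) < complex.Re e) _.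
  have FN : Filter \oo by typeclasses eauto.
  move=> /(_ FN) H; have {}H := H _.
  apply: filterS (H _) => [n Hn x xK dx|x0 Kx0].
    have [_ _ _ /(_ x dx) h] := Hm n; rewrite Hl -mulrA h ee.
    by have := Hn x xK; rewrite -rc_lt.
  pose G := filter_prod (nbhs x0) \oo.
  have FG : Filter G by exact: filter_prod_filter.
  have c1 : (fun t : Cx R * nat => t.1) @ G --> x0 by exact: cvg_fst.
  have c2 j : (fun t : Cx R * nat => zn t.2 j) @ G --> z j.
    by apply: cvg_comp (Hz j); exact: cvg_snd.
  have L1 := @cvg_mform R _ G FG _ a b (fun t => zn t.2) _ z x0 k (- k * z1 W) 1 (- z2 W) c2 c1 (Kx x0 Kx0).
  have L2 := @cvg_mform R _ G FG _ a b (fun t => z) _ z x0 k (- k * z1 W) 1 (- z2 W) (fun j => @cvg_constC R _ G FG (z j)) c1 (Kx x0 Kx0).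
  have := @cvg_mulC R _ G FG _ _ _ _ (@cvg_constC R _ G FG c) (@cvg_subC R _ G FG _ _ _ _ L1 L2).
  rewrite subrr mulr0 => /cvgC /(_ _ e1).
  apply: filterS => -[x n] /=; rewrite subr0 HE -(normal_mform hab _ HW) mulrBr.
  by [].
- move=> v w; rewrite (V1 v w) ltnn //.
by move=> h; case: (H0 h).
Qed.

Lemma ms_of_form_multiscale W : (2 <= p)%N -> multiscale a b (ms_of_form W).
Proof.
move=> p2; split; split => //=.
- by move=> [] []; exact: connect0.
- by rewrite card_void card_unit.
- move=> v; rewrite (eq_card (B := predT)); last by move=> s; rewrite !inE; case: v.
  by rewrite cardT -cardE !card_sum !card_ord card_void; lia.
- by move=> [s|[]] [t|[]] _ /f_pos_inj ->.
- by move=> v L; rewrite leqn0 => /eqP ->; exists tt.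
- by move=> _; exact: f_scale_neq0.
split=> [[]|].
  rewrite (eq_bigl predT) //.
  rewrite big_sumType /= [X in _ + X]big1 ?addr0; last by case.
  rewrite big_sumType /= -(big_morph Posz PoszD (erefl _)).
  under [X in _ + X]eq_bigr => j _ do idtac.
  rewrite sumrN -(big_morph Posz PoszD (erefl _)) -hab PoszD opprD addrA subrr add0r.
  by [].
exists (fun h => match h : void with end); split=> //; try by case.
by move=> L v _ _; rewrite big1 //; case.
Qed.

Lemma ms_of_form_closure lam W : (2 <= p)%N -> in_fiber a b lam W ->
  in_closure a b lam (ms_of_form W).
Proof.
move=> p2 HW; split; first exact: ms_of_form_multiscale.
exists (fun=> W); split=> //; have [k [z Hz]] := normal_exists W.
have [k0 zE _] := Hz.
have := @smooth_modelI (ms_of_form W) k (ms_of_form_multiscale W p2).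
case=> //; [by move=> [] []|].
move=> v1 h0 [W' [c Hc]].
apply: (@smooth_model_cvg _ k z _ (fun=> k) (fun=> z)) => //; last first.
  by move=> j; exact: cvg_constC.
split=> //; exists W', c; suff -> : z = (fun j => k * (ms_pos (inl (inr j) : ms_spec (ms_of_form W)) - ms_pos (inl (inl ord0) : ms_spec (ms_of_form W))) / (ms_pos (inl (inr j) : ms_spec (ms_of_form W)) - ms_pos (inl (inl ord_max) : ms_spec (ms_of_form W)))) by [].
by apply/funext => j; rewrite zE.
Qed.

End SmoothModels.

(** * Points of the open fibre and their normal forms *)

Section FiberPoints.
Variables (R : realType) (p : nat) (a : 'I_2 -> nat) (b : 'I_p -> nat)
  (lam : 'I_p -> Cx R) (X : riemann_surface R) (pt : X -> ms_data R p).
Implicit Types (z : 'I_p -> Cx R) (x : X) (W : p1_form R p).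

Local Notation a1 := (a ord0).
Local Notation a2 := (a ord_max).

Hypothesis hp : (2 <= p)%N.
Hypothesis hab : (\sum_(i < 2) a i + 2 = \sum_(j < p) b j)%N.
Hypothesis hres : ~ resonant lam.
Hypothesis hX : is_fiber_closure a b lam pt.

Lemma lam_neq0 j : lam j != 0.
Proof.
apply/eqP => E; apply: hres; exists [set j]%SET; split.
- by apply/set0Pn; exists j; rewrite inE.
- apply/eqP => /(congr1 (fun A : {set 'I_p} => #|A|)); rewrite cards1 cardsT card_ord.
  by move=> E1; move: hp; rewrite -E1.
by rewrite big_set1.
Qed.

(* x is a point of the open fibre, with normal form z. *)
Definition rep x z : Prop := exists W k,
  [/\ in_fiber a b lam W, ms_equiv a b (pt x) (ms_of_form W) & normal a b W k z].

Definition inner x : Prop := exists z, rep x z.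

Lemma rep_zfiber x z : rep x z -> zfiber a b lam z.
Proof.
move=> [W [k [fW _ nW]]]; split.
- exact: normal_inj nW.
- by move=> j; exact: normal_neq0 nW.
exact/(in_fiber_cf hab lam nW).
Qed.

Lemma rep_model x z : rep x z -> exists k, smooth_model a b (pt x) k z.
Proof.
move=> [W [k [_ eW nW]]]; apply: equiv_smooth_model eW nW.
by have [] := fc_closure hX x.
Qed.

Lemma rep_cvg x z (xn : nat -> X) (zn : nat -> 'I_p -> Cx R) : rep x z ->
  (forall n, rep (xn n) (zn n)) -> (forall j, zn n j @[n --> \oo] --> z j) ->
  xn n @[n --> \oo] --> x.
Proof.
move=> /rep_model[k Hk] Hn Hz.
have /choice[Wk HWk] : forall n, exists Wk : p1_form R p * Cx R,
    [/\ in_fiber a b lam Wk.1, ms_equiv a b (pt (xn n)) (ms_of_form Wk.1) & normal a b Wk.1 Wk.2 (zn n)].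
  by move=> n; have [W [k' H]] := Hn n; exists (W, k').
apply/(fc_topology hX (W := fun n => (Wk n).1)).
  by move=> n; have [] := HWk n.
apply: (smooth_model_cvg hab Hk (kn := fun n => (Wk n).2)) Hz => n.
by have [] := HWk n.
Qed.

(** The sequence constant at one of the points converges to every point with the normal form [z],
    and the surface is Hausdorff. *)
Lemma rep_inj x x' z : rep x z -> rep x' z -> x = x'.
Proof.
move=> Hx Hx'; apply/esym; have H (y : X) : rep y z -> (fun=> x') @ \oo --> y.
  by move=> Hy; apply: (rep_cvg Hy (fun=> Hx')) => j; exact: cvg_cst.
exact: (@cvg_unique _ (@rs_hausdorff _ X) ((fun=> x') @ \oo) _ _ _ (H _ Hx') (H _ Hx)).
Qed.

Lemma rep_exists z : zfiber a b lam z -> exists x, rep x z.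
Proof.
move=> [zI z0 Hz]; have [W [k nW]] := normal_realize a b zI z0.
have fW : in_fiber a b lam W by apply/(in_fiber_cf hab lam nW).
have [x Hx] := fc_surj hX (ms_of_form_closure hab hp fW).
by exists x, W, k.
Qed.

(** Both normal forms come from the same marked points, hence are proportional; the residues, which
    are nonzero, force the factor to be a root of unity. *)
Lemma rep_unique x z z' : rep x z -> rep x z' ->
  exists2 m : Cx R, m ^+ a2.+1 = 1 & forall j, z' j = m * z j.
Proof.
move=> Hz Hz'; have [k [_ _ [W [c [nW _ WP _]]]]] := rep_model Hz.
have [k' [_ _ [W' [c' [nW' _ WP' _]]]]] := rep_model Hz'.
have [zI z0 Hl] := rep_zfiber Hz; have [_ _ Hl'] := rep_zfiber Hz'.
have [k0 zE _] := nW; have [k'0 zE' _] := nW'.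
have E j : z' j = k' / k * z j.
  by rewrite zE zE' !WP !WP'; field; rewrite -!WP k0 pos_neq.
exists (k' / k) => //.
have m0 : k' / k != 0 by rewrite mulf_neq0 ?invr_eq0.
pose j0 := Ordinal (ltnW hp).
have := cf_homog hab z j0 0 m0; rewrite expr0 mul1r.
have -> : (fun j => k' / k * z j) = z' by apply/funext => j; rewrite E.
move/(congr1 (fun y : Cx R => two_pi_i R * y)); rewrite mulrA Hl Hl'.
by rewrite -[X in _ = X]mulr1 => /(mulfI (lam_neq0 j0)).
Qed.

Lemma inner_dense x : exists xn : nat -> X, (forall n, inner (xn n)) /\ xn n @[n --> \oo] --> x.
Proof.
have [_ [W [fW cW]]] := fc_closure hX x.
have /choice[xn Hxn] : forall n, exists y, ms_equiv a b (pt y) (ms_of_form (W n)).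
  by move=> n; exact: (fc_surj hX (ms_of_form_closure hab hp (fW n))).
exists xn; split; last by apply/(fc_topology hX (W := W)) => // n.
move=> n; have [k [z nW]] := normal_exists a b (W n).
by exists z, (W n), k.
Qed.

Definition period (v : Cx R) : Prop := exists w : 'I_p -> int, v = \sum_j (w j)%:~R * lam j.

Lemma period0 : period 0.
Proof. by exists (fun=> 0); rewrite big1 // => j _; rewrite mul0r. Qed.

Lemma periodD u v : period u -> period v -> period (u + v).
Proof.
move=> [w ->] [w' ->]; exists (fun j => w j + w' j).
by rewrite -big_split /=; apply: eq_bigr => j _; rewrite rmorphD mulrDl.
Qed.

Lemma periodZ (n : int) u : period u -> period (n%:~R * u).
Proof.
move=> [w ->]; exists (fun j => n * w j).
by rewrite mulr_sumr; apply: eq_bigr => j _; rewrite rmorphM mulrA.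
Qed.

(* The values at x of the multivalued function \int_(z_1)^(z_2). *)
Definition pval x (t : Cx R) : Prop :=
  (exists z L, [/\ rep x z, forall j, cexp (L j) = z j & t = tau a b z L]) \/
  (~ inner x /\ t = 0).

Lemma pval_exists x : exists t, pval x t.
Proof.
have [[z Hz]|H] := pselect (inner x); last by exists 0; right.
have [zI z0 _] := rep_zfiber Hz.
have /choice[L HL] : forall j, exists L, cexp L = z j by move=> j; exact: cexp_surj.
by exists (tau a b z L); left; exists z, L.
Qed.

Lemma pval_period x t t' : pval x t -> pval x t' -> period (t - t').
Proof.
move=> [[z [L [Hz HL ->]]]|[Hn ->]] [[z' [L' [Hz' HL' ->]]]|[Hn' ->]]; last 3 first.
- by case: Hn'; exists z.
- by case: Hn; exists z'.
- by rewrite subrr; exact: period0.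
have [m m1 mE] := rep_unique Hz Hz'.
have m0 : m != 0 by apply: contra_eq_neq m1 => ->; rewrite expr0n /= eq_sym oner_eq0.
have [zI z0 Hl] := rep_zfiber Hz.
have cE j k : cf a b z' j k = m ^+ k * cf a b z j k.
  have := cf_homog hab z j k m0; rewrite m1 mulr1 => <-.
  by congr (cf _ _ _ _ _); apply/funext => i.
have [l Hl0] := cexp_surj m0.
(* Up to the logarithm [l] of the rotation, the two choices of logarithms differ by integer
   multiples [n j] of 2 pi i; multiplied by the coefficients [cf] these give [n j] times [lam j]. *)
have /choice[n Hn] : forall j, exists n : int, L' j - L j - l = two_pi_i R * n%:~R.
  move=> j; have [|n Hn] := @cexp_eq1 _ (L' j - L j - l); last by exists n.
  by rewrite !cexpB HL HL' Hl0 mE mulfK // divff.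
exists n; rewrite -(tau_shift hab z L l) /tau.
set A := \sum_j \sum_(k < (deg a).-1) cf a b z j k.+1 / k.+1%:R * (- z j) ^- k.+1.
have -> : \sum_j \sum_(k < (deg a).-1) cf a b z' j k.+1 / k.+1%:R * (- z' j) ^- k.+1 = A.
  apply: eq_bigr => j _; apply: eq_bigr => k _.
  rewrite cE mE -mulrN exprMn; field.
  by rewrite nat1r pnatr_eq0 !expf_neq0 // oppr_eq0.
rewrite opprB addrC addrA subrK addrC -sumrN -big_split /=; apply: eq_bigr => j _.
rewrite cE expr0 mul1r -Hl.
have -> : - (cf a b z j 0 * (L j + l)) + cf a b z j 0 * L' j = cf a b z j 0 * (L' j - L j - l) by ring.
by rewrite Hn; ring.
Qed.

End FiberPoints.

(** * Local lifts *)

Section DifferentiableFunctions.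
Variable R : realType.
Implicit Types (f g : Cx R -> Cx R) (s : Cx R).

Definition hdiff f s : Prop := exists d, cderiv f s d.

Lemma hdiff_cst c s : hdiff (fun=> c) s.
Proof. by exists 0; exact: cderiv_cst. Qed.

Lemma hdiffD f g s : hdiff f s -> hdiff g s -> hdiff (fun x => f x + g x) s.
Proof. by move=> [d Hd] [e He]; exists (d + e); exact: cderivD. Qed.

Lemma hdiffB f g s : hdiff f s -> hdiff g s -> hdiff (fun x => f x - g x) s.
Proof. by move=> [d Hd] [e He]; exists (d - e); exact: cderivB. Qed.

Lemma hdiffM f g s : hdiff f s -> hdiff g s -> hdiff (fun x => f x * g x) s.
Proof. by move=> [d Hd] [e He]; eexists; exact: cderivM Hd He. Qed.

Lemma hdiffX f n s : hdiff f s -> hdiff (fun x => f x ^+ n) s.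
Proof. by move=> [d Hd]; eexists; exact: cderivX Hd. Qed.

Lemma hdiff_div f g s : g s != 0 -> hdiff f s -> hdiff g s -> hdiff (fun x => f x / g x) s.
Proof. by move=> g0 [d Hd] [e He]; eexists; exact: cderiv_div g0 Hd He. Qed.

Lemma hdiff_prod (I : Type) (r : seq I) (f : I -> Cx R -> Cx R) s :
  (forall i, hdiff (f i) s) -> hdiff (fun x => \prod_(i <- r) f i x) s.
Proof.
move=> H; elim: r => [|i r IH].
  have -> : (fun x => \prod_(i <- [::]) f i x) = fun=> 1 by apply/funext => x; rewrite big_nil.
  exact: hdiff_cst.
have -> : (fun x => \prod_(j <- i :: r) f j x) = fun x => f i x * \prod_(i <- r) f i x.
  by apply/funext => x; rewrite big_cons.
exact: hdiffM.
Qed.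

Lemma hdiff_comp f g s : hdiff f (g s) -> hdiff g s -> hdiff (fun x => f (g x)) s.
Proof. by move=> [d Hd] [e He]; eexists; exact: cderiv_comp Hd He. Qed.

Lemma hdiff_Log f s : slit (f s) -> hdiff f s -> hdiff (fun x => Log (f x)) s.
Proof. by move=> /cderiv_Log H; apply: hdiff_comp; eexists; exact: H. Qed.

Lemma hdiff_cexp f s : hdiff f s -> hdiff (fun x => cexp (f x)) s.
Proof. by apply: hdiff_comp; eexists; exact: cderiv_cexp. Qed.

Lemma hdiff_cont f s : hdiff f s -> {for s, continuous f}.
Proof. by move=> [d]; exact: cderiv_cont. Qed.

Lemma hdiff_near f s (P : Cx R -> Prop) : hdiff f s -> (\forall y \near f s, P y) ->
  \forall x \near s, P (f x).
Proof. by move=> /hdiff_cont; exact: near_comp. Qed.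

Lemma near_neq0 s : s != 0 -> \forall y \near s, y != 0.
Proof.
rewrite -nz_gt0 => s0; apply/nearC; exists (nz s) => // y.
by apply: contraTneq => ->; rewrite sub0r nzN ltxx.
Qed.

Lemma open_disc s (r : R) : open [set y | nz (y - s) < r].
Proof.
rewrite openE => y /= Hy; apply/nearC; exists (r - nz (y - s)); first by rewrite subr_gt0.
move=> w Hw /=; have -> : w - s = (w - y) + (y - s) by ring.
by apply: le_lt_trans (nzD _ _) _; lra.
Qed.

Lemma cvg_realC (T : Type) (F : set_system T) {FF : Filter F} (f : T -> R) (c : R) :
  f @ F --> c -> rc (f t) @[t --> F] --> rc c.
Proof.
move=> H; apply/cvgC => e e0; have /cvgrPdist_lt/(_ e e0) := H.
by apply: filterS => t; rewrite -rcB nz_rc distrC.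
Qed.

(** An absolute value in place of the case distinction reduces joint continuity to operations on
    limits. *)
Lemma brkE (u0 m u1 : Cx R) (u : R) : brk u0 m u1 u =
  u0 + rc ((2 * u + 1 - `|2 * u - 1|) / 2) * (m - u0) + rc ((2 * u - 1 + `|2 * u - 1|) / 2) * (u1 - m).
Proof.
rewrite /brk /seg; case: ifPn => [h|]; last rewrite -ltNge => h.
  rewrite ler0_norm; last by lra.
  have -> : (2 * u + 1 - - (2 * u - 1)) / 2 = 2 * u by field.
  have -> : (2 * u - 1 + - (2 * u - 1)) / 2 = 0 by field.
  by have -> : rc 0 = 0 :> Cx R by []; rewrite mul0r addr0.
rewrite ger0_norm; last by lra.
have -> : (2 * u + 1 - (2 * u - 1)) / 2 = 1 by field.
have -> : (2 * u - 1 + (2 * u - 1)) / 2 = 2 * u - 1 by field.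
by have -> : rc 1 = 1 :> Cx R by []; rewrite mul1r addrC addrCA subrr addr0 addrC.
Qed.

Lemma brk_continuous (A : set (Cx R)) (f g : Cx R -> Cx R) m :
  (forall s, A s -> {for s, continuous f}) -> (forall s, A s -> {for s, continuous g}) ->
  {within A `*` `[0, 1]%classic,
    continuous (fun sr : Cx R * R => brk (f sr.1) m (g sr.1) sr.2)}.
Proof.
move=> Hf Hg; apply: continuous_in_subspaceT => -[s u]; rewrite inE => -[/= As _].
pose F := nbhs (s, u).
have FF : Filter F by exact: nbhs_filter.
have c1 : (fun t : Cx R * R => t.1) @ F --> s by exact: cvg_fst.
have c2 : (fun t : Cx R * R => t.2) @ F --> u by exact: cvg_snd.
have cf : (fun t : Cx R * R => f t.1) @ F --> f s by apply: cvg_comp c1 _; exact: Hf.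
have cg : (fun t : Cx R * R => g t.1) @ F --> g s by apply: cvg_comp c1 _; exact: Hg.
have ca (c : R) : (fun t : Cx R * R => 2 * t.2 + c) @ F --> 2 * u + c.
  by apply: cvgD; [apply: cvgM => //; exact: cvg_cst|exact: cvg_cst].
have cn : (fun t : Cx R * R => `|2 * t.2 - 1|) @ F --> `|2 * u - 1|.
  by apply: cvg_norm; exact: ca.
have r1 : (fun t : Cx R * R => (2 * t.2 + 1 - `|2 * t.2 - 1|) / 2) @ F --> (2 * u + 1 - `|2 * u - 1|) / 2.
  by apply: cvgM; [apply: cvgB => //; exact: ca|exact: cvg_cst].
have r2 : (fun t : Cx R * R => (2 * t.2 - 1 + `|2 * t.2 - 1|) / 2) @ F --> (2 * u - 1 + `|2 * u - 1|) / 2.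
  by apply: cvgM; [apply: cvgD => //; exact: ca|exact: cvg_cst].
have cm := @cvg_constC R _ F FF m.
pose al (t : Cx R * R) : R := (2 * t.2 + 1 - `|2 * t.2 - 1|) / 2.
pose be (t : Cx R * R) : R := (2 * t.2 - 1 + `|2 * t.2 - 1|) / 2.
pose f1 (t : Cx R * R) := f t.1; pose g1 (t : Cx R * R) := g t.1.
pose t1 t := f1 t + rc (al t) * (m - f1 t); pose t2 t := rc (be t) * (g1 t - m).
have r1' : (fun t => rc (al t)) @ F --> rc (al (s, u)) by exact: (@cvg_realC _ F FF al (al (s, u)) r1).
have r2' : (fun t => rc (be t)) @ F --> rc (be (s, u)) by exact: (@cvg_realC _ F FF be (be (s, u)) r2).
have h1 : (fun t => m - f1 t) @ F --> m - f1 (s, u) by exact: (@cvg_subC R _ F FF (fun=> m) f1 _ _ cm cf).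
have h2 : (fun t => g1 t - m) @ F --> g1 (s, u) - m by exact: (@cvg_subC R _ F FF g1 (fun=> m) _ _ cg cm).
have h3 := @cvg_mulC R _ F FF (fun t => rc (al t)) (fun t => m - f1 t) _ _ r1' h1.
have h4 : t1 @ F --> t1 (s, u) by exact: (@cvg_addC R _ F FF f1 (fun t => rc (al t) * (m - f1 t)) _ _ cf h3).
have h5 : t2 @ F --> t2 (s, u) by exact: (@cvg_mulC R _ F FF (fun t => rc (be t)) (fun t => g1 t - m) _ _ r2' h2).
have h6 : (fun t => t1 t + t2 t) @ F --> t1 (s, u) + t2 (s, u) by exact: (@cvg_addC R _ F FF t1 t2 _ _ h4 h5).
have E : (fun sr : Cx R * R => brk (f sr.1) m (g sr.1) sr.2) = (fun t => t1 t + t2 t).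
  by apply/funext => t; rewrite brkE.
by rewrite E.
Qed.

End DifferentiableFunctions.

Section LocalLift.
Variables (R : realType) (p : nat) (a : 'I_2 -> nat) (b : 'I_p -> nat)
  (lam : 'I_p -> Cx R) (X : riemann_surface R) (pt : X -> ms_data R p) (om : mero_form X).
Implicit Types (x : X) (Z L : 'I_p -> Cx R -> Cx R).

Local Notation a1 := (a ord0).
Local Notation a2 := (a ord_max).
Local Notation inner := (inner a b lam pt).
Local Notation rep := (rep a b lam pt).

Hypothesis hab : (\sum_(i < 2) a i + 2 = \sum_(j < p) b j)%N.
Hypothesis hX : is_fiber_closure a b lam pt.
Hypothesis hom : is_omega a b lam pt om.

(* On the disc of radius r about s0 in the i-th chart, Z is a holomorphic
   choice of normal forms, L of their logarithms. *)
Definition lift_on (i : rs_idx X) (s0 : Cx R) (r : R) Z L : Prop :=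
  forall s, nz (s - s0) < r ->
  [/\ rs_im i s, rep (rs_psi i s) (fun j => Z j s), forall j, cexp (L j s) = Z j s,
      forall j, hdiff (Z j) s /\ hdiff (L j) s &
      cderiv (fun s => tau a b (fun j => Z j s) (fun j => L j s)) s (om_coef om i s)].

(** The family supplied by the complex structure is normalised by holomorphic branches: a root of
    [K] for the scale, logarithms recentred at one base point [m] for the integrals. The broken
    paths through [m] form the continuous family that [is_omega] asks for. *)
Lemma lift_some_chart x : inner x ->
  exists i r Z L, [/\ rs_dom i x, 0 < r & lift_on i (rs_phi i x) r Z L].
Proof.
move=> [z0 [W0 [k0' [fW0 eW0 _]]]].
have [i [U [W [xi Us0 [Uo Ui HU hpos hsc]]]]] := fc_complex hX fW0 eW0.
pose s0 := rs_phi i x; rewrite -/s0 in Us0.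
have [k0 [zz0 nW0]] := normal_exists a b (W s0).
have [k0n _ k0E] := nW0.
pose z1 s := f_pos (W s) (inl ord0); pose z2 s := f_pos (W s) (inl ord_max).
pose pj j s := f_pos (W s) (inr j).
have hp s l : U s -> hdiff (fun s' => f_pos (W s') l) s.
  by move=> Us; exact: nbhs_singleton (hpos s l Us).
have h1 s : U s -> hdiff z1 s by exact: hp.
have h2 s : U s -> hdiff z2 s by exact: hp.
have hj j s : U s -> hdiff (pj j) s by exact: hp.
have hs s : U s -> hdiff (fun s' => f_scale (W s')) s.
  by move=> Us; exact: nbhs_singleton (hsc s Us).
have n12 s : z1 s - z2 s != 0 by exact: pos_neq.
have nj1 j s : pj j s - z1 s != 0 by exact: pos_neq.
have nj2 j s : pj j s - z2 s != 0 by exact: pos_neq.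
pose K s := (\prod_j (pj j s - z2 s) ^+ b j) / (f_scale (W s) * (z1 s - z2 s) ^+ (a1 + a2).+1).
have Kd0 s : f_scale (W s) * (z1 s - z2 s) ^+ (a1 + a2).+1 != 0.
  by rewrite mulf_neq0 ?f_scale_neq0 ?expf_neq0.
have K0 s : K s != 0.
  rewrite mulf_neq0 ?invr_eq0 //; apply/prodf_neq0 => j _; exact: expf_neq0.
have hK s : U s -> hdiff K s.
  move=> Us; apply: (@hdiff_div _ (fun s => \prod_j (pj j s - z2 s) ^+ b j)) => //.
    apply: (@hdiff_prod _ _ _ (fun j s => (pj j s - z2 s) ^+ b j)) => j.
    by apply: (@hdiffX _ (fun s => pj j s - z2 s)); apply: hdiffB; [exact: hj|exact: h2].
  apply: hdiffM; first exact: hs.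
  by apply: (@hdiffX _ (fun s => z1 s - z2 s)); apply: hdiffB; [exact: h1|exact: h2].
have [m [rm [rm0 Hm]]] : exists m (r : R), 0 < r /\ forall wq, wq \in
    [seq (z1 s0, pj j s0) | j <- enum 'I_p] ++ [seq (z2 s0, pj j s0) | j <- enum 'I_p] ->
    forall y, nz (y - m) < r -> good_base wq.1 wq.2 y.
  apply: exists_good_base => wq; rewrite mem_cat => /orP[] /mapP[j _ ->] /=.
    by rewrite -subr_eq0 -opprB oppr_eq0.
  by rewrite -subr_eq0 -opprB oppr_eq0.
have mm : nz (m - m) < rm by rewrite subrr nz0.
have gb1 j : good_base (z1 s0) (pj j s0) m.
  apply: (Hm (z1 s0, pj j s0)) => //; rewrite mem_cat; apply/orP; left.
  by apply/mapP; exists j => //; rewrite mem_enum.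
have gb2 j : good_base (z2 s0) (pj j s0) m.
  apply: (Hm (z2 s0, pj j s0)) => //; rewrite mem_cat; apply/orP; right.
  by apply/mapP; exists j => //; rewrite mem_enum.
have near_gb (f : Cx R -> Cx R) : hdiff f s0 -> (forall j, good_base (f s0) (pj j s0) m) ->
    \forall s \near s0, forall j, good_base (f s) (pj j s) m.
  move=> hf gf; apply: (@filter_forall _ _ (fun j s => good_base (f s) (pj j s) m) (nbhs s0) _) => j.
  have [g1 g2] := gf j; have hjm : hdiff (fun s => m - pj j s) s0.
    by apply: hdiffB; [exact: hdiff_cst|exact: hj].
  have e1 := hdiff_near hjm (near_neq0 g1).
  have e2 : \forall s \near s0, slit ((f s - pj j s) / (m - pj j s)).
    apply: (@hdiff_near _ (fun s => (f s - pj j s) / (m - pj j s)) s0 (@slit R)); last exact: slit_open.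
    by apply: (@hdiff_div _ (fun s => f s - pj j s)) => //; apply: hdiffB => //; exact: hj.
  by apply: filterS2 e1 e2 => s; split.
have e1 := near_gb z1 (h1 s0 Us0) gb1; have e2 := near_gb z2 (h2 s0 Us0) gb2.
have e3 : \forall s \near s0, slit (K s / K s0).
  apply: (@hdiff_near _ (fun s => K s / K s0) s0 (@slit R)).
    by apply: (@hdiff_div _ K) => //; [exact: hK|exact: hdiff_cst].
  by apply: slit_open; rewrite divff //; apply: slit_Re; exact: ltr01.
have e4 : \forall s \near s0, U s by exact: (open_nbhs_nbhs (conj Uo Us0)).
have [r r0 Hr] := (nearC _ _).1 (filterI (filterI e1 e2) (filterI e3 e4)).
have [l0 Hl0] := cexp_surj k0n.
(* A logarithm of the scale: division by [a2.+1] extracts the root of [K], and [l0] makes it start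
   at [k0]. *)
pose l s := l0 + Log (K s / K s0) / a2.+1%:R.
pose Z j s := cexp (l s) * (pj j s - z1 s) / (pj j s - z2 s).
pose L' j s := Log ((z1 s - pj j s) / (m - pj j s)) - Log ((z2 s - pj j s) / (m - pj j s)).
pose L j s := L' j s + l s.
have kpow s : nz (s - s0) < r -> cexp (l s) ^+ a2.+1 = K s.
  move=> /Hr[_ [h3 _]].
  have a20 : a2.+1%:R != 0 :> Cx R by rewrite pnatr_eq0.
  have E1 : cexp (Log (K s / K s0) / a2.+1%:R) ^+ a2.+1 = K s / K s0.
    by rewrite -cexp_nat mulrC divfK // LogK.
  rewrite /l cexpD exprMn E1 Hl0.
  suff -> : k0 ^+ a2.+1 = K s0 by rewrite mulrC divfK.
  apply: (mulIf (Kd0 s0)); rewrite /K divfK // -[RHS]k0E; by rewrite /z1 /z2; ring.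
have nW s : nz (s - s0) < r -> normal a b (W s) (cexp (l s)) (fun j => Z j s).
  move=> Hs; split=> //; first exact: cexp_neq0.
  by rewrite (kpow s Hs) /K mulrAC -/(z1 s) -/(z2 s) mulrC divfK.
have hl s : nz (s - s0) < r -> hdiff l s.
  move=> /Hr[_ [h3 Us]]; apply: hdiffD; first exact: hdiff_cst.
  apply: hdiff_div; [by rewrite pnatr_eq0| |exact: hdiff_cst].
  apply: (@hdiff_Log _ (fun s => K s / K s0)) => //.
  by apply: (@hdiff_div _ K) => //; [exact: hK|exact: hdiff_cst].
have hLog j (f : Cx R -> Cx R) s : U s -> hdiff f s -> good_base (f s) (pj j s) m ->
    hdiff (fun s => Log ((f s - pj j s) / (m - pj j s))) s.
  move=> Us hf [g1 g2]; apply: (@hdiff_Log _ (fun s => (f s - pj j s) / (m - pj j s))) => //.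
  apply: (@hdiff_div _ (fun s => f s - pj j s)) => //; apply: hdiffB => //; try exact: hj.
  exact: hdiff_cst.
have cL j s : nz (s - s0) < r -> cexp (L j s) = Z j s.
  move=> Hs; have [[g1 g2] _] := Hr s Hs; have [d1 t1] := g1 j; have [d2 t2] := g2 j.
  rewrite /L /L' cexpD cexpB !LogK // /Z.
  have u1 := nj1 j s; have u2 := nj2 j s.
  have u2' : z2 s - pj j s != 0 by rewrite -opprB oppr_eq0.
  by field; rewrite u2 d1 u2'.
pose V : set (Cx R) := [set s | nz (s - s0) < r].
have Vo : open V by exact: open_disc.
have VU s : V s -> U s by move=> /Hr[_ []].
have ff : fiber_family a b lam pt i V W.
  split=> //.
  - by move=> s /VU; exact: Ui.
  - by move=> s /VU; exact: HU.
  - by move=> s q /VU; exact: hpos.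
  - by move=> s /VU; exact: hsc.
exists i, r, Z, L; split; [exact: xi|exact: r0|move=> s Hs]; have [[g1 g2] [h3 Us]] := Hr s Hs.
have [fW eW] := HU s Us.
split.
- exact: Ui.
- by exists (W s), (cexp (l s)); split=> //; exact: nW.
- by move=> j; exact: cL.
- move=> j; split.
    apply: (@hdiff_div _ (fun s => cexp (l s) * (pj j s - z1 s))) => //; last first.
      by apply: hdiffB; [exact: hj|exact: h2].
    apply: hdiffM; last by apply: hdiffB; [exact: hj|exact: h1].
    by apply: hdiff_cexp; exact: hl.
  apply: hdiffD; last exact: hl.
  by apply: hdiffB; apply: hLog => //; [exact: h1|exact: h2].
apply: (hom (g := fun s => brk (z1 s) m (z2 s)) ff) => //.
  by apply: brk_continuous => s' /VU Us'; apply: hdiff_cont; [exact: h1|exact: h2].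
move=> s' Vs'; have [[g1' g2'] _] := Hr s' Vs'; split.
- exact: brk0.
- exact: brk1.
- move=> u j u01 E; rewrite mem01 in u01.
  have := brk_slit u01 (g1' j) (g2' j); rewrite E subrr mul0r => /slit_neq0.
  by rewrite eqxx.
have := path_integral_brk hab (nW s' Vs') g1' g2'.
by rewrite -(tau_shift hab _ _ (l s')).
Qed.

(** The first lift lives in a chart that cannot be chosen; transition maps and the compatibility of
    [om] carry it to a prescribed one. *)
Lemma lift_any_chart x i : rs_dom i x -> inner x ->
  exists r Z L, 0 < r /\ lift_on i (rs_phi i x) r Z L.
Proof.
move=> xi /lift_some_chart[i' [r' [Z [L [xi' r'0 HL]]]]].
have [im0 psi0 phic] := rs_phiP xi.
pose T s := rs_phi i' (rs_psi i s).
have Ts0 : T (rs_phi i x) = rs_phi i' x by rewrite /T psi0.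
have dom0 : rs_dom i' (rs_psi i (rs_phi i x)) by rewrite psi0.
have hT : \forall s \near rs_phi i x, hdiff T s by exact: rs_transition im0 dom0.
have e1 : \forall s \near rs_phi i x, nz (T s - rs_phi i' x) < r'.
  rewrite -Ts0; have /contC/(_ _ r'0)[r r0 H] := hdiff_cont (nbhs_singleton hT).
  by apply/nearC; exists r.
have e2 : \forall s \near rs_phi i x, rs_im i s.
  exact: (open_nbhs_nbhs (conj (@rs_im_open _ X i) im0)).
have e3 : \forall s \near rs_phi i x, rs_dom i' (rs_psi i s).
  have [_ _ c] := rs_psiP im0.
  by apply: c; exact: (open_nbhs_nbhs (conj (@rs_dom_open _ X i') dom0)).
have [r r0 Hr] := (nearC _ _).1 (filterI (filterI hT e1) (filterI e2 e3)).
exists r, (fun j s => Z j (T s)), (fun j s => L j (T s)); split; first exact: r0.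
move=> s Hs.
have [[hTs ds] [ims doms]] := Hr s Hs.
have [_ rp cL hZL dt] := HL _ ds.
have [_ pT _] := rs_phiP doms.
split; [exact: ims|by move: rp; rewrite pT|exact: cL| |].
  by move=> j; have [h1 h2] := hZL j; split; [exact: (@hdiff_comp _ (Z j))|exact: (@hdiff_comp _ (L j))].
have [d Hd] := hTs.
rewrite (om_compat om ims doms Hd).
exact: (@cderiv_comp _ (fun s => tau a b (fun j => Z j s) (fun j => L j s)) T).
Qed.

End LocalLift.

(** * Zeros in the open fibre *)

Section LocalAnalysis.
Variable R : realType.
Implicit Types (f g t h : Cx R -> Cx R) (s y w z : Cx R).

Lemma seg_bound_open f (D : R -> Cx R) (M : R) z y :
  (forall u : R, 0 < u <= 1 -> cderiv f (seg z y u) (D u)) ->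
  (forall u : R, 0 < u <= 1 -> nz (D u) <= M) ->
  {for z, continuous f} ->
  nz (f y - f z) <= M * nz (y - z).
Proof.
move=> Hf HD /contC Hc.
have -> : f y - f z = f (seg z y 1) - f (seg z y 0) by rewrite seg0 seg1.
have n0 := nz_ge0 (y - z); have n1 : 0 < 1 + nz (y - z) by lra.
apply: (@mvi_open _ (fun u => f (seg z y u))) => [u u01 e e0|e e0].
  have e1 : 0 < e / (1 + nz (y - z)) by rewrite divr_gt0.
  have /cderivP/(_ _ e1)[r r0 Hr] := Hf u u01.
  exists (r / (1 + nz (y - z))); first by rewrite divr_gt0.
  move=> s s01 su; have := Hr (seg z y s); rewrite nz_seg => /(_ _) h.
  have h1 : `|s - u| * nz (y - z) < r.
    move: su; rewrite ltr_pdivlMr //; have := normr_ge0 (s - u); nra.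
  have := nzD (f (seg z y s) - f (seg z y u) - D u * (seg z y s - seg z y u))
            (D u * (seg z y s - seg z y u)).
  rewrite subrK nzM nz_seg => h2; have h3 := h h1; have h4 := HD u u01.
  apply: le_trans h2 _; rewrite mulrDl [leRHS]addrC; apply: lerD; last first.
    by rewrite mulrAC -mulrA ler_wpM2r // mulr_ge0.
  apply: le_trans h3 _.
  rewrite mulrA mulrAC ler_wpM2r // mulrAC ler_pdivrMr //.
  by rewrite ler_wpM2l ?ltW //; lra.
have [r r0 Hr] := Hc e e0.
exists (r / (1 + nz (y - z))); first by rewrite divr_gt0.
move=> s /andP[s0 sr]; rewrite seg0; apply/ltW/Hr.
rewrite -[z in _ - z](seg0 z y) nz_seg subr0 ger0_norm ?ltW //.
by move: sr; rewrite ltr_pdivlMr //; nra.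
Qed.

Lemma cont_cstC (c z : Cx R) : {for z, continuous (fun _ : Cx R => c)}.
Proof. by apply/contC => e e0; exists 1 => // s _; rewrite subrr nz0. Qed.

Lemma cont_mulC f g z : {for z, continuous f} -> {for z, continuous g} ->
  {for z, continuous (fun x => f x * g x)}.
Proof. exact: (@cvg_mulC R _ (nbhs z) _ f g). Qed.

Lemma cont_subC f g z : {for z, continuous f} -> {for z, continuous g} ->
  {for z, continuous (fun x => f x - g x)}.
Proof. exact: (@cvg_subC R _ (nbhs z) _ f g). Qed.

Lemma cont_compC f g z : {for g z, continuous f} -> {for z, continuous g} ->
  {for z, continuous (fun x => f (g x))}.
Proof. by move=> cf cg; exact: (@continuous_comp _ _ _ g f z cg cf). Qed.

Lemma cont_invX f n z : f z != 0 -> {for z, continuous f} ->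
  {for z, continuous (fun x => (f x ^+ n)^-1)}.
Proof.
move=> f0 cf.
have H : cderiv (fun y => y ^- n) (f z) (- n%:R * 1 * f z ^- n.+1).
  by have := @cderiv_invX R (fun x => x) n (f z) 1 f0 (cderiv_id (f z)).
have cH : {for f z, continuous (fun y : Cx R => y ^- n)} := cderiv_cont H.
have H2 := @cont_compC (fun y => y ^- n) f z cH cf.
exact: H2.
Qed.

(** Minus its presumed linear part, [t] has small derivative off [z]; on segments issuing from [z]
    the mean value inequality asks only for continuity at [z]. *)
Lemma removable_deriv t h z (r : R) : 0 < r ->
  (forall s, s != z -> nz (s - z) < r -> cderiv t s (h s)) ->
  {for z, continuous t} -> {for z, continuous h} -> cderiv t z (h z).
Proof.
move=> r0 Ht ct ch; apply/cderivP => e e0.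
have [r1 r10 H1] := (contC _ _).1 ch e e0.
exists (Num.min r r1); first by rewrite lt_min r0.
move=> s; rewrite lt_min => /andP[sr sr1].
have [->|sz] := eqVneq s z; first by rewrite !subrr mulr0 subr0 nz0 mulr0.
have S (u : R) : 0 < u <= 1 -> seg z s u != z /\ nz (seg z s u - z) <= nz (s - z).
  move=> /andP[u0 u1]; have E : seg z s u - z = rc u * (s - z) by rewrite /seg; ring.
  rewrite -[_ != z]negbK -subr_eq0 E mulf_eq0 rc_eq0 gt_eqF //= subr_eq0 sz; split=> //.
  by rewrite nzM nz_rc gtr0_norm // ler_piMl ?nz_ge0.
have := @seg_bound_open (fun x => t x - h z * x) (fun u => h (seg z s u) - h z) e z s.
rewrite (_ : t s - h z * s - (t z - h z * z) = t s - t z - h z * (s - z)); last by ring.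
apply=> [u u01|u u01|].
- have [h1 h2] := S u u01; apply: cderivB.
    by apply: Ht => //; exact: le_lt_trans h2 sr.
  by have := cderivZ (h z) (cderiv_id (seg z s u)); rewrite mulr1.
- by have [_ h2] := S u u01; apply/ltW/H1; exact: le_lt_trans h2 sr1.
exact: (cont_subC ct (cderiv_cont (cderivZ (h z) (cderiv_id z)))).
Qed.

Lemma geometric_zero (x B : R) : (forall n, x <= B / 2 ^+ n) -> x <= 0.
Proof.
move=> H; rewrite leNgt; apply/negP => x0.
have B0 : 0 < B by have := H 0%N; rewrite expr0 divr1; lra.
have [n Hn] : exists n : nat, B / x < n%:R.
  by exists (Num.bound (B / x)); apply: archi_boundP; rewrite ltW // divr_gt0.
have := H n; rewrite ler_pdivlMr ?exprn_gt0 //; move: Hn; rewrite ltr_pdivrMr //.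
have : n%:R <= 2 ^+ n :> R by rewrite -natrX ler_nat ltnW // ltn_expl.
nra.
Qed.

(** On a disc of radius at most [1 / (2 (M K + 1))], a bound on the difference of the solutions can
    be halved by the mean value inequality on segments from [z], again and again. *)
Lemma ode_unique (I : Type) (f g : I -> Cx R -> Cx R) (H : Cx R -> Cx R)
    (E : (I -> Cx R) -> I -> Cx R) z (r M K B : R) : 0 < r -> 0 <= M -> 0 <= K ->
  (forall s, nz (s - z) < r -> nz (H s) <= M) ->
  (forall s i, nz (s - z) < r -> cderiv (f i) s (H s * E (fun j => f j s) i)) ->
  (forall s i, nz (s - z) < r -> cderiv (g i) s (H s * E (fun j => g j s) i)) ->
  (forall s i, nz (s - z) < r -> nz (f i s - g i s) <= B) ->
  (forall s i (d : R), nz (s - z) < r -> (forall j, nz (f j s - g j s) <= d) ->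
    nz (E (fun j => f j s) i - E (fun j => g j s) i) <= K * d) ->
  (forall i, f i z = g i z) ->
  exists2 r' : R, 0 < r' <= r & forall s i, nz (s - z) < r' -> f i s = g i s.
Proof.
move=> r0 M0 K0 HM Hf Hg HB HE Hz.
have MK : 0 < 2 * (M * K + 1) by have := mulr_ge0 M0 K0; lra.
exists (Num.min r (2 * (M * K + 1))^-1).
  by rewrite lt_min r0 invr_gt0 MK ge_min lexx.
suff S n : forall s i, nz (s - z) < Num.min r (2 * (M * K + 1))^-1 ->
    nz (f i s - g i s) <= B / 2 ^+ n.
  move=> s i Hs; apply/eqP; rewrite -subr_eq0 -nz_eq0 eq_le nz_ge0 andbT.
  by apply: (@geometric_zero _ B) => n; exact: S.
elim: n => [|n IH] s i; rewrite lt_min => /andP[s1 s2].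
  by rewrite expr0 divr1; exact: HB.
have S (u : R) : 0 <= u <= 1 -> nz (seg z s u - z) <= nz (s - z).
  move=> /andP[u0 u1]; have -> : seg z s u - z = rc u * (s - z) by rewrite /seg; ring.
  by rewrite nzM nz_rc ger0_norm // ler_piMl ?nz_ge0.
have Bn : 0 <= B / 2 ^+ n.
  by apply: le_trans (nz_ge0 _) (IH z i _); rewrite subrr nz0 lt_min r0 invr_gt0.
have := @seg_bound _ (fun x => f i x - g i x)
  (fun u => H (seg z s u) * E (fun j => f j (seg z s u)) i - H (seg z s u) * E (fun j => g j (seg z s u)) i)
  (M * (K * (B / 2 ^+ n))) z s.
rewrite Hz subrr subr0 => h.
apply: le_trans (h _ _) _ => [u u01|u u01|].
- by apply: cderivB; [apply: Hf|apply: Hg]; exact: le_lt_trans (S u u01) s1.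
- have su : nz (seg z s u - z) < r by exact: le_lt_trans (S u u01) s1.
  rewrite -mulrBr nzM; apply: ler_pM; rewrite ?nz_ge0 //; first exact: HM.
  apply: HE => // j; apply: IH; rewrite lt_min su /=.
  exact: le_lt_trans (S u u01) s2.
have -> : B / 2 ^+ n.+1 = B / 2 ^+ n / 2 by rewrite exprSr invfM mulrA.
move: Bn s2; rewrite -[(2 * _)^-1]mul1r ltr_pdivlMr //.
move: (B / 2 ^+ n) (nz (s - z)) (nz_ge0 (s - z)) => Q N N0 Q0.
have := mulr_ge0 M0 K0; move: (M * K) (mulrA M K Q) => P -> P0 h1.
have h2 : P * N <= 1 / 2 by lra.
have h3 : Q * (P * N) <= Q * (1 / 2) by rewrite ler_wpM2l.
by rewrite [P * Q]mulrC -mulrA; lra.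
Qed.

(** Iterating [x + (y - f x)] from 0 halves the defect at each step; the solution is a limit given
    by [bounded_subsequence]. *)
Lemma near_id_inverse f (r : R) : 0 < r -> f 0 = 0 ->
  (forall w w', nz w < r -> nz w' < r -> nz ((f w - w) - (f w' - w')) <= nz (w - w') / 2) ->
  exists g, forall y, nz y < r / 2 -> nz (g y) <= 2 * nz y /\ f (g y) = y.
Proof.
move=> r0 f0 Hf; suff S y : nz y < r / 2 -> exists x, nz x <= 2 * nz y /\ f x = y.
  have /choice[g Hg] : forall y, exists x, nz y < r / 2 -> nz x <= 2 * nz y /\ f x = y.
    move=> y; have [/S[x Hx]|h] := ltP (nz y) (r / 2); first by exists x.
    by exists 0.
  by exists g.
move=> yr; pose x n := iter n (fun x => x + (y - f x)) 0.
have xS n : x n.+1 = x n + (y - f (x n)) by [].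
have y0 := nz_ge0 y.
have xb n : nz (x n) <= 2 * nz y.
  elim: n => [|n IH]; first by rewrite nz0 mulr_ge0.
  have xr : nz (x n) < r by lra.
  have := Hf (x n) 0 xr; rewrite nz0 f0 !subr0 => /(_ r0) h.
  rewrite xS (_ : _ + _ = y - (f (x n) - x n)); last by ring.
  by apply: le_trans (nzB _ _) _; lra.
have xr n : nz (x n) < r by have := xb n; lra.
have xd n : nz (y - f (x n)) <= nz y / 2 ^+ n.
  elim: n => [|n IH]; first by rewrite f0 subr0 expr0 divr1.
  have -> : y - f (x n.+1) = (f (x n) - x n) - (f (x n.+1) - x n.+1) by rewrite xS; ring.
  apply: le_trans (Hf _ _ (xr n) (xr n.+1)) _.
  rewrite xS opprD addrA subrr add0r nzN exprSr invfM mulrA.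
  by rewrite ler_pM2r ?invr_gt0.
have [k [x' [kn /(_ ord0) Hx]]] := @bounded_subsequence R 1 (fun n _ => x n) (2 * nz y) (fun n _ => xb n).
exists (x' ord0).
have x'b : nz (x' ord0) <= 2 * nz y.
  rewrite leNgt; apply/negP => h; have e0 : 0 < nz (x' ord0) - 2 * nz y by lra.
  have /cvgC/(_ _ e0)[n _ /(_ n (leqnn n)) /=] := Hx.
  have := nzBge (x' ord0) (x (k n)); have := xb (k n); rewrite nzC; lra.
split=> //; apply/eqP; rewrite -subr_eq0 -nz_eq0 eq_le nz_ge0 andbT.
apply/ler_addgt0Pr => e e0; rewrite add0r.
have e1 : 0 < e / 4 by lra.
have /cvgC/(_ _ e1)[N _ HN] := Hx.
have [n Hn] : exists n : nat, nz y / (e / 4) < n%:R.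
  by exists (Num.bound (nz y / (e / 4))); apply: archi_boundP; rewrite divr_ge0 // ltW.
pose m := maxn N n.
have h1 := HN m (leq_maxl _ _).
have h2 : nz y / 2 ^+ (k m) < e / 4.
  rewrite ltr_pdivrMr ?exprn_gt0 //; move: Hn; rewrite ltr_pdivrMr // => Hn.
  apply: lt_le_trans Hn _; rewrite mulrC ler_wpM2l ?ltW //.
  rewrite -natrX ltr_nat; apply: leq_ltn_trans (ltn_expl _ (ltnSn 1)).
  by apply: leq_trans (kn m); exact: leq_maxr.
have x'r : nz (x' ord0) < r by lra.
have h3 := Hf (x' ord0) (x (k m)) x'r (xr _).
have -> : f (x' ord0) - y = (f (x' ord0) - x' ord0 - (f (x (k m)) - x (k m))) +
   (x' ord0 - x (k m)) - (y - f (x (k m))) by ring.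
apply: le_trans (nzB _ _) _; have := xd (k m).
have := nzD (f (x' ord0) - x' ord0 - (f (x (k m)) - x (k m))) (x' ord0 - x (k m)).
by move: h1 h3; rewrite /= [nz (x (k m) - _)]nzC; lra.
Qed.

Lemma cderiv_inverse f g y d (r : R) : 0 < r ->
  (forall w, nz (w - y) < r -> f (g w) = w /\ nz (g w - g y) <= 2 * nz (w - y)) ->
  cderiv f (g y) d -> d != 0 -> cderiv g y d^-1.
Proof.
move=> r0 Hg /cderivP Hf d0; apply/cderivP => e e0.
have D0 : 0 < nz d by rewrite nz_gt0.
have e1 : 0 < e * nz d / 2 by rewrite divr_gt0 // mulr_gt0.
have [r1 r10 H1] := Hf _ e1.
exists (Num.min r (r1 / 2)); first by rewrite lt_min r0 divr_gt0.
move=> w; rewrite lt_min => /andP[w1 w2].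
have [E1 E2] := Hg w w1; have [E3 _] := Hg y (eq_ind_r (fun x => x < r) r0 (eq_ind_r (fun x => nz x = 0) (nz0 R) (subrr y))).
have h := H1 (g w) _; rewrite E1 E3 in h.
have -> : g w - g y - d^-1 * (w - y) = - d^-1 * (w - y - d * (g w - g y)) by field.
rewrite nzM nzN nzV ler_pdivrMl //.
apply: le_trans (h _) _; first by lra.
by have := nz_ge0 (w - y); nra.
Qed.

Lemma nontrivial_unity_root k : (0 < k)%N -> exists2 w : Cx R, w != 1 & w ^+ k.+1 = 1 /\ nz w = 1.
Proof.
move=> k0; have k1 : k.+1%:R != 0 :> Cx R by rewrite pnatr_eq0.
have E1 : cexp (two_pi_i R / k.+1%:R) ^+ k.+1 = 1.
  rewrite -cexp_nat mulrC divfK //; rewrite /two_pi_i.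
  by rewrite /cexp /= !mul0r !mul1r !subr0 !add0r ?addr0 /= !(cos2pi, sin2pi) /= expR0 !mul1r.
exists (cexp (two_pi_i R / k.+1%:R)).
  apply/eqP => /cexp_eq1 [n]; rewrite -/(two_pi_i R) => /(mulfI (two_pi_i_neq0 R)) E.
  have : (n * k.+1%:Z)%:~R = 1%:~R :> Cx R by rewrite rmorphM /= -E -pmulrn mulVf.
  move/intr_inj => E2; have : (`|n| * k.+1)%N = 1%N by rewrite -[k.+1]absz_nat -abszM E2.
  by move/eqP; rewrite muln_eq1 eqSS => /andP[_ /eqP E3]; move: k0; rewrite E3.
split=> //; have : nz (cexp (two_pi_i R / k.+1%:R)) ^+ k.+1 = 1 by rewrite -nzX E1 nz1.
by move/eqP; rewrite pexprn_eq1 ?nz_ge0 // => /eqP.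
Qed.

(* psi inverts a (k+1)-st root of t - t s0, so that s0 + psi y and
   s0 + psi (w * y) have the same image under t when w ^+ k.+1 = 1. *)
Lemma critical_coordinate t h g s0 k (r : R) : 0 < r ->
  (forall s, nz (s - s0) < r -> cderiv t s (h s)) ->
  (forall s, nz (s - s0) < r -> h s = (s - s0) ^+ k * g s) ->
  (forall s, nz (s - s0) < r -> {for s, continuous g}) -> g s0 != 0 ->
  exists (psi dpsi phi : Cx R -> Cx R) (q : R), [/\ 0 < q, psi 0 = 0,
    forall y, nz y < q -> nz (psi y) < r /\ phi (psi y) = y,
    forall y, nz y < q -> cderiv psi y (dpsi y) &
    forall y, nz y < q -> h (s0 + psi y) * dpsi y = g s0 * y ^+ k].
Proof.
move=> r0 Ht Hh cg g00; have k1 : k.+1%:R != 0 :> Cx R by rewrite pnatr_eq0.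
have ss : nz (s0 - s0) < r by rewrite subrr nz0.
pose u0 := g s0 / k.+1%:R; have u00 : u0 != 0 by rewrite mulf_neq0 ?invr_eq0.
have sw w : s0 + w - s0 = w by rewrite addrAC subrr add0r.
(* The value at 0 is the one that makes the quotient continuous. *)
pose u w := if w == 0 then u0 else (t (s0 + w) - t s0) / w ^+ k.+1.
have uE w : w ^+ k.+1 * u w = t (s0 + w) - t s0.
  rewrite /u; have [->|w0] := eqVneq w 0; first by rewrite expr0n mul0r addr0 subrr.
  by rewrite mulrC divfK // expf_neq0.
have dshift w : cderiv (fun w => s0 + w) w 1.
  by have := cderivD (cderiv_cst s0 w) (cderiv_id w); rewrite add0r.
have dt w : nz w < r -> cderiv (fun w => t (s0 + w)) w (h (s0 + w)).
  move=> wr; have := cderiv_comp (f := t) (g := fun w => s0 + w) (Ht (s0 + w) _) (dshift w).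
  by rewrite mulr1; apply; rewrite sw.
have segE w (v : R) : seg 0 w v = rc v * w by rewrite /seg subr0 add0r.
have nseg w (v : R) : 0 <= v <= 1 -> nz (seg 0 w v) <= nz w.
  move=> /andP[v0 v1]; rewrite segE nzM nz_rc ger0_norm //.
  by rewrite ler_piMl ?nz_ge0.
have cu0 : {for 0, continuous u}.
  apply/contC => e e0; have e2 : 0 < e / 2 by lra.
  have [r1 r10 H1] := (contC _ _).1 (cg s0 ss) _ e2.
  exists (Num.min r r1) => [|w]; first by rewrite lt_min r0.
  rewrite subr0 lt_min => /andP[wr wr1].
  have [->|w0] := eqVneq w 0; first by rewrite subrr nz0.
  have W0 : 0 < nz w by rewrite nz_gt0.
  have := @seg_bound _ (fun w => t (s0 + w) - u0 * w ^+ k.+1)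
    (fun v => seg 0 w v ^+ k * (g (s0 + seg 0 w v) - g s0)) (nz w ^+ k * (e / 2)) 0 w.
  rewrite expr0n mulr0 addr0 !subr0 => H.
  have {H} : nz (t (s0 + w) - u0 * w ^+ k.+1 - t s0) <= nz w ^+ k * (e / 2) * nz w.
    apply: H => v v01.
      have vr : nz (seg 0 w v) < r by exact: le_lt_trans (nseg w v v01) wr.
      have := cderivB (dt _ vr) (cderivZ u0 (cderivX k.+1 (cderiv_id (seg 0 w v)))).
      rewrite Hh sw //; congr (cderiv _ _ _); rewrite /u0 /=; move: (seg 0 w v) => S.
      by field; rewrite nat1r.
    rewrite nzM nzX; apply: ler_pM; rewrite ?exprn_ge0 ?nz_ge0 //.
      by rewrite lerXn2r ?nnegrE ?nz_ge0 // nseg.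
    apply/ltW/H1; rewrite sw; exact: le_lt_trans (nseg w v v01) wr1.
  have -> : t (s0 + w) - u0 * w ^+ k.+1 - t s0 = w ^+ k.+1 * (u w - u 0).
    have -> : u 0 = u0 by rewrite /u eqxx.
    by rewrite mulrBr uE; move: (t _) (t s0) (w ^+ _) => A B C; ring.
  rewrite nzM nzX mulrAC -exprSr ler_pM2l ?exprn_gt0 // => H2; lra.
pose rho w := cexp (Log (u w / u0) / k.+1%:R).
(* [phi ^+ k.+1] is the increment of [t] divided by [u0]; [dphi] is what differentiating this
   relation gives off 0, in a form that is continuous at 0. *)
pose phi w := w * rho w; pose dphi w := g (s0 + w) / g s0 / rho w ^+ k.
have rho0 : rho 0 = 1 by rewrite /rho /u eqxx divff // Log1 mul0r cexp0.
have cquo : {for (0 : Cx R), continuous (fun w : Cx R => u w / u0)}.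
  exact: (@cont_mulC u (fun=> u0^-1) 0 cu0 (@cont_cstC u0^-1 0)).
have n1 : \forall w \near (0 : Cx R), slit (u w / u0).
  apply: near_comp cquo _; apply: slit_open.
  by rewrite /u eqxx divff //; apply: slit_Re; exact: ltr01.
have cgs : {for 0, continuous (fun w => g (s0 + w))}.
  by apply: (@cont_compC g (fun w => s0 + w)); [rewrite addr0; exact: cg|exact: cderiv_cont (dshift 0)].
have n2 : \forall w \near (0 : Cx R), g (s0 + w) != 0.
  apply: (@near_comp _ (fun w => g (s0 + w)) 0 (fun y => y != 0)); last by rewrite addr0; exact: near_neq0.
  exact: cgs.
have crho : {for 0, continuous rho}.
  apply: (@cont_compC (@cexp R) (fun w => Log (u w / u0) / k.+1%:R)).
    exact: cderiv_cont (cderiv_cexp _).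
  apply: (@cont_mulC (fun w => Log (u w / u0)) (fun=> k.+1%:R^-1)); last exact: (@cont_cstC k.+1%:R^-1 0).
  apply: (@cont_compC (@Log R) (fun w => u w / u0)); last exact: cquo.
  by apply: cont_Log; rewrite /u eqxx divff //; apply: slit_Re; exact: ltr01.
have [q1 q10 Hq1] := (nearC _ _).1 (filterI n1 n2).
have rhoE w : nz w < q1 -> rho w ^+ k.+1 = u w / u0.
  move=> wq; rewrite /rho -cexp_nat mulrC divfK // LogK //.
  by have [] := Hq1 w; rewrite ?subr0.
have phiE w : nz w < q1 -> phi w ^+ k.+1 = (t (s0 + w) - t s0) / u0.
  by move=> wq; rewrite exprMn rhoE // mulrA uE.
have rhon w : rho w != 0 by exact: cexp_neq0.
have phi0 : phi 0 = 0 by rewrite /phi mul0r.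
have dphi0 : dphi 0 = 1 by rewrite /dphi rho0 addr0 expr1n divff // divr1.
have dphi_off w : w != 0 -> nz w < Num.min q1 r -> cderiv phi w (dphi w).
  rewrite lt_min => w0 /andP[wq wr].
  have [sl gn] := Hq1 w (eq_ind_r (fun x => nz x < q1) wq (subr0 w)).
  have du : hdiff u w.
    have [d Hd] : hdiff (fun w => (t (s0 + w) - t s0) / w ^+ k.+1) w.
      apply: (@hdiff_div _ (fun w => t (s0 + w) - t s0)); first by rewrite expf_neq0.
        by apply: (@hdiffB _ (fun w => t (s0 + w))); [eexists; exact: dt|exact: hdiff_cst].
      by apply: (@hdiffX _ id); eexists; exact: cderiv_id.
    exists d; apply: cderiv_ext Hd; apply: filterS (near_neq0 w0) => x x0.
    by rewrite /u (negbTE x0).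
  have [d Hd] : hdiff phi w.
    apply: (@hdiffM _ id); first by eexists; exact: cderiv_id.
    apply: (@hdiff_cexp _ (fun w => Log (u w / u0) / k.+1%:R)).
    apply: (@hdiff_div _ (fun w => Log (u w / u0))) => //; last exact: hdiff_cst.
    apply: (@hdiff_Log _ (fun w => u w / u0)) => //.
    by apply: (@hdiff_div _ u) => //; exact: hdiff_cst.
  suff <- : d = dphi w by [].
  have D1 := cderivX k.+1 Hd.
  have D2 : cderiv (fun w => phi w ^+ k.+1) w (h (s0 + w) / u0).
    have := cderivB (cderivM (dt w wr) (cderiv_cst u0^-1 w)) (cderiv_cst (t s0 / u0) w).
    rewrite mulr0 addr0 subr0; apply: cderiv_ext.
    apply/nearC; exists (q1 - nz w); first by rewrite subr_gt0.
    move=> x xw; rewrite phiE ?mulrBl //.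
    have := nzD (x - w) w; rewrite subrK; lra.
  have := cderiv_unique D1 D2; rewrite /= Hh sw // /dphi /u0 /phi exprMn.
  move: (expf_neq0 k w0) (expf_neq0 k (rhon w)) => + + E.
  move: (w ^+ k) (rho w ^+ k) E => A C E A0 C0.
  have E' : k.+1%:R * (A * C) * d = k.+1%:R * (A * C) * (g (s0 + w) / g s0 / C).
    by rewrite E; field; rewrite nat1r k1 C0 g00.
  by move/mulfI: E'; apply; rewrite !mulf_neq0.
have cphi : {for 0, continuous phi}.
  exact: (@cont_mulC id rho 0 (cderiv_cont (cderiv_id 0)) crho).
have cdphi : {for 0, continuous dphi}.
  exact: (@cont_mulC (fun w => g (s0 + w) / g s0) (fun w => (rho w ^+ k)^-1) 0
    (@cont_mulC (fun w => g (s0 + w)) (fun=> (g s0)^-1) 0 cgs (@cont_cstC (g s0)^-1 0))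
    (@cont_invX rho k 0 (rhon 0) crho)).
have q2 : 0 < Num.min q1 r by rewrite lt_min q10.
have dphiP w : nz w < Num.min q1 r -> cderiv phi w (dphi w).
  move=> wq; have [->|w0] := eqVneq w 0; last exact: dphi_off.
  apply: (@removable_deriv phi dphi 0 _ q2 _ cphi cdphi) => s s0'; rewrite subr0.
  exact: dphi_off.
have phiD w : phi w = w * rho w by [].
have dphiD w : dphi w = g (s0 + w) / g s0 / rho w ^+ k by [].
clearbody phi dphi.
have half : 0 < 1 / 2 :> R by lra.
(* Where [dphi] is within 1/2 of 1, [phi] minus the identity contracts by 1/2, as [near_id_inverse]
   requires. *)
have [q3 q30 H3] := (contC _ _).1 cdphi _ half.
pose q4 := Num.min (Num.min q1 r) q3.
have q40 : 0 < q4 by rewrite lt_min q2.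
have [psi Hpsi] : exists psi, forall y, nz y < q4 / 2 -> nz (psi y) <= 2 * nz y /\ phi (psi y) = y.
  apply: near_id_inverse => // w w' Hw Hw'.
  rewrite mulrC; have := @seg_bound _ (fun w => phi w - w) (fun v => dphi (seg w' w v) - 1) (2^-1) w' w.
  apply=> v v01; have := @seg_ball _ 0 q4 w' w v; rewrite !subr0 => /(_ Hw' Hw v01).
    by rewrite lt_min => /andP[v1 _]; exact: cderivB (dphiP _ v1) (cderiv_id _).
  rewrite lt_min => /andP[_ v2]; rewrite -dphi0 -[2^-1]mul1r; apply/ltW/H3.
  by rewrite subr0.
have pinj w w' : nz w < q4 -> nz w' < q4 -> nz (w - w') <= 2 * nz (phi w - phi w').
  move=> Hw Hw'.
  have H : nz ((phi w - w) - (phi w' - w')) <= 2^-1 * nz (w - w').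
    have := @seg_bound _ (fun w => phi w - w) (fun v => dphi (seg w' w v) - 1) (2^-1) w' w.
    apply=> v v01; have := @seg_ball _ 0 q4 w' w v; rewrite !subr0 => /(_ Hw' Hw v01).
      by rewrite lt_min => /andP[v1 _]; exact: cderivB (dphiP _ v1) (cderiv_id _).
    rewrite lt_min => /andP[_ v2]; rewrite -dphi0 -[2^-1]mul1r; apply/ltW/H3.
    by rewrite subr0.
  have := nzB (phi w - phi w') ((phi w - w) - (phi w' - w')).
  have -> : phi w - phi w' - (phi w - w - (phi w' - w')) = w - w'.
    by move: (phi w) (phi w') => A B; ring.
  by have := nz_ge0 (w - w'); lra.
have qq y : nz y < q4 / 2 -> nz (psi y) < q4 by move=> yq; have [] := Hpsi y yq; lra.
have psi0 : psi 0 = 0.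
  have [|h1 _] := Hpsi 0; first by rewrite nz0; lra.
  by apply/eqP; rewrite -nz_eq0 eq_le nz_ge0 andbT; move: h1; rewrite nz0 mulr0.
have qmin y : nz y < q4 / 2 -> nz (psi y) < q1 /\ nz (psi y) < r.
  by move=> /qq; rewrite !lt_min => /andP[/andP[]].
have dn y : nz y < q4 / 2 -> dphi (psi y) != 0.
  move=> yq; have [y1 y2] := qmin y yq.
  have [_ gn] := Hq1 (psi y) (eq_ind_r (fun x => nz x < q1) y1 (subr0 _)).
  by rewrite dphiD !mulf_neq0 ?invr_eq0 ?expf_neq0.
exists psi, (fun y => (dphi (psi y))^-1), phi, (q4 / 2); split.
- by lra.
- exact: psi0.
- by move=> y yq; have [] := qmin y yq; have [] := Hpsi y yq.
- move=> y yq; have yq' : 0 < q4 / 2 - nz y by lra.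
  apply: (cderiv_inverse yq'); [|apply: dphiP|exact: dn].
    move=> w Hw; have wq : nz w < q4 / 2 by have := nzD (w - y) y; rewrite subrK; lra.
    have [_ E1] := Hpsi w wq; have [_ E2] := Hpsi y yq; split=> //.
    by have := pinj _ _ (qq w wq) (qq y yq); rewrite E1 E2.
  by have := qq y yq; rewrite lt_min => /andP[].
move=> y yq; have [y1 y2] := qmin y yq; have [_ E] := Hpsi y yq.
rewrite Hh ?sw //.
have -> : y ^+ k = psi y ^+ k * rho (psi y) ^+ k by rewrite -exprMn -phiD E.
rewrite dphiD.
have [_ gn] := Hq1 (psi y) (eq_ind_r (fun x => nz x < q1) y1 (subr0 _)).
move: (psi y ^+ k) (rho (psi y) ^+ k) (expf_neq0 k (rhon (psi y))) => A C C0.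
by field; rewrite g00 gn C0.
Qed.

End LocalAnalysis.

(** * Absence of zeros at inner points *)

Section InteriorPoints.
Variables (R : realType) (p : nat) (a : 'I_2 -> nat) (b : 'I_p -> nat)
  (lam : 'I_p -> Cx R) (X : riemann_surface R) (pt : X -> ms_data R p) (om : mero_form X).
Implicit Types (x : X) (Z L : 'I_p -> Cx R -> Cx R).

Local Notation inner := (inner a b lam pt).
Local Notation rep := (rep a b lam pt).
Local Notation lift_on := (lift_on a b lam pt om).

Hypothesis hb : forall j, (1 <= b j)%N.
Hypothesis hab : (\sum_(i < 2) a i + 2 = \sum_(j < p) b j)%N.
Hypothesis hX : is_fiber_closure a b lam pt.
Hypothesis hom : is_omega a b lam pt om.

Lemma near_disc (s s0 : Cx R) (r : R) (P : Cx R -> Prop) : nz (s - s0) < r ->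
  (forall y, nz (y - s0) < r -> P y) -> \forall y \near s, P y.
Proof.
move=> Hs HP; apply/nearC; exists (r - nz (s - s0)); first by rewrite subr_gt0.
move=> y Hy; apply: HP; have -> : y - s0 = (y - s) + (s - s0) by ring.
by apply: le_lt_trans (nzD _ _) _; lra.
Qed.

Lemma lift_ode i s0 (r : R) Z L : lift_on i s0 r Z L ->
  forall s j, nz (s - s0) < r ->
    cderiv (Z j) s (om_coef om i s * ifield a b (fun j => Z j s) j).
Proof.
move=> HL s j Hs; have [_ _ _ hZL dt] := HL s Hs.
apply: (tau_ode hb hab (lam := lam) (L := L)) dt _ => //.
- by apply: near_disc Hs _ => y /HL[_ rp _ _ _]; exact: rep_zfiber rp.
- by move=> k; have [] := hZL k.
- by apply: near_disc Hs _ => y /HL[_ _ cL _ _].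
by move=> k; apply: hdiff_cont; have [] := hZL k.
Qed.

Lemma lift_inj i s0 (r : R) Z L s s' : lift_on i s0 r Z L ->
  nz (s - s0) < r -> nz (s' - s0) < r -> (forall j, Z j s = Z j s') -> s = s'.
Proof.
move=> HL Hs Hs' E; have [im rp _ _ _] := HL s Hs; have [im' rp' _ _ _] := HL s' Hs'.
have : rs_psi i s = rs_psi i s'.
  apply: (rep_inj hab hX) rp _; suff -> : (fun j => Z j s) = (fun j => Z j s') by [].
  by apply/funext.
have [_ p1 _] := rs_psiP im; have [_ p2 _] := rs_psiP im'.
by rewrite -{2}p1 -{2}p2 => ->.
Qed.

(** In the coordinate [y] of [critical_coordinate] the time has velocity [g s0 * y ^+ k], and the
    rotation [y] to [w * y] preserves the equation because [w ^+ k * w = 1]. A coefficient vanishing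
    identically would make [Z] constant, against [lift_inj] as well. *)
Lemma inner_not_zero x : inner x -> ~ is_zero om x.
Proof.
move=> xin [i [xi H]]; have [r [Z [L [r0 HL]]]] := lift_any_chart hab hX hom xi xin.
set s0 := rs_phi i x in H HL *.
have ss : nz (s0 - s0) < r by rewrite subrr nz0.
case: H => [[k [k0 [g [hg g0 Hg]]]]|H0]; last first.
  have [r1 r10 H1] := (nearC _ _).1 H0.
  have q0 : 0 < Num.min r r1 by rewrite lt_min r0.
  pose s := s0 + rc (Num.min r r1 / 2).
  have sE : nz (s - s0) = Num.min r r1 / 2.
    by rewrite /s addrAC subrr add0r nz_rc gtr0_norm // divr_gt0.
  have Hs : nz (s - s0) < Num.min r r1 by rewrite sE; lra.
  suff E : s = s0 by move: sE; rewrite E subrr nz0; lra.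
  apply: (lift_inj HL) => //; first by move: Hs; rewrite lt_min => /andP[].
  move=> j; apply: (@deriv0_const _ (Z j) s0 (Num.min r r1)) => // y.
  rewrite lt_min => /andP[y1 y2]; have := lift_ode HL j y1.
  by rewrite H1 // mul0r.
case: k k0 Hg => // k k0 Hg; have {}k0 : (0 < k)%N by [].
have [r1 r10 H1] := (nearC _ _).1 (filterI hg Hg).
pose r2 := Num.min r r1; have r20 : 0 < r2 by rewrite lt_min r0.
pose t s := tau a b (fun j => Z j s) (fun j => L j s).
have [psi [dpsi [phi [q [q0 psi0 Hpsi Hd Hh]]]]] : exists (psi dpsi phi : Cx R -> Cx R) (q : R),
   [/\ 0 < q, psi 0 = 0,
    forall y, nz y < q -> nz (psi y) < r2 /\ phi (psi y) = y,
    forall y, nz y < q -> cderiv psi y (dpsi y) &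
    forall y, nz y < q -> om_coef om i (s0 + psi y) * dpsi y = g s0 * y ^+ k].
  apply: (@critical_coordinate _ t) => // s; rewrite lt_min => /andP[h1 h2].
  - by have [] := HL s h1.
  - by have [_ ->] := H1 s h2.
  by have [[d /cderiv_cont]] := H1 s h2.
have [w w1 [wk nw]] := nontrivial_unity_root R k0.
have qr y : nz y < q -> nz (s0 + psi y - s0) < r.
  by move=> /Hpsi[h _]; rewrite addrAC subrr add0r; move: h; rewrite lt_min => /andP[].
have wq y : nz (w * y) = nz y by rewrite nzM nw mul1r.
pose B := \sum_j nz (Z j s0) + 1.
have [q1 q10 Hq1] : exists2 q1 : R, 0 < q1 & forall s, nz (s - s0) < q1 -> forall j, nz (Z j s) <= B.
  apply/nearC; apply: (@filter_forall _ _ (fun j s => nz (Z j s) <= B) (nbhs s0) _) => j.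
  have [_ _ _ hZ _] := HL s0 ss; have [/hdiff_cont/contC/(_ 1 ltr01)[e e0 He] _] := hZ j.
  apply/nearC; exists e => // s /He h; have := nzD (Z j s - Z j s0) (Z j s0); rewrite subrK.
  have : nz (Z j s0) <= \sum_j nz (Z j s0).
    by rewrite (bigD1 j) //= lerDl; apply: sumr_ge0 => ? _; exact: nz_ge0.
  by rewrite /B; lra.
have [q2 q20 Hq2] : exists2 q2 : R, 0 < q2 & forall y, nz y < q2 -> nz (psi y) < q1.
  have zq : nz (0 : Cx R) < q by rewrite nz0.
  have := cderiv_cont (Hd 0 zq).
  move=> /contC/(_ q1 q10)[e e0 He]; exists e => // y ye.
  by have := He y; rewrite psi0 !subr0; apply.
pose q3 := Num.min 1 (Num.min q q2).
have q30 : 0 < q3 by rewrite !lt_min ltr01 q0.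
have q3P y : nz y < q3 -> [/\ nz y < 1, nz y < q & nz y < q2].
  by rewrite !lt_min => /and3P.
have ZB y : nz y < q3 -> forall j, nz (Z j (s0 + psi y)) <= B.
  move=> /q3P[_ _ h] j; apply: Hq1; rewrite addrAC subrr add0r; exact: Hq2.
have ZB' y : nz y < q3 -> forall j, nz (Z j (s0 + psi (w * y))) <= B.
  by move=> yq; apply: ZB; rewrite wq.
have [K K0 HK] := ifield_lip a b B.
have dpsi' y : nz y < q -> cderiv (fun y => s0 + psi y) y (dpsi y).
  by move=> yq; have := cderivD (cderiv_cst s0 y) (Hd y yq); rewrite add0r.
have D1 y j : nz y < q -> cderiv (fun y => Z j (s0 + psi y)) y
    (g s0 * y ^+ k * ifield a b (fun j => Z j (s0 + psi y)) j).
  move=> yq; have := @cderiv_comp _ (Z j) (fun y => s0 + psi y) _ _ _ (lift_ode HL j (qr y yq)) (dpsi' y yq).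
  by rewrite mulrAC Hh.
have [e /andP[e0 eq3] He] : exists2 e : R, 0 < e <= q3 & forall y j, nz (y - 0) < e ->
    Z j (s0 + psi y) = Z j (s0 + psi (w * y)).
  apply: (@ode_unique _ _ (fun j y => Z j (s0 + psi y))
    (fun j y => Z j (s0 + psi (w * y))) (fun y => g s0 * y ^+ k) (ifield a b) 0 q3
    (nz (g s0)) K (B + B) q30 (nz_ge0 _) (ltW K0)).
  - move=> s; rewrite subr0 => /q3P[s1 _ _]; rewrite nzM nzX ler_piMr ?nz_ge0 //.
    by rewrite exprn_ile1 ?nz_ge0 // ltW.
  - by move=> s j; rewrite subr0 => /q3P[_ sq _]; exact: D1.
  - move=> s j; rewrite subr0 => /q3P[_ sq _].
    have wsq : nz (w * s) < q by rewrite wq.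
    have Dw : cderiv (fun y => w * y) s w.
      by have := cderivZ w (cderiv_id s); rewrite mulr1.
    have := @cderiv_comp _ (fun y => Z j (s0 + psi y)) (fun y => w * y) _ _ _ (D1 (w * s) j wsq) Dw.
    congr (cderiv _ _ _); rewrite exprMn -[g s0 * s ^+ k]mul1r -wk exprS; ring.
  - move=> s j; rewrite subr0 => sq; apply: le_trans (nzB _ _) _.
    by apply: lerD; [exact: ZB|exact: ZB'].
  - move=> s j d; rewrite subr0 => sq Hdd.
    have [_ _ H] := HK _ (ZB s sq); apply: H => //; exact: ZB'.
  by move=> j; rewrite mulr0.
pose y : Cx R := rc (e / 2).
have yE : nz y = e / 2 by rewrite nz_rc gtr0_norm // divr_gt0.
have y0 : y != 0 by rewrite -nz_gt0 yE divr_gt0.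
have ye : nz y < e by rewrite yE; lra.
have [_ yq _] := q3P y (lt_le_trans ye eq3).
have wyq : nz (w * y) < q by rewrite wq.
have E : s0 + psi y = s0 + psi (w * y).
  apply: (lift_inj HL); [exact: qr|exact: qr|].
  by move=> j; apply: (He y j); rewrite subr0.
move/addrI/(congr1 phi): E; have [_ ->] := Hpsi y yq; have [_ ->] := Hpsi _ wyq.
move=> E; move: w1; rewrite -subr_eq0 => w1.
have : (w - 1) * y = 0 by rewrite mulrBl mul1r -E subrr.
by move/eqP; rewrite mulf_eq0 (negbTE w1) (negbTE y0).
Qed.

End InteriorPoints.

(** * Boundary points *)

Lemma nz_lim_ge (R : realType) (u : nat -> Cx R) (l : Cx R) (c : R) :
  u n @[n --> \oo] --> l -> (forall n, c <= nz (u n)) -> c <= nz l.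
Proof.
move=> Hu Hc; rewrite leNgt; apply/negP => h; have e0 : 0 < c - nz l by lra.
have /cvgC/(_ _ e0)[n _ /(_ n (leqnn n)) /=] := Hu.
by have := nzBge (u n) l; have := Hc n; lra.
Qed.

Lemma nz_lim_le (R : realType) (u : nat -> Cx R) (l : Cx R) (c : R) :
  u n @[n --> \oo] --> l -> (forall n, nz (u n) <= c) -> nz l <= c.
Proof.
move=> Hu Hc; rewrite leNgt; apply/negP => h; have e0 : 0 < nz l - c by lra.
have /cvgC/(_ _ e0)[n _ /(_ n (leqnn n)) /=] := Hu.
by have := nzBge l (u n); have := Hc n; rewrite nzC; lra.
Qed.

Lemma slow_step (R : realType) (u v c l x : R) : u < v -> c * l <= 1 / 4 -> 0 <= x ->
  c * x * ((v - u) * l) <= (v - u) / 2 * x.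
Proof.
move=> uv cl x0; have -> : c * x * ((v - u) * l) = c * l * ((v - u) * x) by ring.
have vx : 0 <= (v - u) * x by rewrite mulr_ge0 // subr_ge0 ltW.
by have := ler_wpM2r vx cl; lra.
Qed.

(** The factor [1 - u / 2] stands in for an exponential: [(1 - u / 2) * (1 - (v - u) / 2)] is at
    least [1 - v / 2], so relative changes of half the elapsed parameter accumulate to at most a
    factor 2. *)
Lemma shrink_below (R : realType) (u v x : R) (A B : Cx R) :
  0 <= u -> u < v -> v <= 1 -> 0 <= x -> (1 - u / 2) * x <= nz A ->
  nz (B - A) <= (v - u) / 2 * nz A -> (1 - v / 2) * x <= nz B.
Proof.
move=> u0 uv v1 x0 xA BA; have := nzBge A (A - B); rewrite subKr [nz (A - B)]nzC => h.
have h1 : (1 - (v - u) / 2) * ((1 - u / 2) * x) <= (1 - (v - u) / 2) * nz A.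
  by rewrite ler_wpM2l //; lra.
have h2 : 0 <= (v - u) / 2 * (u / 2) * x by rewrite !mulr_ge0 //; lra.
by lra.
Qed.

Lemma shrink_above (R : realType) (u v x : R) (A B : Cx R) :
  0 <= u -> u < v -> v <= 1 -> nz (B - A) <= (v - u) / 2 * nz A ->
  (1 - u / 2) * nz A <= x -> (1 - v / 2) * nz B <= x.
Proof.
move=> u0 uv v1 BA Ax; have := nzD (B - A) A; rewrite subrK => h.
have h3 : (1 - v / 2) * nz B <= (1 - v / 2) * ((1 + (v - u) / 2) * nz A).
  by rewrite ler_wpM2l //; lra.
have k1 : 0 <= (v - u) / 2 by lra.
have k2 : 0 <= u / 2 by lra.
have h4 : 0 <= ((v - u) / 2 * (u / 2) + (v - u) / 2 * ((v - u) / 2)) * nz A.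
  by rewrite mulr_ge0 ?nz_ge0 // addr_ge0 // mulr_ge0.
by lra.
Qed.

Section Boundary.
Variables (R : realType) (p : nat) (a : 'I_2 -> nat) (b : 'I_p -> nat)
  (lam : 'I_p -> Cx R) (X : riemann_surface R) (pt : X -> ms_data R p) (om : mero_form X).
Implicit Types (x : X) (Z L : 'I_p -> Cx R -> Cx R).

Local Notation inner := (inner a b lam pt).
Local Notation rep := (rep a b lam pt).
Local Notation pval := (pval a b lam pt).
Local Notation lift_on := (lift_on a b lam pt om).
Local Notation a2 := (a ord_max).

Hypothesis hp : (2 <= p)%N.
Hypothesis hb : forall j, (1 <= b j)%N.
Hypothesis hab : (\sum_(i < 2) a i + 2 = \sum_(j < p) b j)%N.
Hypothesis hres : ~ resonant lam.
Hypothesis hX : is_fiber_closure a b lam pt.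
Hypothesis hom : is_omega a b lam pt om.

Variables (i : rs_idx X) (s0 : Cx R) (r M : R).
Local Notation psi := (rs_psi i).
Hypothesis M0 : 0 <= M.
Hypothesis Him : forall s, nz (s - s0) < r -> rs_im i s.
Hypothesis HM : forall s, nz (s - s0) < r -> nz (om_coef om i s) <= M.

Lemma unity_nz (m : Cx R) n : m ^+ n.+1 = 1 -> nz m = 1.
Proof.
move=> E; have : nz m ^+ n.+1 = 1 by rewrite -nzX E nz1.
by move/eqP; rewrite pexprn_eq1 ?nz_ge0 // => /eqP.
Qed.

(* As long as the normal form is bounded it moves at a bounded logarithmic
   speed, because the derivative of the period is bounded; hence it cannot
   degenerate within a fixed distance. *)
Lemma inner_extends (B : R) : exists2 d : R, 0 < d & forall s s' z,
  nz (s - s0) < r -> nz (s' - s0) < r -> nz (s' - s) < d ->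
  rep (psi s) z -> (forall j, nz (z j) <= B) -> inner (psi s').
Proof.
have [K K0 HK] := ifield_lip a b (2 * B).
have MK0 : 0 < M * K + 1 by have := mulr_ge0 M0 (ltW K0); lra.
(* The bound [M * K + 1] on the logarithmic speed times the length of the segment is then at most
   1/4, as [slow_step] asks. *)
exists (4 * (M * K + 1))^-1; first by rewrite invr_gt0; lra.
move=> s s' z sr s'r ss' rz zB.
have [zI z0 zl] := rep_zfiber hab rz.
(* No pole shrinks or grows, and no mutual distance shrinks, by more than a factor 2; these bounds
   pass to limits and exclude degeneration. *)
pose P (u : R) := exists w, [/\ rep (psi (seg s s' u)) w,
  forall j, (1 - u / 2) * nz (z j) <= nz (w j),
  forall j, (1 - u / 2) * nz (w j) <= nz (z j) &
  forall k j, (1 - u / 2) * nz (z k - z j) <= nz (w k - w j)].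
have segr (u : R) : 0 <= u <= 1 -> nz (seg s s' u - s0) < r by move=> u01; exact: seg_ball.
suff /(_ 1) : forall u : R, 0 <= u <= 1 -> P u.
  rewrite ler01 lexx => /(_ isT) [w [rw _ _ _]]; exists w; by rewrite -(seg1 s s').
apply: real_induction => [|u /andP[u0 u1] IH|u /andP[u0 u1] [w [rw w1 w2 w3]]].
- by exists z; rewrite seg0 mul0r subr0; split=> // [j|j|k j]; rewrite mul1r.
- pose v n : R := u - u / n.+1%:R.
  have vu n : 0 <= v n < u.
    have n1 : 1 <= n.+1%:R :> R by rewrite ler1n.
    have n0 : 0 < n.+1%:R :> R by rewrite ltr0n.
    rewrite /v subr_ge0 ler_pdivrMr // ler_peMr ?(ltW u0) //=.
    by rewrite ltrBlDr ltrDl divr_gt0.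
  have /choice[w Hw] : forall n, exists w, [/\ rep (psi (seg s s' (v n))) w,
      forall j, (1 - v n / 2) * nz (z j) <= nz (w j),
      forall j, (1 - v n / 2) * nz (w j) <= nz (z j) &
      forall k j, (1 - v n / 2) * nz (z k - z j) <= nz (w k - w j)].
    by move=> n; exact: IH (vu n).
  have le1 n (x : R) : 0 <= x -> (1 - u / 2) * x <= (1 - v n / 2) * x.
    by move=> x0; have := vu n; move=> /andP[_ h]; rewrite ler_wpM2r //; lra.
  have wB n j : nz (w n j) <= 2 * B.
    have [_ _ h _] := Hw n; have := le1 n _ (nz_ge0 (w n j)); have := h j; have := zB j.
    have := nz_ge0 (w n j); nra.
  have [f [w' [fn Hw']]] := bounded_subsequence wB.
  have b1 j : (1 - u / 2) * nz (z j) <= nz (w' j).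
    apply: nz_lim_ge (Hw' j) _ => n; have [_ h _ _] := Hw (f n).
    exact: le_trans (le1 _ _ (nz_ge0 _)) (h j).
  have b2 j : (1 - u / 2) * nz (w' j) <= nz (z j).
    have u2 : 0 < 1 - u / 2 by lra.
    rewrite mulrC -ler_pdivlMr //; apply: nz_lim_le (Hw' j) _ => n.
    rewrite ler_pdivlMr // mulrC; have [_ _ h _] := Hw (f n).
    exact: le_trans (le1 _ _ (nz_ge0 _)) (h j).
  have b3 k j : (1 - u / 2) * nz (z k - z j) <= nz (w' k - w' j).
    apply: (@nz_lim_ge _ (fun n => w (f n) k - w (f n) j)).
      exact: (@cvg_subC R _ \oo _ (fun n => w (f n) k) (fun n => w (f n) j) _ _ (Hw' k) (Hw' j)).
    move=> n; have [_ _ _ h] := Hw (f n).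
    exact: le_trans (le1 _ _ (nz_ge0 _)) (h k j).
  have u2 : 0 < 1 - u / 2 by lra.
  (* The bounds make the limit a normal form again. It represents some point, which by [rep_cvg] and
     uniqueness of limits is the point at parameter [u]. *)
  have fw : zfiber a b lam w'.
    have wI : injective w'.
      move=> k j E; apply: zI; apply/eqP; rewrite -subr_eq0 -nz_eq0.
      have := b3 k j; rewrite E subrr nz0 pmulr_rle0 // => h.
      by rewrite eq_le h nz_ge0.
    split=> // j.
      rewrite -nz_gt0; apply: lt_le_trans (b1 j).
      by rewrite mulr_gt0 // nz_gt0.
    have c1 : two_pi_i R * cf a b (w (f n)) j 0 @[n --> \oo] --> two_pi_i R * cf a b w' j 0.
      exact: (@cvg_mulC R _ \oo _ (fun=> two_pi_i R) (fun n => cf a b (w (f n)) j 0) _ _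
        (@cvg_constC R _ \oo _ (two_pi_i R)) (cf_cvg wI Hw')).
    have c2 : two_pi_i R * cf a b (w (f n)) j 0 @[n --> \oo] --> lam j.
      have -> : (fun n => two_pi_i R * cf a b (w (f n)) j 0) = fun=> lam j.
        by apply/funext => n; have [rw _ _ _] := Hw (f n); have [_ _ ->] := rep_zfiber hab rw.
      exact: (@cvg_constC R _ \oo _ (lam j)).
    exact: (@cvg_unique _ (@norm_hausdorff _ (Cx R)) _ _ _ _ c1 c2).
  have [y ry] := rep_exists hp hab hX fw.
  have cy : psi (seg s s' (v (f n))) @[n --> \oo] --> y.
    by apply: (rep_cvg hab hX ry) Hw' => n; have [] := Hw (f n).
  have cu : psi (seg s s' (v (f n))) @[n --> \oo] --> psi (seg s s' u).
    have u01 : 0 <= u <= 1 by rewrite u1 ltW.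
    have [_ _ cpsi] := rs_psiP (Him (segr u u01)).
    apply: (@cvg_comp _ _ _ (fun n => seg s s' (v (f n))) (rs_psi i) _ _ _ _ cpsi).
    apply/cvgC => e e0.
    have [N HN] : exists N : nat, nz (s' - s) / e < N%:R.
      by exists (Num.bound (nz (s' - s) / e)); apply: archi_boundP; rewrite divr_ge0 ?nz_ge0 // ltW.
    exists N => // n /= Nn; rewrite nz_seg.
    have fn1 : N%:R < (f n).+1%:R :> R by rewrite ltr_nat ltnS (leq_trans Nn).
    have f0 : 0 < (f n).+1%:R :> R by rewrite ltr0n.
    rewrite /v addrAC subrr add0r normrN ger0_norm ?divr_ge0 ?(ltW u0) ?(ltW f0) //.
    rewrite mulrAC ltr_pdivrMr //; move: HN; rewrite ltr_pdivrMr // => HN.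
    have : u * nz (s' - s) <= nz (s' - s) by rewrite ler_piMl ?nz_ge0.
    have : N%:R * e <= (f n).+1%:R * e by rewrite ler_wpM2r ?(ltW e0) ?(ltW fn1).
    by rewrite [e * _]mulrC; lra.
  have E := @cvg_unique _ (@rs_hausdorff _ X) _ _ _ _ cy cu.
  by exists w'; split=> //; rewrite -E.
have u01 : 0 <= u <= 1 by rewrite u0 ltW.
set su := seg s s' u; have sur : nz (su - s0) < r by exact: segr.
have [dsu psu _] := rs_psiP (Him sur).
have rin : inner (psi su) by exists w.
(* At [su] this lift may differ from [w] by a root of unity, which affects no modulus. *)
have [q [Z [L [q0 HL]]]] := lift_any_chart hab hX hom dsu rin.
rewrite psu in HL.
have ss : nz (su - su) < q by rewrite subrr nz0.
have [_ rZ _ _ _] := HL su ss.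
have [m m1 mE] := rep_unique hp hab hres hX rw rZ.
have nm := unity_nz m1.
have nZ j : nz (Z j su) = nz (w j) by rewrite mE nzM nm mul1r.
have nZZ k j : nz (Z k su - Z j su) = nz (w k - w j) by rewrite !mE -mulrBr nzM nm mul1r.
have wB j : nz (Z j su) <= 2 * B.
  by rewrite nZ; have := w2 j; have := zB j; have := nz_ge0 (w j); nra.
have [E1 E2 _] := HK (fun j => Z j su) wB.
have [wI w0 _] := rep_zfiber hab rw.
have hsu := HM sur.
have near1 : \forall y \near su, forall j, nz (Z j y - Z j su) <= (M * K + 1) * nz (w j) * nz (y - su).
  apply: (@filter_forall _ _ (fun j y => nz (Z j y - Z j su) <= (M * K + 1) * nz (w j) * nz (y - su)) (nbhs su) _) => j.
  have wj : 0 < nz (w j) by rewrite nz_gt0.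
  have /cderivP/(_ _ wj)[e e0 He] := lift_ode hb hab HL j ss.
  apply/nearC; exists e => // y /He h.
  have := nzD (Z j y - Z j su - om_coef om i su * ifield a b (fun j => Z j su) j * (y - su))
              (om_coef om i su * ifield a b (fun j => Z j su) j * (y - su)).
  rewrite subrK nzM [nz (_ * ifield _ _ _ _)]nzM => h1.
  have h2 := E1 j; rewrite nZ in h2.
  have h3 : nz (om_coef om i su) * nz (ifield a b (fun j => Z j su) j) <= M * (K * nz (w j)).
    by apply: ler_pM => //; exact: nz_ge0.
  have := ler_wpM2r (nz_ge0 (y - su)) h3; lra.
have near2 : \forall y \near su, forall kj : 'I_p * 'I_p,
    nz ((Z kj.1 y - Z kj.2 y) - (Z kj.1 su - Z kj.2 su)) <= (M * K + 1) * nz (w kj.1 - w kj.2) * nz (y - su).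
  apply: (@filter_forall _ _ (fun kj y => nz ((Z kj.1 y - Z kj.2 y) - (Z kj.1 su - Z kj.2 su)) <=
     (M * K + 1) * nz (w kj.1 - w kj.2) * nz (y - su)) (nbhs su) _) => -[k j] /=.
  have [->|kj] := eqVneq k j.
    by apply/nearC; exists 1 => // y _; rewrite !subrr nz0 mulr0 mul0r.
  have wj : 0 < nz (w k - w j) by rewrite nz_gt0 subr_eq0 (inj_eq wI).
  have /cderivP/(_ _ wj)[e e0 He] := cderivB (lift_ode hb hab HL k ss) (lift_ode hb hab HL j ss).
  apply/nearC; exists e => // y /He; rewrite -mulrBr => h.
  have := nzD (Z k y - Z j y - (Z k su - Z j su) -
      om_coef om i su * (ifield a b (fun j => Z j su) k - ifield a b (fun j => Z j su) j) * (y - su))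
      (om_coef om i su * (ifield a b (fun j => Z j su) k - ifield a b (fun j => Z j su) j) * (y - su)).
  rewrite subrK nzM [nz (_ * (ifield _ _ _ _ - _))]nzM => h1.
  have h2 := E2 k j; rewrite nZZ in h2.
  have h3 : nz (om_coef om i su) * nz (ifield a b (fun j => Z j su) k - ifield a b (fun j => Z j su) j) <= M * (K * nz (w k - w j)).
    by apply: ler_pM => //; exact: nz_ge0.
  have := ler_wpM2r (nz_ge0 (y - su)) h3; lra.
have [e e0 He] := (nearC _ _).1 (filterI near1 near2).
have l0 := nz_ge0 (s' - s).
exists (Num.min q e / (nz (s' - s) + 1)).
  by rewrite divr_gt0 ?lt_min ?q0 //; lra.
move=> v /andP[uv vr] v1.
have dv : nz (seg s s' v - su) = (v - u) * nz (s' - s).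
  by rewrite nz_seg ger0_norm // subr_ge0 ltW.
have dvr : (v - u) * nz (s' - s) < Num.min q e.
  have : v - u < Num.min q e / (nz (s' - s) + 1) by lra.
  by rewrite ltr_pdivlMr; nra.
have [dq de] : nz (seg s s' v - su) < q /\ nz (seg s s' v - su) < e.
  by rewrite dv; move: dvr; rewrite lt_min => /andP.
have [n1 n2] := He _ de; have [_ rv _ _ _] := HL _ dq.
have cl : (M * K + 1) * nz (s' - s) <= 1 / 4.
  have c4 : 0 < 4 * (M * K + 1) by rewrite mulr_gt0.
  move/ltW: ss'; rewrite -[_^-1]mul1r ler_pdivlMr // ler_pdivlMr //.
  by rewrite (_ : (M * K + 1) * nz (s' - s) * 4 = nz (s' - s) * (4 * (M * K + 1))) //; ring.
have step (x : R) : 0 <= x -> (M * K + 1) * x * nz (seg s s' v - su) <= (v - u) / 2 * x.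
  by move=> x0; rewrite dv; exact: slow_step.
have step1 j : nz (Z j (seg s s' v) - Z j su) <= (v - u) / 2 * nz (Z j su).
  by rewrite nZ; apply: le_trans (n1 j) (step _ (nz_ge0 _)).
have step2 k j : nz ((Z k (seg s s' v) - Z j (seg s s' v)) - (Z k su - Z j su)) <=
    (v - u) / 2 * nz (Z k su - Z j su).
  by rewrite nZZ; apply: le_trans (n2 (k, j)) (step _ (nz_ge0 _)).
exists (fun j => Z j (seg s s' v)); split=> // [j|j|k j].
- by apply: (shrink_below u0 uv v1 (nz_ge0 _) _ (step1 j)); rewrite nZ.
- by apply: (shrink_above u0 uv v1 (step1 j)); rewrite nZ.
by apply: (shrink_below u0 uv v1 (nz_ge0 _) _ (step2 k j)); rewrite nZZ.
Qed.

End Boundary.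

(** * The integral near a boundary point *)

Section ClusterFunction.
Variables (R : realType) (p : nat) (a : 'I_2 -> nat) (b : 'I_p -> nat)
  (lam : 'I_p -> Cx R) (X : riemann_surface R) (pt : X -> ms_data R p) (om : mero_form X).
Implicit Types (x : X) (z : 'I_p -> Cx R).

Local Notation inner := (inner a b lam pt).
Local Notation rep := (rep a b lam pt).
Local Notation pval := (pval a b lam pt).
Local Notation a2 := (a ord_max).

Hypothesis hp : (2 <= p)%N.
Hypothesis hb : forall j, (1 <= b j)%N.
Hypothesis hab : (\sum_(i < 2) a i + 2 = \sum_(j < p) b j)%N.
Hypothesis hres : ~ resonant lam.
Hypothesis hX : is_fiber_closure a b lam pt.
Hypothesis hom : is_omega a b lam pt om.

Definition mean z : Cx R := (\sum_j z j) / p%:R.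
Definition tmean z : Cx R := tau_cluster a b z (mean z).

Lemma cf_rep_unique x z z' : rep x z -> rep x z' ->
  exists2 m : Cx R, m != 0 & (forall j, z' j = m * z j) /\
    forall j k, cf a b z' j k = m ^+ k * cf a b z j k.
Proof.
move=> Hz Hz'; have [m m1 mE] := rep_unique hp hab hres hX Hz Hz'.
have m0 : m != 0 by apply: contra_eq_neq m1 => ->; rewrite expr0n /= eq_sym oner_eq0.
exists m => //; split=> // j k; have := cf_homog hab z j k m0; rewrite m1 mulr1 => <-.
by congr (cf _ _ _ _ _); apply/funext => l.
Qed.

(** The mean rotates together with the poles, so the logarithms of the quotients do not change,
    whereas logarithms of the poles themselves would. *)
Lemma tmean_unique x z z' : rep x z -> rep x z' -> tmean z' = tmean z.
Proof.
move=> Hz Hz'; have [m m0 [mE cE]] := cf_rep_unique Hz Hz'.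
have [zI z0 _] := rep_zfiber hab Hz.
have wE : mean z' = m * mean z.
  by rewrite /mean mulrA mulr_sumr; congr (_ / _); apply: eq_bigr => j _.
rewrite /tmean /tau_cluster /tau; apply: (congr2 (fun u v => u - v)).
  apply: eq_bigr => j _; apply: eq_bigr => k _; rewrite cE mE -mulrN exprMn.
  by field; rewrite nat1r pnatr_eq0 !expf_neq0 // oppr_eq0.
by apply: eq_bigr => j _; rewrite cE mE wE expr0 mul1r -mulf_div divff // mul1r.
Qed.

Variables (i : rs_idx X) (s0 : Cx R) (r M : R).
Local Notation psi := (rs_psi i).
Hypothesis r0 : 0 < r.
Hypothesis M0 : 0 <= M.
Hypothesis Him : forall s, nz (s - s0) < r -> rs_im i s.
Hypothesis HM : forall s, nz (s - s0) < r -> nz (om_coef om i s) <= M.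

(* Near a boundary point the poles cluster far from the two zeros, and the
   period along a path avoiding the cluster tends to 0. *)
Lemma cluster_function : ~ inner (psi s0) ->
  exists (r' : R) (t : Cx R -> Cx R), [/\ 0 < r' <= r,
    forall s, nz (s - s0) < r' -> inner (psi s) -> cderiv t s (om_coef om i s),
    forall s, nz (s - s0) < r' -> ~ inner (psi s) -> t s = 0 /\ {for s, continuous t} &
    forall s, nz (s - s0) < r' -> pval (psi s) (t s)].
Proof.
move=> ni0; have [M1 HM1] := cluster_mean hab hp hres.
have ext := inner_extends hp hb hab hres hX hom M0 Him HM.
have [d d0 Hd] := ext M1.
pose t s := if pselect (inner (psi s)) is left H then tmean (projT1 (cid H)) else 0.
have tE s z : rep (psi s) z -> t s = tmean z.
  move=> Hz; rewrite /t; case: pselect => [H|[]]; last by exists z.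
  by case: cid => z' /= Hz'; exact: tmean_unique Hz Hz'.
have t0 s : ~ inner (psi s) -> t s = 0 by rewrite /t; case: pselect.
pose r' := Num.min r d; have r'0 : 0 < r' by rewrite lt_min r0.
(* Contrapositive of [inner_extends]: close enough to a point without normal form, some pole exceeds
   the given bound. *)
have far s z s1 (B e : R) : nz (s - s0) < r -> nz (s1 - s0) < r -> ~ inner (psi s1) ->
    (forall s s' z, nz (s - s0) < r -> nz (s' - s0) < r -> nz (s' - s) < e ->
      rep (psi s) z -> (forall j, nz (z j) <= B) -> inner (psi s')) ->
    nz (s - s1) < e -> rep (psi s) z -> exists j, B < nz (z j).
  move=> sr s1r ni He se rz; apply: contrapT => /forallNP H; apply: ni.
  apply: (He s s1 z) => //; first by rewrite nzC.
  by move=> j; rewrite leNgt; apply/negP; exact: H.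
have clus s z : nz (s - s0) < r' -> rep (psi s) z ->
    mean z != 0 /\ forall j, nz (z j / mean z - 1) <= 1 / 2.
  rewrite lt_min => /andP[sr sd] rz.
  have ss : nz (s0 - s0) < r by rewrite subrr nz0.
  have [j Hj] := far s z s0 M1 d sr ss ni0 Hd sd rz.
  by have [] := HM1 z j (rep_zfiber hab rz) (ltW Hj).
have slitw z j : nz (z j / mean z - 1) <= 1 / 2 -> slit (z j / mean z).
  move=> h; apply: slit_Re; have := nzRe (z j / mean z - 1); rewrite ReB /=.
  by rewrite ler_norml => /andP[h1 _]; lra.
exists r', t; split.
- by rewrite r'0 ge_min lexx.
- move=> s sr' sin; have sr : nz (s - s0) < r by move: sr'; rewrite lt_min => /andP[].
  have [ds ps _] := rs_psiP (Him sr).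
  have [q [Z [L [q0 HL]]]] := lift_any_chart hab hX hom ds sin; rewrite ps in HL.
  have sq : nz (s - s) < q by rewrite subrr nz0.
  have [_ rZ cL hZL dt] := HL s sq.
  have [_ Z0 _] := rep_zfiber hab rZ.
  pose w y := mean (fun j => Z j y).
  have [w0 wc] := clus s _ sr' rZ; rewrite -/(w s) in w0 wc.
  have hw y : nz (y - s) < q -> hdiff w y.
    move=> /HL[_ _ _ hZ _]; apply: (@hdiffM _ (fun y => \sum_j Z j y)); last exact: hdiff_cst.
    have /choice[dz dZ] : forall j, exists d, cderiv (Z j) y d by move=> j; have [] := hZ j.
    exists (\sum_j dz j); apply: (@cderiv_sum _ _ _ _ (fun j y => Z j y)) => j _; exact: dZ.
  have hs := hw s sq.
  have nslit : \forall y \near s, slit (w y / w s).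
    apply: (@hdiff_near _ (fun y => w y / w s) s (@slit R)).
      by apply: (@hdiffM _ w) => //; exact: hdiff_cst.
    by apply: slit_open; rewrite divff //; apply: slit_Re; exact: ltr01.
  have nr' : \forall y \near s, nz (y - s0) < r' by exact: near_disc sr' _.
  have nq : \forall y \near s, nz (y - s) < q by apply/nearC; exists q.
  have [l0 Hl0] := cexp_surj w0.
  pose l y := l0 + Log (w y / w s).
  (* Compares the logarithms of the cluster branch with those of the lift. Its exponential is 1, so
     as a continuous logarithm of a constant it has derivative 0, and [t] inherits the derivative
     known for the lift. *)
  pose D j y := Log (Z j y / w y) + l y - L j y.
  have [e e0 near3] := (nearC _ _).1 (filterI nslit (filterI nr' nq)).
  have Dexp : \forall y \near s, forall j, cexp (D j y) = 1.
    apply/nearC; exists e => // y /near3[h1 [h2 h3]] j; have [_ ry cLy _ _] := HL y h3.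
    have [wy0 wyc] := clus y _ h2 ry.
    have E1 : cexp (Log (Z j y / w y)) = Z j y / w y by apply: LogK; exact: slitw.
    have E2 : cexp (l y) = w y by rewrite cexpD Hl0 LogK // mulrC divfK.
    rewrite cexpB cexpD cLy E1 E2.
    have [_ Zy0 _] := rep_zfiber hab ry.
    by rewrite divfK // divff.
  have cD j : {for s, continuous (D j)}.
    apply: hdiff_cont; apply: hdiffB; last by have [] := hZL j.
    apply: hdiffD.
      apply: (@hdiff_Log _ (fun y => Z j y / w y)); first exact: slitw.
      by apply: hdiff_div => //; have [] := hZL j.
    apply: hdiffD; first exact: hdiff_cst.
    apply: (@hdiff_Log _ (fun y => w y / w s)); first exact: nbhs_singleton nslit.
    by apply: (@hdiffM _ w) => //; exact: hdiff_cst.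
  have dD j : cderiv (D j) s 0.
    have := @cderiv_log _ (D j) (fun=> 1) s 0 _ (cD j) (cderiv_cst 1 s).
    by rewrite mul0r; apply; apply: filterS Dexp => y; apply.
  have dD' : cderiv (fun y => \sum_j lam j / two_pi_i R * D j y) s 0.
    have E0 : \sum_(j < p) lam j / two_pi_i R * 0 = 0 by rewrite big1 // => j _; rewrite mulr0.
    rewrite -[X in cderiv _ _ X]E0.
    apply: (@cderiv_sum _ _ _ _ (fun j y => lam j / two_pi_i R * D j y)) => j _.
    exact: cderivZ.
  have := cderivB dt dD'; rewrite subr0; apply: cderiv_ext.
  apply/nearC; exists e => // y /near3[_ [h2 h3]]; have [_ ry _ _ _] := HL y h3.
  rewrite (tE y _ ry) /tmean /tau_cluster -/(w y) -[RHS](tau_shift hab _ _ (l y)) /tau.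
  rewrite -addrA; congr (_ + _); rewrite -opprD; congr (- _).
  rewrite -big_split /=; apply: eq_bigr => j _.
  have [_ _ /(_ j) <-] := rep_zfiber hab ry.
  have -> : two_pi_i R * cf a b (fun j => Z j y) j 0 / two_pi_i R = cf a b (fun j => Z j y) j 0.
    by rewrite mulrAC divff ?mul1r // two_pi_i_neq0.
  by rewrite -mulrDr /D; congr (_ * _); ring.
- move=> s sr' sni; split; first exact: t0.
  have sr : nz (s - s0) < r by move: sr'; rewrite lt_min => /andP[].
  apply/contC => e e0; rewrite t0 //.
  (* With a pole beyond [B] the mean exceeds [1 + 2 ^+ deg a / e] in modulus, which brings the bound
     of [tau_cluster_bound] below [e]. *)
  pose B := Num.max M1 (2 + 2 ^+ (deg a).+1 / e).
  have P0 : 0 < 2 ^+ (deg a).+1 / e :> R by rewrite divr_gt0 // exprn_gt0.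
  have B1 : M1 <= B by rewrite le_max lexx.
  have B2 : 2 + 2 ^+ (deg a).+1 / e <= B by rewrite le_max lexx orbT.
  have [d1 d10 Hd1] := ext B.
  have [q q0 Hq] := (nearC _ _).1 (near_disc sr' (fun y h => h)).
  exists (Num.min q d1); first by rewrite lt_min q0.
  move=> y; rewrite lt_min => /andP[yq yd]; rewrite subr0.
  have yr' := Hq y yq.
  have yr : nz (y - s0) < r by move: yr'; rewrite lt_min => /andP[].
  have [[z rz]|yni] := pselect (inner (psi y)); last by rewrite t0 // nz0.
  rewrite (tE y z rz); have [w0 wc] := clus y z yr' rz.
  have [j Hj] := far y z s B d1 yr sr sni Hd1 yd rz.
  have fz := rep_zfiber hab rz; have [zI _ _] := fz.
  have M1j : M1 <= nz (z j) by lra.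
  have [_ _ wj] := HM1 z j fz M1j; rewrite -/(mean z) in wj.
  apply: le_lt_trans (tau_cluster_bound hab zI w0 wc) _.
  have W0 : 1 <= nz (mean z) by lra.
  rewrite ltr_pdivrMr ?exprn_gt0 ?nz_gt0 //.
  have h1 : nz (mean z) <= nz (mean z) ^+ a2.+1 by rewrite ler_eXnr.
  have h2 : 2 ^+ (deg a).+1 / e < 2 * nz (mean z) by lra.
  move: h2; rewrite ltr_pdivrMr // exprS -mulrA ltr_pM2l // => h2.
  apply: lt_le_trans h2 _; rewrite mulrC ler_wpM2l //; exact: ltW.
move=> s sr'; have [[z rz]|sni] := pselect (inner (psi s)); last by right; rewrite t0.
left; have [w0 wc] := clus s z sr' rz; have [l Hl] := cexp_surj w0.
exists z, (fun j => Log (z j / mean z) + l); split=> // [j|].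
  by rewrite cexpD Hl LogK ?divfK //; exact: slitw.
by rewrite tau_shift // (tE s z rz).
Qed.

End ClusterFunction.

(** * Discreteness and removal of the boundary *)

Section ThinBoundary.
Variables (R : realType) (I : Cx R -> Prop) (t h : Cx R -> Cx R) (s0 : Cx R) (r : R).
Hypothesis r0 : 0 < r.
Hypothesis Iopen : forall s, nz (s - s0) < r -> I s -> \forall y \near s, I y.
Hypothesis Idense : forall s (e : R), nz (s - s0) < r -> 0 < e -> exists2 y, nz (y - s) < e & I y.
Hypothesis It : forall s, nz (s - s0) < r -> I s -> cderiv t s (h s).
Hypothesis nIt : forall s, nz (s - s0) < r -> ~ I s -> t s = 0 /\ {for s, continuous t}.
Hypothesis hcont : forall s, nz (s - s0) < r -> {for s, continuous h}.

Lemma first_exit (y c : Cx R) : (forall u : R, 0 <= u <= 1 -> nz (seg y c u - s0) < r) ->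
  I y -> ~ I c -> exists u : R, [/\ 0 < u <= 1, ~ I (seg y c u) &
    forall v : R, 0 <= v < u -> I (seg y c v)].
Proof.
move=> Hseg Iy nIc; apply: contrapT => /forallNP H; apply: nIc; rewrite -(seg1 y c).
suff /(_ 1) : forall u : R, 0 <= u <= 1 -> I (seg y c u) by apply; rewrite ler01 lexx.
apply: real_induction; first by rewrite seg0.
  by move=> u u01 IH; apply: contrapT => nI; apply: (H u); split.
move=> u /andP[u0 u1] Iu; have u01 : 0 <= u <= 1 by rewrite u0 ltW.
have [e e0 He] := (nearC _ _).1 (Iopen (Hseg u u01) Iu).
have n0 := nz_ge0 (c - y).
exists (e / (nz (c - y) + 1)); first by rewrite divr_gt0 //; lra.
move=> v /andP[uv vu] _; apply: He; rewrite nz_seg ger0_norm ?subr_ge0 ?(ltW uv) //.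
have : v - u < e / (nz (c - y) + 1) by lra.
by rewrite ltr_pdivlMr; nra.
Qed.

(* phi s := s - t s / h sc fixes the boundary points and is a contraction along
   segments of interior points, so that from an interior point almost halfway
   between two boundary points the boundary cannot be hit in two nearly opposite
   directions. *)
Lemma boundary_discrete sc : nz (sc - s0) < r -> h sc != 0 ->
  exists2 rho : R, 0 < rho & forall b1 b2, nz (b1 - sc) < rho -> nz (b2 - sc) < rho ->
    ~ I b1 -> ~ I b2 -> b1 = b2.
Proof.
move=> scr h0; have H0 : 0 < nz (h sc) by rewrite nz_gt0.
have e4 : 0 < nz (h sc) / 4 by lra.
have [q q0 Hq] := (contC _ _).1 (hcont scr) _ e4.
pose rho := Num.min q (r - nz (sc - s0)).
exists rho; first by rewrite lt_min q0 subr_gt0.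
move=> b1 b2 B1 B2 nI1 nI2; apply: contrapT => /eqP b12.
have inr y : nz (y - sc) < rho -> nz (y - s0) < r.
  rewrite lt_min => /andP[_ h1]; have -> : y - s0 = (y - sc) + (sc - s0) by ring.
  by apply: le_lt_trans (nzD _ _) _; lra.
have hq y : nz (y - sc) < rho -> nz (1 - h y / h sc) <= 1 / 4.
  rewrite lt_min => /andP[/Hq h1 _].
  have -> : 1 - h y / h sc = (h sc - h y) / h sc by field.
  by rewrite nzM nzV ler_pdivrMr // nzC; lra.
pose m := seg b1 b2 (1 / 2); pose be := b1 - m.
have mE : m = (b1 + b2) / 2.
  rewrite /m /seg; have -> : rc (1 / 2) = 2^-1 :> Cx R by rewrite rcM rc1 mul1r rcV rc_nat.
  by field.
have beE : be = (b1 - b2) / 2 by rewrite /be mE; field.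
have be0 : 0 < nz be by rewrite beE nz_gt0 mulf_neq0 ?subr_eq0 ?invr_eq0.
have mr : nz (m - sc) < rho by apply: seg_ball => //; lra.
have [y ym Iy] : exists2 y, nz (y - m) < Num.min (nz be / 8) (rho - nz (m - sc)) & I y.
  by apply: Idense; [exact: inr|rewrite lt_min divr_gt0 // subr_gt0].
move: ym; rewrite lt_min => /andP[ym1 ym2].
have yr : nz (y - sc) < rho.
  have -> : y - sc = (y - m) + (m - sc) by ring.
  by apply: le_lt_trans (nzD _ _) _; lra.
(* Let [d] be the first exit on the way from [y] to [c]. As phi fixes [d], the distance of [phi y]
   to [d] is at most a quarter of that of [y] to [d]. *)
have hit c : nz (c - sc) < rho -> ~ I c -> exists u : R, 0 < u <= 1 /\
    nz (y - t y / h sc - (y + rc u * (c - y))) <= 1 / 4 * (u * nz (c - y)).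
  move=> cr nIc.
  have sr (u : R) : 0 <= u <= 1 -> nz (seg y c u - sc) < rho by move=> u01; exact: seg_ball.
  have [u [/andP[u0 u1] nIu Iv]] := first_exit (fun u u01 => inr _ (sr u u01)) Iy nIc.
  have u01 : 0 <= u <= 1 by rewrite u1 ltW.
  exists u; split; first by rewrite u0.
  set d := seg y c u; have [td ct] := nIt (inr _ (sr u u01)) nIu.
  have segE (v : R) : seg d y v = seg y c (u * (1 - v)).
    by rewrite /d /seg rcM rcB rc1; ring.
  have := @seg_bound_open _ (fun x => x - t x / h sc) (fun v => 1 - h (seg d y v) / h sc) (1 / 4) d y.
  rewrite -/d td mul0r subr0 => H.
  have -> : u * nz (c - y) = nz (y - d).
    have -> : y - d = - (rc u * (c - y)) by rewrite /d /seg; ring.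
    by rewrite nzN nzM nz_rc gtr0_norm.
  have -> : y + rc u * (c - y) = d by [].
  have vb (v : R) : 0 < v <= 1 -> 0 <= u * (1 - v) < u /\ 0 <= u * (1 - v) <= 1.
    by move=> /andP[v0 v1]; split; nra.
  apply: H => [v v01|v v01|].
  - have [w1 w2] := vb v v01.
    apply: cderivB; first exact: cderiv_id.
    have := cderivM (It (inr _ (sr _ w2)) (Iv _ w1)) (cderiv_cst (h sc)^-1 (seg y c (u * (1 - v)))).
    by rewrite mulr0 addr0 segE.
  - by have [_ w2] := vb v v01; rewrite segE; apply: hq; exact: sr.
  apply: (@cont_subC _ (fun x => x) (fun x => t x / h sc)); first exact: cderiv_cont (cderiv_id d).
  exact: (@cont_mulC _ t (fun=> (h sc)^-1) d ct (@cont_cstC _ (h sc)^-1 d)).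
have [u1 [/andP[u10 u11] H1]] := hit b1 B1 nI1.
have [u2 [/andP[u20 u21] H2]] := hit b2 B2 nI2.
(* [A] is close to both exit points, which lie on nearly opposite sides of [y]: in units of
   [(u1 + u2) * nz be] their distance is at least 7/8 and at most 9/32. *)
set A := y - t y / h sc in H1 H2.
pose ep := m - y; have epb : nz ep < nz be / 8 by rewrite /ep nzC.
have E1 : b1 - y = be + ep by rewrite /be /ep; ring.
have E2 : b2 - y = - be + ep by rewrite beE /ep mE; field.
have N1 : nz (b1 - y) <= 9 / 8 * nz be by rewrite E1; have := nzD be ep; lra.
have N2 : nz (b2 - y) <= 9 / 8 * nz be.
  by rewrite E2; have := nzD (- be) ep; rewrite nzN; lra.
have low : (u1 + u2) * (7 / 8 * nz be) <= nz (rc u1 * (b1 - y) - rc u2 * (b2 - y)).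
  have -> : rc u1 * (b1 - y) - rc u2 * (b2 - y) = rc (u1 + u2) * be - rc (u2 - u1) * ep.
    by rewrite E1 E2 rcD rcB; ring.
  have := nzBge (rc (u1 + u2) * be) (rc (u2 - u1) * ep).
  rewrite !nzM !nz_rc [`|u1 + u2|]gtr0_norm ?addr_gt0 // => h1.
  have h2 : `|u2 - u1| <= u1 + u2 by rewrite ler_norml; lra.
  have h3 : `|u2 - u1| * nz ep <= (u1 + u2) * (nz be / 8).
    by apply: ler_pM => //; [exact: nz_ge0|exact: ltW].
  lra.
have up : nz (rc u1 * (b1 - y) - rc u2 * (b2 - y)) <= 1 / 4 * (u1 * nz (b1 - y)) + 1 / 4 * (u2 * nz (b2 - y)).
  have -> : rc u1 * (b1 - y) - rc u2 * (b2 - y) =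
    (A - (y + rc u2 * (b2 - y))) - (A - (y + rc u1 * (b1 - y))) by ring.
  by apply: le_trans (nzB _ _) _; lra.
have k1 : u1 * nz (b1 - y) <= u1 * (9 / 8 * nz be) by rewrite ler_wpM2l ?(ltW u10).
have k2 : u2 * nz (b2 - y) <= u2 * (9 / 8 * nz be) by rewrite ler_wpM2l ?(ltW u20).
have : 0 < (u1 + u2) * nz be by rewrite mulr_gt0 // addr_gt0.
by lra.
Qed.

Lemma deriv_off_zero sc : nz (sc - s0) < r -> h sc != 0 -> cderiv t sc (h sc).
Proof.
move=> scr h0; have [Is|nIs] := pselect (I sc); first exact: It.
have [rho rho0 Hrho] := boundary_discrete scr h0.
have q0 : 0 < Num.min rho (r - nz (sc - s0)) by rewrite lt_min rho0 subr_gt0.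
apply: (@removable_deriv _ t h sc _ q0) => [s ssc| |]; last exact: hcont.
  rewrite lt_min => /andP[s1 s2]; apply: It.
    have -> : s - s0 = (s - sc) + (sc - s0) by ring.
    by apply: le_lt_trans (nzD _ _) _; lra.
  apply: contrapT => nI; move/eqP: ssc; apply; apply: Hrho => //.
  by rewrite subrr nz0.
by have [] := nIt scr nIs.
Qed.

(** At [s0] itself [h] may vanish; once the derivative is known at all other points, [s0] is removed
    in its turn. *)
Lemma deriv_everywhere : (forall s, nz (s - s0) < r -> s != s0 -> h s != 0) ->
  forall s, nz (s - s0) < r -> cderiv t s (h s).
Proof.
move=> hn s sr; have [E|ss0] := eqVneq s s0; last by apply: deriv_off_zero => //; exact: hn.
have [Is|nIs] := pselect (I s); first exact: It.
rewrite E; apply: (@removable_deriv _ t h s0 _ r0) => [y ys yr| |].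
- by apply: deriv_off_zero => //; exact: hn.
- by rewrite -E; have [] := nIt sr nIs.
by rewrite -E; exact: hcont.
Qed.

End ThinBoundary.

(** * Antiderivatives near a point that is not a pole *)

Section LocalPrimitive.
Variables (R : realType) (p : nat) (a : 'I_2 -> nat) (b : 'I_p -> nat)
  (lam : 'I_p -> Cx R) (X : riemann_surface R) (pt : X -> ms_data R p) (om : mero_form X).
Implicit Types (x : X) (z : 'I_p -> Cx R).

Local Notation inner := (inner a b lam pt).
Local Notation rep := (rep a b lam pt).
Local Notation pval := (pval a b lam pt).

Hypothesis hp : (2 <= p)%N.
Hypothesis hb : forall j, (1 <= b j)%N.
Hypothesis hab : (\sum_(i < 2) a i + 2 = \sum_(j < p) b j)%N.
Hypothesis hres : ~ resonant lam.
Hypothesis hX : is_fiber_closure a b lam pt.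
Hypothesis hom : is_omega a b lam pt om.

Lemma inner_open_chart i s : rs_im i s -> inner (rs_psi i s) ->
  \forall y \near s, inner (rs_psi i y).
Proof.
move=> ims ins; have [ds ps _] := rs_psiP ims.
have [r [Z [L [r0 HL]]]] := lift_any_chart hab hX hom ds ins; rewrite ps in HL.
by apply/nearC; exists r => // y /HL[_ ry _ _ _]; exists (fun j => Z j y).
Qed.

Lemma inner_dense_chart i s (e : R) : rs_im i s -> 0 < e ->
  exists2 y, nz (y - s) < e & rs_im i y /\ inner (rs_psi i y).
Proof.
move=> ims e0; have [ds ps _] := rs_psiP ims.
have [_ _ cphi] := rs_phiP ds.
have [xn [inn cxn]] := inner_dense hp hab hX (rs_psi i s).
have e1 : \forall n \near \oo, rs_dom i (xn n).
  by apply: cxn; exact: (open_nbhs_nbhs (conj (@rs_dom_open _ X i) ds)).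
have c2 : rs_phi i (xn n) @[n --> \oo] --> s.
  by rewrite -ps; apply: (@cvg_comp _ _ _ xn (rs_phi i) _ _ _ cxn cphi).
have /cvgC/(_ e e0) e2 := c2.
have [N _ HN] := filterI e1 e2; have [dN eN] := HN N (leqnn N).
have [imN psN _] := rs_phiP dN.
by exists (rs_phi i (xn N)) => //; split=> //; rewrite psN.
Qed.

Lemma local_primitive x i : rs_dom i x -> ~ is_pole om x ->
  exists G : Cx R -> Cx R, \forall s \near rs_phi i x,
    cderiv G s (om_coef om i s) /\ pval (rs_psi i s) (G s).
Proof.
move=> xi npole; have [im0 psi0 _] := rs_phiP xi; set s0 := rs_phi i x in im0 psi0 *.
have [xin|xni] := pselect (inner x).
  have [r [Z [L [r0 HL]]]] := lift_any_chart hab hX hom xi xin.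
  exists (fun s => tau a b (fun j => Z j s) (fun j => L j s)).
  apply/nearC; exists r => // s /HL[_ rs cL _ dt]; split=> //.
  by left; exists (fun j => Z j s), (fun j => L j s).
have nim : \forall s \near s0, rs_im i s.
  exact: (open_nbhs_nbhs (conj (@rs_im_open _ X i) im0)).
(* Were the coefficient identically 0 nearby, some inner point, by density, would be a zero. So it
   has an order, nonnegative off the poles, and does not vanish elsewhere near [s0]. *)
have [r [r0 Hr hn]] : exists r : R, [/\ 0 < r,
    forall s, nz (s - s0) < r -> rs_im i s /\ hdiff (om_coef om i) s &
    forall s, nz (s - s0) < r -> s != s0 -> om_coef om i s != 0].
  have [[k Hk]|H0] := om_mero om im0; last first.
    have [q q0 Hq] := (nearC _ _).1 H0.
    have [y yq [imy iny]] := inner_dense_chart im0 q0.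
    case: (inner_not_zero hb hab hX hom iny); exists i; split; first by have [] := rs_psiP imy.
    have [_ -> _] := rs_psiP imy; right; exact: near_disc yq Hq.
  have k0 : 0 <= k.
    by rewrite leNgt; apply/negP => kn; apply: npole; exists i; split=> //; exists k.
  case: k k0 Hk => // k _ [g [hg g0 Hg]].
  have gn : \forall s \near s0, g s != 0.
    by apply: (@hdiff_near _ g s0 (fun y => y != 0) (nbhs_singleton hg)); exact: near_neq0.
  have [q q0 Hq] := (nearC _ _).1 (filterI (filterI nim hg) (filterI gn Hg)).
  exists q; split=> // s Hs; have [[ims hgs] [gs hs]] := Hq s Hs.
    split=> //; have [d Hd] : hdiff (fun s => (s - s0) ^+ k * g s) s.
      apply: hdiffM => //; apply: (@hdiffX _ (fun s => s - s0)).
      by apply: (@hdiffB _ (fun s => s)); [eexists; exact: cderiv_id|exact: hdiff_cst].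
    exists d; apply: cderiv_ext Hd; apply: near_disc Hs _ => y /Hq[_ [_ ->]].
    by rewrite -exprnP.
  by move=> ss; rewrite hs -exprnP mulf_neq0 // expf_neq0 // subr_eq0.
pose M := nz (om_coef om i s0) + 1.
have M0 : 0 <= M by rewrite addr_ge0 ?nz_ge0.
have ss : nz (s0 - s0) < r by rewrite subrr nz0.
have [_ /hdiff_cont/contC/(_ 1 ltr01)[q q0 Hq]] := Hr s0 ss.
pose r1 := Num.min r q; have r10 : 0 < r1 by rewrite lt_min r0.
have Him s : nz (s - s0) < r1 -> rs_im i s.
  by rewrite lt_min => /andP[/Hr[]].
have HM s : nz (s - s0) < r1 -> nz (om_coef om i s) <= M.
  rewrite lt_min => /andP[_ /Hq h]; have := nzD (om_coef om i s - om_coef om i s0) (om_coef om i s0).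
  by rewrite subrK /M; lra.
have ni0 : ~ inner (rs_psi i s0) by rewrite psi0.
have [r' [t [/andP[r'0 r'r] tin tout tpv]]] := cluster_function hp hb hab hres hX hom r10 M0 Him HM ni0.
have sub s : nz (s - s0) < r' -> nz (s - s0) < r1 by move=> h; exact: lt_le_trans h r'r.
have sub2 s : nz (s - s0) < r' -> nz (s - s0) < r.
  by move=> /sub; rewrite lt_min => /andP[].
exists t; apply/nearC; exists r' => // s Hs; split; last exact: tpv.
apply: (@deriv_everywhere _ (fun s => inner (rs_psi i s)) t (om_coef om i) s0 r' r'0) => //.
- by move=> y yr; apply: inner_open_chart; exact: Him (sub y yr).
- move=> y e yr e0; have [w we [_ inw]] := inner_dense_chart (Him _ (sub y yr)) e0.
  by exists w.
- by move=> y /sub2 /Hr[_]; exact: hdiff_cont.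
by move=> y /sub2; exact: hn.
Qed.

End LocalPrimitive.

(** * Integrals along paths *)

Lemma transfer_primitive (R : realType) (X : riemann_surface R) (om : mero_form X)
    (i j : rs_idx X) (x : X) (G : Cx R -> Cx R) :
  rs_dom i x -> rs_dom j x ->
  (\forall z \near rs_phi j x, cderiv G z (om_coef om j z)) ->
  \forall z \near rs_phi i x, cderiv (fun z => G (rs_phi j (rs_psi i z))) z (om_coef om i z).
Proof.
move=> xi xj HG; have [im0 psi0 _] := rs_phiP xi.
pose T s := rs_phi j (rs_psi i s).
have Tx : T (rs_phi i x) = rs_phi j x by rewrite /T psi0.
have dom0 : rs_dom j (rs_psi i (rs_phi i x)) by rewrite psi0.
have hT : \forall s \near rs_phi i x, hdiff T s by exact: rs_transition im0 dom0.
have e1 : \forall s \near rs_phi i x, cderiv G (T s) (om_coef om j (T s)).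
  apply: (@hdiff_near _ T _ (fun y => cderiv G y (om_coef om j y)) (nbhs_singleton hT)).
  by rewrite Tx.
have e2 : \forall s \near rs_phi i x, rs_im i s.
  exact: (open_nbhs_nbhs (conj (@rs_im_open _ X i) im0)).
have e3 : \forall s \near rs_phi i x, rs_dom j (rs_psi i s).
  have [_ _ c] := rs_psiP im0.
  by apply: c; exact: (open_nbhs_nbhs (conj (@rs_dom_open _ X j) dom0)).
have [r r0 Hr] := (nearC _ _).1 (filterI (filterI hT e1) (filterI e2 e3)).
apply/nearC; exists r => // s /Hr[[[d hd] ds] [ims doms]].
rewrite (om_compat om ims doms hd).
exact: (@cderiv_comp _ G T).
Qed.

Section Periods.
Variables (R : realType) (p : nat) (a : 'I_2 -> nat) (b : 'I_p -> nat)
  (lam : 'I_p -> Cx R) (X : riemann_surface R) (pt : X -> ms_data R p) (om : mero_form X).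

Local Notation inner := (inner a b lam pt).
Local Notation pval := (pval a b lam pt).
Local Notation period := (period lam).

Hypothesis hp : (2 <= p)%N.
Hypothesis hb : forall j, (1 <= b j)%N.
Hypothesis hab : (\sum_(i < 2) a i + 2 = \sum_(j < p) b j)%N.
Hypothesis hres : ~ resonant lam.
Hypothesis hX : is_fiber_closure a b lam pt.
Hypothesis hom : is_omega a b lam pt om.

Section OnePath.
Variable g : R -> X.
Hypothesis gc : {within `[0, 1]%classic, continuous g}.
Hypothesis gP : forall u : R, `[0, 1]%classic u -> ~ is_pole om (g u).

Lemma path_near (u : R) (A : set X) : 0 <= u <= 1 -> open A -> A (g u) ->
  exists2 d : R, 0 < d & forall v : R, 0 <= v <= 1 -> `|v - u| < d -> A (g v).
Proof.
move=> u01 Ao Au; have /subspace_continuousP/(_ u) := gc; rewrite mem01 => /(_ u01) H.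
have /nearR[d d0 Hd] := H A (open_nbhs_nbhs (conj Ao Au)).
exists d => // v v01 vd; have := Hd v vd; rewrite mem01 => /(_ v01).
exact.
Qed.

Lemma path_near_chart (u : R) i (P : Cx R -> Prop) : 0 <= u <= 1 -> rs_dom i (g u) ->
  (\forall z \near rs_phi i (g u), P z) ->
  exists2 d : R, 0 < d & forall v : R, 0 <= v <= 1 -> `|v - u| < d ->
    rs_dom i (g v) /\ P (rs_phi i (g v)).
Proof.
move=> u01 ui HP; have [d1 d10 H1] := path_near u01 (@rs_dom_open _ X i) ui.
have [_ _ c] := rs_phiP ui.
have [A [Ao Au AP]] : exists A : set X, [/\ open A, A (g u) & A `<=` [set x | P (rs_phi i x)]].
  have := c _ HP; rewrite /= nbhsE => -[A [Ao Au] AP]; exists A; split=> //.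
have [d2 d20 H2] := path_near u01 Ao Au.
exists (Num.min d1 d2); first by rewrite lt_min d10.
move=> v v01; rewrite lt_min => /andP[v1 v2]; split; first exact: H1.
by apply: AP; exact: H2.
Qed.

Lemma path_chart (u : R) i : 0 <= u <= 1 -> rs_dom i (g u) ->
  exists (G : Cx R -> Cx R) (d : R), 0 < d /\ forall v : R, 0 <= v <= 1 -> `|v - u| < d ->
    [/\ rs_dom i (g v), \forall z \near rs_phi i (g v), cderiv G z (om_coef om i z) &
        pval (g v) (G (rs_phi i (g v)))].
Proof.
move=> u01 ui; have npole : ~ is_pole om (g u) by apply: gP; rewrite mem01.
have [G HG] := local_primitive hp hb hab hres hX hom ui npole.
have HG2 : \forall z \near rs_phi i (g u),
    (\forall y \near z, cderiv G y (om_coef om i y)) /\ pval (rs_psi i z) (G z).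
  have [r r0 Hr] := (nearC _ _).1 HG; apply/nearC; exists r => // z zr; split.
    by apply: near_disc zr _ => y /Hr[].
  by have [] := Hr z zr.
have [d d0 Hd] := path_near_chart u01 ui HG2.
exists G, d; split; first exact: d0.
move=> v v01 /(Hd v v01)[di [h1 h2]]; split; [exact: di|exact: h1|].
by have [_ E _] := rs_phiP di; move: h2; rewrite E.
Qed.

Definition local_prim (w : R) (F : R -> Cx R) (v : R) : Prop :=
  exists i (G : Cx R -> Cx R), [/\ rs_dom i (g v),
    \forall z \near rs_phi i (g v), cderiv G z (om_coef om i z) &
    exists2 d : R, 0 < d & forall s : R, 0 <= s <= w -> `|s - v| < d -> F s = G (rs_phi i (g s))].

(** The values of [F] are recorded modulo periods along with the local primitives, so that a gluing
    constant is known to be a period. *)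
Definition primitive_upto (w : R) : Prop := exists F : R -> Cx R, forall v : R, 0 <= v <= w ->
  (exists2 t, pval (g v) t & period (F v - t)) /\ local_prim w F v.

(** The new primitive is shifted by [l] to agree with the old one at [v]. Only at [v] itself do two
    charts meet, and there the two primitives are compared by [same_deriv_const]. *)
Lemma extend_primitive (v w : R) i G : 0 <= v -> v <= w -> w <= 1 ->
  (forall s : R, v <= s <= w ->
    [/\ rs_dom i (g s), \forall z \near rs_phi i (g s), cderiv G z (om_coef om i z) &
        pval (g s) (G (rs_phi i (g s)))]) ->
  primitive_upto v -> primitive_upto w.
Proof.
move=> v0 vw w1 HG [F HF].
have vv : 0 <= v <= v by rewrite v0 lexx.
have v01 : 0 <= v <= 1 by rewrite v0 (le_trans vw).
have vvw : v <= v <= w by rewrite lexx.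
have [[t1 pt1 pe1] [iv [Gv [div HGv [dv dv0 Hdv]]]]] := HF v vv.
have [di HGi pvi] := HG v vvw.
pose l := F v - G (rs_phi i (g v)).
have pl : period l.
  rewrite /l; have -> : F v - G (rs_phi i (g v)) = (F v - t1) + (t1 - G (rs_phi i (g v))) by ring.
  by apply: periodD => //; exact: (pval_period hp hab hres hX pt1 pvi).
pose F' (s : R) := if s <= v then F s else G (rs_phi i (g s)) + l.
have dG s : v <= s <= w -> \forall z \near rs_phi i (g s), cderiv (fun z => G z + l) z (om_coef om i z).
  move=> /HG[_ H _]; apply: filterS H => z Hz.
  by have := cderivD Hz (cderiv_cst l z); rewrite addr0.
exists F' => s /andP[s0 sw]; rewrite {1}/F' /=.
have [sv|vs] := leP s v; last first.
  have vsw : v <= s <= w by rewrite sw ltW.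
  have [dis _ ps] := HG s vsw; split.
    by exists (G (rs_phi i (g s))); rewrite // addrAC subrr add0r.
  exists i, (fun z => G z + l); split; [exact: dis|exact: dG|].
  exists (s - v); first by rewrite subr_gt0.
  move=> y _; rewrite ltr_norml => /andP[h _]; rewrite /F' ifF //.
  by apply/negbTE; rewrite -ltNge; lra.
have s0v : 0 <= s <= v by rewrite s0.
have [pvs [j [Gj [dj HGj [e e0 He]]]]] := HF s s0v; split; first exact: pvs.
have [E|sv'] := eqVneq s v; last first.
  have {sv'}sv : s < v by rewrite lt_neqAle sv' sv.
  exists j, Gj; split; [exact: dj|exact: HGj|exists (Num.min e (v - s))].
    by rewrite lt_min e0 subr_gt0.
  move=> y /andP[y0 yw]; rewrite lt_min => /andP[y1]; rewrite ltr_norml => /andP[_ h].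
  have yv : y <= v by lra.
  by rewrite /F' yv; apply: He => //; rewrite y0.
rewrite E; exists i, (fun z => G z + l); split; [exact: di|exact: dG|].
have tr := transfer_primitive di div HGv.
have same := same_deriv_const tr HGi.
have [d1 d10 H1] := path_near_chart v01 di same.
exists (Num.min dv d1); first by rewrite lt_min dv0.
move=> y /andP[y0 yw]; rewrite lt_min => /andP[yd1 yd2]; rewrite /F'.
case: (leP y v) => // yv.
have y01 : 0 <= y <= 1 by rewrite y0 (le_trans yw).
have [diy Ey] := H1 y y01 yd2.
have y0v : 0 <= y <= v by rewrite y0.
have vdv : `|v - v| < dv by rewrite subrr normr0.
have Fy := Hdv y y0v yd1; have Fv := Hdv v vv vdv.
have [_ py _] := rs_phiP diy; have [_ pv _] := rs_phiP di.
rewrite py pv -Fy -Fv in Ey.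
by rewrite /l -Ey; ring.
Qed.

Lemma primitive_exists : primitive_upto 1.
Proof.
suff /(_ 1) : forall u : R, 0 <= u <= 1 -> primitive_upto u by apply; rewrite ler01 lexx.
apply: real_induction.
- have u01 : (0 <= (0 : R)) && ((0 : R) <= 1) by rewrite lexx ler01.
  have [i di] := rs_cover (g 0); have [G [d [d0 HG]]] := path_chart u01 di.
  have dd : `|(0 : R) - 0| < d by rewrite subrr normr0.
  have [_ h1 h2] := HG 0 u01 dd.
  exists (fun s => G (rs_phi i (g s))) => v v0.
  have -> : v = 0 by apply/eqP; rewrite eq_le andbC.
  split; first by exists (G (rs_phi i (g 0))) => //; rewrite subrr; exact: period0.
  by exists i, G; split; [exact: di|exact: h1|exists 1].
- move=> u /andP[u0 u1] IH; have u01 : 0 <= u <= 1 by rewrite u1 ltW.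
  have [i di] := rs_cover (g u); have [G [d [d0 HG]]] := path_chart u01 di.
  pose v := Num.max 0 (u - d / 2).
  have v0 : 0 <= v by rewrite le_max lexx.
  have vd : u - d / 2 <= v by rewrite le_max lexx orbT.
  have vu : v < u by rewrite gt_max u0; lra.
  apply: (@extend_primitive v u i G) => //; first exact: ltW.
    move=> s /andP[s1 s2]; apply: HG; first by apply/andP; split; lra.
    by rewrite ltr_norml; lra.
  by apply: IH; rewrite v0.
move=> u /andP[u0 u1] Pu; have u01 : 0 <= u <= 1 by rewrite u0 ltW.
have [i di] := rs_cover (g u); have [G [d [d0 HG]]] := path_chart u01 di.
exists d => // v /andP[uv vd] v1.
apply: (@extend_primitive u v i G) => //; first exact: ltW.
move=> s /andP[s1 s2]; apply: HG; first by apply/andP; split; lra.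
by rewrite ltr_norml; lra.
Qed.

(** [chain_integral] selects its value by [get], which is meaningful only once an integral
    exists. *)
Lemma surf_integral_exists : exists v, surf_path_integral om g v.
Proof.
have [F HF] := primitive_exists; exists (F 1 - F 0), F; split=> // u.
rewrite mem01 => u01; have [_ [i [G [di HG [d d0 Hd]]]]] := HF u u01.
exists i, G; split; [exact: di|exact: HG|]; apply/nearR; exists d => // s sd; rewrite mem01 => s01.
exact: Hd.
Qed.

(** A primitive along the path differs locally by a constant from the one of [local_primitive], so
    [F u - F 0 + t0] remains a value of the multivalued integral modulo periods, for whatever [F] is
    used. *)
Lemma surf_integral_value v t0 t1 : surf_path_integral om g v ->
  pval (g 0) t0 -> pval (g 1) t1 -> period (v - (t1 - t0)).
Proof.
move=> [F [-> HF]] p0 p1.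
pose Q (u : R) := exists2 t, pval (g u) t & period (F u - F 0 + t0 - t).
have loc (u : R) : 0 <= u <= 1 -> exists2 d : R, 0 < d &
    forall s s' : R, 0 <= s <= 1 -> 0 <= s' <= 1 -> `|s - u| < d -> `|s' - u| < d -> Q s -> Q s'.
  move=> u01; have := HF u; rewrite mem01 => /(_ u01)[i [G [di HG /nearR[d1 d10 Hd1]]]].
  have [G2 [d2 [d20 HG2]]] := path_chart u01 di.
  have uu : `|u - u| < d2 by rewrite subrr normr0.
  have [_ HGu _] := HG2 u u01 uu.
  have [d3 d30 Hd3] := path_near_chart u01 di (same_deriv_const HG HGu).
  exists (Num.min d1 (Num.min d2 d3)); first by rewrite !lt_min d10 d20.
  move=> s s' s01 s'01; rewrite !lt_min => /and3P[a1 a2 a3] /and3P[b1 b2 b3] [t pt1 pe].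
  have [_ _ ps] := HG2 s s01 a2; have [_ _ ps'] := HG2 s' s'01 b2.
  have [_ e] := Hd3 s s01 a3; have [_ e'] := Hd3 s' s'01 b3.
  have Fs : F s = G (rs_phi i (g s)) by apply: Hd1 => //; rewrite mem01.
  have Fs' : F s' = G (rs_phi i (g s')) by apply: Hd1 => //; rewrite mem01.
  exists (G2 (rs_phi i (g s'))) => //.
  have -> : F s' - F 0 + t0 - G2 (rs_phi i (g s')) =
      (F s - F 0 + t0 - t) + (t - G2 (rs_phi i (g s))).
    have : F s' - G2 (rs_phi i (g s')) = F s - G2 (rs_phi i (g s)) by rewrite Fs Fs' e e'.
    move: (F s') (F s) (G2 (rs_phi i (g s'))) (G2 (rs_phi i (g s))) => A B C D h.
    have -> : A - F 0 + t0 - C = (A - C) - F 0 + t0 by ring.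
    by rewrite h; ring.
  by apply: periodD => //; exact: (pval_period hp hab hres hX pt1 ps).
have [t pt1 pe] : Q 1.
  suff /(_ 1) : forall u : R, 0 <= u <= 1 -> Q u by apply; rewrite ler01 lexx.
  apply: real_induction.
  - by exists t0 => //; rewrite subrr add0r subrr; exact: period0.
  - move=> u /andP[u0 u1] IH; have u01 : 0 <= u <= 1 by rewrite u1 ltW.
    have [d d0 Hd] := loc u u01; pose y := Num.max 0 (u - d / 2).
    have v0 : 0 <= y by rewrite le_max lexx.
    have vd : u - d / 2 <= y by rewrite le_max lexx orbT.
    have vu : y < u by rewrite gt_max u0; lra.
    apply: (Hd y u) => //.
    + by apply/andP; split; lra.
    + by rewrite ltr_norml; lra.
    + by rewrite subrr normr0.
    by apply: IH; rewrite v0.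
  move=> u /andP[u0 u1] Qu; have u01 : 0 <= u <= 1 by rewrite u0 ltW.
  have [d d0 Hd] := loc u u01; exists d => // y /andP[uv vd] v1.
  apply: (Hd u y) => //.
  - by apply/andP; split; lra.
  - by rewrite subrr normr0.
  by rewrite ltr_norml; lra.
have -> : F 1 - F 0 - (t1 - t0) = (F 1 - F 0 + t0 - t) + (t - t1) by ring.
by apply: periodD => //; exact: (pval_period hp hab hres hX pt1 p1).
Qed.

End OnePath.

(** Zeros are boundary points, where the value is 0 by convention. *)
Lemma pval_zero x t : is_zero om x -> pval x t -> t = 0.
Proof.
move=> zx [[z [L [rz _ _]]]|[]] //.
by case: (@inner_not_zero _ _ _ _ _ _ _ _ hb hab hX hom x) => //; exists z.
Qed.

(** Regrouping by end points weights [th x] with the coefficient of [x] in the boundary of the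
    chain: this coefficient is 0 off the zeros of [om], and [th] is 0 at them. *)
Lemma boundary_sum (c : chain X) (th : X -> Cx R) :
  (forall x : X, is_zero om x -> th x = 0) ->
  (forall x : X, ~ is_zero om x ->
     \sum_(mg <- c) mg.1 * ((mg.2 1 == x)%:R - (mg.2 0 == x)%:R) = 0) ->
  \sum_(mg <- c) mg.1%:~R * (th (mg.2 1) - th (mg.2 0)) = 0.
Proof.
move=> th0 Hc; pose S := undup (flatten [seq [:: mg.2 1; mg.2 0] | mg <- c]).
have thE (x : X) : x \in S -> th x = \sum_(y <- S) (x == y)%:R * th y.
  move=> xS; rewrite (bigD1_seq x) ?undup_uniq //= eqxx mul1r big1 ?addr0 // => y.
  by rewrite eq_sym => /negbTE ->; rewrite mul0r.
have memS mg : List.In mg c -> (mg.2 1 \in S) && (mg.2 0 \in S).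
  rewrite !mem_undup => H; apply/andP; split; apply/flattenP; exists [:: mg.2 1; mg.2 0];
    rewrite ?inE ?eqxx ?orbT //; by elim: (c) H => //= m s IH [->|/IH h]; rewrite inE ?eqxx ?h ?orbT.
have -> : \sum_(mg <- c) mg.1%:~R * (th (mg.2 1) - th (mg.2 0)) =
   \sum_(mg <- c) \sum_(y <- S) (mg.1 * ((mg.2 1 == y)%:R - (mg.2 0 == y)%:R))%:~R * th y.
  elim: (c) memS => [|m s IH] memS; first by rewrite !big_nil.
  rewrite !big_cons IH; last by move=> mg H; apply: memS; right.
  congr (_ + _); have /andP[h1 h0] := memS m (or_introl (erefl _)).
  rewrite {1}(thE _ h1) {1}(thE _ h0) -sumrB mulr_sumr; apply: eq_bigr => y _.
  by rewrite rmorphM rmorphB /= !rmorph_nat -mulrA mulrBl.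
rewrite exchange_big /= big1 // => y _; rewrite -mulr_suml -rmorph_sum /=.
by have [/th0 ->|/Hc ->] := pselect (is_zero om y); rewrite ?mulr0 ?mul0r.
Qed.

End Periods.

Theorem proposition4p14 (R : realType) (p : nat) (a : 'I_2 -> nat)
    (b : 'I_p -> nat) (lam : 'I_p -> Cx R) (X : riemann_surface R)
    (pt : X -> ms_data R p) (om : mero_form X) (c : chain X)
    (hp : (2 <= p)%N)
    (ha : forall i, (1 <= a i)%N) (hb : forall j, (1 <= b j)%N)
    (hab : (\sum_(i < 2) a i + 2 = \sum_(j < p) b j)%N)
    (hlam : residue_config lam) (hres : ~ resonant lam)
    (hX : is_fiber_closure a b lam pt) (hom : is_omega a b lam pt om)
    (hc : rel_cycle (is_pole om) (is_zero om) c) :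
  exists w : 'I_p -> int,
    chain_integral om c = \sum_(j < p) (w j)%:~R * lam j.
Proof.
(* One value is fixed at every point once and for all, so that the same number occurs at a point
   shared by several paths. *)
have /choice[th Hth] : forall x, exists t, pval a b lam pt x t.
  by move=> x; exact: pval_exists.
have [cpath cbd] := hc.
have th0 (x : X) : is_zero om x -> th x = 0.
  by move=> zx; exact: (pval_zero hb hab hX hom zx (Hth x)).
have B := boundary_sum th0 cbd.
suff : period lam (chain_integral om c - \sum_(mg <- c) mg.1%:~R * (th (mg.2 1) - th (mg.2 0))).
  by rewrite B subr0.
rewrite /chain_integral -sumrB; elim: (c) cpath => [|[m g] s IH] cpath.
  by rewrite big_nil; exact: period0.
rewrite big_cons; apply: periodD; last by apply: IH => m' g' H; apply: (cpath m' g'); exact: or_intror H.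
have [gc gP] := cpath m g (or_introl (erefl _)).
rewrite -mulrBr; apply: periodZ.
have [v Hv] := surf_integral_exists hp hb hab hres hX hom gc gP.
exact: (surf_integral_value hp hb hab hres hX hom gc gP (getI Hv) (Hth _) (Hth _)).
Qed.
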